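(* Let $\mathcal{F}$ be a foliation on a manifold $M$ endowed with a transverse generalized complex structure $\mathcal{J}$. Then $\mathcal{F}$ satisfies the basic $dd^{\mathcal{J}}$-lemma if and only if the projection $$p:(\Omega^{\bullet}(M/\mathcal{F},\mathbb{C}),d^{\mathcal{J}})\rightarrow(\Omega^{\bullet}(M/\mathcal{F},\mathbb{C})/\mathrm{Im}(d),d^{\mathcal{J}})$$ induces an isomorphism in cohomology, where $\Omega^{\bullet}(M/\mathcal{F},\mathbb{C})$ is considered as $\mathbb{Z}_2$-graded by the parity of the degree of forms.
   Context: Foliations. $M$ is a smooth $n$-manifold with a foliation $\mathcal{F}$ of dimension $n-2q$ (codimension $2q$), given by an open cover $\{V_i\}_{i\in I}$ of $M$, a $2q$-dimensional smooth manifold $T_0$, submersions $f_i:V_i\to T_0$ with connected fibres, and, whenever $V_i\cap V_j\neq\emptyset$, a local diffeomorphism $\gamma_{ij}$ of $T_0$ with $f_j=\gamma_{ij}\circ f_i$. The transverse manifold is $T=\coprod_i f_i(V_i)$, and the holonomy pseudogroup $\mathcal{H}$ is the pseudogroup on $T$ generated by the $\gamma_{ij}$. A form $\omega$ on $M$ is basic if $i_X\omega=i_Xd\omega=0$ for all vector fields $X$ tangent to the leaves. Basic forms correspond bijectively to $\mathcal{H}$-invariant forms on $T$. $\Omega^\bullet(M/\mathcal{F},\mathbb{C})$ denotes the complex-valued basic forms, a subcomplex of the de Rham complex. Generalized complex structures. On $T$, the bundle $TT\oplus T^*T$ carries the pairing $(X_1+\alpha_1,X_2+\alpha_2)=\frac12(\alpha_1(X_2)+\alpha_2(X_1))$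 and the Courant bracket $$[X_1+\alpha_1,X_2+\alpha_2]=[X_1,X_2]+i_{X_1}d\alpha_2-i_{X_2}d\alpha_1+\tfrac12 d(\alpha_2(X_1)-\alpha_1(X_2)).$$ A generalized complex structure on $T$ is an almost complex structure $\mathcal{J}$ on the bundle $TT\oplus T^*T$, orthogonal for the pairing, such that $[\mathcal{J}Y_1,\mathcal{J}Y_2]-\mathcal{J}[Y_1,\mathcal{J}Y_2]-\mathcal{J}[\mathcal{J}Y_1,Y_2]+\mathcal{J}^2[Y_1,Y_2]=0$ for all sections $Y_1,Y_2$. A transverse generalized complex structure on $(M,\mathcal{F})$ is a generalized complex structure on $T$ invariant under $\mathcal{H}$. The operators. Let $L\subset(TT\oplus T^*T)\otimes\mathbb{C}$ be the $i$-eigenbundle of $\mathcal{J}$. The Clifford algebra of $(TT\oplus T^*T)\otimes\mathbb{C}$ acts on forms by $(X+\alpha)\bullet\beta=i_X\beta+\alpha\wedge\beta$. There is a unique complex line subbundle $\Phi$ of $\bigoplus_i\wedge^iT^*T\otimes\mathbb{C}$ with $L_x=\{v\in(T_xT\oplus T_x^*T)\otimes\mathbb{C}\mid v\bullet\Phi_x=0\}$ for all $x\in T$. Set $U^{q-k}_x=(\wedge^k\bar L_x)\bullet\Phi_x$ for $0\le k\le 2q$. Then $\bigoplus_i\wedge^iT^*T\otimes\mathbb{C}=\bigoplus_{j=-q}^{q}U^j$, and integrability of $\mathcal{J}$ gives $d=\partial+\bar\partial$ with $\partial:\Gamma(U^j)\to\Gamma(U^{j+1})$ and $\bar\partial:\Gamma(U^j)\to\Gamma(U^{j-1})$.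 The bundles $U^j$ are $\mathcal{H}$-invariant, so $\partial$ and $\bar\partial$ preserve $\mathcal{H}$-invariant forms and hence act on basic forms. Define $d^{\mathcal{J}}=i(\bar\partial-\partial)$. All of $d,d^{\mathcal{J}},\partial,\bar\partial$, and their kernels and images, are taken on $\Omega^\bullet(M/\mathcal{F},\mathbb{C})$. The basic $dd^{\mathcal{J}}$-lemma. $\mathcal{F}$ satisfies the basic $dd^{\mathcal{J}}$-lemma if $$\mathrm{Im}(dd^{\mathcal{J}})=\mathrm{Im}(d)\cap\mathrm{Ker}(d^{\mathcal{J}})=\mathrm{Ker}(d)\cap\mathrm{Im}(d^{\mathcal{J}}).$$ *)

(* Defs.v *)
From HB Require Import structures.
From mathcomp Require Import all_boot all_order all_algebra.
From mathcomp Require Import ring_quotient generic_quotient.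
From mathcomp Require Import all_classical all_reals all_analysis.
From mathcomp Require Import ring.
Set Implicit Arguments.
Unset Strict Implicit.
Unset Printing Implicit Defensive.
Import Order.TTheory GRing.Theory Num.Theory.
Import numFieldNormedType.Exports.
Local Open Scope classical_set_scope.
Local Open Scope ring_scope.

(* Differential calculus is done as in Helgason (Differential Geometry, Lie
   Groups, and Symmetric Spaces, ch. I): a smooth vector field is a derivation
   of the algebra of smooth functions, a tangent vector at x is the value at x
   of a vector field, and a differential form is an alternating multilinear map
   over the smooth functions on vector fields. *)

(* f is k times continuously differentiable on U. U is always an open set; the
   partial derivatives are named by an existential because only their values
   on U matter. *)
Fixpoint Ck (R : realType) (n : nat) (k : nat) (U : set 'rV[R]_n)
    (f : 'rV[R]_n -> R) : Prop :=
  (forall x, U x -> {for x, continuous f}) /\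
  if k is k'.+1 then
    forall j, exists2 g, (forall x, U x -> is_derive x (delta_mx 0 j) f (g x)) & Ck k' U g
  else True.

Lemma CkS (R : realType) n k (U : set 'rV[R]_n) f : Ck k.+1 U f -> Ck k U f.
Proof.
elim: k f => [|k IH] f /=; first by case.
by move=> [cf df]; split=> // j; have [g dg Cg] := df j; exists g => //; apply: IH.
Qed.

Lemma Ck_cst (R : realType) n k (U : set 'rV[R]_n) (c : R) : Ck k U (cst c).
Proof.
elim: k c => [|k IH] c /=; split=> //; try by move=> x _; exact: cst_continuous.
by move=> j; exists (cst 0) => // x _; exact: is_derive_cst.
Qed.

Lemma CkB (R : realType) n k (U : set 'rV[R]_n) f g : Ck k U f -> Ck k U g -> Ck k U (f - g).
Proof.
elim: k f g => [|k IH] f g /=.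
  move=> [cf _] [cg _]; split=> // x Ux; exact: continuousB (cf _ Ux) (cg _ Ux).
move=> [cf df] [cg dg]; split; first by move=> x Ux; exact: continuousB (cf _ Ux) (cg _ Ux).
move=> j; have [f' hf Cf] := df j; have [g' hg Cg] := dg j.
exists (f' - g'); last exact: IH.
by move=> x Ux; have ? := hf x Ux; have ? := hg x Ux; exact: is_deriveB.
Qed.

Lemma CkM (R : realType) n k (U : set 'rV[R]_n) f g : Ck k U f -> Ck k U g -> Ck k U (f * g).
Proof.
elim: k f g => [|k IH] f g.
  move=> [cf _] [cg _]; split=> // x Ux; exact: continuousM (cf _ Ux) (cg _ Ux).
move=> Cf Cg; have Cf' := CkS Cf; have Cg' := CkS Cg; case: Cf Cg => [cf df] [cg dg].
split; first by move=> x Ux; exact: continuousM (cf _ Ux) (cg _ Ux).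
move=> j; have [f' hf Hf] := df j; have [g' hg Hg] := dg j.
exists (f * g' - (0 - g * f')).
  move=> x Ux; apply: is_derive_eq (is_deriveM (hf x Ux) (hg x Ux)) _.
  by rewrite !fctE sub0r opprK.
by apply: CkB; [exact: IH|apply: CkB; [exact: Ck_cst|exact: IH]].
Qed.

(* The data on which the calculus depends: the points, the topology, and the
   algebra of smooth functions. It is instantiated below by a manifold M and by
   the transverse manifold T of a foliation. *)
Record smoothSpace (R : realType) := SmoothSpace {
  point_of :> topologicalType;
  smooth_fun : set (point_of -> R);
  smooth_cst : forall r : R, smooth_fun (cst r);
  smoothB : forall f g, smooth_fun f -> smooth_fun g -> smooth_fun (f - g);
  smoothM : forall f g, smooth_fun f -> smooth_fun g -> smooth_fun (f * g) }.

Section Algebra.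
Context {R : realType} (S : smoothSpace R).

Definition smooth_pred : {pred (S -> R)} := fun f => `[< smooth_fun f >].

Lemma smooth_subring : subring_closed smooth_pred.
Proof.
split; first by apply/asboolP; exact: (smooth_cst S 1).
- by move=> f g /asboolP sf /asboolP sg; apply/asboolP; exact: smoothB.
- by move=> f g /asboolP sf /asboolP sg; apply/asboolP; exact: smoothM.
Qed.
HB.instance Definition _ := GRing.isSubringClosed.Build _ smooth_pred smooth_subring.

Record Cinf := MkCinf { Cval :> S -> R; _ : Cval \in smooth_pred }.
HB.instance Definition _ := [isSub for Cval].
HB.instance Definition _ := [Choice of Cinf by <:].
HB.instance Definition _ := GRing.SubChoice_isSubComPzRing.Build _ _ Cinf smooth_subring.

Definition Ccst (r : R) : Cinf := MkCinf (asboolT (smooth_cst S r)).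

Definition is_vfield : {pred (Cinf -> Cinf^o)} := fun X => `[<
  [/\ forall f g, X (f + g) = X f + X g,
      forall r f, X (Ccst r * f) = Ccst r * X f
    & forall f g, X (f * g) = X f * g + f * X g] >].

Lemma is_vfield_submod : submod_closed is_vfield.
Proof.
split.
  have E f : (0 : Cinf -> Cinf^o) f = 0 by [].
  by apply/asboolP; split=> *; rewrite !E ?(mulr0, mul0r, addr0).
move=> a X Y /asboolP[XD Xr XM] /asboolP[YD Yr YM]; apply/asboolP.
have E f : (a *: X + Y) f = a * X f + Y f :> Cinf by [].
split.
- by move=> f g; rewrite !E XD YD mulrDr addrACA.
- by move=> r f; rewrite !E Xr Yr mulrDr mulrCA.
- move=> f g; rewrite !E XM YM !mulrDl !mulrDr addrACA !mulrA.
  by rewrite [f * a]mulrC.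
Qed.
HB.instance Definition _ := GRing.isSubmodClosed.Build _ _ is_vfield is_vfield_submod.

Record vfield := MkVfield { vfun : Cinf -> Cinf^o; _ : vfun \in is_vfield }.
HB.instance Definition _ := [isSub for vfun].
HB.instance Definition _ := [Choice of vfield by <:].
HB.instance Definition _ := [SubChoice_isSubLmodule of vfield by <:].
Definition vact (X : vfield) : Cinf -> Cinf := vfun X.
End Algebra.
Coercion vact : vfield >-> Funclass.
Arguments vact : simpl never.

Section Lie.
Context {R : realType} {S : smoothSpace R}.
Local Notation A := (Cinf S).
Local Notation V := (vfield S).
Implicit Types (f g : A) (X Y Z : V).

Lemma vactP X : [/\ forall f g, X (f + g) = X f + X g,
      forall r f, X (Ccst S r * f) = Ccst S r * X f
    & forall f g, X (f * g) = X f * g + f * X g].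
Proof. by have /asboolP := valP X. Qed.
Lemma vactD X f g : X (f + g) = X f + X g. Proof. by have [] := vactP X. Qed.
Lemma vactM X f g : X (f * g) = X f * g + f * X g. Proof. by have [] := vactP X. Qed.
Lemma vactC X r f : X (Ccst S r * f) = Ccst S r * X f. Proof. by have [] := vactP X. Qed.
Lemma vact0 X : X 0 = 0.
Proof. by apply: (addrI (X 0)); rewrite -vactD !addr0. Qed.
Lemma vactN X f : X (- f) = - X f.
Proof. by apply: (addrI (X f)); rewrite -vactD !subrr vact0. Qed.

Lemma lie_subproof X Y :
  ((fun f => X (Y f) - Y (X f)) : A -> A^o) \in @is_vfield R S.
Proof.
apply/asboolP; split.
- move=> f g; rewrite !vactD; ring.
- by move=> r f; rewrite !vactC mulrBr.
- move=> f g; rewrite !vactM !vactD !vactM; ring.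
Qed.
Definition lie X Y : V := MkVfield (lie_subproof X Y).

Definition is_oneform : {pred (V -> A^o)} := fun al => `[<
  forall f X Y, al (f *: X + Y) = f * al X + al Y >].
Lemma is_oneform_submod : submod_closed is_oneform.
Proof.
split.
  have E X : (0 : V -> A^o) X = 0 by [].
  by apply/asboolP=> *; rewrite !E mulr0 addr0.
move=> a al be /asboolP ha /asboolP hb; apply/asboolP=> f X Y.
have E Z : (a *: al + be) Z = a * al Z + be Z :> A by [].
rewrite !E ha hb; ring.
Qed.
HB.instance Definition _ := GRing.isSubmodClosed.Build _ _ is_oneform is_oneform_submod.
Record oneform := MkOneform { ofun : V -> A^o; _ : ofun \in is_oneform }.
HB.instance Definition _ := [isSub for ofun].
HB.instance Definition _ := [Choice of oneform by <:].
HB.instance Definition _ := [SubChoice_isSubLmodule of oneform by <:].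
Definition oval (al : oneform) : V -> A := ofun al.
Coercion oval : oneform >-> Funclass.
Arguments oval : simpl never.

(* Forms of mixed degree: a map on finite sequences of vector fields, whose
   restriction to sequences of size k is the component of degree k. On a
   manifold of dimension n the components of degree > n vanish, so this is the
   direct sum of the spaces of k-forms. *)
Definition is_form : {pred (seq V -> A^o)} := fun w => `[<
  (forall s1 s2 f X Y, w (s1 ++ f *: X + Y :: s2)
      = f * w (s1 ++ X :: s2) + w (s1 ++ Y :: s2)) /\
  (forall s1 s2 s3 X, w (s1 ++ X :: s2 ++ X :: s3) = 0) >].
Lemma is_form_submod : submod_closed is_form.
Proof.
split.
  have E s : (0 : seq V -> A^o) s = 0 by [].
  by apply/asboolP; split=> *; rewrite !E ?mulr0 ?addr0.
move=> a al be /asboolP[ha ha'] /asboolP[hb hb']; apply/asboolP.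
have E s : (a *: al + be) s = a * al s + be s :> A by [].
split=> [s1 s2 f X Y|s1 s2 s3 X].
  by rewrite !E ha hb; ring.
by rewrite E ha' hb' mulr0 addr0.
Qed.
HB.instance Definition _ := GRing.isSubmodClosed.Build _ _ is_form is_form_submod.
Record form := MkForm { ffn : seq V -> A^o; _ : ffn \in is_form }.
HB.instance Definition _ := [isSub for ffn].
HB.instance Definition _ := [Choice of form by <:].
HB.instance Definition _ := [SubChoice_isSubLmodule of form by <:].
Definition fval (w : form) : seq V -> A := ffn w.
Coercion fval : form >-> Funclass.
Arguments fval : simpl never.
Lemma faddE f (u v : form) s : (f *: u + v : form) s = f * u s + v s. Proof. by []. Qed.
Lemma vfactE f X Y g : (f *: X + Y : V) g = f * X g + Y g. Proof. by []. Qed.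
Lemma oaddE f (u v : oneform) s : (f *: u + v : oneform) s = f * u s + v s. Proof. by []. Qed.

Lemma oneformP (al : oneform) f X Y : al (f *: X + Y) = f * al X + al Y.
Proof. by have /asboolP := valP al; apply. Qed.

Lemma formP (w : form) :
  (forall s1 s2 f X Y, w (s1 ++ f *: X + Y :: s2)
      = f * w (s1 ++ X :: s2) + w (s1 ++ Y :: s2)) /\
  (forall s1 s2 s3 X, w (s1 ++ X :: s2 ++ X :: s3) = 0).
Proof. by have /asboolP := valP w. Qed.

(* To show that all members of P are forms it suffices to look at the first
   arguments, if P is stable under contraction. *)
Section Closed.
Variable P : set (seq V -> A).
Hypothesis Plin : forall w, P w ->
  forall s f X Y, w (f *: X + Y :: s) = f * w (X :: s) + w (Y :: s).
Hypothesis Palt : forall w, P w -> forall s X, w (X :: X :: s) = 0.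
Hypothesis Pins : forall w, P w -> forall X, P (fun s => w (X :: s)).

Lemma closed_lin w : P w -> forall s1 s2 f X Y, w (s1 ++ f *: X + Y :: s2)
      = f * w (s1 ++ X :: s2) + w (s1 ++ Y :: s2).
Proof.
move=> Pw s1; elim: s1 w Pw => [|Z s1 IH] w Pw s2 f X Y; first exact: Plin.
exact: (IH _ (Pins Pw Z)).
Qed.

Lemma closed_swap w : P w -> forall s X Y, w (X :: Y :: s) = - w (Y :: X :: s).
Proof.
move=> Pw s X Y; have := Palt Pw s (1 *: X + Y).
rewrite (closed_lin Pw [::]) /= (closed_lin Pw [:: X]) (closed_lin Pw [:: Y]) /=.
rewrite !(Palt Pw) => h; apply/eqP; rewrite -addr_eq0 -[X in _ == X]h.
apply/eqP; ring.
Qed.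

Lemma closed_form w : P w -> w \in is_form.
Proof.
move=> Pw; apply/asboolP; split; first exact: closed_lin.
move=> s1; elim: s1 w Pw => [|Z s1 IH] w Pw s2 s3 X; last exact: (IH _ (Pins Pw Z)).
elim: s2 w Pw => [|Y s2 IH] w Pw /=; first exact: Palt.
by rewrite closed_swap // (IH _ (Pins Pw Y)) oppr0.
Qed.
End Closed.

Lemma form_lin0 (w : form) f X Y s : w (f *: X + Y :: s) = f * w (X :: s) + w (Y :: s).
Proof. exact: (formP w).1 [::] _ _ _ _. Qed.
Lemma form_alt0 (w : form) X s : w (X :: X :: s) = 0.
Proof. exact: (formP w).2 [::] [::] _ _. Qed.

Lemma contract_subproof X (w : form) : ((fun s => w (X :: s)) : seq V -> A) \in is_form.
Proof.
apply/asboolP; split=> [s1|s1]; [exact: (formP w).1 (X :: s1)|exact: (formP w).2 (X :: s1)].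
Qed.
Definition contract X w : form := MkForm (contract_subproof X w).
Lemma contractE X w s : contract X w s = w (X :: s). Proof. by []. Qed.

Lemma formE (w w' : form) : w =1 w' -> w = w'.
Proof. by move=> e; apply: val_inj; apply/funext. Qed.

Lemma form_swap (w : form) X Y s : w (X :: Y :: s) = - w (Y :: X :: s).
Proof.
apply: (@closed_swap [set w | w \in is_form]) => [u|u|u|].
- move=> h s' f X' Y'; exact: (form_lin0 (MkForm h)).
- move=> h s' X'; exact: (form_alt0 (MkForm h)).
- move=> h Z; exact: (contract_subproof Z (MkForm h)).
- exact: valP.
Qed.

Definition remove_nth (T : Type) (i : nat) (s : seq T) := take i s ++ drop i.+1 s.

(* (al /\ w)(X_0, .., X_k) = sum_i (-1)^i al(X_i) w(X_0, .., X_i omitted, .., X_k) *)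
Definition wedge_fun (al : oneform) (w : seq V -> A) : seq V -> A := fun s =>
  \sum_(i < size s) (-1) ^+ i * (al (nth 0 s i) * w (remove_nth i s)).

(* Koszul's formula, in every degree. *)
Definition ext_d_fun (w : seq V -> A) : seq V -> A := fun s =>
  \sum_(i < size s) (-1) ^+ i * nth 0 s i (w (remove_nth i s))
  + \sum_(i < size s) \sum_(j < size s | (i < j)%N)
      (-1) ^+ (i + j) * w (lie (nth 0 s i) (nth 0 s j) :: remove_nth i (remove_nth j s)).

Lemma wedge_cons al w X s :
  wedge_fun al w (X :: s) = al X * w s - wedge_fun al (fun s => w (X :: s)) s.
Proof.
rewrite /wedge_fun /= big_ord_recl /= expr0 mul1r /remove_nth /= drop0; congr (_ + _).
rewrite -sumrN; apply: eq_bigr => i _.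
by rewrite /bump /= add1n exprS mulN1r mulNr.
Qed.

Lemma wedge_lin al (w1 w2 w : seq V -> A) f s :
  (forall s, w s = f * w1 s + w2 s) ->
  wedge_fun al w s = f * wedge_fun al w1 s + wedge_fun al w2 s.
Proof.
move=> E; rewrite /wedge_fun mulr_sumr -big_split /=; apply: eq_bigr => i _.
by rewrite E; ring.
Qed.

Lemma wedge_subproof al (w : form) : wedge_fun al w \in is_form.
Proof.
pose P := [set u | exists th w : form, forall s, u s = th s + wedge_fun al w s].
apply: (@closed_form P); last first.
  exists 0, w => s; have -> : (0 : form) s = 0 by []. by rewrite add0r.
- move=> u0 [th [u e]] X; exists (al X *: u + contract X th), ((-1) *: contract X u + 0).
  move=> s; rewrite e wedge_cons faddE.
  rewrite (@wedge_lin _ (contract X u) (0 : form) ((-1) *: contract X u + 0) (-1)) => [|t]; last exact: faddE.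
  have -> : wedge_fun al (0 : form) s = 0.
    by rewrite /wedge_fun big1 // => i _; rewrite !mulr0.
  rewrite contractE; ring.
- move=> u0 [th [u e]] s X; rewrite e !wedge_cons form_alt0.
  rewrite /wedge_fun big1; last by move=> i _; rewrite form_alt0 !mulr0.
  ring.
- move=> u0 [th [u e]] s f X Y; rewrite !e !wedge_cons form_lin0 oneformP.
  rewrite (@wedge_lin _ (fun s => u (X :: s)) (fun s => u (Y :: s)) _ f); first by ring.
  by move=> t; rewrite form_lin0.
Qed.
Definition wedge al w : form := MkForm (wedge_subproof al w).
End Lie.
Arguments oneform {R} S.
Arguments form {R} S.
Arguments is_form {R} S.
Arguments is_oneform {R} S.

Section Cartan.
Context {R : realType} {S : smoothSpace R}.
Local Notation A := (Cinf S).
Local Notation V := (vfield S).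
Local Notation form := (form S).
Implicit Types (f g : A) (X Y Z : V) (u v w : form).

Lemma vfE X Y : X =1 Y -> X = Y.
Proof. by move=> e; apply: val_inj; apply/funext. Qed.
Lemma vfaddE X Y g : (X + Y) g = X g + Y g. Proof. by []. Qed.
Lemma fsubE u v s : (u - v) s = u s - v s. Proof. by []. Qed.
Lemma lieE X Y g : lie X Y g = X (Y g) - Y (X g). Proof. by []. Qed.

Lemma lie_linr X f Y Z : lie X (f *: Y + Z) = X f *: Y + (f *: lie X Y + lie X Z).
Proof.
apply: vfE => g; rewrite !vfactE !lieE !vfactE vactD vactM; ring.
Qed.
Lemma lie_linl X f Y Z : lie (f *: Y + Z) X = - X f *: Y + (f *: lie Y X + lie Z X).
Proof.
apply: vfE => g; rewrite !vfactE !lieE !vfactE vactD vactM; ring.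
Qed.
Lemma lieXX X : lie X X = 0.
Proof. by apply: vfE => g; rewrite lieE subrr. Qed.
Lemma jacobi X Y Z : lie X (lie Y Z) = lie Y (lie X Z) + lie (lie X Y) Z.
Proof.
apply: vfE => g; rewrite vfaddE !lieE !vactD !vactN; ring.
Qed.
Lemma form0 w s : w (0 :: s) = 0.
Proof.
have := form_lin0 w (-1) 0 0 s; rewrite scaler0 addr0 => ->; ring.
Qed.
Lemma formD w X Y s : w (X + Y :: s) = w (X :: s) + w (Y :: s).
Proof. by rewrite -[X in X + Y]scale1r form_lin0 mul1r. Qed.

Definition lieD_fun X (w : seq V -> A) : seq V -> A := fun s =>
  X (w s) - \sum_(i < size s) (-1) ^+ i * w (lie X (nth 0 s i) :: remove_nth i s).

Lemma lieD_cons X w Y s :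
  lieD_fun X w (Y :: s) = lieD_fun X (contract Y w) s - w (lie X Y :: s).
Proof.
rewrite /lieD_fun /= big_ord_recl /= expr0 mul1r /remove_nth /= drop0.
rewrite opprD addrA addrAC ?contractE; congr (_ - _); congr (_ + _).
rewrite -!sumrN; apply: eq_bigr => i _.
rewrite /bump /= add1n exprS mulN1r mulNr opprK ?contractE.
by rewrite [X in _ = - (_ * X)]form_swap mulrN opprK.
Qed.

Lemma lieD_lin X (f : A) (u v w : seq V -> A) s :
  (forall s, w s = f * u s + v s) ->
  lieD_fun X w s = X f * u s + f * lieD_fun X u s + lieD_fun X v s.
Proof.
rewrite /lieD_fun => E.
rewrite E vactD vactM.
have -> : \sum_(i < size s) (-1) ^+ i * w (lie X (nth 0 s i) :: remove_nth i s)
  = f * \sum_(i < size s) (-1) ^+ i * u (lie X (nth 0 s i) :: remove_nth i s)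
   + \sum_(i < size s) (-1) ^+ i * v (lie X (nth 0 s i) :: remove_nth i s).
  rewrite mulr_sumr -big_split /=; apply: eq_bigr => i _; rewrite E; ring.
ring.
Qed.

Lemma contract_lin f X Y w : contract (f *: X + Y) w = f *: contract X w + contract Y w.
Proof. by apply: formE => s; rewrite faddE !contractE form_lin0. Qed.

Lemma contractXX X w : contract X (contract X w) = 0.
Proof. by apply: formE => s; rewrite !contractE form_alt0. Qed.

Lemma zeroE s : (0 : form) s = 0. Proof. by []. Qed.

Lemma lieD0 X s : lieD_fun X (0 : form) s = 0.
Proof.
rewrite /lieD_fun zeroE vact0 big1 ?subr0 // => i _; exact: mulr0.
Qed.

Lemma lieD_subproof X w : lieD_fun X w \in is_form S.
Proof.
pose P := [set u | exists th w : form, forall s, u s = th s + lieD_fun X w s].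
apply: (@closed_form _ _ P); last first.
  by exists 0, w => s; rewrite zeroE add0r.
- move=> u0 [th [u e]] Z; exists (contract Z th - contract (lie X Z) u), (contract Z u) => s.
  by rewrite !e lieD_cons fsubE !contractE addrCA addrC.
- move=> u0 [th [u e]] s Z; rewrite e !lieD_cons form_alt0 contractXX lieD0 contractE.
  rewrite [u (Z :: _)]form_swap; ring.
- move=> u0 [th [u e]] s f Y Z; rewrite !e !lieD_cons form_lin0 contract_lin.
  rewrite (@lieD_lin _ f (contract Y u) (contract Z u)); last by move=> t; rewrite faddE.
  rewrite lie_linr !form_lin0 !contractE; ring.
Qed.
Definition lieD X w : form := MkForm (lieD_subproof X w).

Lemma ext_d_cons w X s : ext_d_fun w (X :: s) = lieD_fun X w s - ext_d_fun (contract X w) s.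
Proof.
rewrite /ext_d_fun /lieD_fun /= !big_ord_recl /= expr0 mul1r [remove_nth 0 _]/remove_nth /= drop0.
rewrite [X in _ + (X + _) = _]big_mkcond /= big_ord_recl /= add0r.
have -> : \sum_(i < size s) (-1) ^+ bump 0 i * nth 0 s i (w (remove_nth (bump 0 i) (X :: s)))
   = - \sum_(i < size s) (-1) ^+ i * nth 0 s i (contract X w (remove_nth i s)).
  rewrite -sumrN; apply: eq_bigr => i _.
  by rewrite /bump add1n exprS mulN1r mulNr contractE.
have -> : \sum_(i < size s) (-1) ^+ (0 + bump 0 i) *
     w (lie X (nth 0 s i) :: remove_nth 0 (remove_nth (bump 0 i) (X :: s)))
   = - \sum_(i < size s) (-1) ^+ i * w (lie X (nth 0 s i) :: remove_nth i s).
  rewrite -sumrN; apply: eq_bigr => i _.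
  rewrite /bump add0n add1n exprS mulN1r mulNr; congr (- (_ * w (_ :: _))).
  by rewrite /remove_nth /= drop0.
have -> : \sum_(i < size s)
    \sum_(j < (size s).+1 | (bump 0 i < j)%N)
       (-1) ^+ (bump 0 i + j) *
       w (lie (nth 0 s i) (nth 0 (X :: s) j)
          :: remove_nth (bump 0 i) (remove_nth j (X :: s))) = 
   - \sum_(i < size s)
      \sum_(j < size s | (i < j)%N)
         (-1) ^+ (i + j) * contract X w (lie (nth 0 s i) (nth 0 s j) :: remove_nth i (remove_nth j s)).
  rewrite -sumrN; apply: eq_bigr => i _; rewrite -sumrN.
  rewrite big_mkcond big_ord_recl /= add0r [RHS]big_mkcond; apply: eq_bigr => j _.
  rewrite /bump !add1n ltnS; case: ifP => // _.
  rewrite addSn addnS !exprS mulN1r mulN1r opprK ?contractE form_swap mulrN opprK.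
  by [].
ring.
Qed.


Lemma ext_d_nil (w : seq V -> A) : ext_d_fun w [::] = 0.
Proof. by rewrite /ext_d_fun /= !big_ord0 addr0. Qed.

Lemma ext_d_lin (f : A) (u v w : seq V -> A) s :
  (forall s, w s = f * u s + v s) ->
  ext_d_fun w s = (\sum_(i < size s) (-1) ^+ i * (nth 0 s i f * u (remove_nth i s)))
    + f * ext_d_fun u s + ext_d_fun v s.
Proof.
move=> E; rewrite /ext_d_fun mulrDr !mulr_sumr.
rewrite [RHS](AC (1*2*2) ((1*2*4)*(3*5)))/=; congr (_ + _).
  by rewrite -!big_split; apply: eq_bigr => i _; rewrite E vactD vactM /=; ring.
rewrite -big_split; apply: eq_bigr => i _; rewrite mulr_sumr -big_split; apply: eq_bigr => j _.
rewrite E /=; ring.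
Qed.

Lemma ext_d_sub (u v : form) s : ext_d_fun (u - v) s = ext_d_fun u s - ext_d_fun v s.
Proof.
rewrite (@ext_d_lin (-1) v u) => [|t]; last by rewrite fsubE; ring.
rewrite big1 => [|i _]; first by ring.
rewrite vactN; suff -> : nth 0 s i 1 = 0 by rewrite oppr0 mul0r mulr0.
have := vactM (nth 0 s i) 1 1; rewrite !mulr1 mul1r => h.
by apply: (addrI (nth 0 s i 1)); rewrite -h addr0.
Qed.

Lemma ext_d_zero s : ext_d_fun (0 : form) s = 0.
Proof. by rewrite -[0 : form](subrr (0 : form)) ext_d_sub subrr. Qed.

Lemma lieD_lin0 f X Y w s : lieD_fun (f *: X + Y) w s =
  (\sum_(i < size s) (-1) ^+ i * (nth 0 s i f * contract X w (remove_nth i s)))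
    + f * lieD_fun X w s + lieD_fun Y w s.
Proof.
rewrite /lieD_fun vfactE.
have -> : \sum_(i < size s) (-1) ^+ i * w (lie (f *: X + Y) (nth 0 s i) :: remove_nth i s)
  = - (\sum_(i < size s) (-1) ^+ i * (nth 0 s i f * contract X w (remove_nth i s)))
    + f * (\sum_(i < size s) (-1) ^+ i * w (lie X (nth 0 s i) :: remove_nth i s))
    + \sum_(i < size s) (-1) ^+ i * w (lie Y (nth 0 s i) :: remove_nth i s).
  rewrite mulr_sumr -sumrN -!big_split; apply: eq_bigr => i _.
  rewrite lie_linl !form_lin0 contractE /=; ring.
ring.
Qed.

Lemma ext_d_subproof w : ext_d_fun w \in is_form S.
Proof.
pose P := [set u | exists th w : form, forall s, u s = th s + ext_d_fun w s].
apply: (@closed_form _ _ P); last first.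
  by exists 0, w => s; rewrite zeroE add0r.
- move=> u0 [th [u e]] Z; exists (1 *: contract Z th + lieD Z u), (0 - contract Z u) => s.
  by rewrite e ext_d_cons ext_d_sub ext_d_zero faddE !contractE mul1r sub0r addrA.
- move=> u0 [th [u e]] s Z; rewrite e ext_d_cons lieD_cons ext_d_cons contractXX ext_d_zero lieXX.
  rewrite form_alt0 form0; ring.
- move=> u0 [th [u e]] s f Y Z; rewrite !e !ext_d_cons form_lin0 contract_lin lieD_lin0.
  rewrite (@ext_d_lin f (contract Y u) (contract Z u)); last by move=> t; rewrite faddE.
  ring.
Qed.
Definition ext_d w : form := MkForm (ext_d_subproof w).
Lemma ext_dB u v : ext_d (u - v) = ext_d u - ext_d v.
Proof. by apply: formE => s; rewrite fsubE; exact: ext_d_sub. Qed.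

Lemma lieD_sub X u v : lieD X (u - v) = lieD X u - lieD X v.
Proof.
apply: formE => s; rewrite fsubE.
change (lieD_fun X (u - v) s = lieD_fun X u s - lieD_fun X v s).
rewrite (@lieD_lin X (-1) v u) => [|t]; last by rewrite fsubE; ring.
have h0 : X 1 = 0.
  have := vactM X 1 1; rewrite !mulr1 mul1r => h.
  by apply: (addrI (X 1)); rewrite -h addr0.
rewrite vactN h0; ring.
Qed.

Lemma contract_lieD X Y w : contract Y (lieD X w) = lieD X (contract Y w) - contract (lie X Y) w.
Proof. by apply: formE => s; rewrite fsubE !contractE -lieD_cons. Qed.
Lemma contract_ext_d X w : contract X (ext_d w) = lieD X w - ext_d (contract X w).
Proof. by apply: formE => s; rewrite fsubE contractE; exact: ext_d_cons. Qed.
Lemma contractB X u v : contract X (u - v) = contract X u - contract X v.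
Proof. exact: formE. Qed.

Lemma lieD_lie X Y w : lieD X (lieD Y w) - lieD Y (lieD X w) = lieD (lie X Y) w.
Proof.
apply: formE => s; elim: s w => [|Z s IH] w.
  rewrite fsubE; change (lieD_fun X (lieD_fun Y w) [::] - lieD_fun Y (lieD_fun X w) [::]
    = lieD_fun (lie X Y) w [::]).
  by rewrite /lieD_fun /= !big_ord0 !subr0.
rewrite -!contractE !contractB !contract_lieD !lieD_sub !fsubE -IH !fsubE (jacobi X Y Z).
rewrite [contract (_ + _) w s]contractE formD -!contractE; ring.
Qed.

Lemma ext_d_lieD X w : ext_d (lieD X w) = lieD X (ext_d w).
Proof.
apply: formE => s; elim: s X w => [|Y s IH] X w.
  change (ext_d_fun (lieD X w) [::] = lieD_fun X (ext_d_fun w) [::]).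
  by rewrite /lieD_fun !ext_d_nil /= big_ord0 vact0 subr0.
rewrite -!contractE contract_ext_d contract_lieD ext_dB contract_lieD !contract_ext_d lieD_sub !fsubE IH.
rewrite -(lieD_lie X Y w) fsubE; ring.
Qed.

Lemma ext_dd w : ext_d (ext_d w) = 0.
Proof.
apply: formE => s; elim: s w => [|X s IH] w; first exact: ext_d_nil.
rewrite -contractE contract_ext_d contract_ext_d ext_dB ext_d_lieD !fsubE IH !zeroE; ring.
Qed.
End Cartan.

Section GeneralizedComplex.
Context {R : realType} {S : smoothSpace R}.
Local Notation A := (Cinf S).
Local Notation V := (vfield S).

Lemma vact_cst (X : V) r : X (Ccst S r) = 0.
Proof.
have h : X 1 = 0.
  by have := vactM X 1 1; rewrite !mulr1 mul1r => h; apply: (addrI (X 1)); rewrite -h addr0.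
by have := vactC X r 1; rewrite mulr1 h mulr0.
Qed.

Lemma differential_subproof (f : A) : (fun X : V => X f) \in is_oneform S.
Proof. by apply/asboolP => g X Y; rewrite vfactE. Qed.
Definition differential f : oneform S := MkOneform (differential_subproof f).

Lemma contract_d_subproof (X : V) (al : oneform S) :
  (fun Y : V => X (al Y) - Y (al X) - al (lie X Y)) \in is_oneform S.
Proof.
apply/asboolP => f Y Z.
have oD u v : al (u + v) = al u + al v.
  by rewrite -[u]scale1r oneformP mul1r scale1r.
rewrite lie_linr oneformP oneformP oneformP vfactE vactD vactM; ring.
Qed.
(* i_X (d al), as a 1-form. *)
Definition contract_d X al : oneform S := MkOneform (contract_d_subproof X al).

(* Global smooth sections of TT + T^*T. An endomorphism of this bundle is a map
   on sections that is linear over the smooth functions. *)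
Definition gtan := (vfield S * oneform S)%type.

Definition pairing (u v : gtan) : A := Ccst S 2^-1 * (u.2 v.1 + v.2 u.1).

Definition courant (u v : gtan) : gtan :=
  (lie u.1 v.1,
   contract_d u.1 v.2 - contract_d v.1 u.2 + Ccst S 2^-1 *: differential (v.2 u.1 - u.2 v.1)).

Record gcs := Gcs {
  gcs_map :> gtan -> gtan;
  gcs_linear : forall (f : A) u v, gcs_map (f *: u + v) = f *: gcs_map u + gcs_map v;
  gcs_square : forall u, gcs_map (gcs_map u) = - u;
  gcs_orthogonal : forall u v, pairing (gcs_map u) (gcs_map v) = pairing u v;
  gcs_integrable : forall u v,
    courant (gcs_map u) (gcs_map v) - gcs_map (courant u (gcs_map v))
    - gcs_map (courant (gcs_map u) v) + gcs_map (gcs_map (courant u v)) = 0 }.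

(* Complexifications: a pair (a, b) stands for a + i b. *)
Definition cgtan := (gtan * gtan)%type.
Definition cform := (form S * form S)%type.

Definition cliff (u : gtan) (w : form S) : form S := contract u.1 w + wedge u.2 w.
Definition ccliff (e : cgtan) (w : cform) : cform :=
  (cliff e.1 w.1 - cliff e.2 w.2, cliff e.1 w.2 + cliff e.2 w.1).

Definition muli (w : cform) : cform := (- w.2, w.1).
Definition ext_dC (w : cform) : cform := (ext_d w.1, ext_d w.2).

(* u and v have the same value at x. *)
Definition eq_at (x : S) (u v : gtan) : Prop :=
  (forall f, u.1 f x = v.1 f x) /\ (forall X, u.2 X x = v.2 X x).

(* e is a section whose value at x lies in L_x: for e = a + i b, the equation
   J e = i e reads J a = - b and J b = a. *)
Definition eigenL (J : gtan -> gtan) (x : S) : set cgtan :=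
  [set e | eq_at x (J e.1) (- e.2) /\ eq_at x (J e.2) e.1].
Definition eigenLbar J x : set cgtan := [set e | eigenL J x (e.1, - e.2)].

(* The value at x of a complex form, as an element of the fibre at x of the
   bundle of complex forms. Complex numbers a + i b act by cscale a b. *)
Definition cfibre := ((seq V -> R) * (seq V -> R))%type.
Definition at_pt (x : S) (w : cform) : cfibre := (fun s => w.1 s x, fun s => w.2 s x).
Definition cscale (a b : R) (p : cfibre) : cfibre :=
  (fun s => a * p.1 s - b * p.2 s, fun s => a * p.2 s + b * p.1 s).

(* Phi x is a complex line in the fibre at x, locally spanned by a smooth
   nowhere vanishing form. *)
Definition line_subbundle (Phi : S -> set cfibre) : Prop :=
  forall x : S, exists w : cform, \forall y \near x,
    at_pt y w <> 0 /\ Phi y = [set p | exists a b, p = cscale a b (at_pt y w)].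

Definition annihilator (Phi : S -> set cfibre) (x : S) : set cgtan :=
  [set e | forall w : cform, Phi x (at_pt x w) -> at_pt x (ccliff e w) = 0].

(* The unique complex line subbundle whose annihilator is L. *)
Definition spinor_line (J : gtan -> gtan) : S -> set cfibre :=
  xget (fun=> set0) [set Phi | line_subbundle Phi /\
                               forall x, eigenL J x = annihilator Phi x].

(* The span of the e_1 . ( .. (e_k . w)), with e_l in bar L_x and w in Phi_x; it
   is (/\^k bar L_x) . Phi_x since bar L_x is isotropic. *)
Definition cliff_power J k x : set cfibre :=
  [set p | exists m (w : 'I_m -> cform) (e : 'I_m -> k.-tuple cgtan),
     [/\ forall i, spinor_line J x (at_pt x (w i)),
         forall i l, eigenLbar J x (tnth (e i) l)
       & p = \sum_i at_pt x (foldr ccliff (w i) (e i))]].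

Section Split.
Variables (q : nat) (J : gtan -> gtan).

(* U^j_x, where j = q - k with 0 <= k <= 2q; it is 0 for the other j. *)
Definition bundleU (j : int) (x : S) : set cfibre :=
  if (`|j| <= q)%N then cliff_power J `|q%:Z - j|%N x else [set 0].

Definition sectionU (j : int) : set cform :=
  [set w | forall x, bundleU j x (at_pt x w)].

(* The component in U^j for the decomposition of the forms as the direct sum of
   the U^{q-k}, 0 <= k <= 2q. *)
Definition component (j : int) (w : cform) : cform :=
  xget 0 [set v | exists c : int -> cform,
    [/\ forall l, sectionU l (c l),
        w = \sum_(k < (2 * q).+1) c (q%:Z - k%:Z)
      & v = c j]].

(* The components of d that map U^j to U^{j+1}, resp. to U^{j-1}. *)
Definition partial_op (w : cform) : cform :=
  \sum_(k < (2 * q).+1)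
    component (q%:Z - k%:Z + 1) (ext_dC (component (q%:Z - k%:Z) w)).
Definition partialbar_op (w : cform) : cform :=
  \sum_(k < (2 * q).+1)
    component (q%:Z - k%:Z - 1) (ext_dC (component (q%:Z - k%:Z) w)).
Definition dJ_op (w : cform) : cform := muli (partialbar_op w - partial_op w).
End Split.
End GeneralizedComplex.
Arguments gtan {R} S.
Arguments gcs {R} S.
Arguments cgtan {R} S.
Arguments cform {R} S.

(* G is the graph of a smooth map defined on an open subset of S. All maps below
   are submersions or local diffeomorphisms, so every tangent vector at y is the
   image of a tangent vector at x. *)
Section Pullback.
Context {R : realType} {S S' : smoothSpace R}.
Variables (G : S -> S' -> Prop) (x : S) (y : S').

(* dG_x (X_x) = Y_y: X_x (h o G) = Y_y (h), where g is any smooth function that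
   agrees with h o G near x. *)
Definition related (X : vfield S) (Y : vfield S') : Prop :=
  forall (h : Cinf S') (g : Cinf S),
    (\forall x' \near x, forall y', G x' y' -> g x' = h y') -> X g x = Y h y.

(* al_x = G^* be_y *)
Definition related1 (al : oneform S) (be : oneform S') : Prop :=
  forall X Y, related X Y -> al X x = be Y y.

Definition related_gtan (u : gtan S) (v : gtan S') : Prop :=
  related u.1 v.1 /\ related1 u.2 v.2.

(* w_x = (G^* t)_x *)
Definition pullback_at (w : form S) (t : form S') : Prop :=
  forall s : seq (vfield S * vfield S'),
    (forall p, p \in s -> related p.1 p.2) -> w (unzip1 s) x = t (unzip2 s) y.
End Pullback.

Definition is_pullback (R : realType) (S S' : smoothSpace R) (G : S -> S' -> Prop)
    (w : cform S) (t : cform S') : Prop :=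
  forall x y, G x y -> pullback_at G x y w.1 t.1 /\ pullback_at G x y w.2 t.2.

Definition invariant_gcs (R : realType) (S : smoothSpace R) (G : S -> S -> Prop)
    (J : gtan S -> gtan S) : Prop :=
  forall x y, G x y -> forall u v,
    related_gtan G x y u v -> related_gtan G x y (J u) (J v).

Definition smooth_in (R : realType) (n : nat) (U : set 'rV[R]_n) (f : 'rV[R]_n -> R) :=
  forall k, Ck k U f.

Record chart (R : realType) (n : nat) (M : Type) := Chart {
  chart_dom : set M;
  coord :> M -> 'rV[R]_n }.

Section Charts.
Context {R : realType} {n : nat} {M : topologicalType}.
Implicit Types (c : chart R n M) (V : set M).

(* A homeomorphism from an open set onto an open subset of R^n. *)
Definition is_chart c : Prop :=
  [/\ open (chart_dom c), {in chart_dom c &, injective c}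
    & forall O, O `<=` chart_dom c -> (open O <-> open (c @` O))].

(* h is smooth on V when read in the chart c. *)
Definition smooth_via c V (h : M -> R) : Prop :=
  exists2 g, smooth_in (c @` (V `&` chart_dom c)) g
           & forall x, (V `&` chart_dom c) x -> h x = g (c x).

Definition smooth_atlas (At : set (chart R n M)) : Prop :=
  [/\ forall x, exists2 c, At c & chart_dom c x,
      forall c, At c -> is_chart c
    & forall c c' j, At c -> At c' -> smooth_via c (chart_dom c') (fun x => c' x ord0 j)].
End Charts.

Record manifold (R : realType) (n : nat) := Manifold {
  man_pt :> topologicalType;
  man_hausdorff : hausdorff_space man_pt;
  man_countable : @second_countable man_pt;
  atlas : set (chart R n man_pt);
  atlasP : smooth_atlas atlas }.

Section SmoothFunctions.
Context {R : realType}.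

Lemma smooth_in_cst n (U : set 'rV[R]_n) r : smooth_in U (cst r).
Proof. by move=> k; exact: Ck_cst. Qed.
Lemma smooth_inB n (U : set 'rV[R]_n) f g :
  smooth_in U f -> smooth_in U g -> smooth_in U (f - g).
Proof. by move=> sf sg k; exact: CkB. Qed.
Lemma smooth_inM n (U : set 'rV[R]_n) f g :
  smooth_in U f -> smooth_in U g -> smooth_in U (f * g).
Proof. by move=> sf sg k; exact: CkM. Qed.

Definition smooth_on n (M : manifold R n) (V : set M) (h : M -> R) : Prop :=
  forall c, atlas c -> smooth_via c V h.

Section Global.
Context {n : nat} (M : manifold R n).
Lemma smooth_on_cst r : smooth_on [set: M] (cst r).
Proof. by move=> c _; exists (cst r) => //; exact: smooth_in_cst. Qed.
Lemma smooth_onB f g : smooth_on [set: M] f -> smooth_on [set: M] g ->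
  smooth_on [set: M] (f - g).
Proof.
move=> sf sg c Ac; have [f' sf' ef] := sf c Ac; have [g' sg' eg] := sg c Ac.
exists (f' - g'); first exact: smooth_inB.
by move=> x Vx; rewrite !fctE ef ?eg.
Qed.
Lemma smooth_onM f g : smooth_on [set: M] f -> smooth_on [set: M] g ->
  smooth_on [set: M] (f * g).
Proof.
move=> sf sg c Ac; have [f' sf' ef] := sf c Ac; have [g' sg' eg] := sg c Ac.
exists (f' * g'); first exact: smooth_inM.
by move=> x Vx; rewrite !fctE ef ?eg.
Qed.
Definition space_of : smoothSpace R := SmoothSpace smooth_on_cst smooth_onB smooth_onM.
End Global.

Definition smooth_map m n (M : manifold R m) (N : manifold R n) (V : set M)
    (f : M -> N) : Prop :=
  (forall x, V x -> {for x, continuous f}) /\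
  forall c j, atlas c -> smooth_on (V `&` f @^-1` chart_dom c) (fun x => c (f x) ord0 j).

Definition graph_on (M N : Type) (V : set M) (f : M -> N) : M -> N -> Prop :=
  fun x y => V x /\ y = f x.

(* The differential of f is onto at every point of V. *)
Definition submersion m n (M : manifold R m) (N : manifold R n) (V : set M)
    (f : M -> N) : Prop :=
  smooth_map V f /\
  forall x, V x -> forall Y : vfield (space_of N), exists X : vfield (space_of M),
    @related R (space_of M) (space_of N) (graph_on V f) x (f x) X Y.

Definition local_diffeo m n (M : manifold R m) (N : manifold R n) (V : set M)
    (f : M -> N) : Prop :=
  smooth_map V f /\
  forall x, V x -> exists (O : set M) (g : N -> M),
    [/\ open O, O x, O `<=` V & open (f @` O)] /\
    (smooth_map (f @` O) g /\ forall z, O z -> g (f z) = z).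
End SmoothFunctions.

(* fol_map and fol_trans are total functions, whose values are only used on
   fol_dom i and on fol_map i (fol_dom i `&` fol_dom j). *)
Record foliation (R : realType) (n q : nat) (M : manifold R n) := Foliation {
  fol_codim : (2 * q <= n)%N;
  fol_idx : choiceType;
  fol_dom : fol_idx -> set M;
  fol_dom_open : forall i, open (fol_dom i);
  fol_domP : forall x, exists i, fol_dom i x;
  fol_target : manifold R (2 * q);
  fol_map : fol_idx -> M -> fol_target;
  fol_map_submersion : forall i, submersion (fol_dom i) (fol_map i);
  fol_map_connected : forall i y, connected (fol_dom i `&` fol_map i @^-1` [set y]);
  fol_trans : fol_idx -> fol_idx -> fol_target -> fol_target;
  fol_trans_diffeo : forall i j, fol_dom i `&` fol_dom j !=set0 ->
    local_diffeo (fol_map i @` (fol_dom i `&` fol_dom j)) (fol_trans i j);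
  fol_transP : forall i j x, fol_dom i x -> fol_dom j x -> fol_map j x = fol_trans i j (fol_map i x) }.

Section Transverse.
Context {R : realType} {n q : nat} {M : manifold R n} (F : foliation q M).
Local Notation I := (fol_idx F).

(* T is the disjoint union of the f_i(V_i), with its sum topology. *)
Definition piece (i : I) : set (fol_target F) := fol_map i @` fol_dom i.
Definition transverse_pt := {i : I & (piece i : Type)}.

Definition transverse_smooth (h : transverse_pt -> R) : Prop :=
  forall (i : I) c, atlas c ->
    exists2 g, smooth_in (c @` (piece i `&` chart_dom c)) g
      & forall y : piece i, chart_dom c (set_val y) -> h (existT _ i y) = g (c (set_val y)).

Lemma transverse_cst r : transverse_smooth (cst r).
Proof. by move=> i c _; exists (cst r) => //; exact: smooth_in_cst. Qed.
Lemma transverseB f g : transverse_smooth f -> transverse_smooth g ->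
  transverse_smooth (f - g).
Proof.
move=> sf sg i c Ac; have [f' sf' ef] := sf i c Ac; have [g' sg' eg] := sg i c Ac.
exists (f' - g'); first exact: smooth_inB.
by move=> x Vx; rewrite !fctE ef ?eg.
Qed.
Lemma transverseM f g : transverse_smooth f -> transverse_smooth g ->
  transverse_smooth (f * g).
Proof.
move=> sf sg i c Ac; have [f' sf' ef] := sf i c Ac; have [g' sg' eg] := sg i c Ac.
exists (f' * g'); first exact: smooth_inM.
by move=> x Vx; rewrite !fctE ef ?eg.
Qed.
Definition transverse : smoothSpace R :=
  @SmoothSpace R {i : I & (piece i : Type)} transverse_smooth
    transverse_cst transverseB transverseM.

Definition map_graph (i : I) (x : space_of M) (t : transverse) : Prop :=
  fol_dom i x /\ exists2 y : piece i, t = existT _ i y & set_val y = fol_map i x.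

Definition trans_graph (i j : I) (t t' : transverse) : Prop :=
  exists (y : piece i) (y' : piece j),
    [/\ t = existT _ i y, t' = existT _ j y',
        (fol_map i @` (fol_dom i `&` fol_dom j)) (set_val y)
      & set_val y' = fol_trans i j (set_val y)].

(* The pseudogroup generated by the trans_graph i j; its elements, which are
   diffeomorphisms between open subsets of T, are given by their graphs. *)
Inductive holonomy : (transverse -> transverse -> Prop) -> Prop :=
| hol_gen i j : holonomy (trans_graph i j)
| hol_id : holonomy (fun t t' => t' = t)
| hol_inv G : holonomy G -> holonomy (fun t t' => G t' t)
| hol_comp G G' : holonomy G -> holonomy G' ->
    holonomy (fun t t'' => exists2 t', G t t' & G' t' t'')
| hol_restrict G (O : set transverse) : open O -> holonomy G ->
    holonomy (fun t t' => O t /\ G t t')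
| hol_glue (K : Type) (G : K -> transverse -> transverse -> Prop) :
    (forall k, holonomy (G k)) ->
    (forall k l t t' t'', G k t t' -> G l t t'' -> t' = t'') ->
    (forall k l t t' t'', G k t t'' -> G l t' t'' -> t = t') ->
    holonomy (fun t t' => exists k, G k t t').

Record transverse_gcs := TransverseGcs {
  tgcs :> gcs transverse;
  tgcs_invariant : forall G, holonomy G -> invariant_gcs G tgcs }.

(* The leaves are locally the fibres of the submersions f_i. *)
Definition leaf_tangent (X : vfield (space_of M)) : Prop :=
  forall i x, fol_dom i x ->
    @related R (space_of M) (space_of (fol_target F)) (graph_on (fol_dom i) (fol_map i))
      x (fol_map i x) X 0.

Definition is_basic : {pred cform (space_of M)} := fun w => `[<
  forall X, leaf_tangent X ->
    [/\ contract X w.1 = 0, contract X (ext_d w.1) = 0, contract X w.2 = 0 & contract X (ext_d w.2) = 0] >].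

Lemma is_basic_zmod : zmod_closed is_basic.
Proof.
have e0 X : contract X 0 = 0 :> form (space_of M) by exact: formE.
have d0 : ext_d (0 : form (space_of M)) = 0 by apply: formE => s; exact: ext_d_zero.
split; first by apply/asboolP => X _; split; rewrite /= ?d0 e0.
move=> u v /asboolP hu /asboolP hv; apply/asboolP => X tX.
have [a1 a2 a3 a4] := hu X tX; have [b1 b2 b3 b4] := hv X tX.
by split; rewrite /= ?ext_dB contractB ?a1 ?a2 ?a3 ?a4 ?b1 ?b2 ?b3 ?b4 subrr.
Qed.
HB.instance Definition _ := GRing.isZmodClosed.Build _ is_basic is_basic_zmod.

Record basic_form := MkBasic { basic_val :> cform (space_of M); _ : basic_val \in is_basic }.
HB.instance Definition _ := [isSub for basic_val].
HB.instance Definition _ := [Choice of basic_form by <:].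
HB.instance Definition _ := [SubChoice_isSubZmodule of basic_form by <:].

Lemma basic_ext_d_subproof (w : basic_form) : ext_dC w \in is_basic.
Proof.
have e0 X : contract X 0 = 0 :> form (space_of M) by exact: formE.
have /asboolP h := valP w; apply/asboolP => X /h [_ h1 _ h2].
by split; rewrite /= ?ext_dd ?e0.
Qed.
Definition basic_ext_d (w : basic_form) : basic_form := MkBasic (basic_ext_d_subproof w).

Definition invariant_form (t : cform transverse) : Prop :=
  forall G, holonomy G -> is_pullback G t t.

(* w = f_i^* t on V_i for every i. *)
Definition represents (t : cform transverse) (w : cform (space_of M)) : Prop :=
  forall i, is_pullback (map_graph i) w t.

Variable J : transverse_gcs.

(* d^J on basic forms, through their bijection with the invariant forms on T. *)
Definition basic_dJ (w : basic_form) : basic_form :=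
  xget 0 [set v : basic_form | exists t, [/\ invariant_form t, represents t w
                                     & represents (dJ_op q J t) v]].

Definition basic_ddJ_lemma : Prop :=
  range (basic_ext_d \o basic_dJ) = range basic_ext_d `&` [set w | basic_dJ w = 0] /\
  range basic_ext_d `&` [set w | basic_dJ w = 0] =
    [set w | basic_ext_d w = 0] `&` range basic_dJ.

Definition im_d : {pred basic_form} := fun w => `[< range basic_ext_d w >].
Lemma im_d_zmod : zmod_closed im_d.
Proof.
have bB u v : basic_ext_d (u - v) = basic_ext_d u - basic_ext_d v.
  by apply: val_inj; rewrite /= /ext_dC /= !ext_dB.
split; first by apply/asboolP; exists 0 => //; rewrite -[0 in LHS](subrr 0) bB subrr.
move=> _ _ /asboolP[u _ <-] /asboolP[v _ <-]; apply/asboolP; exists (u - v) => //.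
Qed.
HB.instance Definition _ := GRing.isZmodClosed.Build _ im_d im_d_zmod.

Definition basic_mod_d := Quotient.quot im_d.
End Transverse.

(* Cohomology of a Z/2-graded group U with an odd differential D; deg e is the
   part of parity e (true is odd). A cohomology class is a coset, i.e. a set of
   cocycles. *)
Section Cohomology.
Context {V W : zmodType} (degV : bool -> set V) (D : V -> V)
        (degW : bool -> set W) (D' : W -> W).

Definition cocycle (U : zmodType) (deg : bool -> set U) (D : U -> U) (e : bool) : set U :=
  [set u | deg e u /\ D u = 0].
Definition cohomology_class (U : zmodType) (deg : bool -> set U) (D : U -> U)
    (e : bool) (u : U) : set U :=
  [set v | cocycle deg D e v /\ exists2 b, deg (~~ e) b & v - u = D b].
Definition cohomology (U : zmodType) (deg : bool -> set U) (D : U -> U)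
    (e : bool) : set (set U) :=
  cohomology_class deg D e @` cocycle deg D e.

Definition induced_map (p : V -> W) (e : bool) (c : set V) : set W :=
  \bigcup_(v in c) cohomology_class degW D' e (p v).

Definition cohomology_iso (p : V -> W) : Prop :=
  forall e, set_bij (cohomology degV D e) (cohomology degW D' e) (induced_map p e).
End Cohomology.

Section QuotientComplex.
Context {R : realType} {n q : nat} {M : manifold R n} {F : foliation q M}.
Variable J : transverse_gcs F.

Definition basic_parity (e : bool) : set (basic_form F) :=
  [set w | forall s, odd (size s) != e -> (basic_val w).1 s = 0 /\ (basic_val w).2 s = 0].

Definition quot_proj : basic_form F -> basic_mod_d F := \pi_(basic_mod_d F)%qT.
Definition quot_parity (e : bool) : set (basic_mod_d F) := quot_proj @` basic_parity e.
(* This does not depend on the representative, because d^J d = - d d^J. *)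
Definition quot_dJ (c : basic_mod_d F) : basic_mod_d F := quot_proj (basic_dJ J (repr c)).
End QuotientComplex.

(* Main.v *)
(** Quantising [J] gives a zeroth order operator [N] on forms with [[N, u] = J u] for
    the Clifford action of sections [u]; the bundle [U ^ (q - k)] is the eigenbundle
    on which [q - (- i N)] is multiplication by the level [k]. By derived brackets,
    integrability of [J] is a condition on [[[d, u], v]], which forces
    [((ad N) ^ 2 + 1) ^ 2 d = 0]; so [d] changes the level by 1 or -1, and the two
    parts give the operator [d ^ J]. Pulling back along holonomy commutes with [N],
    and connectedness of the fibres identifies basic forms with invariant forms, so
    the level decomposition acts on basic forms.

    Multiplying level [k] by [i ^ k] conjugates [d] to [d ^ J] and [d ^ J] to [- d].
    Hence [d ^ J]-cohomology is [d]-cohomology up to this rotation, and the two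
    equalities of the lemma are equivalent to each other. If they hold, a
    [d ^ J]-cocycle modulo [Im d] can be corrected by a [d]-exact form to a genuine
    cocycle, and exactness modulo [Im d] lifts in the same way. Conversely,
    injectivity and surjectivity of the induced map allow one to write a [d]-exact
    [d ^ J]-closed form first as [d ^ J c] and then as [d d ^ J b]. *)
From HB Require Import structures.
From mathcomp Require Import all_boot all_order all_algebra.
From mathcomp Require Import all_classical all_reals all_analysis.
From mathcomp Require Import ring_quotient generic_quotient.
From mathcomp Require Import ring lra zify.
Require Import Defs.
Set Implicit Arguments.
Unset Strict Implicit.
Unset Printing Implicit Defensive.
Import Order.TTheory GRing.Theory Num.Theory.
Import numFieldNormedType.Exports.
Local Open Scope classical_set_scope.
Local Open Scope ring_scope.

(** * Smooth functions on open subsets of coordinate space *)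

Section CkTheory.
Context {R : realType} {n : nat}.
Implicit Types (U V : set 'rV[R]_n) (f g : 'rV[R]_n -> R) (k : nat).

(** Vector fields are derivations of the global smooth functions and forms are multilinear maps on
    them, so nothing is local or pointwise by definition. Bump functions and Hadamard's lemma yield
    local frames; the inverse function theorem yields charts in which a submersion is a linear
    projection, and these allow fields to be lifted and forms to descend. [leuclid] collects what
    this calculus needs and covers both M and the transverse manifold. Fibres of bundles are never
    formed: a statement at x is one modulo the forms vanishing at x, and the decomposition into
    levels follows from a vanishing product of shifted level operators, without choosing bases of
    the U^j. The square in the equation for d arises because integrability does not act on (ad N)^2
    d + d itself: it makes the anticommutators of this operator with sections commute with the
    Clifford action, hence with N, and a second application of (ad N)^2 + 1 turns that into
    vanishing. A nonzero component from level k to level l then forces (1 - (l - k)^2)^2 = 0. The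
    level components mix degrees and respect only their parity, which is why parity is the
    grading. *)

Definition pd (j : 'I_n) f : 'rV[R]_n -> R := 'D_(delta_mx 0 j) f.

Lemma Ck_continuous k U f x : Ck k U f -> U x -> {for x, continuous f}.
Proof. by case: k => [|k] [cf _] Ux; exact: cf. Qed.

Lemma Ck_sub k U V f : V `<=` U -> Ck k U f -> Ck k V f.
Proof.
move=> VU; elim: k f => [|k IH] f /=.
  by move=> [cf _]; split=> // x /VU; exact: cf.
move=> [cf df]; split=> [x /VU|j]; first exact: cf.
by have [g dg Cg] := df j; exists g; [move=> x /VU; exact: dg|exact: IH].
Qed.

Lemma near_continuous (T1 T2 : topologicalType) (f g : T1 -> T2) (x : T1) :
  (\forall y \near x, f y = g y) -> {for x, continuous f} -> {for x, continuous g}.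
Proof.
move=> e cf; rewrite /prop_for /continuous_at -(nbhs_singleton e).
by apply: cvg_trans cf; apply: near_eq_cvg.
Qed.

Lemma open_near (T : topologicalType) (U : set T) (x : T) (P : T -> Prop) :
  open U -> U x -> (forall y, U y -> P y) -> \forall y \near x, P y.
Proof. by move=> oU Ux h; apply: filterS (open_nbhs_nbhs (conj oU Ux)). Qed.

Lemma Ck_ext k U f g : open U -> (forall x, U x -> f x = g x) -> Ck k U f -> Ck k U g.
Proof.
move=> oU e; case: k => [|k] /=.
  move=> [cf _]; split=> // x Ux; apply: near_continuous (cf _ Ux).
  exact: open_near Ux e.
move=> [cf df]; split=> [x Ux|j].
  by apply: near_continuous (cf _ Ux); exact: open_near Ux e.
have [h dh Ch] := df j; exists h => // x Ux.
by apply: near_eq_is_derive (dh _ Ux); exact: open_near Ux e.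
Qed.

(** Replaces the existentially named partial derivatives of [Ck] by the actual ones; those depend
    only on values near a point, which makes smoothness on open sets a local notion. *)
Lemma CkSE k U f : open U -> Ck k.+1 U f <->
  (forall x, U x -> {for x, continuous f}) /\
  forall j, (forall x, U x -> derivable f x (delta_mx 0 j)) /\ Ck k U (pd j f).
Proof.
move=> oU; split=> [[cf df]|[cf df]]; split=> // j; last first.
  have [d1 d2] := df j; exists (pd j f) => // x Ux.
  exact/derivableP/d1.
have [g dg Cg] := df j; split=> [x Ux|]; first by have [] := dg _ Ux.
apply: Ck_ext Cg => // x Ux; by have [_ <-] := dg _ Ux.
Qed.

Lemma Ck_local k U f :
  (forall x, U x -> exists V, [/\ open V, V x & Ck k V f]) -> Ck k U f.
Proof.
elim: k f => [|k IH] f h.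
  by split=> // x /h[V [oV Vx [cf _]]]; exact: cf.
split=> [x /h[V [oV Vx [cf _]]]|j]; first exact: cf.
exists (pd j f) => [x /h[V [oV Vx /CkSE[]// _ df]]|].
  by have [d1 _] := df j; exact/derivableP/d1.
apply: IH => x /h[V [oV Vx /CkSE[]// _ df]]; exists V; split=> //.
by have [] := df j.
Qed.

Lemma CkD k U f g : Ck k U f -> Ck k U g -> Ck k U (f \+ g).
Proof.
move=> Cf Cg.
have -> : f \+ g = f - (cst 0 - g) by apply/funext => x; rewrite !fctE sub0r opprK.
by apply: CkB => //; apply: CkB => //; exact: Ck_cst.
Qed.

Lemma Ck_sum k U (I : Type) (s : seq I) (F : I -> 'rV[R]_n -> R) :
  (forall i, Ck k U (F i)) -> Ck k U (fun x => \sum_(i <- s) F i x).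
Proof.
move=> CF; elim: s => [|i s IH].
  have -> : (fun x => \sum_(i <- [::]) F i x) = cst 0.
    by apply/funext => x; rewrite big_nil.
  exact: Ck_cst.
have -> : (fun x => \sum_(j <- i :: s) F j x) = F i \+ (fun x => \sum_(i <- s) F i x).
  by apply/funext => x; rewrite big_cons.
exact: CkD.
Qed.

Lemma Ck_prod k U (I : Type) (s : seq I) (F : I -> 'rV[R]_n -> R) :
  (forall i, Ck k U (F i)) -> Ck k U (fun x => \prod_(i <- s) F i x).
Proof.
move=> CF; elim: s => [|i s IH].
  have -> : (fun x => \prod_(i <- [::]) F i x) = cst 1.
    by apply/funext => x; rewrite big_nil.
  exact: Ck_cst.
have -> : (fun x => \prod_(j <- i :: s) F j x) = F i * (fun x => \prod_(i <- s) F i x).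
  by apply/funext => x; rewrite big_cons.
exact: CkM.
Qed.

Lemma is_derive_coord (x v : 'rV[R]_n) (i : 'I_n) :
  is_derive x v (fun y : 'rV[R]_n => y 0 i) (v 0 i).
Proof.
have d := @derivable_id R 'rV[R]_n x v.
split; first by have /derivable_mxP := d; apply.
have := derive_mx d; rewrite derive_id => {2}->; by rewrite mxE.
Qed.

Lemma Ck_coord k U (i : 'I_n) : Ck k U (fun x => x 0 i).
Proof.
case: k => [|k] /=; split=> //; try by move=> x _; exact: coord_continuous.
move=> j; exists (cst ((delta_mx 0 j : 'rV[R]_n) 0 i)); last exact: Ck_cst.
by move=> x _; exact: is_derive_coord.
Qed.

Lemma CkV k U f : (forall x, U x -> f x != 0) -> Ck k U f -> Ck k U (fun x => (f x)^-1).
Proof.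
move=> f0; elim: k => [|k IH].
  by move=> [cf _]; split=> // x Ux; exact: (cvgV (f0 _ Ux) (cf _ Ux)).
move=> Cf; have Cf' := CkS Cf; case: Cf => [cf df]; split=> [x Ux|j].
  by exact: (cvgV (f0 _ Ux) (cf _ Ux)).
have [g dg Cg] := df j.
exists ((cst 0 - ((fun x => (f x)^-1) * (fun x => (f x)^-1))) * g).
  move=> x Ux; have [d1 d2] := dg _ Ux; have fx0 := f0 _ Ux.
  split; first exact: derivableV.
  by rewrite deriveV // d2 !fctE sub0r -invfM -expr2 -[_ *: _]/(_ * _).
by apply: CkM Cg; apply: CkB; [exact: Ck_cst|apply: CkM; exact: IH].
Qed.

Lemma is_derive_line f (x v : 'rV[R]_n) (t : R) :
  derivable f (x + t *: v) v ->
  is_derive t 1 (fun t => f (x + t *: v)) ('D_v f (x + t *: v)).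
Proof.
have e : (fun h : R => h^-1 *: (((fun t => f (x + t *: v)) \o shift t) (h *: 1) - f (x + t *: v)))
   = (fun h => h^-1 *: ((f \o shift (x + t *: v)) (h *: v) - f (x + t *: v))).
  apply/funext => h /=; congr (_ *: (f _ - _)).
  by rewrite [h%:A]mulr1 scalerDl addrCA.
by split; rewrite /derivable /derive e.
Qed.

(** The increment h may be negative or zero, so the intermediate point is given by its ratio to h,
    and the mean value theorem is used on [0, h] or on [h, 0]. *)
Lemma slope1 f (x v : 'rV[R]_n) (h : R) :
  (forall th, 0 <= th <= 1 -> derivable f (x + (th * h) *: v) v) ->
  exists2 th, 0 <= th <= 1 & f (x + h *: v) - f x = h * 'D_v f (x + (th * h) *: v).
Proof.
move=> df; have [->|h0] := eqVneq h 0.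
  by exists 0; rewrite ?lexx ?ler01 // scale0r addr0 subrr mul0r.
pose F := fun t => f (x + t *: v).
have dF t : 0 <= t / h <= 1 -> is_derive t 1 F ('D_v f (x + t *: v)).
  by move=> th; apply: is_derive_line; have := df _ th; have -> : t / h * h = t by rewrite divfK.
have [hp|hn] := ltP 0 h.
  have I t : t \in `[0, h] -> 0 <= t / h <= 1.
    by rewrite in_itv /= ler_pdivrMr // mul1r => /andP[t0 ->]; rewrite divr_ge0 // ltW.
  have [|||c ch] := @MVT_segment R F (fun t => 'D_v f (x + t *: v)) 0 h.
  - exact: ltW.
  - by move=> t /subset_itv_oo_cc /I; exact: dF.
  - by apply: derivable_within_continuous => t /I th; have [] := dF _ th.
  rewrite /F scale0r addr0 subr0 mulrC => E.
  by exists (c / h); [exact: I|rewrite divfK].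
have hn' : h < 0 by rewrite lt_neqAle h0.
have I t : t \in `[h, 0] -> 0 <= t / h <= 1.
  by rewrite in_itv /= ler_ndivrMr // mul1r => /andP[-> t0]; rewrite andbT mulr_le0 // invr_le0.
have [|||c ch] := @MVT_segment R F (fun t => 'D_v f (x + t *: v)) h 0.
- by [].
- by move=> t /subset_itv_oo_cc /I; exact: dF.
- by apply: derivable_within_continuous => t /I th; have [] := dF _ th.
rewrite /F scale0r addr0 sub0r mulrN mulrC => E.
exists (c / h); first exact: I.
by rewrite divfK // -[LHS]opprK opprB E opprK.
Qed.

(** Each coordinate has its own parameter because increments are taken along coordinate axes; for
    parameters in [0, 1] the point lies in every cube that contains x and y. *)
Definition mix (x y : 'rV[R]_n) (t : 'I_n -> R) : 'rV[R]_n :=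
  \row_i (x 0 i + t i * (y 0 i - x 0 i)).

(* Mean value theorem, moving one coordinate at a time. *)
Lemma mvt_slopes f (x y : 'rV[R]_n) :
  (forall (t : 'I_n -> R) (j : 'I_n), (forall i, 0 <= t i <= 1) ->
    derivable f (mix x y t) (delta_mx 0 j)) ->
  exists2 t : 'I_n -> 'I_n -> R, (forall j i, 0 <= t j i <= 1)
    & f y - f x = \sum_j (y 0 j - x 0 j) * pd j f (mix x y (t j)).
Proof.
move=> df.
pose z (k : nat) := mix x y (fun i => (i < k)%:R).
pose s (j : 'I_n) (th : R) := fun i : 'I_n => if i == j then th else (i < j)%:R : R.
have sz (j : 'I_n) (th : R) : z j + (th * (y 0 j - x 0 j)) *: delta_mx 0 j = mix x y (s j th).
  apply/rowP => i; rewrite !mxE /s eqxx /=; have [->|ij] := eqVneq i j.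
    by rewrite ltnn mul0r addr0 mulr1.
  by rewrite mulr0 addr0.
have s01 (j : 'I_n) (th : R) : 0 <= th <= 1 -> forall i, 0 <= s j th i <= 1.
  by move=> h i; rewrite /s; case: ifP => // _; case: (_ < _)%N; rewrite ?lexx ?ler01.
have zS (j : 'I_n) : z j.+1 = z j + (y 0 j - x 0 j) *: delta_mx 0 j.
  rewrite -[_ - _]mul1r sz; apply/rowP => i; rewrite !mxE /s ltnS.
  by rewrite leq_eqVlt val_eqE; have [->|ij] := eqVneq i j.
have st (j : 'I_n) : exists t : 'I_n -> R, (forall i, 0 <= t i <= 1) /\
    f (z j.+1) - f (z j) = (y 0 j - x 0 j) * pd j f (mix x y t).
  have [th h01|th h01 E] := @slope1 f (z j) (delta_mx 0 j) (y 0 j - x 0 j).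
    by rewrite sz; apply: df; exact: s01.
  by exists (s j th); split; [exact: s01|rewrite zS E sz].
have [t ht] := choice st; exists t; first by move=> j; have [] := ht j.
have -> : f y - f x = f (z n) - f (z 0%N).
  congr (f _ - f _); apply/rowP => i; rewrite !mxE ?ltn_ord ?ltn0 /=;
    rewrite ?mul0r ?mul1r ?addr0 //; ring.
rewrite -(telescope_sumr (fun k => f (z k))) // big_mkord.
by apply: eq_bigr => j _; have [] := ht j.
Qed.

Definition cube (a : 'rV[R]_n) (r : R) : set 'rV[R]_n :=
  [set x | forall i, `|x 0 i - a 0 i| < r].

Lemma cubeE a (r : R) : 0 < r -> cube a r = ball a r.
Proof.
move=> r0; apply/seteqP; split=> x.
  by move=> h; split=> // i j; rewrite (ord1 i) /ball /= distrC; exact: h.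
by move=> [_ h] i; have := h 0 i; rewrite /ball /= distrC.
Qed.

Lemma cube_nbhs a (r : R) : 0 < r -> nbhs a (cube a r).
Proof. by move=> r0; rewrite cubeE //; exact: nbhsx_ballx. Qed.

Lemma cube_open a (r : R) : 0 < r -> open (cube a r).
Proof.
by move=> r0; rewrite cubeE //; exact: ball_open.
Qed.

Lemma cubexx a (r : R) : 0 < r -> cube a r a.
Proof. by move=> r0 i; rewrite subrr normr0. Qed.

Lemma nbhs_cube a (A : set 'rV[R]_n) : nbhs a A -> exists2 r, 0 < r & cube a r `<=` A.
Proof. by move=> /nbhs_ballP[r r0 h]; exists r => //; rewrite cubeE. Qed.

Lemma cube_mid a (r : R) x y (t : 'I_n -> R) : (forall i, 0 <= t i <= 1) ->
  cube a r x -> cube a r y -> cube a r (mix x y t).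
Proof.
move=> t01 cx cy i; rewrite mxE; have /andP[t0 t1] := t01 i.
have -> : x 0 i + t i * (y 0 i - x 0 i) - a 0 i =
   (1 - t i) * (x 0 i - a 0 i) + t i * (y 0 i - a 0 i) by ring.
apply: le_lt_trans (ler_normD _ _) _; rewrite !normrM (ger0_norm t0) ger0_norm ?subr_ge0 //.
have := cx i; have := cy i.
set u := `|_|; set v := `|_| => h1 h2.
have [->|tn] := eqVneq (t i) 0; first by rewrite subr0 mul1r mul0r addr0.
have tp : 0 < t i by rewrite lt_neqAle eq_sym tn.
have : t i * u < t i * r by rewrite ltr_pM2l.
have : (1 - t i) * v <= (1 - t i) * r by apply: ler_wpM2l; rewrite ?subr_ge0 // ltW.
lra.
Qed.

Lemma nearP_cube a (P : 'rV[R]_n -> Prop) :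
  (\forall x \near a, P x) <-> exists2 r, 0 < r & forall x, cube a r x -> P x.
Proof.
split=> [/nbhs_cube[r r0 h]|[r r0 h]]; first by exists r.
exact: filterS (cube_nbhs a r0).
Qed.
End CkTheory.

(** * Limits along lines, the chain rule, and smoothness of inverse matrices *)

Section Chain.
Context {R : realType}.

Lemma is_deriveP (V : normedModType R) (f : V -> R) x v l :
  (h^-1 * (f (h *: v + x) - f x) @[h --> 0^'] --> l) -> is_derive x v f l.
Proof.
move=> c; split; first by apply/cvg_ex; exists l.
exact: cvg_lim.
Qed.

Lemma is_derive_cvg (V : normedModType R) (f : V -> R) x v l :
  is_derive x v f l -> (h^-1 * (f (h *: v + x) - f x) @[h --> 0^'] --> l).
Proof. by move=> [d <-]; apply: cvgP d. Qed.

Lemma derivable_line_cvg n (f : 'rV[R]_n -> R) x v :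
  derivable f x v -> f (h *: v + x) @[h --> 0^'] --> f x.
Proof.
move=> /derivable1P /derivable1_diffP /differentiable_continuous c.
have e : f x = f ((0 : R) *: v + x) by rewrite scale0r add0r.
by apply: cvg_within_filter; rewrite e.
Qed.

Lemma cvg_cube m (T : Type) (F : set_system T) {FF : Filter F} (g : T -> 'rV[R]_m) (a : 'rV[R]_m) :
  (forall k, g x 0 k @[x --> F] --> a 0 k) ->
  forall r : R, 0 < r -> \forall x \near F, cube a r (g x).
Proof.
move=> cg r r0; apply: filter_forall => k.
exact: cvgr_distC_lt (cg k) _ r0.
Qed.

Lemma cvg_rowP m (T : Type) (F : set_system T) {FF : Filter F} (g : T -> 'rV[R]_m) (a : 'rV[R]_m) :
  (forall k, g x 0 k @[x --> F] --> a 0 k) -> g x @[x --> F] --> a.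
Proof.
move=> cg A /nbhs_cube[r r0 rA].
by apply: filterS (cvg_cube cg r0) => x /rA.
Qed.

Lemma mid_cube m (a y : 'rV[R]_m) (r : R) t : 0 < r -> (forall i, 0 <= t i <= 1) ->
  cube a r y -> cube a r (mix a y t).
Proof. by move=> r0 h; apply: cube_mid => //; exact: cubexx. Qed.

Lemma cvg_mid m (T : Type) (F : set_system T) {FF : Filter F} (g : T -> 'rV[R]_m)
    (a : 'rV[R]_m) (t : T -> 'I_m -> R) (f : 'rV[R]_m -> R) :
  (forall k, g x 0 k @[x --> F] --> a 0 k) -> (forall x i, 0 <= t x i <= 1) ->
  {for a, continuous f} -> f (mix a (g x) (t x)) @[x --> F] --> f a.
Proof.
move=> cg t01 cf A /cf /nbhs_cube[r r0 rA].
by apply: filterS (cvg_cube cg r0) => x cx; apply: rA; apply: mid_cube.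
Qed.

Lemma cvg_sumr (T : Type) (F : set_system T) {FF : Filter F} (I : Type) (s : seq I)
    (f : I -> T -> R) (a : I -> R) :
  (forall i, f i x @[x --> F] --> a i) ->
  \sum_(i <- s) f i x @[x --> F] --> \sum_(i <- s) a i.
Proof. by move=> h; apply: cvg_big => //; exact: add_continuous. Qed.

(** The increment of g is written by [mvt_slopes] with partial derivatives at intermediate points.
    These points tend to p x, because the coordinates of p are continuous along the line, and
    continuity of the [pd k g] gives the limit. *)
Lemma is_derive_chain n m (g : 'rV[R]_m -> R) (p : 'rV[R]_n -> 'rV[R]_m) x v (dp : 'I_m -> R) :
  (forall k, is_derive x v (fun y => p y 0 k) (dp k)) ->
  (\forall y \near p x, forall k, derivable g y (delta_mx 0 k)) ->
  (forall k, {for p x, continuous (pd k g)}) ->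
  is_derive x v (g \o p) (\sum_k dp k * pd k g (p x)).
Proof.
move=> dpk /nearP_cube[r r0 dg] cg; set a := p x.
have pc k : p (h *: v + x) 0 k @[h --> 0^'] --> a 0 k.
  by apply: (@derivable_line_cvg n (fun y => p y 0 k)); case: (dpk k).
have tau (h : R) : exists t : 'I_m -> 'I_m -> R, (forall k i, 0 <= t k i <= 1) /\
    (cube a r (p (h *: v + x)) -> g (p (h *: v + x)) - g a =
     \sum_k (p (h *: v + x) 0 k - a 0 k) * pd k g (mix a (p (h *: v + x)) (t k))).
  (* Outside the cube nothing is claimed and the parameters default to 0; for small h this case does
     not occur. *)
  have [c|nc] := pselect (cube a r (p (h *: v + x))); last first.
    by exists (fun _ _ => 0); split => // k i; rewrite lexx ler01.
  have [t j t01|t t01 E] := @mvt_slopes R m g a (p (h *: v + x)).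
    by apply: dg; apply: mid_cube.
  by exists t.
have [t ht] := choice tau.
apply: is_deriveP.
have : \sum_k (h^-1 * (p (h *: v + x) 0 k - p x 0 k)) * pd k g (mix a (p (h *: v + x)) (t h k))
    @[h --> 0^'] --> \sum_k dp k * pd k g a.
  apply: cvg_sumr => k; apply: cvgM; first exact: is_derive_cvg.
  apply: cvg_mid => // h i; by have [] := ht h.
apply: cvg_trans; apply: near_eq_cvg.
apply: filterS (cvg_cube pc r0) => h ch /=.
rewrite -/a; have [_ ->//] := ht h.
by rewrite mulr_sumr; apply: eq_bigr => k _; rewrite mulrA.
Qed.

Lemma continuous_row n m (p : 'rV[R]_n -> 'rV[R]_m) x :
  (forall k, {for x, continuous (fun y => p y 0 k)}) -> {for x, continuous p}.
Proof. by move=> h; apply: (@cvg_rowP _ _ (nbhs x) _ p). Qed.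

Lemma Ck_comp n m k (U : set 'rV[R]_n) (W : set 'rV[R]_m) (g : 'rV[R]_m -> R)
    (p : 'rV[R]_n -> 'rV[R]_m) :
  open U -> open W -> (forall x, U x -> W (p x)) -> Ck k W g ->
  (forall i, Ck k U (fun x => p x 0 i)) -> Ck k U (g \o p).
Proof.
move=> oU oW UW; elim: k g => [|k IH] g Cg Cp.
  split=> // x Ux; apply: continuous_comp; last exact: (Ck_continuous Cg (UW _ Ux)).
  by apply: continuous_row => i; exact: (Ck_continuous (Cp i) Ux).
have Cp' i := CkS (Cp i).
split=> [x Ux|j].
  apply: continuous_comp; last exact: (Ck_continuous Cg (UW _ Ux)).
  by apply: continuous_row => i; exact: (Ck_continuous (Cp i) Ux).
have dp i := ((CkSE _ _ oU).1 (Cp i)).2 j.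
have [cg dg] := (CkSE _ _ oW).1 Cg.
exists (fun x => \sum_i pd j (fun x => p x 0 i) x * pd i g (p x)) => [x Ux|].
  apply: is_derive_chain => [i||i].
  - by apply: derivableP; have [h _] := dp i; exact: h.
  - by apply: open_near oW (UW _ Ux) _ => y Wy i; have [h _] := dg i; exact: h.
  - by have [_ h] := dg i; exact: (Ck_continuous h (UW _ Ux)).
apply: Ck_sum => i; apply: CkM; first by have [] := dp i.
by apply: IH => //; have [] := dg i.
Qed.

Lemma Ck_det n m k (U : set 'rV[R]_n) (A : 'rV[R]_n -> 'M[R]_m) :
  (forall i j, Ck k U (fun x => A x i j)) -> Ck k U (fun x => \det (A x)).
Proof.
move=> CA; apply: Ck_sum => s; apply: CkM; first exact: Ck_cst.
by apply: Ck_prod => i.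
Qed.

(** Cramer's rule: an entry of the inverse is a cofactor, polynomial in the entries of A, divided by
    the determinant. *)
Lemma Ck_invmx n m k (U : set 'rV[R]_n) (A : 'rV[R]_n -> 'M[R]_m) i j :
  (forall x, U x -> A x \in unitmx) ->  open U ->
  (forall i j, Ck k U (fun x => A x i j)) -> Ck k U (fun x => invmx (A x) i j).
Proof.
move=> uA oU CA.
apply: (@Ck_ext _ _ _ _ ((fun x => (\det (A x))^-1) * (fun x => \adj (A x) i j))) => //.
  by move=> x Ux; rewrite /invmx uA // fctE [RHS]mxE.
apply: CkM.
  by apply: CkV; [move=> x /uA; rewrite unitmxE unitfE|exact: Ck_det].
have -> : (fun x => \adj (A x) i j) =
  (cst ((-1) ^+ (j + i))) * (fun x => \det (row' j (col' i (A x)))).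
  by apply/funext => x; rewrite !mxE /cofactor.
apply: CkM; first exact: Ck_cst.
apply: Ck_det => a b.
have -> : (fun x => row' j (col' i (A x)) a b) = (fun x => A x (lift j a) (lift i b)).
  by apply/funext => x; rewrite !mxE.
exact: CA.
Qed.
End Chain.

(** * The inverse function theorem *)

Section IFT.
Context {R : realType}.

Lemma coord_le_norm n (x : 'rV[R]_n) i : `|x 0 i| <= `|x|.
Proof.
rewrite [leRHS]/Num.norm /= mx_normrE; apply/bigmax_geP; right => /=.
by exists (0, i).
Qed.

Lemma norm_le_coord n (x : 'rV[R]_n) (c : R) : 0 <= c -> (forall i, `|x 0 i| <= c) -> `|x| <= c.
Proof.
move=> c0 h; rewrite [leLHS]/Num.norm /= mx_normrE; apply/bigmax_leP; split => //= -[i j] _ /=.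
by rewrite (ord1 i).
Qed.

Lemma cube_norm n (a x : 'rV[R]_n) (r : R) : 0 < r -> cube a r x <-> `|x - a| < r.
Proof. by move=> r0; rewrite cubeE // mx_norm_ball /ball_ /= distrC. Qed.

Lemma mulmx_bounded n (A : 'M[R]_n) : exists2 K, 0 < K & forall v : 'rV[R]_n, `|v *m A| <= K * `|v|.
Proof.
pose K := 1 + \sum_i \sum_j `|A i j|.
have K0 : 0 < K by rewrite ltr_wpDr // sumr_ge0 // => i _; rewrite sumr_ge0.
exists K => // v; apply: norm_le_coord; first by rewrite mulr_ge0 // ltW.
move=> j; rewrite mxE; apply: le_trans (ler_norm_sum _ _ _) _.
rewrite mulrDl mul1r; apply: ler_wpDl => //; rewrite mulr_suml; apply: ler_sum => i _.
rewrite normrM mulrC; apply: ler_pM => //; last exact: coord_le_norm.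
by rewrite (bigD1 j) //= lerDl sumr_ge0.
Qed.

Lemma lipschitz_pd n (f : 'rV[R]_n -> R) (a : 'rV[R]_n) (r c : R) :
  (forall x j, cube a r x -> derivable f x (delta_mx 0 j)) ->
  (forall x j, cube a r x -> `|pd j f x| <= c) ->
  forall x y, cube a r x -> cube a r y -> `|f y - f x| <= n%:R * c * `|y - x|.
Proof.
move=> df bf x y cx cy.
have [t j t01|t t01 ->] := @mvt_slopes R n f x y; first by apply: df; exact: cube_mid.
apply: le_trans (ler_norm_sum _ _ _) _.
have -> : n%:R * c * `|y - x| = \sum_(j < n) (`|y - x| * c).
  by rewrite sumr_const card_ord -[RHS]mulr_natl; ring.
apply: ler_sum => j _; rewrite normrM; apply: ler_pM => //.
  by have := coord_le_norm (y - x) j; rewrite !mxE.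
by apply: bf; exact: cube_mid.
Qed.

(** Compactness replaces the iteration of T: at a minimiser c of |T x - x| on the closed ball, the
    value at T c is at most half of the minimum, so the minimum is 0. *)
Lemma fixpoint_compact n (a : 'rV[R]_n) (r : R) (T : 'rV[R]_n -> 'rV[R]_n) : 0 < r ->
  (forall x, `|x - a| <= r -> {for x, continuous T}) ->
  (forall x, `|x - a| <= r -> `|T x - a| <= r) ->
  (forall x y, `|x - a| <= r -> `|y - a| <= r -> `|T x - T y| <= 2^-1 * `|x - y|) ->
  exists2 x, `|x - a| <= r & T x = x.
Proof.
move=> r0 cT TB TL; pose B := closed_ball a r.
have BE x : B x <-> `|x - a| <= r by rewrite /B closed_ballE // /closed_ball_ /= distrC.
have Bc : compact B.
  apply: bounded_closed_compact; last exact: closed_ball_closed.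
  exists (`|a| + r); split; first exact: num_real.
  move=> M hM x /BE Bx; apply: le_trans (ltW hM).
  by rewrite -[x](subrK a) addrC; apply: le_trans (ler_normD _ _) _; rewrite lerD2l.
have Ba : B a by apply/BE; rewrite subrr normr0 ltW.
have [||c cB hc] := @compact_EVT_min _ R (fun x => `|T x - x|) B _ Bc.
- by exists a.
- apply: continuous_in_subspaceT => x /set_mem /BE Bx.
  apply: (@continuous_comp _ _ _ (fun x => T x - x) (fun x => `|x|)); last exact: norm_continuous.
  by apply: continuousB; [exact: cT|exact: cvg_id].
have {cB} Bc' := (BE c).1 (set_mem cB).
exists c => //; apply/eqP; rewrite -subr_eq0 -normr_eq0.
have := hc (T c) (mem_set ((BE _).2 (TB _ Bc'))).
have := TL _ _ (TB _ Bc') Bc'; have := normr_ge0 (T c - c); lra.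
Qed.

Lemma is_derive_sumr n (I : Type) (s : seq I) (f : I -> 'rV[R]_n -> R) x v (df : I -> R) :
  (forall i, is_derive x v (f i) (df i)) ->
  is_derive x v (fun y => \sum_(i <- s) f i y) (\sum_(i <- s) df i).
Proof.
move=> h; elim: s => [|i s IH].
  have -> : (fun y => \sum_(i <- [::]) f i y) = cst 0 by apply/funext => y; rewrite big_nil.
  by rewrite big_nil; exact: is_derive_cst.
have -> : (fun y => \sum_(j <- i :: s) f j y) = f i + (fun y => \sum_(i <- s) f i y).
  by apply/funext => y; rewrite big_cons.
by rewrite big_cons; have := h i => ?; exact: is_deriveD.
Qed.

Lemma is_derive_mulr n (f : 'rV[R]_n -> R) x v (df c : R) :
  is_derive x v f df -> is_derive x v (fun y => f y * c) (df * c).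
Proof.
move=> d; have -> : (fun y => f y * c) = f * cst c by [].
by apply: is_derive_eq; rewrite scaler0 add0r [c *: _]mulrC.
Qed.

Lemma cvg_bounded0 (T : Type) (F : set_system T) {FF : Filter F} (B : R) (q u : T -> R) :
  (\forall x \near F, `|q x| <= B) -> u x @[x --> F] --> 0 -> q x * u x @[x --> F] --> 0.
Proof.
move=> qB /cvgr0Pnorm_lt u0; apply/cvgr0Pnorm_lt => e e0.
pose B' := `|B| + 1.
have B'0 : 0 < B' by rewrite ltr_wpDl.
have := u0 _ (divr_gt0 e0 B'0); apply: filterS2 qB => x qx ux.
rewrite normrM; apply: (@le_lt_trans _ _ (B' * `|u x|)).
  by apply: ler_wpM2r => //; apply: le_trans qx _; rewrite /B' (le_trans (ler_norm _)) // lerDl.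
by rewrite mulrC -ltr_pdivlMr.
Qed.

(** Rows index the variables and columns the components of F, so that the differential acts on row
    vectors by multiplication on the right. *)
Definition jac n m (F : 'rV[R]_n -> 'rV[R]_m) (x : 'rV[R]_n) : 'M[R]_(n, m) :=
  \matrix_(i, j) pd i (fun x => F x 0 j) x.

Lemma smooth_in_pd n (U : set 'rV[R]_n) f j : open U -> smooth_in U f -> smooth_in U (pd j f).
Proof. by move=> oU sf k; have [_ /(_ j)[]] := (CkSE _ _ oU).1 (sf k.+1). Qed.

Lemma smooth_in_continuous n (U : set 'rV[R]_n) f x : smooth_in U f -> U x -> {for x, continuous f}.
Proof. by move=> sf; exact: Ck_continuous (sf 0%N). Qed.

Lemma smooth_in_derivable n (U : set 'rV[R]_n) f x j : open U -> smooth_in U f -> U x ->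
  derivable f x (delta_mx 0 j).
Proof. by move=> oU sf Ux; have [_ /(_ j)[h _]] := (CkSE _ _ oU).1 (sf 1%N); exact: h. Qed.

Lemma continuous_near0 (T : topologicalType) (f : T -> R) (a : T) (e : R) :
  {for a, continuous f} -> f a = 0 -> 0 < e -> \forall x \near a, `|f x| < e.
Proof.
move=> c f0 e0; have : nbhs (f a) [set t | `|t| < e]
  by rewrite f0; apply/nbhs_ballP; exists e => // t; rewrite /ball /= sub0r normrN.
exact: c.
Qed.

Section Local.
Variables (n : nat) (F : 'rV[R]_n -> 'rV[R]_n) (p : 'rV[R]_n) (r : R) (A : 'M[R]_n).
Let V := cube p r.
Let H (x : 'rV[R]_n) : 'rV[R]_n := x - F x *m A.
Hypothesis r0 : 0 < r.
Hypothesis sF : forall j, smooth_in V (fun x => F x 0 j).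
Hypothesis uA : A \in unitmx.
Hypothesis HL : forall x y, V x -> V y -> `|H x - H y| <= 2^-1 * `|x - y|.
Hypothesis uJ : forall x, V x -> jac F x \in unitmx.

(** From x - y = (H x - H y) + (F x - F y) A, where the first term is at most half of |x - y|.
    Injectivity and continuity of the inverse both come from this bound. *)
Lemma ift_bound : exists2 K, 0 < K & forall x y, V x -> V y -> `|x - y| <= K * `|F x - F y|.
Proof.
have [K K0 hK] := mulmx_bounded A; exists (2 * K); first by rewrite mulr_gt0.
move=> x y Vx Vy; have e : x - y = (H x - H y) + (F x - F y) *m A.
  rewrite /H mulmxBl; apply/rowP => i; rewrite !mxE; ring.
have := HL Vx Vy; have := hK (F x - F y).
have : `|x - y| <= `|H x - H y| + `|(F x - F y) *m A| by rewrite {1}e ler_normD.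
lra.
Qed.

Lemma ift_inj x y : V x -> V y -> F x = F y -> x = y.
Proof.
move=> Vx Vy e; have [K K0 /(_ _ _ Vx Vy)] := ift_bound.
by rewrite e subrr normr0 mulr0 normr_le0 subr_eq0 => /eqP.
Qed.

(** Newton's method with the fixed matrix A: since A is invertible, the solutions of F x = y are the
    fixed points of x |-> H x + y A, a contraction of a small ball around x0 when y is near F x0. *)
Lemma ift_open : open (F @` V).
Proof.
rewrite openE => _ [x0 Vx0 <-].
have : nbhs x0 V by apply: open_nbhs_nbhs; split => //; exact: cube_open.
move=> /nbhs_cube[e e0 eV]; pose rho := e / 2.
have rho0 : 0 < rho by rewrite divr_gt0.
have sub x : `|x - x0| <= rho -> V x.
  by move=> h; apply: eV; apply/(cube_norm _ _ e0); apply: le_lt_trans h _; rewrite /rho; lra.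
have [K K0 hK] := mulmx_bounded A.
(* For |y - F x0| below this radius, (y - F x0) A has norm at most rho / 2; the contraction supplies
   the other half of rho, so T maps the ball to itself. *)
have d0 : 0 < rho / 2 / K by rewrite !divr_gt0.
apply: filterS (cube_nbhs (F x0) d0) => y /(cube_norm _ _ d0) hy.
pose T x := H x + y *m A.
have TE x : T x - x0 = (H x - H x0) + (y - F x0) *m A.
  by rewrite /T /H mulmxBl; apply/rowP => i; rewrite !mxE; ring.
have hyA : `|(y - F x0) *m A| <= rho / 2.
  by apply: le_trans (hK _) _; rewrite mulrC -ler_pdivlMr // ltW.
have [|||x xr Tx] := @fixpoint_compact n x0 rho T rho0.
- move=> x /sub Vx; apply: (@cvg_rowP _ _ _ (nbhs x) _ T) => k.
  pose G (x : 'rV[R]_n) := x 0 k - \sum_j F x 0 j * A j k + (y *m A) 0 k.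
  have TG : (fun x => T x 0 k) = G by apply/funext => z; rewrite /G /T /H !mxE.
  have CG : Ck 0 V G.
    have -> : G = ((fun x : 'rV[R]_n => x 0 k) - (fun x => \sum_j F x 0 j * A j k)) \+
      cst ((y *m A) 0 k) by [].
    apply: CkD; last exact: Ck_cst.
    apply: CkB; first exact: Ck_coord.
    apply: Ck_sum => j.
    have -> : (fun x => F x 0 j * A j k) = (fun x => F x 0 j) * cst (A j k) by [].
    by apply: CkM; [exact: sF|exact: Ck_cst].
  have := Ck_continuous CG Vx; by rewrite -TG.
- move=> x xr; rewrite TE; apply: le_trans (ler_normD _ _) _.
  have := HL (sub _ xr) Vx0; have := hyA; lra.
- move=> x z xr zr; have -> : T x - T z = H x - H z by rewrite /T opprD addrACA subrr addr0.
  exact: HL (sub _ xr) (sub _ zr).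
exists x; first exact: sub.
have : (F x - y) *m A = 0.
  by rewrite mulmxBl -[F x *m A](subKr x) -/(H x) addrAC -addrA -opprD [_ + H x]addrC -/(T x) Tx
    subrr.
move=> /(congr1 (mulmx^~ (invmx A))); rewrite mulmxK // mul0mx => /eqP.
by rewrite subr_eq0 => /eqP.
Qed.

Definition ift_inv y := xget p [set x | V x /\ F x = y].

Lemma ift_invP x : V x -> ift_inv (F x) = x.
Proof.
by move=> Vx; rewrite /ift_inv; case: xgetP => [z _ [Vz /ift_inj]|/(_ x)[]//]; apply.
Qed.

Lemma ift_inv_cont y i : (F @` V) y -> {for y, continuous (fun y => ift_inv y 0 i)}.
Proof.
move=> Vy; have [K K0 hK] := ift_bound.
apply/(@cvgrPdist_lt _ _ _ (nbhs y)) => e e0; have [x Vx yx] := Vy.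
have ey : ift_inv y = x by rewrite -yx ift_invP.
rewrite ey -yx.
have d0 : 0 < e / K by rewrite divr_gt0.
have : nbhs (F x) (F @` V) by have := ift_open; rewrite openE; apply; exists x.
apply: filterS2 (cube_nbhs (F x) d0) => y' /(cube_norm _ _ d0) hy' [x' Vx' ex'].
rewrite -ex' ift_invP //; have := coord_le_norm (x - x') i; rewrite !mxE => h.
apply: le_lt_trans h _; apply: le_lt_trans (hK _ _ Vx Vx') _.
by rewrite mulrC -ltr_pdivlMr // distrC ex'.
Qed.

Lemma mulmx_sub_entry (u : 'rV[R]_n) (B C E : 'M[R]_n) i :
  (u *m ((B - C) *m E)) 0 i = \sum_l \sum_k u 0 l * ((B l k - C l k) * E k i).
Proof.
rewrite mxE; apply: eq_bigr => l _; rewrite mxE mulr_sumr; apply: eq_bigr => k _.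
by rewrite !mxE.
Qed.

(** The difference quotient q of the inverse satisfies q M = e_j, where M holds the partial
    derivatives of F at intermediate points and tends to the Jacobian. The Lipschitz bound keeps q
    bounded, so the error q (jac - M) jac^-1 tends to 0. *)
Lemma ift_inv_derive x i j : V x ->
  is_derive (F x) (delta_mx 0 j) (fun y => ift_inv y 0 i) (invmx (jac F x) j i).
Proof.
move=> Vx; have [K K0 hK] := ift_bound.
pose y (h : R) : 'rV[R]_n := h *: delta_mx 0 j + F x; pose z h := ift_inv (y h).
have yc : y h @[h --> 0^'] --> F x.
  apply: (@cvg_rowP _ _ _ (0^') _ y) => k; apply: cvg_within_filter.
  have -> : (fun h => y h 0 k) = (fun h => h * (delta_mx 0 j : 'rV[R]_n) 0 k + F x 0 k).
    by apply/funext => h; rewrite !mxE.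
  suff : h * (delta_mx 0 j : 'rV[R]_n) 0 k + F x 0 k @[h --> (0 : R)] -->
      0 * (delta_mx 0 j : 'rV[R]_n) 0 k + F x 0 k by rewrite mul0r add0r.
  apply: cvgD; last exact: cvg_cst.
  by apply: cvgM; [exact: cvg_id|exact: cvg_cst].
have yV : \forall h \near 0^', (F @` V) (y h).
  have : nbhs (F x) (F @` V) by have := ift_open; rewrite openE; apply; exists x.
  exact: yc.
have zV : \forall h \near 0^', V (z h) /\ F (z h) = y h.
  by apply: filterS yV => h [x' Vx' e]; rewrite /z -e ift_invP.
have zc k : z h 0 k @[h --> 0^'] --> x 0 k.
  have c : {for F x, continuous (fun y => ift_inv y 0 k)} by apply: ift_inv_cont; exists x.
  by move: c; rewrite /prop_for /continuous_at ift_invP // => c; exact: cvg_comp yc c.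
have tau (h : R) k : exists t : 'I_n -> 'I_n -> R, (forall l i, 0 <= t l i <= 1) /\
    (V (z h) -> F (z h) 0 k - F x 0 k = \sum_l (z h 0 l - x 0 l) * pd l (fun x => F x 0 k)
      (mix x (z h) (t l))).
  have [c|nc] := pselect (V (z h)); last first.
    by exists (fun _ _ => 0); split => // ? ?; rewrite lexx ler01.
  have [t l t01|t t01 E] := @mvt_slopes R n (fun x => F x 0 k) x (z h); last by exists t.
  apply: (@smooth_in_derivable n V (fun x => F x 0 k) _ l (cube_open r0) (sF k)); exact: cube_mid.
have [t ht] := choice (fun hk : R * 'I_n => tau hk.1 hk.2).
pose M h := \matrix_(l, k) pd l (fun x => F x 0 k) (mix x (z h) (t (h, k) l)).
pose q h := h^-1 *: (z h - x).
have Mc l k : M h l k @[h --> 0^'] --> jac F x l k.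
  rewrite mxE; have -> : (fun h => M h l k) =
    (fun h => pd l (fun x => F x 0 k) (mix x (z h) (t (h, k) l))).
    by apply/funext => h; rewrite mxE.
  apply: (@cvg_mid _ _ _ _ _ z x (fun h => t (h, k) l)) => //.
    by move=> h i'; have [] := ht (h, k).
  exact: (smooth_in_continuous (smooth_in_pd l (cube_open r0) (sF k))).
have qM : \forall h \near 0^', q h *m M h = delta_mx 0 j.
  have n0 : \forall h \near (0 : R)^', h != 0 by exact: nbhs_dnbhs_neq.
  apply: filterS2 zV n0 => h [Vz Fz] h0; apply/rowP => k.
  rewrite mxE; have [_ /(_ Vz)] := ht (h, k); rewrite /= Fz !mxE addrK => E.
  apply: (mulfI h0); rewrite [RHS]E mulr_sumr; apply: eq_bigr => l _.
  by rewrite !mxE mulrA mulrA mulfV // mul1r.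
have qB l : \forall h \near 0^', `|q h 0 l| <= K.
  have n0 : \forall h \near (0 : R)^', h != 0 by exact: nbhs_dnbhs_neq.
  apply: filterS2 zV n0 => h [Vz Fz] h0; apply: le_trans (coord_le_norm _ _) _.
  rewrite /q normrZ normfV mulrC ler_pdivrMr ?normr_gt0 //.
  apply: le_trans (hK _ _ Vz Vx) _; apply: ler_wpM2l; first exact: ltW.
  rewrite Fz addrK; apply: norm_le_coord => // i'; rewrite !mxE eqxx /=.
  by case: eqP => _; rewrite ?mulr1 // mulr0 normr0.
apply: is_deriveP.
have E : \forall h \near 0^', invmx (jac F x) j i +
     \sum_l \sum_k q h 0 l * ((jac F x l k - M h l k) * invmx (jac F x) k i) =
     h^-1 * (ift_inv (h *: delta_mx 0 j + F x) 0 i - ift_inv (F x) 0 i).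
  apply: filterS qM => h qh; rewrite ift_invP //.
  have -> : h^-1 * (ift_inv (h *: delta_mx 0 j + F x) 0 i - x 0 i) = q h 0 i by rewrite !mxE.
  have : q h = delta_mx 0 j *m invmx (jac F x) + q h *m ((jac F x - M h) *m invmx (jac F x)).
    by rewrite mulmxA -mulmxDl mulmxBr qh addrC subrK mulmxK // uJ.
  move=> {2}->; rewrite mxE -rowE mxE; congr (_ + _).
  by rewrite mulmx_sub_entry.
have : invmx (jac F x) j i +
     \sum_l \sum_k q h 0 l * ((jac F x l k - M h l k) * invmx (jac F x) k i) @[h --> 0^'] -->
     invmx (jac F x) j i + \sum_(l < n) \sum_(k < n) 0.
  apply: cvgD; first exact: cvg_cst.
  apply: cvg_sumr => l; apply: cvg_sumr => k; apply: cvg_bounded0 (qB l) _.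
  have : (jac F x l k - M h l k) * invmx (jac F x) k i @[h --> 0^'] -->
     (jac F x l k - jac F x l k) * invmx (jac F x) k i.
    by apply: cvgM; [apply: cvgB; [exact: cvg_cst|exact: Mc]|exact: cvg_cst].
  by rewrite subrr mul0r.
rewrite big1 => [|l _]; last by rewrite big1.
by rewrite addr0; apply: cvg_trans; apply: near_eq_cvg; apply: filterS E.
Qed.

(** Bootstrapping: the partial derivatives of the inverse are entries of the inverse Jacobian
    composed with the inverse, so each order of differentiability yields the next. *)
Lemma ift_inv_smooth i : smooth_in (F @` V) (fun y => ift_inv y 0 i).
Proof.
move=> k; elim: k i => [|k IH] i.
  by split=> // y; exact: ift_inv_cont.
split=> [y|j]; first exact: ift_inv_cont.
exists (fun y => invmx (jac F (ift_inv y)) j i).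
  by move=> _ [x Vx <-]; rewrite ift_invP //; exact: ift_inv_derive.
apply: Ck_invmx; [|exact: ift_open|].
  by move=> _ [x Vx <-]; rewrite ift_invP // uJ.
move=> a b.
have -> : (fun y => jac F (ift_inv y) a b) = pd a (fun x => F x 0 b) \o ift_inv.
  by apply/funext => y; rewrite mxE.
apply: (@Ck_comp _ _ _ _ _ V) => //; [exact: ift_open|exact: cube_open|..].
  by move=> _ [x Vx <-]; rewrite ift_invP.
exact: (smooth_in_pd a (cube_open r0) (sF b)).
Qed.
End Local.

(** With A the inverse Jacobian at p, the partial derivatives of H vanish at p; they remain small on
    a cube around p, where H is therefore a contraction with constant 1/2. *)
Theorem inverse_function n (U : set 'rV[R]_n) (F : 'rV[R]_n -> 'rV[R]_n) p :
  open U -> U p -> (forall i, smooth_in U (fun x => F x 0 i)) -> jac F p \in unitmx ->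
  exists W G, [/\ open W, W p, W `<=` U & open (F @` W)] /\
    ((forall x, W x -> G (F x) = x) /\ forall i, smooth_in (F @` W) (fun y => G y 0 i)).
Proof.
move=> oU Up sF uJ; pose A := invmx (jac F p).
pose H (x : 'rV[R]_n) : 'rV[R]_n := x - F x *m A.
have HE j : (fun x : 'rV[R]_n => H x 0 j) = (fun x : 'rV[R]_n => x 0 j) - (fun x : 'rV[R]_n =>
  \sum_k F x 0 k * A k j).
  by apply/funext => x; rewrite !mxE fctE.
have sH j : smooth_in U (fun x => H x 0 j).
  move=> k; rewrite HE; apply: CkB; first exact: Ck_coord.
  apply: Ck_sum => i.
  have -> : (fun x => F x 0 i * A i j) = (fun x => F x 0 i) * cst (A i j) by [].
  by apply: CkM; [exact: sF|exact: Ck_cst].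
have dH i j : pd i (fun x => H x 0 j) p = 0.
  have d k : is_derive p (delta_mx 0 i) (fun x => F x 0 k) (jac F p i k).
    by rewrite mxE; apply: derivableP; exact: smooth_in_derivable oU (sF k) Up.
  have := is_deriveB (is_derive_coord p (delta_mx 0 i) j)
     (is_derive_sumr (index_enum 'I_n) (fun k => is_derive_mulr (A k j) (d k))).
  rewrite -HE => -[_]; rewrite /pd => ->.
  have := congr1 (fun M : 'M[R]_n => M i j) (mulmxV uJ); rewrite mxE => ->.
  by rewrite !mxE eqxx /= eq_sym subrr.
(* [lipschitz_pd] costs a factor n; the denominator uses n + 1 so that it does not vanish for n =
   0. *)
have cz : 0 < (2 * n.+1%:R : R)^-1 by rewrite invr_gt0 mulr_gt0.
have near1 : \forall x \near p, forall i j, `|pd i (fun x => H x 0 j) x| < (2 * n.+1%:R)^-1.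
  apply: (@filter_forall _ 'I_n (fun i x => forall j,
    `|pd i (fun x => H x 0 j) x| < (2 * n.+1%:R)^-1) (nbhs p)) => i.
  apply: (@filter_forall _ 'I_n (fun j x => `|pd i (fun x => H x 0 j) x| < (2 * n.+1%:R)^-1)
    (nbhs p)) => j.
  have c := smooth_in_continuous (smooth_in_pd i oU (sH j)) Up.
  exact: (@continuous_near0 _ _ p _ c (dH i j) cz).
have near2 : \forall x \near p, \det (jac F x) != 0.
  have c : {for p, continuous (fun x => \det (jac F x))}.
    apply: (@Ck_continuous _ _ 0 U) => //; apply: Ck_det => i j.
    have -> : (fun x => jac F x i j) = pd i (fun x => F x 0 j) by apply/funext => x; rewrite mxE.
    exact: (smooth_in_pd i oU (sF j)).
  have d0 : \det (jac F p) != 0 by rewrite -unitfE -unitmxE.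
  have : nbhs (\det (jac F p)) [set t | t != 0].
    by apply: open_nbhs_nbhs; split => //; exact: open_neq.
  exact: c.
have near3 : nbhs p U by exact: open_nbhs_nbhs.
have [r r0 hr] := nbhs_cube (filterI near1 (filterI near2 near3)).
have VU : cube p r `<=` U by move=> x /hr[_ []].
have sV j : smooth_in (cube p r) (fun x => F x 0 j) by move=> k; apply: Ck_sub VU _; exact: sF.
have uA : A \in unitmx by rewrite unitmx_inv.
have HL x y : cube p r x -> cube p r y -> `|H x - H y| <= 2^-1 * `|x - y|.
  move=> cx cy; apply: norm_le_coord; first by rewrite mulr_ge0.
  move=> j; have := @lipschitz_pd n (fun x => H x 0 j) p r ((2 * n.+1%:R)^-1) _ _ y x cy cx.
  rewrite !mxE => h; apply: le_trans (h _ _) _.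
  - by move=> z k cz'; apply: smooth_in_derivable oU (sH j) _; exact: VU.
  - by move=> z k /hr[h' _]; apply: ltW.
  apply: ler_wpM2r => //; rewrite invfM mulrCA -[leRHS]mulr1; apply: ler_wpM2l;
    first by rewrite invr_ge0.
  by rewrite ler_pdivrMr // mul1r ler_nat.
have uV x : cube p r x -> jac F x \in unitmx by move=> /hr[_ [h _]]; rewrite unitmxE unitfE.
exists (cube p r), (ift_inv F p r); split; split => //.
- exact: cube_open.
- exact: cubexx.
- exact: (ift_open r0 sV uA HL).
- by move=> x; exact: (ift_invP HL).
- by move=> i; exact: (ift_inv_smooth r0 sV uA HL uV).
Qed.
End IFT.

(** * Bump functions *)

Section Bump.
Context {R : realType}.

(** The functions t^-k e^(-1/t), extended by 0. The derivative of each is a combination of two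
    others, so the whole family is smooth by a single induction. *)
Definition fexp (k : nat) (t : R) : R := if 0 < t then t^-1 ^+ k * expR (- t^-1) else 0.

Lemma fexp_pos k t : 0 < t -> fexp k t = t^-1 ^+ k * expR (- t^-1).
Proof. by rewrite /fexp => ->. Qed.
Lemma fexp_neg k t : t <= 0 -> fexp k t = 0.
Proof. by rewrite /fexp leNgt => /negPf ->. Qed.

(** With u = 1/h > 0 the claim reads u^(k+2) <= (k+2)! e^u, one term of the exponential series. It
    gives the derivative 0 at the origin. *)
Lemma fexp_bound k (h : R) : `|h^-1 * fexp k h| <= (k.+2)`!%:R * `|h|.
Proof.
have [h0|h0] := ltP 0 h; last by rewrite fexp_neg // mulr0 normr0 mulr_ge0.
rewrite fexp_pos // mulrA -exprS; set u := h^-1; have u0 : 0 < u by rewrite invr_gt0.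
rewrite (gtr0_norm h0) ger0_norm; last by rewrite mulr_ge0 ?exprn_ge0 ?expR_ge0 // (ltW u0).
have hu : h = u^-1 by rewrite invrK.
rewrite hu expRN ler_pdivrMr ?expR_gt0 //.
have := expR_ge1Dxn k.+1 (ltW u0) => h1.
apply: (@le_trans _ _ ((k.+2)`!%:R * u^-1 * (u ^+ k.+2 / (k.+2)`!%:R))).
  have fn : (k.+2)`!%:R != 0 :> R by rewrite pnatr_eq0 -lt0n fact_gt0.
  have aux (c v w : R) : c != 0 -> c * v * (w / c) = v * w by move=> c0; field.
  rewrite aux //.
  by rewrite [in leRHS]exprS mulrA mulVf ?gt_eqF // mul1r.
apply: ler_wpM2l; first by rewrite mulr_ge0 // invr_ge0 (ltW u0).
by apply: le_trans h1; rewrite lerDr.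
Qed.

Lemma is_derive_fexp k (t : R) : is_derive t 1 (fexp k) (fexp k.+2 t - k%:R * fexp k.+1 t).
Proof.
have [t0|t0|t0] := ltgtP t 0.
- rewrite !fexp_neg ?(ltW t0) // mulr0 subr0.
  apply: (near_eq_is_derive _ (is_derive_cst (0 : R) t 1)).
  by apply: (@open_near _ [set y : R | y < 0]);
    [exact: open_lt|exact: t0|move=> y /= /ltW /fexp_neg ->].
- rewrite !fexp_pos //.
  have tn : t != 0 by rewrite gt_eqF.
  apply: (@near_eq_is_derive R R R ((fun y : R => y^-1) ^+ k * (expR \o (- (fun y : R => y^-1))))).
    by apply: (@open_near _ [set y : R | 0 < y]);
      [exact: open_gt|exact: t0|move=> y /= y0; rewrite fexp_pos // !fctE].
  have dV : is_derive t 1 (fun y : R => y^-1) (- t ^- 2).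
    by apply: is_derive_eq (@is_deriveV R id t 1 1 tn _) _; rewrite -[_ *: _]/(_ * _) mulr1.
  apply: is_derive_eq; rewrite -![_ *: _]/(_ * _) !fctE /=.
  rewrite -exprVn; case: k => [|k] /=.
    by rewrite !(mulr0n, mul0r, subr0, mulr0, addr0, expr0, mul1r, mulrN, opprK); ring.
  rewrite !exprS -mulr_natl; ring.
- rewrite t0 !fexp_neg // mulr0 subr0; apply: is_deriveP.
  have nc : `|h| @[h --> (0 : R)^'] --> (0 : R).
    by apply: cvg_within_filter; have := @norm_continuous R R 0; rewrite /continuous_at normr0.
  have mc : (k.+2)`!%:R * `|h| @[h --> (0 : R)^'] --> (0 : R).
    have : (k.+2)`!%:R * `|h| @[h --> (0 : R)^'] --> (k.+2)`!%:R * (0 : R).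
      by apply: cvgM; [exact: cvg_cst|exact: nc].
    by rewrite mulr0.
  have : (fun h : R => h^-1 * fexp k h) @ 0^' --> (0 : R).
    apply: (@squeeze_cvgr _ _ _ _ (fun h => - ((k.+2)`!%:R * `|h|))
      (fun h => ((k.+2)`!%:R * `|h|))).
    - by apply: nearW => h; rewrite -ler_norml fexp_bound.
    - by rewrite -[X in _ --> X]oppr0; apply: cvgN.
    - by [].
  apply: cvg_trans; apply: near_eq_cvg; apply: nearW => h /=.
  by rewrite addr0 [h%:A]mulr1 (fexp_neg _ (lexx 0)) subr0.
Qed.

Lemma fexp_continuous k : continuous (fexp k).
Proof.
move=> t; apply: differentiable_continuous; apply/derivable1_diffP.
by have [] := is_derive_fexp k t.
Qed.

Lemma smooth_fexp k m (U : set 'rV[R]_1) : Ck m U (fun y => fexp k (y 0 0)).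
Proof.
elim: m k => [|m IH] k.
  split=> // y _; apply: (@continuous_comp _ _ _ (fun y : 'rV[R]_1 => y 0 0) (fexp k)).
    exact: coord_continuous.
  exact: fexp_continuous.
split=> [y _|j].
  apply: (@continuous_comp _ _ _ (fun y : 'rV[R]_1 => y 0 0) (fexp k)).
    exact: coord_continuous.
  exact: fexp_continuous.
exists ((fun y => fexp k.+2 (y 0 0)) - cst k%:R * (fun y => fexp k.+1 (y 0 0))).
  move=> y _; apply: is_deriveP.
  have := is_derive_cvg (is_derive_fexp k (y 0 0)).
  have -> // : (fun h : R => h^-1 * (fexp k (h *: 1 + y 0 0) - fexp k (y 0 0))) =
     (fun h => h^-1 * (fexp k ((h *: delta_mx 0 j + y) 0 0) - fexp k (y 0 0))).
  by apply/funext => h; rewrite !mxE (ord1 j) eqxx.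
apply: CkB; first exact: IH.
by apply: CkM; [exact: Ck_cst|exact: IH].
Qed.

Lemma smooth_fexp_comp n (U : set 'rV[R]_n) k f : open U -> smooth_in U f ->
  smooth_in U (fun x => fexp k (f x)).
Proof.
move=> oU sf m.
have -> : (fun x => fexp k (f x)) = (fun y : 'rV[R]_1 => fexp k (y 0 0)) \o
  (fun x => \row_(i < 1) f x).
  by apply/funext => x /=; rewrite mxE.
apply: (@Ck_comp R _ _ _ _ setT) => //; [exact: openT|exact: smooth_fexp|].
move=> i; have -> : (fun x => (\row_(i < 1) f x) 0 i) = f by apply/funext => x; rewrite mxE.
exact: sf.
Qed.

Definition fstep (t : R) : R := fexp 0 t * (fexp 0 t + fexp 0 (1 - t))^-1.

Lemma fexp_ge0 k t : 0 <= fexp k t.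
Proof.
rewrite /fexp; case: ifP => // t0.
by rewrite mulr_ge0 ?expR_ge0 // exprn_ge0 // invr_ge0 ltW.
Qed.
Lemma fexp_gt0 k t : 0 < t -> 0 < fexp k t.
Proof. by move=> t0; rewrite fexp_pos // mulr_gt0 ?expR_gt0 // exprn_gt0 // invr_gt0. Qed.

Lemma fstep_den t : 0 < fexp 0 t + fexp 0 (1 - t).
Proof.
have [t0|t0] := ltP 0 t; first by rewrite ltr_wpDr ?fexp_ge0 // fexp_gt0.
by rewrite ltr_wpDl ?fexp_ge0 // fexp_gt0 // subr_gt0 (le_lt_trans t0).
Qed.

Lemma fstep1 t : 1 <= t -> fstep t = 1.
Proof.
move=> t1; rewrite /fstep (@fexp_neg 0 (1 - t)) ?subr_le0 // addr0 divff //.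
by rewrite gt_eqF // fexp_gt0 // (lt_le_trans _ t1).
Qed.
Lemma fstep0 t : t <= 0 -> fstep t = 0.
Proof. by move=> t0; rewrite /fstep fexp_neg // mul0r. Qed.

Lemma smooth_fstep n (U : set 'rV[R]_n) f : open U -> smooth_in U f ->
  smooth_in U (fun x => fstep (f x)).
Proof.
move=> oU sf k.
apply: (@CkM _ _ _ _ (fun x => fexp 0 (f x)) (fun x => (fexp 0 (f x) + fexp 0 (1 - f x))^-1)).
  exact: smooth_fexp_comp.
apply: CkV; first by move=> x _; rewrite gt_eqF // fstep_den.
apply: (@CkD _ _ _ _ (fun x => fexp 0 (f x)) (fun x => fexp 0 (1 - f x))).
  exact: smooth_fexp_comp.
apply: (@smooth_fexp_comp _ _ _ (cst 1 - f)) => // m.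
by apply: CkB; [exact: Ck_cst|exact: sf].
Qed.

Lemma bump_cube n (a : 'rV[R]_n) (r : R) : 0 < r -> exists f,
  [/\ smooth_in setT f, forall x, cube a r x -> f x = 1
    & forall x, ~ cube a (2 * r) x -> f x = 0].
Proof.
move=> r0; pose u (j : 'I_n) (x : 'rV[R]_n) := (x 0 j - a 0 j) / r.
have su j : smooth_in setT (cst 2 - u j * u j).
  move=> k; have Cu : Ck k setT (u j).
    have -> : u j = ((fun x : 'rV[R]_n => x 0 j) - cst (a 0 j)) * cst r^-1 by [].
    by apply: CkM; [apply: CkB; [exact: Ck_coord|exact: Ck_cst]|exact: Ck_cst].
  by apply: CkB; [exact: Ck_cst|exact: CkM].
(* The factor at j is 1 for |u_j| <= 1 and 0 for u_j^2 >= 2, in particular for |u_j| >= 2; squaring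
   avoids the absolute value, which is not smooth. *)
exists (fun x => \prod_j fstep ((cst 2 - u j * u j) x)); split.
- move=> k; apply: Ck_prod => j; exact: (smooth_fstep openT (su j)).
- move=> x cx; apply: big1 => j _; apply: fstep1; rewrite !fctE.
  have h : `|u j x| <= 1.
    by rewrite /u normrM normfV (gtr0_norm r0) ler_pdivrMr // mul1r ltW.
  have : u j x * u j x <= 1.
    by rewrite -expr2 -real_normK ?num_real // expr_le1.
  lra.
- move=> x /existsNP[j /negP]; rewrite -leNgt => h.
  rewrite (bigD1 j) //= fstep0 ?mul0r // !fctE.
  have h2 : 2 <= `|u j x| by rewrite /u normrM normfV (gtr0_norm r0) ler_pdivlMr.
  have : 2 ^+ 2 <= u j x * u j x.
    by rewrite -expr2 -[leRHS]real_normK ?num_real // lerXn2r // nnegrE.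
  rewrite expr2; lra.
Qed.
End Bump.

(** * Hadamard's lemma *)

Section Hadamard.
Context {R : realType}.
Let mu := @lebesgue_measure R.

Definition int01 (f : R -> R) : R := (\int[mu]_(s in `[0, 1]) f s)%R.
Definition cont01 (f : R -> R) := forall s : R, 0 <= s <= 1 -> {for s, continuous f}.

Lemma cont01_within f : cont01 f -> {within `[(0 : R), 1], continuous f}.
Proof.
move=> cf; apply: continuous_in_subspaceT => s /set_mem /=; rewrite in_itv /=; exact: cf.
Qed.

Lemma cont01_int f : cont01 f -> mu.-integrable `[0, 1] (EFin \o f).
Proof.
by move=> /cont01_within cf; apply: continuous_compact_integrable => //; exact: segment_compact.
Qed.

Lemma int01B f g : cont01 f -> cont01 g -> int01 (fun s => f s - g s) = int01 f - int01 g.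
Proof. by move=> cf cg; apply: RintegralB => //; exact: cont01_int. Qed.

Lemma int01Z c f : cont01 f -> int01 (fun s => c * f s) = c * int01 f.
Proof. by move=> cf; apply: RintegralZl => //; exact: cont01_int. Qed.

Lemma int01D f g : cont01 f -> cont01 g -> int01 (fun s => f s + g s) = int01 f + int01 g.
Proof. by move=> cf cg; apply: RintegralD => //; exact: cont01_int. Qed.

Lemma int01_cst c : int01 (fun=> c) = c.
Proof.
by rewrite /int01 Rintegral_cst //= lebesgue_measure_itv /= lte01 /= oppr0 addr0 mulr1.
Qed.

Lemma int01_bound f B : cont01 f -> (forall s, 0 <= s <= 1 -> `|f s| <= B) -> `|int01 f| <= B.
Proof.
move=> cf fB; apply: (le_trans (@le_normr_Rintegral _ _ _ mu `[0, 1]%classic f _ (cont01_int cf)))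
  => //.
rewrite -[leRHS]int01_cst; apply: le_Rintegral => //.
- by apply: (@cont01_int (fun s => `|f s|)) => s hs; apply: continuous_comp;
  [exact: cf|exact: norm_continuous].
- by apply: (@cont01_int (fun=> B)) => s _; exact: cst_continuous.
Qed.

Lemma int01_FTC f F : cont01 f -> cont01 F -> (forall s : R, 0 < s < 1 -> is_derive s 1 F (f s)) ->
  int01 f = F 1 - F 0.
Proof.
move=> cf cF dF; rewrite /int01 /Rintegral.
rewrite (@continuous_FTC2 R f F 0 1) //; first exact: cont01_within.
- split.
  + by move=> s /=; rewrite in_itv /= => /dF[].
  + by apply: cvg_at_right_filter; apply: cF; rewrite lexx ler01.
  + by apply: cvg_at_left_filter; apply: cF; rewrite lexx ler01.
- by move=> s; rewrite in_itv /= => /dF[_ <-]; rewrite derive1E.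
Qed.

Section Center.
Variables (n : nat) (a : 'rV[R]_n) (r : R).
Hypothesis r0 : 0 < r.
Let C := cube a r.

Definition ray (x : 'rV[R]_n) (s : R) := a + s *: (x - a).

Lemma ray_cube (r1 : R) x s : 0 <= s <= 1 -> cube a r1 x -> cube a r1 (ray x s).
Proof.
move=> /andP[s0 s1] cx i; have r1_0 : 0 < r1 by apply: le_lt_trans (cx i).
rewrite !mxE addrAC subrr add0r normrM (ger0_norm s0).
apply: le_lt_trans (cx i); rewrite -[leRHS]mul1r; exact: ler_wpM2r.
Qed.

Lemma ray_continuous x s : {for s, continuous (ray x)}.
Proof.
apply: (@cvg_rowP _ _ _ (nbhs s) _ (ray x)) => k.
have -> : (fun s => ray x s 0 k) = (fun s => a 0 k + s * (x - a) 0 k).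
  by apply/funext => t; rewrite !mxE.
have -> : ray x s 0 k = a 0 k + s * (x - a) 0 k by rewrite !mxE.
by apply: cvgD; [exact: cvg_cst|apply: cvgM; [exact: cvg_id|exact: cvg_cst]].
Qed.

Lemma cont01_ray f x k : smooth_in C f -> C x -> cont01 (fun s => s ^+ k * f (ray x s)).
Proof.
move=> sf Cx s hs; apply: cvgM; first exact: exprn_continuous.
apply: (@continuous_comp _ _ _ (ray x) f); first exact: ray_continuous.
by apply: (smooth_in_continuous sf); exact: ray_cube.
Qed.

(** Hadamard's quotients are the case k = 0 applied to the [pd j f]; general k is needed because
    each partial derivative brings out a factor s. *)
Definition radial (k : nat) (f : 'rV[R]_n -> R) x := int01 (fun s => s ^+ k * f (ray x s)).

Lemma smooth_bounded f x : smooth_in C f -> C x ->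
  exists r1 B, [/\ 0 < r1, r1 < r, cube a r1 x & forall y, cube a r1 y -> `|f y| <= B].
Proof.
move=> sf Cx; pose M := \big[Num.max/0]_(i < n) `|x 0 i - a 0 i|.
have Mr : M < r by apply/bigmax_ltP; split.
pose r1 := (M + r) / 2.
have M0 : 0 <= M by exact: bigmax_ge_id.
have r1r : r1 < r by rewrite /r1; lra.
have Mr1 : M < r1 by rewrite /r1; lra.
pose K := [set y : 'rV[R]_n | forall i, `|y 0 i - a 0 i| <= r1].
have Kc : compact K.
  have -> : K = [set y : 'rV[R]_n | forall i, `[(a 0 i - r1), (a 0 i + r1)]%classic (y ord0 i)].
    apply/seteqP; split=> y h i; have := h i; rewrite /= in_itv /= ler_distl //.
  by apply: (@rV_compact _ _ (fun i => `[a 0 i - r1, a 0 i + r1]%classic)) => i;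
    exact: segment_compact.
have KC : K `<=` C by move=> y h i; exact: le_lt_trans (h i) r1r.
have r10 : 0 < r1 by rewrite /r1; lra.
have xr1 : cube a r1 x.
  by move=> i; apply: le_lt_trans Mr1; apply/bigmax_geP; right; exists i.
have [||c cK hc] := @compact_EVT_max _ R (fun y => `|f y|) K _ Kc.
- by exists x => i; apply: ltW.
- apply: continuous_in_subspaceT => y /set_mem Ky.
  by apply: continuous_comp; [exact: (smooth_in_continuous sf (KC _ Ky))|exact: norm_continuous].
exists r1, `|f c|; split => // y cy; apply: hc; apply/mem_set => i.
exact: ltW.
Qed.

Lemma uniform_bound (I : finType) (f : I -> 'rV[R]_n -> R) x : (forall i, smooth_in C (f i)) ->
  C x ->
  exists r1 B, [/\ 0 < r1, cube a r1 `<=` C, cube a r1 x, 0 <= B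
     & forall i y, cube a r1 y -> `|f i y| <= B].
Proof.
move=> sf Cx.
have h i : exists rB : R * R, [/\ 0 < rB.1, rB.1 < r, cube a rB.1 x & forall y, cube a rB.1 y ->
  `|f i y| <= rB.2].
  by have [r1 [B h]] := smooth_bounded (sf i) Cx; exists (r1, B).
have [rB hrB] := choice h.
have [r2 [B2 [r20 r2r cx2 _]]] := @smooth_bounded (cst 0) x (fun k => Ck_cst _ _ _) Cx.
exists (\big[Num.min/r2]_i (rB i).1), (\big[Num.max/0]_i (rB i).2); split.
- by apply/bigmin_gtP; split=> // i _; have [] := hrB i.
- move=> y cy j; apply: lt_le_trans (cy j) _; apply: le_trans (ltW r2r); exact: bigmin_le_id.
- by move=> j; apply/bigmin_gtP; split=> [|i _]; [exact: cx2|have [_ _ + _] := hrB i; exact].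
- exact: bigmax_ge_id.
- move=> i y cy; have [_ _ _ hB] := hrB i; apply: (@le_trans _ _ (rB i).2).
    apply: hB => j; apply: lt_le_trans (cy j) _; exact: bigmin_le_cond.
  exact: le_bigmax.
Qed.

Lemma ray_dist x y s : 0 <= s <= 1 -> `|ray y s - ray x s| <= `|y - x|.
Proof.
move=> /andP[s0 s1]; have -> : ray y s - ray x s = s *: (y - x).
  by apply/rowP => i; rewrite !mxE; ring.
by rewrite normrZ (ger0_norm s0) -[leRHS]mul1r; apply: ler_wpM2r.
Qed.

Lemma ray_lipschitz f r1 B : cube a r1 `<=` C -> 0 <= B -> smooth_in C f ->
  (forall i y, cube a r1 y -> `|pd i f y| <= B) ->
  forall x y s, cube a r1 x -> cube a r1 y -> 0 <= s <= 1 ->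
    `|f (ray y s) - f (ray x s)| <= n%:R * B * `|y - x|.
Proof.
move=> r1C B0 sf hB x y s cx cy s01.
apply: (le_trans (@lipschitz_pd R n f a r1 B _ _ _ _ _ _)).
- by move=> z j /r1C Cz; exact: (@smooth_in_derivable R n C f z j (cube_open r0) sf Cz).
- by move=> z j cz; exact: hB.
- exact: ray_cube.
- exact: ray_cube.
- by apply: ler_wpM2l; [exact: mulr_ge0|exact: ray_dist].
Qed.

Lemma norm_exprn_le1 (s : R) k : 0 <= s <= 1 -> `|s ^+ k| <= 1.
Proof. by move=> /andP[s0 s1]; rewrite ger0_norm ?exprn_ge0 // exprn_ile1. Qed.

Lemma radial_continuous k f x : smooth_in C f -> C x -> {for x, continuous (radial k f)}.
Proof.
move=> sf Cx.
have [r1 [B [r10 r1C cx B0 hB]]] := uniform_bound (fun i => smooth_in_pd i (cube_open r0) sf) Cx.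
have L0 : 0 <= n%:R * B by exact: mulr_ge0.
apply/(@cvgrPdist_lt _ _ _ (nbhs x)) => e e0.
have n1 : nbhs x (cube a r1) by apply: open_nbhs_nbhs; split => //; exact: cube_open.
have d0 : 0 < e / (n%:R * B + 1) by rewrite divr_gt0 // ltr_wpDl.
apply: filterS2 n1 (cube_nbhs x d0) => y cy /(cube_norm _ _ d0) hy.
rewrite distrC /radial -int01B; [|exact: cont01_ray (r1C _ cy)|exact: cont01_ray].
apply: (@le_lt_trans _ _ (n%:R * B * `|y - x|)).
  apply: int01_bound.
    by move=> s hs; apply: cvgB;
      [exact: (@cont01_ray f y k sf (r1C _ cy) s hs)|exact: (@cont01_ray f x k sf Cx s hs)].
  move=> s hs; rewrite -mulrBr normrM -[leRHS]mul1r.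
  by apply: ler_pM => //;
    [exact: (norm_exprn_le1 _ hs)|exact: (@ray_lipschitz f r1 B r1C B0 sf hB x y s cx cy hs)].
apply: (@le_lt_trans _ _ ((n%:R * B + 1) * `|y - x|)); first by rewrite ler_wpM2r // lerDl.
by rewrite mulrC -ltr_pdivlMr // ltr_wpDl.
Qed.

(** Differentiation under the integral by an explicit error: for each s, [slope1] and the Lipschitz
    bound for [pd j f] put the difference quotient within L |h| of the candidate, uniformly in s. *)
Lemma radial_derive k f x j : smooth_in C f -> C x ->
  is_derive x (delta_mx 0 j) (radial k f) (radial k.+1 (pd j f) x).
Proof.
move=> sf Cx; have sfj := smooth_in_pd j (cube_open r0) sf.
have [r1 [B [r10 r1C cx B0 hB]]] := uniform_bound (fun i => smooth_in_pd i (cube_open r0) sfj) Cx.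
pose L := n%:R * B; have L0 : 0 <= L by exact: mulr_ge0.
apply: is_deriveP.
pose y (h : R) : 'rV[R]_n := h *: delta_mx 0 j + x.
have yc : \forall h \near (0 : R)^', cube a r1 (y h).
  have : y h @[h --> 0] --> y 0.
    apply: (@cvg_rowP _ _ _ (nbhs 0) _ y) => i.
    have -> : (fun h => y h 0 i) = (fun h => h * (delta_mx 0 j : 'rV[R]_n) 0 i + x 0 i).
      by apply/funext => h; rewrite !mxE.
    have -> : y 0 0 i = 0 * (delta_mx 0 j : 'rV[R]_n) 0 i + x 0 i by rewrite !mxE.
    by apply: cvgD; [apply: cvgM; [exact: cvg_id|exact: cvg_cst]|exact: cvg_cst].
  have -> : y 0 = x by rewrite /y scale0r add0r.
  move=> c; have c' : y h @[h --> 0^'] --> x by exact: cvg_within_filter.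
  exact: (c' _ (open_nbhs_nbhs (conj (cube_open r10) cx))).
have n0 : \forall h \near (0 : R)^', h != 0 by exact: nbhs_dnbhs_neq.
have key : \forall h \near (0 : R)^',
    `|h^-1 * (radial k f (h *: delta_mx 0 j + x) - radial k f x) - radial k.+1 (pd j f) x| <=
      L * `|h|.
  apply: filterS2 yc n0 => h cy h0; rewrite -/(y h).
  have c1 : cont01 (fun s => s ^+ k * f (ray (y h) s)) by exact: cont01_ray (r1C _ cy).
  have c2 : cont01 (fun s => s ^+ k * f (ray x s)) by exact: cont01_ray.
  have c3 : cont01 (fun s => s ^+ k.+1 * pd j f (ray x s)) by exact: cont01_ray.
  have c4 : cont01 (fun s => s ^+ k * f (ray (y h) s) - s ^+ k * f (ray x s)).
    by move=> s hs; apply: cvgB; [exact: c1|exact: c2].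
  have c5 : cont01 (fun s => h^-1 * (s ^+ k * f (ray (y h) s) - s ^+ k * f (ray x s))).
    by move=> s hs; apply: cvgM; [exact: cvg_cst|exact: c4].
  rewrite /radial -int01B // -int01Z // -int01B //.
  apply: int01_bound; first by move=> s hs; apply: cvgB; [exact: c5|exact: c3].
  move=> s hs.
  have zE th : ray x s + (th * (s * h)) *: delta_mx 0 j = ray (mix x (y h) (fun=> th)) s.
    by apply/rowP => i; rewrite !mxE; ring.
  have zc th : 0 <= th <= 1 -> cube a r1 (mix x (y h) (fun=> th)) by move=> ?; exact: cube_mid.
  have [|th h01 E] := @slope1 R n f (ray x s) (delta_mx 0 j) (s * h).
    move=> th h01; rewrite zE; apply: (@smooth_in_derivable R n C f _ j (cube_open r0) sf).
    by apply: ray_cube => //; apply: r1C; exact: zc.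
  have yE : ray x s + (s * h) *: delta_mx 0 j = ray (y h) s.
    by apply/rowP => i; rewrite !mxE; ring.
  rewrite yE zE in E.
  have -> : h^-1 * (s ^+ k * f (ray (y h) s) - s ^+ k * f (ray x s)) - s ^+ k.+1 * pd j f (ray x s)
     = s ^+ k.+1 * (pd j f (ray (mix x (y h) (fun=> th)) s) - pd j f (ray x s)).
    rewrite -mulrBr E exprS -/(pd j f _); field; exact: h0.
  rewrite normrM -[leRHS]mul1r; apply: ler_pM => //; first exact: (norm_exprn_le1 _ hs).
  apply: (le_trans (@ray_lipschitz _ r1 B r1C B0 sfj hB _ _ _ cx (zc _ h01) hs)).
  apply: ler_wpM2l => //; apply: norm_le_coord => // i; rewrite !mxE eqxx /=.
  have /andP[t0 t1] := h01.
  have -> : x 0 i + th * (h * (i == j)%:R + x 0 i - x 0 i) - x 0 i = th * (h * (i == j)%:R) by ring.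
  rewrite normrM (ger0_norm t0) -[leRHS]mul1r; apply: ler_pM => //.
  by case: (i == j); rewrite ?mulr1 // mulr0 normr0.
have lim0 : L * `|h| @[h --> (0 : R)^'] --> (0 : R).
  have : L * `|h| @[h --> (0 : R)^'] --> L * (0 : R).
    apply: cvgM; first exact: cvg_cst.
    by apply: cvg_within_filter; have := @norm_continuous R R 0; rewrite /continuous_at normr0.
  by rewrite mulr0.
apply/subr_cvg0.
apply: (@squeeze_cvgr _ _ _ _ (fun h => - (L * `|h|)) (fun h => L * `|h|)); last exact: lim0.
  by move: key; apply: filterS => h; rewrite ler_norml.
by rewrite -[X in _ --> X]oppr0; apply: cvgN.
Qed.

Lemma radial_smooth k f : smooth_in C f -> smooth_in C (radial k f).
Proof.
move=> sf m; elim: m k f sf => [|m IH] k f sf.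
  by split=> // x Cx; exact: radial_continuous.
split=> [x Cx|j]; first exact: radial_continuous.
exists (radial k.+1 (pd j f)); first by move=> x Cx; exact: radial_derive.
by apply: IH; exact: smooth_in_pd (cube_open r0) sf.
Qed.

(** The derivative of f along the ray from a to x is integrated over [0, 1]; linearity pulls the
    factors x_j - a_j out of the integral. *)
Lemma hadamard f : smooth_in C f -> exists2 g : 'I_n -> 'rV[R]_n -> R,
  (forall j, smooth_in C (g j)) &
  forall x, C x -> f x = f a + \sum_j (x 0 j - a 0 j) * g j x.
Proof.
move=> sf; exists (fun j => radial 0 (pd j f)).
  by move=> j; apply: radial_smooth; exact: smooth_in_pd (cube_open r0) sf.
move=> x Cx; pose F (s : R) := f (ray x s).
pose D (s : R) := \sum_j (x 0 j - a 0 j) * (s ^+ 0 * pd j f (ray x s)).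
have cD j : cont01 (fun s => s ^+ 0 * pd j f (ray x s)).
  by apply: cont01_ray => //; exact: smooth_in_pd (cube_open r0) sf.
have cD' j : cont01 (fun s => (x 0 j - a 0 j) * (s ^+ 0 * pd j f (ray x s))).
  by move=> s hs; apply: cvgM; [exact: cvg_cst|exact: cD].
have sumE (I : seq 'I_n) : cont01
  (fun s => \sum_(j <- I) (x 0 j - a 0 j) * (s ^+ 0 * pd j f (ray x s))) /\
   int01 (fun s => \sum_(j <- I) (x 0 j - a 0 j) * (s ^+ 0 * pd j f (ray x s))) =
   \sum_(j <- I) (x 0 j - a 0 j) * radial 0 (pd j f) x.
  elim: I => [|j I [IH1 IH2]].
    have -> : (fun s => \sum_(j <- [::]) (x 0 j - a 0 j) * (s ^+ 0 * pd j f (ray x s))) = (fun=> 0).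
      by apply/funext => s; rewrite big_nil.
    by split; [move=> s _; exact: cst_continuous|rewrite big_nil int01_cst].
  have -> : (fun s => \sum_(i <- j :: I) (x 0 i - a 0 i) * (s ^+ 0 * pd i f (ray x s))) =
     (fun s => (x 0 j - a 0 j) * (s ^+ 0 * pd j f (ray x s)) +
       \sum_(i <- I) (x 0 i - a 0 i) * (s ^+ 0 * pd i f (ray x s))).
    by apply/funext => s; rewrite big_cons.
  split; first by move=> s hs; apply: cvgD; [exact: cD'|exact: IH1].
  by rewrite big_cons int01D // IH2 int01Z.
have [cS eS] := sumE (index_enum 'I_n).
have cF : cont01 F.
  move=> s hs; apply: (@continuous_comp _ _ _ (ray x) f); first exact: ray_continuous.
  by apply: (smooth_in_continuous sf); exact: ray_cube.
have E : int01 (fun s => \sum_j (x 0 j - a 0 j) * (s ^+ 0 * pd j f (ray x s))) = F 1 - F 0;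
  last first.
  have e1 : ray x 1 = x by rewrite /ray scale1r addrC subrK.
  have e0 : ray x 0 = a by rewrite /ray scale0r addr0.
  by rewrite -eS E /F e1 e0 addrC subrK.
apply: (int01_FTC cS cF) => s hs; have hs' : 0 <= s <= 1 by move: hs => /andP[/ltW -> /ltW ->].
have d : is_derive (ray x s) (x - a) f (\sum_j (x 0 j - a 0 j) * (s ^+ 0 * pd j f (ray x s))).
  have -> : f = f \o id by [].
  apply: is_derive_eq.
    apply: (@is_derive_chain R n n f id (ray x s) (x - a) (fun j => (x - a) 0 j)) => [k||k].
    - exact: is_derive_coord.
    - apply: (open_near (cube_open r0)) (ray_cube hs' Cx) _ => z Cz k.
      exact: (@smooth_in_derivable R n C f z k (cube_open r0) sf Cz).
    - apply: (smooth_in_continuous (smooth_in_pd k (cube_open r0) sf)).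
      exact: ray_cube.
  by apply: eq_bigr => j _; rewrite !mxE expr0 mul1r.
have [d1 d2] := d.
by apply: is_derive_eq (is_derive_line d1) _.
Qed.
End Center.
End Hadamard.

(** * Tensor calculus on locally Euclidean spaces *)

Section LocallyEuclidean.
Context {R : realType}.

Definition mkC (S : smoothSpace R) (h : S -> R) (sh : smooth_fun h) : Cinf S := MkCinf (asboolT sh).

Section Values.
Variable S : smoothSpace R.
Implicit Types f g : Cinf S.
Lemma CvalD f g x : (f + g) x = f x + g x. Proof. by []. Qed.
Lemma CvalN f x : (- f) x = - f x. Proof. by []. Qed.
Lemma CvalB f g x : (f - g) x = f x - g x. Proof. by []. Qed.
Lemma CvalM f g x : (f * g) x = f x * g x. Proof. by []. Qed.
Lemma Cval0 x : (0 : Cinf S) x = 0. Proof. by []. Qed.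
Lemma Cval1 x : (1 : Cinf S) x = 1. Proof. by []. Qed.
Lemma Cval_cst r x : Ccst S r x = r. Proof. by []. Qed.
Lemma Cval_sum (I : Type) (s : seq I) (P : pred I) (F : I -> Cinf S) x :
  (\sum_(i <- s | P i) F i) x = \sum_(i <- s | P i) F i x.
Proof. by elim/big_rec2: _ => // i y1 y2 _ <-. Qed.
Lemma CinfP f g : (forall x, f x = g x) -> f = g.
Proof. by move=> e; apply: val_inj; apply/funext. Qed.
Lemma Cinf_smooth f : smooth_fun (f : S -> R).
Proof. by have /asboolP := valP f. Qed.
Lemma Ccst0 : Ccst S 0 = 0. Proof. exact: CinfP. Qed.
Lemma Ccst1 : Ccst S 1 = 1. Proof. exact: CinfP. Qed.
Lemma CcstD a b : Ccst S (a + b) = Ccst S a + Ccst S b. Proof. exact: CinfP. Qed.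
Lemma CcstN a : Ccst S (- a) = - Ccst S a. Proof. exact: CinfP. Qed.
Lemma CcstM a b : Ccst S (a * b) = Ccst S a * Ccst S b. Proof. exact: CinfP. Qed.
End Values.

(** The inverse [psi] is total, with values that matter only on the image. The last clause lifts
    functions smooth near phi x to global smooth functions with the same germ at x, which is how
    local data become elements of [Cinf]. *)
Definition lchart (m : nat) (S : smoothSpace R) (O : set S) (phi : S -> 'rV[R]_m)
  (psi : 'rV[R]_m -> S) : Prop :=
  [/\ open O, forall x, O x -> psi (phi x) = x, forall x, O x -> {for x, continuous phi},
      open (phi @` O) & forall u, (phi @` O) u -> {for u, continuous psi}] /\
  ((forall h, smooth_fun h -> smooth_in (phi @` O) (h \o psi)) /\
   (forall (W : set 'rV[R]_m) g x, open W -> smooth_in W g -> O x -> W (phi x) ->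
      exists2 h : S -> R, smooth_fun h & \forall x' \near x, h x' = g (phi x'))).

(** Locality of smoothness, charts and bump functions: the interface through which M, T_0 and the
    transverse manifold are treated alike, the last being a disjoint union over an arbitrary index
    type and not given as a [manifold]. *)
Definition leuclid (m : nat) (S : smoothSpace R) : Prop :=
  [/\ forall h : S -> R, (forall x : S, exists2 g : S -> R, smooth_fun g & \forall y \near x,
    h y = g y) -> smooth_fun h,
      forall p : S, exists O (phi : S -> 'rV[R]_m) psi, O p /\ lchart O phi psi
    & forall (p : S) A, nbhs p A -> exists chi : S -> R,
      [/\ smooth_fun chi, \forall x \near p, chi x = 1
        & forall x : S, ~ A x -> \forall y \near x, chi y = 0]].

Section Theory.
Variables (m : nat) (S : smoothSpace R).
Hypothesis HS : leuclid m S.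
Local Notation A := (Cinf S).
Implicit Types (f g : A) (X Y : vfield S).

Lemma bump_at (p : S) B : nbhs p B -> exists chi : A, (\forall x \near p, chi x = 1) /\
  forall x : S, ~ B x -> \forall y \near x, chi y = 0.
Proof. by move=> nB; have [_ _ /(_ _ _ nB)[chi [s1 s2 s3]]] := HS; exists (mkC s1). Qed.

Lemma glueC (h : S -> R) : (forall x : S, exists f : A, \forall y \near x, h y = f y) ->
  exists f : A, forall x, f x = h x.
Proof.
move=> hl; have [H _ _] := HS.
have sh : smooth_fun h.
  by apply: H => x; have [f hf] := hl x; exists f => //; exact: Cinf_smooth.
by exists (mkC sh).
Qed.

Definition pder (p : S) (d : A -> R) : Prop :=
  [/\ forall f g, d (f + g) = d f + d g, forall r f, d (Ccst S r * f) = r * d f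
    & forall f g, d (f * g) = d f * g p + f p * d g].

Lemma vfield_pder X p : pder p (fun f => X f p).
Proof.
by split=> [f g|r f|f g]; rewrite ?vactD ?vactC ?vactM ?CvalD ?CvalM.
Qed.

Section Pder.
Variables (p : S) (d : A -> R).
Hypothesis hd : pder p d.

Lemma pderD f g : d (f + g) = d f + d g. Proof. by case: hd. Qed.
Lemma pderM f g : d (f * g) = d f * g p + f p * d g. Proof. by case: hd. Qed.
Lemma pder0 : d 0 = 0.
Proof. by apply: (addrI (d 0)); rewrite -pderD !addr0. Qed.
Lemma pderN f : d (- f) = - d f.
Proof. by apply: (addrI (d f)); rewrite -pderD !subrr pder0. Qed.
Lemma pderB f g : d (f - g) = d f - d g. Proof. by rewrite pderD pderN. Qed.
Lemma pder1 : d 1 = 0.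
Proof.
by have := pderM 1 1; rewrite mulr1 Cval1 mulr1 mul1r => h; apply: (addrI (d 1)); rewrite -h addr0.
Qed.
Lemma pder_cst r : d (Ccst S r) = 0.
Proof. by have [_ /(_ r 1) + _] := hd; rewrite mulr1 pder1 mulr0. Qed.
Lemma pder_sum (I : Type) (s : seq I) (F : I -> A) : d (\sum_(i <- s) F i) = \sum_(i <- s) d (F i).
Proof. by elim: s => [|i s IH]; rewrite ?big_nil ?pder0 // !big_cons pderD IH. Qed.

(** A bump function chi supported where f = g gives chi (f - g) = 0; the Leibniz rule at p, where
    chi is 1 and f - g is 0, reduces this to d (f - g) = 0. *)
Lemma pder_local f g : (\forall x \near p, f x = g x) -> d f = d g.
Proof.
move=> fg; have [chi [c1 c0]] := bump_at fg.
have h : chi * (f - g) = 0.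
  apply: CinfP => x; rewrite CvalM CvalB Cval0.
  have [->|nfg] := pselect (f x = g x); first by rewrite subrr mulr0.
  by rewrite (nbhs_singleton (c0 _ nfg)) mul0r.
have := pderM chi (f - g); rewrite h pder0 CvalB (nbhs_singleton fg) subrr mulr0 add0r.
by rewrite (nbhs_singleton c1) mul1r pderB => /eqP; rewrite eq_sym subr_eq0 => /eqP.
Qed.
End Pder.

Lemma vlocal X f g (p : S) : (\forall x \near p, f x = g x) -> X f p = X g p.
Proof. exact: pder_local (vfield_pder X p) _ _. Qed.

Section Chart.
Variables (O : set S) (phi : S -> 'rV[R]_m) (psi : 'rV[R]_m -> S).
Hypothesis hc : lchart O phi psi.
Local Notation U := (phi @` O).

Lemma chart_open : open O. Proof. by case: hc => -[]. Qed.
Lemma chart_imopen : open U. Proof. by case: hc => -[]. Qed.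
Lemma chartK x : O x -> psi (phi x) = x. Proof. by case: hc => -[_ + _ _ _ _]; apply. Qed.
Lemma chart_cont x : O x -> {for x, continuous phi}. Proof. by case: hc => -[_ _ + _ _ _]; apply.
  Qed.
Lemma chart_invcont u : U u -> {for u, continuous psi}. Proof. by case: hc => -[_ _ _ _ + _];
  apply. Qed.
Lemma chart_read f : smooth_in U (f \o psi).
Proof. by case: hc => _ [+ _]; apply; exact: Cinf_smooth. Qed.
Lemma chart_lift (W : set 'rV[R]_m) (g : 'rV[R]_m -> R) (x : S) : open W -> smooth_in W g ->
  O x -> W (phi x) ->
  exists f : A, \forall x' \near x, f x' = g (phi x').
Proof.
by move=> oW sg Ox Wx; case: hc => _ [_ /(_ W g x oW sg Ox Wx)[h sh e]]; exists (mkC sh).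
Qed.
Lemma chart_near (x : S) W : O x -> nbhs (phi x) W -> \forall y \near x, O y /\ W (phi y).
Proof.
move=> Ox nW; have c := chart_cont Ox.
apply: filterI; last exact: c.
by apply: open_nbhs_nbhs; split => //; exact: chart_open.
Qed.

Lemma chart_derivable f (x : S) j : O x -> derivable (f \o psi) (phi x) (delta_mx 0 j).
Proof.
by move=> Ox; apply: (smooth_in_derivable chart_imopen (chart_read f)); exists x.
Qed.

Lemma pd_pder (x : S) j : O x -> pder x (fun f => pd j (f \o psi) (phi x)).
Proof.
move=> Ox; have d f := derivableP (@chart_derivable f x j Ox); rewrite /pd; split=> [f g|r f|f g].
- have -> : (f + g : A) \o psi = (f \o psi) + (g \o psi) by [].
  by apply: derive_val; exact: is_deriveD.
- have -> : (Ccst S r * f : A) \o psi = (fun u => (f \o psi) u * r).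
    by apply/funext => u; rewrite /= mulrC.
  by rewrite mulrC; apply: derive_val; exact: is_derive_mulr.
- have -> : (f * g : A) \o psi = (f \o psi) * (g \o psi) by [].
  apply: (@derive_val R); apply: is_derive_eq (is_deriveM (d f) (d g)) _.
  by rewrite -![_ *: _]/(_ * _) /= chartK //; ring.
Qed.

(** By Hadamard, f is near x a constant plus products of coordinate differences with functions G_j,
    so any derivation at x is known from its values on coordinates. Applying this to the coordinate
    derivations identifies G_j at x as a partial derivative. *)
Lemma pder_chart (x : S) (xs : 'I_m -> A) (d : A -> R) f : O x -> pder x d ->
  (forall j, \forall y \near x, xs j y = phi y 0 j) ->
  d f = \sum_j d (xs j) * pd j (f \o psi) (phi x).
Proof.
move=> Ox hd hxs.
have nU : nbhs (phi x) U by apply: open_nbhs_nbhs; split; [exact: chart_imopen|exists x].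
have [r r0 rU] := nbhs_cube nU.
have sF : smooth_in (cube (phi x) r) (f \o psi) by move=> k; apply: Ck_sub rU _; exact: chart_read.
have [g sg fE] := hadamard r0 sF.
have cx : cube (phi x) r (phi x) by exact: cubexx.
have [G hG] := choice (fun j => chart_lift (cube_open r0) (sg j) Ox cx).
have main (d' : A -> R) : pder x d' -> d' f = \sum_j d' (xs j) * g j (phi x).
  move=> hd'.
  have fnear : \forall y \near x,
    f y = (Ccst S (f x) + \sum_j (xs j - Ccst S (phi x 0 j)) * G j : A) y.
    have n1 := chart_near Ox (cube_nbhs (phi x) r0).
    have n2 : \forall y \near x, forall j, xs j y = phi y 0 j by exact: filter_forall.
    have n3 : \forall y \near x, forall j, G j y = g j (phi y) by exact: filter_forall.
    apply: filterS3 n1 n2 n3 => y [Oy cy] e1 e2.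
    have h := fE _ cy; rewrite /= !chartK // in h; rewrite h CvalD Cval_sum Cval_cst.
    by congr (_ + _); apply: eq_bigr => j _; rewrite CvalM CvalB e1 e2.
  rewrite (pder_local hd' fnear) (pderD hd') (pder_cst hd') add0r (pder_sum hd').
  apply: eq_bigr => j _; rewrite (pderM hd') (pderB hd') (pder_cst hd') subr0.
  rewrite CvalB Cval_cst (nbhs_singleton (hxs j)) subrr mul0r addr0.
  by rewrite (nbhs_singleton (hG j)).
rewrite main //; apply: eq_bigr => j _; congr (_ * _).
have pdE i : pd j (xs i \o psi) (phi x) = (i == j)%:R.
  have := is_derive_coord (phi x) (delta_mx 0 j) i => -[_]; rewrite mxE eqxx /= eq_sym => <-.
  apply: near_eq_derive.
  have n1 : \forall u \near phi x, xs i (psi u) = phi (psi u) 0 i.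
    have := chart_invcont (ex_intro2 _ _ x Ox erefl);
      rewrite /prop_for /continuous_at chartK // => c.
    exact: (c _ (hxs i)).
  apply: filterS2 n1 nU => u e [y Oy yu] /=; by rewrite e -yu chartK.
rewrite (main _ (pd_pder j Ox)) (bigD1 j) //= big1 => [|i ij].
  by rewrite pdE eqxx mul1r addr0.
by rewrite pdE (negPf ij) mul0r.
Qed.
End Chart.

(* A local frame together with dual coordinate functions; every derivation at a point of O is
   determined by its values on the coordinates. *)
Definition frame_on (O : set S) (xs : 'I_m -> A) (D : 'I_m -> vfield S) : Prop :=
  [/\ open O, forall x i j, O x -> D i (xs j) x = (i == j)%:R
    & forall x d f, O x -> pder x d -> d f = \sum_j d (xs j) * D j f x].

(** Coordinates and coordinate fields become global after multiplication by a bump function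
    supported in O; O' is the open set where that function is locally 1, so that the cut-off has no
    effect there. *)
Lemma chart_frame (O : set S) (phi : S -> 'rV[R]_m) (psi : 'rV[R]_m -> S) (p : S) :
  lchart O phi psi -> O p ->
  exists O' xs D, [/\ O' p, O' `<=` O, frame_on O' xs D,
    forall x j, O' x -> xs j x = phi x 0 j
    & forall x f j, O' x -> D j f x = pd j (f \o psi) (phi x)].
Proof.
move=> hc Op; have oO := chart_open hc.
have [chi [c1 c0]] := bump_at (open_nbhs_nbhs (conj oO Op)).
have lift (g : 'rV[R]_m -> R) : smooth_in (phi @` O) g ->
    exists f : A, (forall x, O x -> f x = chi x * g (phi x)) /\ forall x, ~ O x -> f x = 0.
  move=> sg; pose h x := if `[< O x >] then chi x * g (phi x) else 0.
  have [x|f hf] := @glueC h.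
    have [Ox|nOx] := pselect (O x); last first.
      exists 0; apply: filterS (c0 _ nOx) => y e; rewrite /h e mul0r Cval0; by case: ifP.
    have [G hG] := chart_lift hc (chart_imopen hc) sg Ox (ex_intro2 _ _ x Ox erefl).
    exists (chi * G); apply: filterS2 hG (open_nbhs_nbhs (conj oO Ox)) => y e Oy.
    by rewrite /h asboolT // CvalM e.
  exists f; split=> x Ox; rewrite hf /h; first by rewrite asboolT.
  by rewrite asboolF.
have sx j : smooth_in (phi @` O) (fun u => u 0 j) by move=> k; exact: Ck_coord.
have [xs hxs] := choice (fun j => lift _ (sx j)).
have [D0 hD0] := choice (fun jf : 'I_m * A =>
  lift _ (smooth_in_pd jf.1 (chart_imopen hc) (chart_read hc jf.2))).
have D0E j f x : O x -> D0 (j, f) x = chi x * pd j (f \o psi) (phi x).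
  by move=> Ox; have [-> ] := hD0 (j, f).
have D0N j f x : ~ O x -> D0 (j, f) x = 0 by move=> nOx; have [_ ->] := hD0 (j, f).
have Dv j : (fun f => D0 (j, f)) \in @is_vfield R S.
  apply/asboolP; split=> [f g|r f|f g]; apply: CinfP => x;
    (have [Ox|nOx] := pselect (O x);
      last by rewrite ?(CvalD, CvalM) !D0N // ?(mulr0, mul0r, addr0));
    have [pD pr pM] := pd_pder hc j Ox; cbv beta in pD, pr, pM;
    rewrite ?(CvalD, CvalM) !D0E // ?pD ?pr ?pM ?Cval_cst; ring.
pose D j := MkVfield (Dv j).
pose O' := [set x | \forall y \near x, chi y = 1] `&` O.
have oO' : open O'.
  by apply: openI => //; rewrite openE => x /nbhs_interior.
have chi1 x : O' x -> chi x = 1 by move=> [/nbhs_singleton].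
have xsE x j : O' x -> xs j x = phi x 0 j.
  by move=> O'x; have [-> //] := hxs j; [rewrite chi1 // mul1r|case: O'x].
have DE x f j : O' x -> D j f x = pd j (f \o psi) (phi x).
  by move=> O'x; rewrite -[D j f]/(D0 (j, f)) D0E; [rewrite chi1 // mul1r|case: O'x].
have xnear x j : O' x -> \forall y \near x, xs j y = phi y 0 j.
  by move=> O'x; apply: open_near oO' O'x _ => y /xsE.
exists O', xs, D; split => //; first by move=> x [].
split => // [x i j O'x|x d f O'x hd]; have Ox : O x by case: O'x.
  have := is_derive_coord (phi x) (delta_mx 0 i) j => -[_].
  rewrite mxE eqxx /= eq_sym => <-; rewrite DE //; apply: near_eq_derive.
  have n1 : \forall u \near phi x, xs j (psi u) = phi (psi u) 0 j.
    have := chart_invcont hc (ex_intro2 _ _ x Ox erefl);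
      rewrite /prop_for /continuous_at (chartK hc) // => c.
    exact: (c _ (xnear _ j O'x)).
  have nU : nbhs (phi x) (phi @` O).
    by apply: open_nbhs_nbhs; split; [exact: chart_imopen hc|exists x].
  by apply: filterS2 n1 nU => u e [y Oy yu] /=; rewrite e -yu (chartK hc).
rewrite (pder_chart hc f Ox hd (fun j => xnear x j O'x)).
by apply: eq_bigr => j _; rewrite DE.
Qed.

Lemma frame_exists (p : S) : exists O xs D, O p /\ frame_on O xs D.
Proof.
have [_ H _] := HS; have [ O [phi [psi [Op hc]]]] := H p.
by have [ O' [xs [D [h1 h2 h3 _ _]]]] := chart_frame hc Op; exists O', xs, D.
Qed.
End Theory.
End LocallyEuclidean.

Lemma near_open (T : topologicalType) (x : T) (P : set T) : nbhs x P ->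
  exists O, [/\ open O, O x & O `<=` P].
Proof. by rewrite nbhsE => -[ O [oO Ox] OP]; exists O. Qed.

(** * Tensoriality: values at a point of forms and fields *)

Section Tensor.
Context {R : realType} {m : nat} {S : smoothSpace R}.
Hypothesis HS : leuclid m S.
Local Notation A := (Cinf S).
Local Notation V := (vfield S).

Definition Alin (L : V -> A) : Prop := forall f X Y, L (f *: X + Y) = f * L X + L Y.
Definition vfeq (x : S) (X Y : V) : Prop := forall f, X f x = Y f x.

Lemma Alin0 L : Alin L -> L 0 = 0.
Proof. by move=> hL; have := hL (-1) 0 0; rewrite scaler0 addr0 mulN1r addNr. Qed.
Lemma AlinZ L f X : Alin L -> L (f *: X) = f * L X.
Proof. by move=> hL; rewrite -[f *: X]addr0 hL Alin0 // addr0. Qed.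
Lemma AlinD L X Y : Alin L -> L (X + Y) = L X + L Y.
Proof. by move=> hL; rewrite -[X]scale1r hL mul1r scale1r. Qed.
Lemma Alin_sum L (I : Type) (s : seq I) (F : I -> V) : Alin L -> L (\sum_(i <- s) F i) =
  \sum_(i <- s) L (F i).
Proof.
by move=> hL; elim: s => [|i s IH]; rewrite ?big_nil ?Alin0 // !big_cons AlinD // IH.
Qed.
Lemma vact_sum (I : Type) (s : seq I) (F : I -> V) (f : A) : (\sum_(i <- s) F i) f =
  \sum_(i <- s) F i f.
Proof. by elim: s => [|i s IH]; rewrite ?big_nil // !big_cons vfaddE IH. Qed.
Lemma vact_scale (f : A) (X : V) g : (f *: X) g = f * X g.
Proof. by []. Qed.

Lemma form_slot (w : form S) s1 s2 : Alin (fun X => w (s1 ++ X :: s2)).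
Proof. by move=> f X Y; exact: (formP w).1. Qed.
Lemma oneform_Alin (al : oneform S) : Alin al.
Proof. by move=> f X Y; exact: oneformP. Qed.

(** Linearity of L applies only to global identities, so X is replaced by chi X, which is globally a
    combination of the frame; at x the bump function chi is 1. *)
Lemma frame_expand O xs (D : 'I_m -> V) L X x : frame_on O xs D -> Alin L -> O x ->
  L X x = \sum_j X (xs j) x * L (D j) x.
Proof.
move=> [oO _ fD] hL Ox.
have [chi [c1 c0]] := bump_at HS (open_nbhs_nbhs (conj oO Ox)).
have E : chi *: X = \sum_j (chi * X (xs j)) *: D j.
  apply: vfE => f; rewrite vact_sum vact_scale; apply: CinfP => y; rewrite Cval_sum CvalM.
  have [Oy|nOy] := pselect (O y); last first.
    rewrite (nbhs_singleton (c0 _ nOy)) mul0r big1 // => j _.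
    by rewrite vact_scale !CvalM (nbhs_singleton (c0 _ nOy)) !mul0r.
  rewrite (fD y _ f Oy (vfield_pder X y)) mulr_sumr; apply: eq_bigr => j _.
  by rewrite vact_scale !CvalM mulrA.
have := congr1 (fun Y => L Y x) E; rewrite AlinZ // CvalM (nbhs_singleton c1) mul1r => ->.
rewrite Alin_sum // Cval_sum; apply: eq_bigr => j _.
by rewrite AlinZ // !CvalM (nbhs_singleton c1) mul1r.
Qed.

Lemma Alin_eq L X Y x : Alin L -> vfeq x X Y -> L X x = L Y x.
Proof.
move=> hL e; have [ O [xs [D [Ox hf]]]] := frame_exists HS x.
rewrite !(frame_expand _ hf hL Ox); by apply: eq_bigr => j _; rewrite e.
Qed.

Lemma form_congr (w : form S) x (l : seq (V * V)) :
  (forall p, p \in l -> vfeq x p.1 p.2) -> w (unzip1 l) x = w (unzip2 l) x.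
Proof.
elim: l w => [|p l IH] w h //=.
rewrite -contractE IH; last by move=> q ql; apply: h; rewrite inE ql orbT.
rewrite contractE; apply: (Alin_eq (form_slot w [::] (unzip2 l))).
by apply: h; rewrite inE eqxx.
Qed.

(** A combination of frame fields with constant coefficients suffices, since only the value at p is
    prescribed. *)
Lemma pder_vfield (p : S) d : pder p d -> exists X : V, forall f, X f p = d f.
Proof.
move=> hd; have [ O [xs [D [Op [_ _ fD]]]]] := frame_exists HS p.
exists (\sum_j Ccst S (d (xs j)) *: D j) => f.
rewrite vact_sum Cval_sum (fD p d f Op hd); apply: eq_bigr => j _.
by rewrite vact_scale CvalM.
Qed.

Lemma mk_form (g : seq V -> S -> R) :
  (forall s (x : S), exists f : A, \forall y \near x, g s y = f y) ->
  (forall s1 s2 f X Y x, g (s1 ++ f *: X + Y :: s2) x = f x * g (s1 ++ X :: s2) x +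
    g (s1 ++ Y :: s2) x) ->
  (forall s1 s2 s3 X x, g (s1 ++ X :: s2 ++ X :: s3) x = 0) ->
  exists w : form S, forall s x, w s x = g s x.
Proof.
move=> gs gl ga.
have [w hw] := choice (fun s => glueC HS (gs s)).
have fw : (w : seq V -> (Cinf S)^o) \in is_form S.
  apply/asboolP; split=> [s1 s2 f X Y|s1 s2 s3 X]; apply: CinfP => x.
    by rewrite CvalD CvalM !hw gl.
  by rewrite hw ga.
by exists (MkForm fw).
Qed.
End Tensor.

(** * Manifolds satisfy the locally Euclidean interface *)

Section Manifold.
Context {R : realType} {n : nat} (M : manifold R n).
Implicit Types (c : chart R n M).

Definition chart_inv c (p : M) (u : 'rV[R]_n) : M := xget p [set x | chart_dom c x /\ c x = u].

Lemma atlas_chart c : atlas c -> is_chart c.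
Proof. by case: (atlasP M) => _ + _; apply. Qed.
Lemma chart_dom_open c : atlas c -> open (chart_dom c).
Proof. by move=> /atlas_chart[]. Qed.
Lemma chart_im_open c O : atlas c -> open O -> O `<=` chart_dom c -> open (c @` O).
Proof. by move=> /atlas_chart[_ _ h] oO OD; apply/h. Qed.
Lemma chart_inj c x y : atlas c -> chart_dom c x -> chart_dom c y -> c x = c y -> x = y.
Proof. by move=> /atlas_chart[_ h _] Dx Dy; apply: h; exact/mem_set. Qed.
Lemma chart_invK c p x : atlas c -> chart_dom c x -> chart_inv c p (c x) = x.
Proof.
move=> Ac Dx; rewrite /chart_inv; case: xgetP => [y _ [Dy e]|/(_ x)[]//].
exact: chart_inj e.
Qed.

Lemma manifold_chart_cont c x : atlas c -> chart_dom c x -> {for x, continuous c}.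
Proof.
move=> Ac Dx B; rewrite nbhsE /= => -[W [oW Wx] WB].
pose O := chart_dom c `&` c @^-1` W.
have cO : c @` O = W `&` c @` chart_dom c.
  apply/seteqP; split=> [_ [y [Dy Wy] <-]|z [Wz [y Dy yz]]]; first by split=> //; exists y.
  by exists y => //; split => //; rewrite /= yz.
have oO : open O.
  have [_ _ h] := atlas_chart Ac.
  apply/(h O); first by move=> y [].
  by rewrite cO; apply: openI => //; apply: chart_im_open => //; exact: chart_dom_open.
have : nbhs x O by apply: open_nbhs_nbhs.
by apply: filterS => y [_ /WB].
Qed.

Lemma chart_inv_cont c p u : atlas c -> (c @` chart_dom c) u -> {for u, continuous (chart_inv c p)}.
Proof.
move=> Ac [x Dx <-] B; rewrite chart_invK // nbhsE /= => -[ O [oO Ox] OB].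
have oOD : open (O `&` chart_dom c) by apply: openI => //; exact: chart_dom_open.
have : nbhs (c x) (c @` (O `&` chart_dom c)).
  apply: open_nbhs_nbhs; split; last by exists x.
  by apply: chart_im_open => // y [].
by apply: filterS => _ [y [Oy Dy] <-]; rewrite /= chart_invK //; exact: OB.
Qed.

Lemma smooth_read c p (h : M -> R) : atlas c -> smooth_on [set: M] h ->
  smooth_in (c @` chart_dom c) (h \o chart_inv c p).
Proof.
move=> Ac /(_ c Ac)[g sg hg] k.
have e : [set: M] `&` chart_dom c = chart_dom c by rewrite setTI.
rewrite e in sg hg; apply: Ck_ext (sg k).
  by apply: chart_im_open => //; exact: chart_dom_open.
by move=> _ [x Dx <-] /=; rewrite chart_invK // hg.
Qed.

Lemma smooth_local (h : M -> R) :
  (forall x : M, exists2 g : M -> R, smooth_on [set: M] g & \forall y \near x, h y = g y) ->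
    smooth_on [set: M] h.
Proof.
move=> hl c Ac; rewrite /smooth_via setTI.
have [p|np] := pselect (exists p : M, True); last first.
  exists (cst 0); first by move=> k; exact: Ck_cst.
  by move=> x; case: np; exists x.
have [p0 _] := p; exists (h \o chart_inv c p0) => [k|x Dx]; last by rewrite /= chart_invK.
apply: Ck_local => _ [x Dx <-]; have [g sg /near_open[ O [oO Ox e]]] := hl x.
have oOD : open (O `&` chart_dom c) by apply: openI => //; exact: chart_dom_open.
exists (c @` (O `&` chart_dom c)); split.
- by apply: chart_im_open => // y [].
- by exists x.
apply: (@Ck_ext _ _ _ _ (g \o chart_inv c p0)).
- by apply: chart_im_open => // y [].
- by move=> _ [y [Oy Dy] <-] /=; rewrite chart_invK // e.
apply: Ck_sub (smooth_read p0 Ac sg k) => _ [y [_ Dy] <-]; by exists y.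
Qed.

(** Extension by zero. The part of the chart over K is compact, hence closed by Hausdorffness, and
    its complement is a neighbourhood on which the extension vanishes. The premise of the last
    clause says that x does not lie in that part. *)
Lemma smooth_ext0 c (K : set 'rV[R]_n) (k : 'rV[R]_n -> R) : atlas c ->
  smooth_in setT k -> compact K -> K `<=` c @` chart_dom c -> (forall u, ~ K u -> k u = 0) ->
  exists h : M -> R, [/\ smooth_on [set: M] h, forall x, chart_dom c x -> h x = k (c x)
     & forall x, (forall u, K u -> c x = u -> ~ chart_dom c x) -> \forall y \near x, h y = 0].
Proof.
move=> Ac sk Kc KD k0.
pose h x := if `[< chart_dom c x >] then k (c x) else 0.
have hD x : chart_dom c x -> h x = k (c x) by move=> Dx; rewrite /h asboolT.
have h0 x : (forall u, K u -> c x = u -> ~ chart_dom c x) -> \forall y \near x, h y = 0.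
  move=> nx; pose Q := chart_inv c x @` K.
  have cQ : closed Q.
    apply: compact_closed; first exact: man_hausdorff.
    apply: continuous_compact => //; apply: continuous_in_subspaceT => u /set_mem Ku.
    exact: chart_inv_cont Ac (KD _ Ku).
  have nQ : (~` Q) x.
    move=> [u Ku]; have [y Dy yu] := KD _ Ku; rewrite -yu chart_invK // => yx.
    by apply: (nx u Ku); rewrite -?yx ?yu.
  apply: open_near (closed_openC cQ) nQ _ => y nQy; rewrite /h.
  case: asboolP => // Dy; apply: k0 => Ky; apply: nQy.
  by exists (c y) => //; rewrite chart_invK.
exists h; split => //.
have [p|np] := pselect (exists p : M, True); last first.
  move=> c' Ac'; exists (cst 0); first by move=> j; exact: Ck_cst.
  by move=> x; case: np; exists x.
have [p0 _] := p.
move=> c' Ac'; rewrite /smooth_via setTI.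
exists (h \o chart_inv c' p0) => [j|x Dx]; last by rewrite /= chart_invK.
apply: Ck_local => _ [x D'x <-].
have [Dx|nDx] := pselect (chart_dom c x).
  have oDD : open (chart_dom c `&` chart_dom c') by apply: openI; exact: chart_dom_open.
  have oV : open (c' @` (chart_dom c `&` chart_dom c')) by apply: chart_im_open => // y [].
  exists (c' @` (chart_dom c `&` chart_dom c')); split => //; first by exists x.
  have [_ _ tr] := atlasP M.
  have tr' i : exists g, smooth_in (c' @` (chart_dom c `&` chart_dom c')) g /\
      forall x, (chart_dom c `&` chart_dom c') x -> c x ord0 i = g (c' x).
    by have [g ? ?] := tr c' c i Ac' Ac; exists g.
  have [G hG] := choice tr'.
  apply: (@Ck_ext _ _ _ _ (k \o (fun u => \row_i G i u))) => //.
    move=> _ [y [Dy D'y] <-] /=; rewrite chart_invK // hD //; congr k.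
    by apply/rowP => i; rewrite mxE; have [_ ->] := hG i.
  apply: (@Ck_comp _ _ _ _ _ setT) => //; first exact: openT.
  move=> i; have -> : (fun u => (\row_i G i u) 0 i) = G i by apply/funext => u; rewrite mxE.
  by have [sG _] := hG i; exact: sG.
have [ O [oO Ox e]] := near_open (h0 x (fun _ _ _ => nDx)).
have oOD : open (O `&` chart_dom c') by apply: openI => //; exact: chart_dom_open.
have oV : open (c' @` (O `&` chart_dom c')) by apply: chart_im_open => // y [].
exists (c' @` (O `&` chart_dom c')); split => //; first by exists x.
apply: (@Ck_ext _ _ _ _ (cst 0)) => //; last exact: Ck_cst.
by move=> _ [y [Oy Dy] <-] /=; rewrite chart_invK // e.
Qed.

Definition box (a : 'rV[R]_n) (r : R) : set 'rV[R]_n := [set u | forall i, `|u 0 i - a 0 i| <= r].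

Lemma box_compact a r : compact (box a r).
Proof.
have -> : box a r = [set u : 'rV[R]_n | forall i, `[(a 0 i - r), (a 0 i + r)]%classic (u ord0 i)].
  by apply/seteqP; split=> y h i; have := h i; rewrite /= in_itv /= ler_distl //.
by apply: (@rV_compact _ _ (fun i => `[a 0 i - r, a 0 i + r]%classic)) => i; exact: segment_compact.
Qed.

Lemma box_closed a r : closed (box a r).
Proof. by apply: compact_closed; [exact: norm_hausdorff|exact: box_compact]. Qed.

Lemma cutoff (W : set 'rV[R]_n) (a : 'rV[R]_n) (g : 'rV[R]_n -> R) : open W -> W a ->
  smooth_in W g ->
  exists k r, [/\ 0 < r, smooth_in setT k, box a r `<=` W, forall u, ~ box a r u -> k u = 0
    & \forall u \near a, k u = g u].
Proof.
move=> oW Wa sg; have [e e0 eW] := nbhs_cube (open_nbhs_nbhs (conj oW Wa)).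
(* The bump function is 1 on the cube of radius e/4 and 0 off that of radius e/2; the box of radius
   e/2 that is returned stays inside the cube of radius e on which g is smooth. *)
pose r := e / 4; have r0 : 0 < r by rewrite divr_gt0.
have [f [sf f1 f0]] := bump_cube a r0.
have r20 : 0 < 2 * r by rewrite mulr_gt0.
have bW : box a (2 * r) `<=` cube a e.
  by move=> u hu i; apply: le_lt_trans (hu i) _; rewrite /r; lra.
pose k u := if `[< cube a e u >] then f u * g u else 0.
have kf u : cube a e u -> k u = f u * g u by move=> h; rewrite /k asboolT.
have k0 u : ~ box a (2 * r) u -> k u = 0.
  move=> nb; rewrite /k; case: ifP => // _; rewrite f0 ?mul0r // => cu.
  by apply: nb => i; apply: ltW; exact: cu.
exists k, (2 * r); split => //; last first.
- apply: filterS (cube_nbhs a r0) => u cu; rewrite kf ?f1 ?mul1r // => i.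
  by apply: lt_trans (cu i) _; rewrite /r; lra.
- by move=> u /bW /eW.
move=> j; apply: Ck_local => u _; have [cu|ncu] := pselect (cube a e u).
  exists (cube a e); split => //; first exact: cube_open.
  apply: (@Ck_ext _ _ _ _ (f * g)); first exact: cube_open.
    by move=> v cv; rewrite kf.
  by apply: CkM; [apply: Ck_sub (sf j)|apply: Ck_sub (sg j)].
exists (~` box a (2 * r)); split.
- exact: closed_openC (@box_closed _ _).
- by move=> /bW.
apply: (@Ck_ext _ _ _ _ (cst 0)); last exact: Ck_cst.
  exact: closed_openC (@box_closed _ _).
by move=> v /k0.
Qed.

Lemma manifold_lchart c p : atlas c -> @lchart R n (space_of M) (chart_dom c) c (chart_inv c p).
Proof.
move=> Ac; split; first split.
- exact: chart_dom_open.
- by move=> x Dx; exact: chart_invK.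
- by move=> x; exact: manifold_chart_cont.
- by apply: chart_im_open => //; exact: chart_dom_open.
- by move=> u; exact: chart_inv_cont.
split; first by move=> h; exact: smooth_read.
move=> W g x oW sg Dx Wx.
have oI : open (W `&` c @` chart_dom c).
  by apply: openI => //; apply: chart_im_open => //; exact: chart_dom_open.
have [||k [r [r0 sk bW k0 kg]]] := @cutoff _ (c x) g oI.
- by split => //; exists x.
- by move=> j; apply: Ck_sub (sg j) => u [].
have [|h [sh hD _]] := @smooth_ext0 c (box (c x) r) k Ac sk (@box_compact _ _) _ k0.
- by move=> u /bW[].
exists h => //.
have n1 : \forall y \near x, k (c y) = g (c y) by exact: (manifold_chart_cont Ac Dx kg).
have n2 : nbhs x (chart_dom c) by apply: open_nbhs_nbhs; split => //; exact: chart_dom_open.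
by apply: filterS2 n1 n2 => y e Dy; rewrite hD.
Qed.

Lemma manifold_leuclid : leuclid n (space_of M).
Proof.
have [cov _ _] := atlasP M.
split.
- exact: smooth_local.
- by move=> p; have [c Ac Dp] := cov p; exists (chart_dom c), c, (chart_inv c p); split => //;
  exact: manifold_lchart.
move=> p B; rewrite nbhsE /= => -[ O [oO Op] OB]; have [c Ac Dp] := cov p.
have oOD : open (O `&` chart_dom c) by apply: openI => //; exact: chart_dom_open.
have oI : open (c @` (O `&` chart_dom c)) by apply: chart_im_open => // y [].
have [||k [r [r0 sk bW k0 kg]]] := @cutoff _ (c p) (cst 1) oI.
- by exists p.
- by move=> j; exact: Ck_cst.
have [|h [sh hD h0]] := @smooth_ext0 c (box (c p) r) k Ac sk (@box_compact _ _) _ k0.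
- by move=> u /bW[y [_ Dy] <-]; exists y.
exists h; split => //.
  have n1 : \forall y \near p, k (c y) = cst 1 (c y) by exact: (manifold_chart_cont Ac Dp kg).
  have n2 : nbhs p (chart_dom c) by apply: open_nbhs_nbhs; split => //; exact: chart_dom_open.
  by apply: filterS2 n1 n2 => y e Dy; rewrite hD.
move=> x nBx; apply: h0 => u Ku cx Dx; apply: nBx; apply: OB.
have [y [Oy Dy] yu] := bW _ Ku; by rewrite (chart_inj Ac Dx Dy) // cx yu.
Qed.
End Manifold.

(** * Submersive graphs and the transverse manifold *)

Section ChartChange.
Context {R : realType} {m : nat} {S : smoothSpace R}.
Variables (O1 : set S) (phi1 : S -> 'rV[R]_m) (psi1 : 'rV[R]_m -> S).
Hypothesis hc : lchart O1 phi1 psi1.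

Lemma chart_change (W : set 'rV[R]_m) (F G : 'rV[R]_m -> 'rV[R]_m) :
  W `<=` phi1 @` O1 -> open W -> (forall i, smooth_in W (fun u => F u 0 i)) -> open (F @` W) ->
  (forall i, smooth_in (F @` W) (fun u => G u 0 i)) -> (forall u, W u -> G (F u) = u) ->
  lchart (O1 `&` phi1 @^-1` W) (F \o phi1) (psi1 \o G) /\
  (F \o phi1) @` (O1 `&` phi1 @^-1` W) = F @` W.
Proof.
move=> WO oW sF oFW sG GF.
have cF u : W u -> {for u, continuous F}.
  by move=> Wu; apply: continuous_row => k; exact: smooth_in_continuous (sF k) Wu.
have im : (F \o phi1) @` (O1 `&` phi1 @^-1` W) = F @` W.
  apply/seteqP; split=> [_ [x [ O1x Wx] <-]|_ [u Wu <-]]; first by exists (phi1 x).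
  by have [x O1x xu] := WO _ Wu; exists x => /=; rewrite ?xu.
split; last exact: im.
split; first split.
- rewrite openE => x [ O1x Wx].
  by have := chart_near hc O1x (open_nbhs_nbhs (conj oW Wx)); apply: filterS.
- by move=> x [ O1x Wx] /=; rewrite GF // (chartK hc).
- move=> x [ O1x Wx]; apply: continuous_comp; [exact: (chart_cont hc)|exact: cF].
- by rewrite im.
- rewrite im => _ [u Wu <-]; apply: continuous_comp; last by rewrite GF //;
  apply: (chart_invcont hc); exact: WO.
  by apply: continuous_row => k; apply: smooth_in_continuous (sG k) _; exists u.
split=> [h sh k|W2 g x oW2 sg [ O1x Wx] W2x].
  rewrite im; change (Ck k (F @` W) ((h \o psi1) \o G)).
  apply: (Ck_comp oFW oW) => //; last by move=> i; exact: sG.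
    by move=> _ [u Wu <-]; rewrite GF.
  by apply: Ck_sub WO _; case: hc => _ [+ _] => /(_ h sh); apply.
have oI : open (W `&` F @^-1` W2).
  rewrite openE => u [Wu W2u]; apply: filterI; first exact: open_nbhs_nbhs.
  by apply: (cF _ Wu); exact: open_nbhs_nbhs.
case: hc => _ [_ /(_ _ (g \o F) x oI) H]; apply: H => // k.
apply: (@Ck_comp _ _ _ _ _ W2) => //; first by move=> u [].
by move=> i; apply: Ck_sub (sF i k) => u [].
Qed.
End ChartChange.

(** A left inverse forces full column rank; the columns to be added form a basis of a complement of
    the column space. *)
Lemma complete_columns (F : fieldType) m r (J : 'M[F]_(m + r, m)) (C : 'M[F]_(m, m + r)) :
  C *m J = 1%:M -> exists B : 'M[F]_(m + r, r), row_mx J B \in unitmx.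
Proof.
move=> CJ.
have rJ : \rank J^T = m.
  apply/eqP; rewrite eqn_leq rank_leq_row /= mxrank_tr.
  by have := mxrankM_maxr C J; rewrite CJ mxrank1.
have ep : \rank (complmx J^T) = r by rewrite mxrank_compl rJ addKn.
have [B hB] : exists B : 'M[F]_(r, m + r), eqmx B (complmx J^T).
  by move: (row_base _) (eq_row_base (complmx J^T)); rewrite ep => B h; exists B.
exists B^T; rewrite -unitmx_tr tr_row_mx trmxK -row_full_unit.
have := addsmx_compl_full J^T; rewrite /row_full => /eqP e; apply/eqP; rewrite -[RHS]e.
by rewrite -(addsmxE J^T B); apply: eqmx_rank; apply/eqmxP; exact: adds_eqmx.
Qed.

(** * Smooth partial maps as graphs, and the submersion theorem *)

Section Graphs.
Context {R : realType} {S S' : smoothSpace R}.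

(** Partial maps are relations because the elements of the holonomy pseudogroup are given by graphs.
    The last clause provides the global functions that the definition of [related] quantifies
    over. *)
Definition smooth_graph (G : S -> S' -> Prop) : Prop :=
  [/\ forall x y y', G x y -> G x y' -> y = y',
      forall x y, G x y -> \forall x' \near x, exists y', G x' y',
      forall x y (B : set S'), G x y -> nbhs y B -> \forall x' \near x, forall y', G x' y' -> B y'
    & forall (h : Cinf S') x y, G x y -> exists g : Cinf S, \forall x' \near x, forall y',
      G x' y' -> g x' = h y'].

Definition submersive (G : S -> S' -> Prop) : Prop :=
  forall x y, G x y -> forall Y, exists X, related G x y X Y.
End Graphs.

Section Adapted.
Context {R : realType} {m r : nat} {S S' : smoothSpace R}.
Hypotheses (HS : leuclid (m + r) S) (HS' : leuclid m S').
Variable G : S -> S' -> Prop.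
Hypotheses (sG : smooth_graph G) (subG : submersive G).
Variables (x0 : S) (y0 : S').
Hypothesis G0 : G x0 y0.

(** The submersion theorem. The components of G are completed by linear functions to a map with
    invertible Jacobian, which the inverse function theorem makes a chart. Its image is shrunk to a
    cube so that later arguments may move along coordinate segments. *)
Lemma adapted_chart : exists (O : set S) (phi : S -> 'rV[R]_(m + r)) psi (O' : set S')
  (phi' : S' -> 'rV[R]_m) psi' e,
  [/\ lchart O phi psi, lchart O' phi' psi', O x0, O' y0 & 0 < e] /\
  [/\ phi @` O = cube (phi x0) e
    & forall x, O x -> exists2 y, G x y & O' y /\ phi' y = lsubmx (phi x)].
Proof.
case: sG => Gf Gd Gc Gs.
have [_ /(_ x0)[ O1 [phi1 [psi1 [ O1x hc1]]]] _] := HS.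
have [_ /(_ y0)[ O' [phi' [psi' [ O'y hc']]]] _] := HS'.
have [ O'' [ys [D [ O''y sub'' [oO'' Dys _] ysE _]]]] := chart_frame HS' hc' O'y.
have [g hg] := choice (fun j => Gs (ys j) _ _ G0).
pose F0 u : 'rV[R]_m := \row_j g j (psi1 u).
have [X hX] := choice (fun j => subG G0 (D j)).
pose U := phi1 @` O1.
have oU : open U := chart_imopen hc1.
have Ux : U (phi1 x0) by exists x0.
have F0E j : (fun u => F0 u 0 j) = g j \o psi1 by apply/funext => u; rewrite mxE.
have sF0 j : smooth_in U (fun u => F0 u 0 j) by rewrite F0E; exact: chart_read.
have [ O1' [xs [E [ O1'x _ [oO1' _ _] xsE _]]]] := chart_frame HS hc1 O1x.
(* Submersivity lifts the coordinate fields at y0 to fields X j; their values on the coordinates of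
   S form a left inverse of the Jacobian. *)
have CJ : (\matrix_(j, a) X j (xs a) x0) *m jac F0 (phi1 x0) = 1%:M.
  apply/matrixP => j k; rewrite !mxE -(Dys _ _ _ O''y) -(hX j (ys k) (g k) (hg k)).
  rewrite (pder_chart HS hc1 (g k) O1x (vfield_pder (X j) x0) (xs := xs)); last first.
    by move=> a; apply: open_near oO1' O1'x _ => z /xsE.
  by apply: eq_bigr => a _; rewrite !mxE F0E.
have [B uB] := complete_columns CJ.
pose F u : 'rV[R]_(m + r) := row_mx (F0 u) (u *m B).
have FlE j : (fun u => F u 0 (lshift r j)) = (fun u => F0 u 0 j).
  by apply/funext => u; rewrite row_mxEl.
have FrE k : (fun u => F u 0 (rshift m k)) = (fun u : 'rV[R]_(m + r) => \sum_a u 0 a * B a k).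
  by apply/funext => u; rewrite row_mxEr mxE.
have sF V i : V `<=` U -> smooth_in V (fun u => F u 0 i).
  move=> VU k; apply: Ck_sub VU _; rewrite -(splitK i); case: (fintype.split i) => j /=.
    by rewrite FlE; exact: sF0.
  rewrite FrE; apply: Ck_sum => a;
    apply: (@CkM _ _ _ _ (fun u : 'rV[R]_(m + r) => u 0 a) (cst (B a j))).
    exact: Ck_coord.
  exact: Ck_cst.
have jF : jac F (phi1 x0) = row_mx (jac F0 (phi1 x0)) B.
  apply/matrixP => i j; rewrite mxE -(splitK j); case: (fintype.split j) => k /=.
    by rewrite FlE row_mxEl mxE.
  rewrite FrE row_mxEr; apply: derive_val; apply: is_derive_eq.
    by apply: is_derive_sumr => a; apply: is_derive_mulr; exact: is_derive_coord.
  rewrite (bigD1 i) //= big1 => [|a ai]; first by rewrite mxE !eqxx mul1r addr0.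
  by rewrite mxE eqxx (negPf ai) mul0r.
have good : \forall x \near x0, exists2 y, G x y & O'' y /\ forall j, g j x = ys j y.
  have n1 := Gd _ _ G0; have n2 := Gc _ _ _ G0 (open_nbhs_nbhs (conj oO'' O''y)).
  have n3 : \forall x \near x0, forall j, forall y, G x y -> g j x = ys j y by exact: filter_forall.
  by apply: filterS3 n1 n2 n3 => x [y Gxy] h2 h3; exists y => //; split;
    [exact: h2|move=> j; exact: h3].
have : \forall u \near phi1 x0, U u /\ exists2 y, G (psi1 u) y & O'' y /\ forall j, g j (psi1 u) =
  ys j y.
  apply: filterI; first exact: open_nbhs_nbhs.
  have := chart_invcont hc1 Ux; rewrite /prop_for /continuous_at (chartK hc1) // => c.
  exact: (c _ good).
move=> /near_open[U0 [oU0 U0x U0P]].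
have U0U : U0 `<=` U by move=> u /U0P[].
have [||W [Gi [[oW Wx WU0 oFW] [GiF sGi]]]] := inverse_function oU0 U0x (F := F).
- by move=> i; exact: sF.
- by rewrite jF.
have [e e0 eW] := nbhs_cube (open_nbhs_nbhs (conj oFW (ex_intro2 _ _ _ Wx erefl))).
pose W' := W `&` F @^-1` cube (F (phi1 x0)) e.
have imW' : F @` W' = cube (F (phi1 x0)) e.
  apply/seteqP; split=> [_ [u [Wu cu] <-] //|z cz].
  by have [u Wu uz] := eW _ cz; exists u => //; split => //; rewrite /= uz.
have W'U : W' `<=` U by move=> u [/WU0 /U0U].
have oW' : open W'.
  rewrite openE => u [Wu cu]; apply: filterI; first exact: open_nbhs_nbhs.
  have cF : {for u, continuous F}.
    by apply: continuous_row => k; apply: smooth_in_continuous (sF _ k U0U) _; exact: WU0.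
  by apply: cF; apply: open_nbhs_nbhs; split => //; exact: cube_open.
have [|||||hc im] := chart_change hc1 (W := W') (F := F) (G := Gi) W'U.
- by [].
- by move=> i; exact: sF.
- by rewrite imW'; exact: cube_open.
- by move=> i k; rewrite imW'; apply: Ck_sub (sGi i k).
- by move=> u [Wu _]; exact: GiF.
exists (O1 `&` phi1 @^-1` W'), (F \o phi1), (psi1 \o Gi), O', phi', psi', e.
split; split => //.
- by split => //; split => //; exact: cubexx.
- by rewrite im.
move=> x [ O1x' [Wx' _]]; have [_ [y]] := U0P _ (WU0 _ Wx').
rewrite (chartK hc1) // => Gxy [ O''y' e']; exists y => //; split; first exact: sub''.
by rewrite /= row_mxKl; apply/rowP => j; rewrite mxE (chartK hc1) // e' ysE.
Qed.

Lemma derive_lsubmx (k : 'rV[R]_m -> R) (u v : 'rV[R]_(m + r)) :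
  'D_v (fun u => k (lsubmx u)) u = 'D_(lsubmx v) k (lsubmx u).
Proof.
rewrite /derive.
set f1 := fun h : R => _; set f2 := fun h : R => _; suff -> : f1 = f2 by [].
by apply/funext => h; rewrite /f1 /f2 /= -linearZ -linearD.
Qed.

Lemma derive_dir0 (k : 'rV[R]_m -> R) (u : 'rV[R]_m) : 'D_0 k u = 0.
Proof.
apply: cvg_lim => //; set f := fun h : R => _.
suff -> : f = cst 0 by exact: cvg_cst.
by apply/funext => h; rewrite /f /= scaler0 add0r subrr scaler0.
Qed.

Lemma lsubmx_delta (a : 'I_(m + r)) : lsubmx (delta_mx 0 a : 'rV[R]_(m + r)) =
  if fintype.split a is inl j then delta_mx 0 j else 0.
Proof.
apply/rowP => i; rewrite !mxE eqxx /= -[in LHS](splitK a) /unsplit.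
case: (fintype.split a) => j; rewrite !mxE ?eqxx /=; first by rewrite (inj_eq (@lshift_inj _ _)).
by rewrite eq_lrshift.
Qed.

Lemma adapted_derive (O : set S) (phi : S -> 'rV[R]_(m + r)) psi (O' : set S')
  (phi' : S' -> 'rV[R]_m) psi' :
  lchart O phi psi -> lchart O' phi' psi' ->
  (forall x, O x -> exists2 y, G x y & O' y /\ phi' y = lsubmx (phi x)) ->
  forall x y v (h : Cinf S') (g : Cinf S), O x -> G x y ->
  (\forall x' \near x, forall y', G x' y' -> g x' = h y') ->
  'D_v (g \o psi) (phi x) = 'D_(lsubmx v) (h \o psi') (phi' y).
Proof.
move=> hc hc' ad x y v h g Ox Gxy gh; have [Gf _ _ _] := sG.
have [y1 /(Gf _ _ _ Gxy) <- [_ yE]] := ad _ Ox.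
rewrite yE -derive_lsubmx; apply: near_eq_derive.
have im' : (phi @` O) (phi x) by exists x.
have n1 : \forall u \near phi x, forall y', G (psi u) y' -> g (psi u) = h y'.
  have := chart_invcont hc im'; rewrite /prop_for /continuous_at (chartK hc) // => c.
  exact: (c _ gh).
apply: filterS2 n1 (open_nbhs_nbhs (conj (chart_imopen hc) im')) => u gu [z Oz zu] /=.
have [y' Gy' [ O'y' y'E]] := ad _ Oz.
have := gu y'; rewrite -zu (chartK hc) // => -> //.
by rewrite -y'E (chartK hc').
Qed.

(* In adapted charts the graph reads [u |-> lsubmx u]. *)
Lemma adapted_frame : exists (Q : set S) xs E (Q' : set S') ys D,
  [/\ frame_on Q xs E, frame_on Q' ys D, Q x0
    & forall x y, Q x -> G x y -> [/\ Q' y, forall j, xs (lshift r j) x = ys j y,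
        forall j, related G x y (E (lshift r j)) (D j) & forall k,
          related G x y (E (rshift m k)) 0]].
Proof.
have [ O [phi [psi [ O' [phi' [psi' [e [[hc hc' Ox O'y e0] [im ad]]]]]]]]] := adapted_chart.
have [Gf _ Gc _] := sG.
have [Q [xs [E [Qx QO fQ xsE EE]]]] := chart_frame HS hc Ox.
have [Q' [ys [D [Q'y Q'O fQ' ysE DE]]]] := chart_frame HS' hc' O'y.
have oQ : open Q by case: fQ.
have oQ' : open Q' by case: fQ'.
pose P : set S := [set x : S | \forall x' \near x, forall y', G x' y' -> Q' y'].
have oP : open P by rewrite openE => x /nbhs_interior.
have Px : P x0 by apply: Gc G0 _; exact: open_nbhs_nbhs.
have key x y : (Q `&` P) x -> G x y -> [/\ Q' y, O x & phi' y = lsubmx (phi x)].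
  move=> [Qx' Px'] Gxy; have Ox' := QO _ Qx'; have [z Gxz [_ zE]] := ad _ Ox'.
  by split => //; [exact: (nbhs_singleton Px')|rewrite (Gf _ _ _ Gxy Gxz)].
have rel x y a (h : Cinf S') (g : Cinf S) : (Q `&` P) x -> G x y ->
    (\forall x' \near x, forall y', G x' y' -> g x' = h y') ->
    E a g x = 'D_(lsubmx (delta_mx 0 a)) (h \o psi') (phi' y).
  move=> QPx Gxy gh; have [_ Ox' _] := key _ _ QPx Gxy.
  rewrite EE; last by case: QPx.
  exact: (adapted_derive hc hc' ad).
exists (Q `&` P), xs, E, Q', ys, D; split => //.
  case: fQ => _ f1 f2; split; first exact: openI.
    by move=> x i j [Qx' _]; exact: f1.
  by move=> x d f [Qx' _]; exact: f2.
move=> x y QPx Gxy; have [Q'y' Ox' yE] := key _ _ QPx Gxy; split => //.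
- by move=> j; rewrite xsE ?ysE ?yE ?mxE //; case: QPx.
- move=> j h g gh; rewrite (rel _ _ _ _ _ QPx Gxy gh) (DE y h j Q'y') lsubmx_delta.
  by rewrite -[lshift r j]/(unsplit (inl j)) unsplitK.
- move=> k h g gh; rewrite (rel _ _ _ _ _ QPx Gxy gh) lsubmx_delta.
  by rewrite -[rshift m k]/(unsplit (inr k)) unsplitK /= derive_dir0.
Qed.

(** In adapted charts the graph is a linear projection, and freezing the last r coordinates at those
    of x0 gives a continuous section through x0. *)
Lemma graph_open_map (A : set S) : nbhs x0 A -> \forall y \near y0, exists2 x, A x & G x y.
Proof.
have [ O [phi [psi [ O' [phi' [psi' [e [[hc hc' Ox O'y e0] [im ad]]]]]]]]] := adapted_chart.
have [Gf _ Gc _] := sG.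
move=> nA; have y0E : phi' y0 = lsubmx (phi x0).
  by have [z /(Gf _ _ _ G0) <- []] := ad _ Ox.
pose ext (v : 'rV[R]_m) := row_mx v (rsubmx (phi x0)).
have extx : ext (phi' y0) = phi x0 by rewrite /ext y0E hsubmxK.
have cext : {for phi' y0, continuous ext}.
  apply: continuous_row => k; rewrite /ext -(splitK k); case: (fintype.split k) => j /=.
    have -> : (fun v : 'rV[R]_m => row_mx v (rsubmx (phi x0)) 0 (lshift r j)) = (fun v => v 0 j).
      by apply/funext => v; rewrite row_mxEl.
    exact: coord_continuous.
  have -> : (fun v : 'rV[R]_m => row_mx v (rsubmx (phi x0)) 0 (rshift m j)) =
    cst (rsubmx (phi x0) 0 j).
    by apply/funext => v; rewrite row_mxEr.
  exact: cst_continuous.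
have imx : (phi @` O) (phi x0) by exists x0.
have nAO : nbhs x0 (A `&` O) by apply: filterI => //;
  exact: open_nbhs_nbhs (conj (chart_open hc) Ox).
have n1 : \forall v \near phi' y0, (phi @` O) (ext v) /\ (A `&` O) (psi (ext v)).
  apply: (cext (fun u => (phi @` O) u /\ (A `&` O) (psi u))); rewrite extx; apply: filterI.
    by apply: open_nbhs_nbhs; split => //; exact: (chart_imopen hc).
  have := chart_invcont hc imx; rewrite /prop_for /continuous_at (chartK hc) // => c.
  exact: (c _ nAO).
apply: filterS (chart_near hc' O'y n1) => y [ O'y' [[x Ox' xE] [Ax _]]].
exists x; first by rewrite -(chartK hc Ox') xE.
have [z Gxz [ O'z zE]] := ad _ Ox'.
suff -> : y = z by [].
by rewrite -(chartK hc' O'y') -(chartK hc' O'z) zE xE row_mxKl.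
Qed.

(** The lift has to be related to Y on a whole neighbourhood, since brackets are controlled only
    then. It combines the first m adapted frame fields with the pulled back coefficients of Y. *)
Lemma related_lift Y : exists X, \forall x \near x0, forall y, G x y -> related G x y X Y.
Proof.
have [Q [xs [E [Q' [ys [D [[oQ _ _] [_ _ fD] Qx ad]]]]]]] := adapted_frame.
have [_ _ _ Gs] := sG.
have [g hg] := choice (fun j => Gs (Y (ys j)) _ _ G0).
exists (\sum_j g j *: E (lshift r j)).
have n1 : \forall x \near x0, forall j, forall y, G x y ->
  g j x = Y (ys j) y by exact: filter_forall.
apply: filterS2 n1 (open_nbhs_nbhs (conj oQ Qx)) => x gE Qx' y Gxy h k hk.
have [Q'y _ rl _] := ad _ _ Qx' Gxy.
rewrite vact_sum Cval_sum (fD y _ h Q'y (vfield_pder Y y)); apply: eq_bigr => j _.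
by rewrite vact_scale CvalM (gE j _ Gxy) (rl j h k hk).
Qed.

(** The components of a vertical vector along the first m adapted frame fields vanish, and the
    remaining frame fields are vertical throughout; constant coefficients extend the vector. *)
Lemma related0_extend V : related G x0 y0 V 0 ->
  exists V', vfeq x0 V V' /\ \forall x \near x0, forall y, G x y -> related G x y V' 0.
Proof.
move=> rV; have [Q [xs [E [Q' [ys [D [[oQ _ fE] _ Qx ad]]]]]]] := adapted_frame.
have [Q'y0 _ _ _] := ad _ _ Qx G0.
exists (\sum_k Ccst S (V (xs (rshift m k)) x0) *: E (rshift m k)); split; last first.
  apply: open_near oQ Qx _ => x Qx' y Gxy h g hg; rewrite vact_sum Cval_sum big1 // => k _.
  have [_ _ _ /(_ k h g hg) e] := ad _ _ Qx' Gxy.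
  by rewrite vact_scale CvalM e mulr0.
move=> f; rewrite (fE x0 _ f Qx (vfield_pder V x0)) big_split_ord /= big1 ?add0r => [|j _].
  by rewrite vact_sum Cval_sum; apply: eq_bigr => k _; rewrite vact_scale CvalM.
rewrite (rV (ys j)) ?mul0r //.
by apply: open_near oQ Qx _ => x Qx' y Gxy; have [_ -> ] := ad _ _ Qx' Gxy.
Qed.

(** Vanishing vertical derivatives make g independent of the last r coordinates on a cube, by the
    mean value theorem; the function on S' is then read off on the slice through x0. *)
Lemma factor_through (g : Cinf S) :
  (\forall x \near x0, forall y, G x y -> forall V, related G x y V 0 -> V g x = 0) ->
  exists h : Cinf S', \forall x \near x0, forall y, G x y -> g x = h y.
Proof.
move=> gV; have [ O [phi [psi [ O' [phi' [psi' [e [[hc hc' Ox O'y e0] [im ad]]]]]]]]] :=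
  adapted_chart.
have [Gf _ Gc _] := sG.
have imx : (phi @` O) (phi x0) by exists x0.
have [e1 e10 e1P] : exists2 e1, 0 < e1 & cube (phi x0) e1 `<=` [set u | (phi @` O) u /\
    forall y, G (psi u) y -> forall V, related G (psi u) y V 0 -> V g (psi u) = 0].
  apply: nbhs_cube; apply: filterI; first exact: open_nbhs_nbhs (conj (chart_imopen hc) imx).
  have := chart_invcont hc imx; rewrite /prop_for /continuous_at (chartK hc) // => c.
  exact: (c _ gV).
have sg : smooth_in (phi @` O) (g \o psi) := chart_read hc g.
have pd0 u k : cube (phi x0) e1 u -> pd (rshift m k) (g \o psi) u = 0.
  move=> /e1P[[x Ox' <-]]; rewrite (chartK hc) // => gx.
  have [y Gxy _] := ad _ Ox'.
  have [V VE] := pder_vfield HS (pd_pder hc (rshift m k) Ox').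
  rewrite -VE (gx _ Gxy) // => h g' hg'; rewrite VE.
  rewrite [LHS](adapted_derive hc hc' ad _ Ox' Gxy hg') lsubmx_delta.
  by rewrite -[rshift m k]/(unsplit (inr k)) unsplitK derive_dir0.
pose ext (v : 'rV[R]_m) := row_mx v (rsubmx (phi x0)).
have extc u : cube (phi x0) e1 u -> cube (phi x0) e1 (ext (lsubmx u)).
  move=> cu i; rewrite -(splitK i); case: (fintype.split i) => j /=.
    by rewrite row_mxEl mxE; exact: cu.
  by rewrite row_mxEr mxE subrr normr0.
have gE u : cube (phi x0) e1 u -> g (psi u) = g (psi (ext (lsubmx u))).
  move=> cu; have cm t : (forall i, 0 <= t i <= 1) -> cube (phi x0) e1 (mix (ext (lsubmx u)) u t).
    by move=> t01; apply: cube_mid => //; exact: extc.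
  have [t j t01|t t01] := @mvt_slopes _ _ (g \o psi) (ext (lsubmx u)) u.
    apply: smooth_in_derivable (chart_imopen hc) sg _; by have [] := e1P _ (cm _ t01).
  rewrite big_split_ord /= !big1 ?addr0 => [/eqP|k _|k _].
  - by rewrite subr_eq0 => /eqP.
  - by rewrite pd0 ?mulr0 //; exact: cm.
  - by rewrite row_mxEl mxE subrr mul0r.
have y0E : phi' y0 = lsubmx (phi x0) by have [z /(Gf _ _ _ G0) <- []] := ad _ Ox.
have cext v : cube (phi' y0) e1 v -> cube (phi x0) e1 (ext v).
  rewrite y0E => cv i; rewrite -(splitK i); case: (fintype.split i) => j /=.
    by rewrite row_mxEl; have := cv j; rewrite mxE.
  by rewrite row_mxEr mxE subrr normr0.
have sh : smooth_in (cube (phi' y0) e1) (fun v => g (psi (ext v))).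
  move=> k; apply: (Ck_comp (cube_open e10) (chart_imopen hc) _ (sg k)) => [v /cext /e1P[]//|i].
  rewrite -(splitK i); case: (fintype.split i) => j /=.
    apply: Ck_ext (Ck_coord _ _ j); first exact: cube_open.
    by move=> v _; rewrite row_mxEl.
  apply: Ck_ext (Ck_cst _ _ (rsubmx (phi x0) 0 j)); first exact: cube_open.
  by move=> v _; rewrite row_mxEr.
have [h hh] := chart_lift hc' (cube_open e10) sh O'y (cubexx _ e10).
exists h; have n1 := Gc _ _ _ G0 hh; have n2 := chart_near hc Ox (cube_nbhs _ e10).
apply: filterS2 n1 n2 => x h1 [Ox' cx] y Gxy; rewrite (h1 _ Gxy).
have [z /(Gf _ _ _ Gxy) <- [_ ->]] := ad _ Ox'.
by rewrite -gE // (chartK hc).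
Qed.
End Adapted.

(** * Graphs of smooth maps between manifolds *)

Section MapsOfManifolds.
Context {R : realType} {m n : nat} (M : manifold R m) (N : manifold R n).
Variables (V : set M) (f : M -> N).
Hypotheses (oV : open V) (sf : smooth_map V f).

Lemma smooth_map_near (k : 'rV[R]_n -> R) c (W : set 'rV[R]_n) x :
  atlas c -> open W -> smooth_in W k -> V x -> chart_dom c (f x) -> W (c (f x)) ->
  exists g : Cinf (space_of M), \forall x' \near x, g x' = k (c (f x')).
Proof.
move=> Ac oW sk Vx Dfx Wx; have [cf scf] := sf.
have [cov _ _] := atlasP M; have [c0 Ac0 D0x] := cov x.
pose O := [set x' | [/\ V x', chart_dom c (f x') & chart_dom c0 x']].
have oO : open O.
  rewrite openE => x' [Vx' Dx' D0x'].
  have n1 : nbhs x' (f @^-1` chart_dom c).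
    by apply: (cf _ Vx'); apply: open_nbhs_nbhs; split => //; exact: chart_dom_open.
  have n2 : nbhs x' (chart_dom c0) by apply: open_nbhs_nbhs; split => //; exact: chart_dom_open.
  by apply: filterS3 n1 n2 (open_nbhs_nbhs (conj oV Vx')).
have OE : V `&` f @^-1` chart_dom c `&` chart_dom c0 = O.
  by apply/seteqP; split=> [x' [[? ?] ?]|x' [? ? ?]]; split.
have sm j : exists g, smooth_in (c0 @` O) g /\ forall x', O x' -> c (f x') ord0 j = g (c0 x').
  by have [g sg hg] := scf c j Ac c0 Ac0; rewrite OE in sg hg; exists g.
have [g hg] := choice sm.
pose p u : 'rV[R]_n := \row_j g j u.
have pE x' : O x' -> p (c0 x') = c (f x').
  by move=> Ox'; apply/rowP => j; rewrite mxE; have [_ <-] := hg j.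
have oI : open (c0 @` O) by apply: chart_im_open => // y [].
have cp u : (c0 @` O) u -> {for u, continuous p}.
  move=> Ou; apply: continuous_row => j.
  have -> : (fun y => p y 0 j) = g j by apply/funext => y; rewrite mxE.
  by have [sg _] := hg j; exact: smooth_in_continuous sg Ou.
have oI' : open (c0 @` O `&` p @^-1` W).
  rewrite openE => u [Ou Wu]; apply: filterI; first exact: open_nbhs_nbhs.
  by apply: (cp _ Ou); exact: open_nbhs_nbhs.
have spk : smooth_in (c0 @` O `&` p @^-1` W) (k \o p).
  move=> i; apply: (Ck_comp oI' oW _ (sk i)) => [u []//|j].
  have -> : (fun y => p y 0 j) = g j by apply/funext => y; rewrite mxE.
  by have [sg _] := hg j; apply: Ck_sub (sg i) => u [].
have Ox : O x by split.
have [|h hh] := chart_lift (manifold_lchart x Ac0) oI' spk D0x; first by split;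
  [exists x|rewrite /= pE].
exists h; apply: filterS2 hh (open_nbhs_nbhs (conj oO Ox)) => x' e Ox'.
by rewrite e /= pE.
Qed.

Lemma graph_on_smooth : @smooth_graph R (space_of M) (space_of N) (graph_on V f).
Proof.
have [cf _] := sf; split.
- by move=> x y y' [_ ->] [_ ->].
- by move=> x y [Vx _]; apply: open_near oV Vx _ => x' Vx'; exists (f x').
- move=> x y B [Vx ->] nB; have n1 : \forall x' \near x, B (f x') := cf _ Vx _ nB.
  by move: n1; apply: filterS => x' Bx' y' [_ ->].
- move=> h x y [Vx _]; have [cov _ _] := atlasP N; have [c Ac Dc] := cov (f x).
  have oD : open (c @` chart_dom c) by apply: chart_im_open => //; exact: chart_dom_open.
  have sh := smooth_read (f x) Ac (Cinf_smooth h).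
  have [|g hg] := smooth_map_near Ac oD sh Vx Dc; first by exists (f x).
  exists g; have n1 : nbhs x (f @^-1` chart_dom c).
    by apply: (cf _ Vx); apply: open_nbhs_nbhs; split => //; exact: chart_dom_open.
  by apply: filterS2 hg n1 => x' e Dx' y' [_ ->]; rewrite e /= chart_invK.
Qed.
End MapsOfManifolds.

(** * The transverse manifold and its projection maps *)

Section TransverseSpace.
Context {R : realType} {n q : nat} {M : manifold R n} (F : foliation q M).
Local Notation N := (fol_target F).
Local Notation T := (transverse F).
Implicit Types (i : fol_idx F).

Definition fol_graph i : space_of M -> space_of N -> Prop := graph_on (fol_dom i) (fol_map i).

Lemma fol_graph_smooth i : smooth_graph (fol_graph i).
Proof. by apply: graph_on_smooth; [exact: fol_dom_open|have [] := fol_map_submersion i]. Qed.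

Lemma fol_graph_submersive i : submersive (fol_graph i).
Proof. by move=> x y [Vx ->] Y; have [_ h] := fol_map_submersion i; exact: h. Qed.

Lemma manifold_split_leuclid : leuclid (2 * q + (n - 2 * q)) (space_of M).
Proof. by rewrite subnKC; [exact: manifold_leuclid|exact: fol_codim F]. Qed.

Lemma fol_open_map i (A : set M) x : fol_dom i x -> nbhs x A ->
  nbhs (fol_map i x) (fol_map i @` (A `&` fol_dom i)).
Proof.
move=> Vx nA.
have := graph_open_map manifold_split_leuclid (manifold_leuclid N) (fol_graph_smooth i)
  (@fol_graph_submersive i) (conj Vx erefl) nA.
by apply: filterS => y [x' Ax' [Vx' ->]]; exists x'.
Qed.

Lemma fol_image_open i (O : set M) : open O -> open (fol_map i @` (O `&` fol_dom i)).
Proof.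
move=> oO; rewrite openE => _ [x [Ox Vx] <-]; exact: fol_open_map Vx (open_nbhs_nbhs (conj oO Ox)).
Qed.

Lemma piece_open i : open (piece i).
Proof. by have := @fol_image_open i setT openT; rewrite setTI. Qed.

Lemma pieceP i (y : piece i) : piece i (set_val y).
Proof. exact: set_valP. Qed.

Lemma transverse_nbhs i (y : piece i) (A : set T) : nbhs (existT _ i y : T) A <->
  exists W : set N, [/\ open W, W (set_val y) & forall y' : piece i, W (set_val y') ->
    A (existT _ i y')].
Proof.
change (nbhs y (existT _ i @^-1` A) <-> exists W : set N, [/\ open W, W (set_val y)
  & forall y' : piece i, W (set_val y') -> A (existT _ i y')]).
rewrite nbhsE; split=> [[ O [[W oW <-] Wy] OA]|[W [oW Wy WA]]].
  by exists W; split => // y' Wy'; exact: OA.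
by exists (set_val @^-1` W) => //; split => //; exists W.
Qed.

Lemma nearP_transverse i (y : piece i) (P : T -> Prop) :
  (\forall z \near set_val y, forall y' : piece i, set_val y' = z -> P (existT _ i y')) <->
  \forall t \near (existT _ i y : T), P t.
Proof.
split=> [/near_open[W [oW Wy h]]|/transverse_nbhs[W [oW Wy h]]].
  by apply/transverse_nbhs; exists W; split => // y' /h; exact.
by apply: open_near oW Wy _ => z Wz y' yz; apply: h; rewrite yz.
Qed.

Definition forget_piece : T -> N := fun t => set_val (projT2 t).

Lemma transverse_of_target (h : Cinf (space_of N)) : exists g : Cinf T, forall t,
  g t = h (forget_piece t).
Proof.
have sg : smooth_fun ((fun t => h (forget_piece t)) : T -> R).
  move=> i c Ac; have [g sg hg] := (Cinf_smooth h : smooth_on setT h) c Ac; exists g.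
    by move=> k; apply: Ck_sub (sg k) => _ [y [_ Dy] <-]; exists y.
  by move=> y Dy; apply: hg.
by exists (mkC sg).
Qed.

(** A smooth function on the union of the pieces need not come from T_0, but its germ at each point
    does; this transfers statements between the two spaces. *)
Lemma target_near (h : Cinf T) i (y : piece i) : exists g : Cinf (space_of N),
  \forall z \near set_val y, forall y' : piece i, set_val y' = z -> g z = h (existT _ i y').
Proof.
have [cov _ _] := atlasP N; have [c Ac Dy] := cov (set_val y).
have [k sk hk] := Cinf_smooth h i c Ac.
have oPD : open (piece i `&` chart_dom c) by apply: openI;
  [exact: piece_open|exact: chart_dom_open].
have oI : open (c @` (piece i `&` chart_dom c)) by apply: chart_im_open => // z [].
have [|g hg] := chart_lift (manifold_lchart (set_val y) Ac) oI sk Dy.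
  by exists (set_val y) => //; split => //; exact: pieceP.
exists g; have nD : nbhs (set_val y) (chart_dom c) by apply: open_nbhs_nbhs; split => //;
  exact: chart_dom_open.
by apply: filterS2 hg nD => z e Dz y' yz; rewrite e hk yz.
Qed.

Lemma transverse_smooth_local (h : T -> R) :
  (forall t : T, exists2 g : T -> R, transverse_smooth g & \forall t' \near t, h t' = g t') ->
    transverse_smooth h.
Proof.
move=> hl i c Ac.
have ex (u : 'rV[R]_(2 * q)) : exists r : R, forall y : piece i, chart_dom c (set_val y) ->
  c (set_val y) = u -> h (existT _ i y) = r.
  have [[y [Dy yu]]|ny] := pselect (exists y : piece i, chart_dom c (set_val y) /\ c (set_val y) =
    u).
    exists (h (existT _ i y)) => y' Dy' y'u; congr (h (existT _ i _)); apply: val_inj.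
    by rewrite -!set_valE; apply: (chart_inj Ac) => //; rewrite y'u.
  by exists 0 => y Dy yu; case: ny; exists y.
have [g hg] := choice ex; exists g; last by move=> y Dy; exact: hg.
move=> k; apply: Ck_local => _ [z [pz Dz] <-].
have [y yz] : exists y : piece i, set_val y = z by exists (SigSub (mem_set pz)).
have [g0 sg0] := hl (existT _ i y); move=> /transverse_nbhs[W [oW Wy hW]].
have [g1 sg1 hg1] := sg0 i c Ac.
have oD : open (W `&` (piece i `&` chart_dom c)).
  by apply: openI => //; apply: openI; [exact: piece_open|exact: chart_dom_open].
have oI : open (c @` (W `&` (piece i `&` chart_dom c))) by apply: chart_im_open => // v [_ []].
exists (c @` (W `&` (piece i `&` chart_dom c))); split => //.
  by exists z => //; split => //; rewrite -yz.
apply: Ck_ext oI _ (Ck_sub _ (sg1 k)); last by move=> _ [v [_ Dv] <-]; exists v.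
move=> _ [v [Wv [pv Dv]] <-].
have [y' y'v] : exists y' : piece i, set_val y' = v by exists (SigSub (mem_set pv)).
by rewrite -y'v in Wv Dv *; rewrite -(hg _ y') // -hg1 // hW.
Qed.

Lemma forget_piece_cont (t : T) : {for t, continuous forget_piece}.
Proof.
case: t => i y B nB; have := (@nearP_transverse i y (fun t => B (forget_piece t))).1; apply.
by apply: filterS nB => z Bz y' y'z; rewrite -y'z in Bz.
Qed.

Lemma transverse_chart c i (y0 : piece i) : atlas c -> chart_dom c (set_val y0) ->
  exists psi, @lchart R (2 * q) T [set t | projT1 t = i /\ chart_dom c (forget_piece t)]
    (c \o forget_piece) psi.
Proof.
move=> Ac Dy0; set O := [set t | _].
pose psi (u : 'rV[R]_(2 * q)) : T :=
  xget (existT _ i y0) [set t : T | O t /\ c (forget_piece t) = u].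
have OP t : O t -> exists y : piece i, t = existT _ i y /\ chart_dom c (set_val y).
  by case: t => j y [/= ji]; subst j => Dy; exists y.
have inj t t' : O t -> O t' -> c (forget_piece t) = c (forget_piece t') -> t = t'.
  move=> /OP[y [-> Dy]] /OP[y' [-> Dy']] e; congr existT; apply: val_inj.
  by rewrite -!set_valE; apply: (chart_inj Ac).
have psiK t : O t -> psi (c (forget_piece t)) = t.
  move=> Ot; rewrite /psi; case: xgetP => [t' _ [Ot' e]|/(_ t)[]//].
  exact: inj.
have imO (W : set N) : (c \o forget_piece) @` (O `&` forget_piece @^-1` W) =
  c @` (W `&` (piece i `&` chart_dom c)).
  apply/seteqP; split=> [_ [t [Ot Wt] <-]|_ [z [Wz [pz Dz]] <-]].
    have [y [e Dy]] := OP _ Ot; move: Wt; rewrite e => Wy; exists (set_val y) => //.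
    by split => //; split => //; exact: pieceP.
  have [y yz] : exists y : piece i, set_val y = z by exists (SigSub (mem_set pz)).
  by exists (existT _ i y); rewrite /= /forget_piece /= yz //; split => //; split => //=;
    rewrite /forget_piece /= yz.
have oI (W : set N) : open W -> open ((c \o forget_piece) @` (O `&` forget_piece @^-1` W)).
  move=> oW; rewrite imO; apply: chart_im_open => //; last by move=> z [_ []].
  by apply: openI => //; apply: openI; [exact: piece_open|exact: chart_dom_open].
have OT : O `&` forget_piece @^-1` setT = O by rewrite preimage_setT setIT.
exists psi; split; first split.
- rewrite openE => t Ot; have [y [e Dy]] := OP _ Ot; rewrite e; apply/transverse_nbhs.
  by exists (chart_dom c); split => //; exact: chart_dom_open.
- by move=> t; exact: psiK.
- move=> t Ot; have [y [e Dy]] := OP _ Ot; apply: continuous_comp; first exact: forget_piece_cont.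
  by apply: manifold_chart_cont => //; rewrite e.
- by rewrite -OT; apply: oI; exact: openT.
- move=> _ [t Ot <-] B; rewrite /= psiK //; have [y [e Dy]] := OP _ Ot; rewrite e.
  move=> /transverse_nbhs[W [oW Wy WB]].
  have := oI _ oW => oIW; apply: open_near oIW _ _.
    by exists t; rewrite e.
  move=> _ [t' [Ot' Wt'] <-] /=; rewrite psiK //; have [y' [e' _]] := OP _ Ot'.
  by rewrite e'; apply: WB; move: Wt'; rewrite e'.
have OE : (c \o forget_piece) @` O = c @` (piece i `&` chart_dom c).
  by rewrite -OT imO setTI.
split=> [h sh k|W g t oW sg Ot Wt].
  have [g sg hg] := sh i c Ac; rewrite OE; apply: Ck_ext (sg k); first by rewrite -OE -OT;
    apply: oI; exact: openT.
  move=> _ [z [pz Dz] <-].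
  have [y yz] : exists y : piece i, set_val y = z by exists (SigSub (mem_set pz)).
  have Oy : O (existT _ i y) by split => //=; rewrite /forget_piece /= yz.
  have := psiK _ Oy; rewrite /= /forget_piece /= yz => ->.
  by rewrite hg yz.
have [y [e Dy]] := OP _ Ot; rewrite e in Wt *.
have [h hh] := chart_lift (manifold_lchart (set_val y) Ac) oW sg Dy Wt.
have [h' hh'] := transverse_of_target h.
exists h'; first exact: Cinf_smooth.
apply/nearP_transverse; apply: filterS hh => z zE y' y'z; rewrite hh' /= /forget_piece /= y'z;
  exact: zE.
Qed.

Lemma transverse_bump (t : T) A : nbhs t A -> exists chi : T -> R,
  [/\ transverse_smooth chi, \forall t' \near t, chi t' = 1 & forall t', ~ A t' ->
    \forall t'' \near t', chi t'' = 0].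
Proof.
case: t => i y /transverse_nbhs[W [oW Wy WA]].
have [chi [c1 c0]] := bump_at (manifold_leuclid N) (open_nbhs_nbhs (conj oW Wy)).
pose h (t : T) := if `[< projT1 t = i >] then chi (forget_piece t) else 0.
exists h; split.
- move=> j c Ac; have [ji|ji] := pselect (j = i); last first.
    by exists (cst 0); [move=> k; exact: Ck_cst|move=> z _; rewrite /h asboolF].
  have [g sg hg] := (Cinf_smooth chi : smooth_on setT chi) c Ac; exists g.
    by move=> k; apply: Ck_sub (sg k) => _ [z [_ Dz] <-]; exists z.
  by move=> z Dz; rewrite /h asboolT //; apply: hg.
- by apply/nearP_transverse; apply: filterS c1 => z e y' y'z;
  rewrite /h asboolT // /forget_piece /= y'z.
- case=> j z nA; apply/nearP_transverse; have [ji|ji] := pselect (j = i); last first.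
    by apply: filterE => v y' _; rewrite /h asboolF.
  subst j; have nW : ~ W (set_val z) by move=> /WA.
  by apply: filterS (c0 _ nW) => v e y' y'v; rewrite /h asboolT // /forget_piece /= y'v.
Qed.

Lemma transverse_leuclid : leuclid (2 * q) T.
Proof.
split; [exact: transverse_smooth_local| |exact: transverse_bump].
case=> i y; have [cov _ _] := atlasP N; have [c Ac Dy] := cov (set_val y).
have [psi hpsi] := transverse_chart Ac Dy.
by exists [set t : T | projT1 t = i /\ chart_dom c (forget_piece t)], (c \o forget_piece), psi.
Qed.

Lemma map_graphE i x t : map_graph i x t -> exists y : piece i,
  [/\ t = existT _ i y, set_val y = fol_map i x & fol_dom i x].
Proof. by case=> Vx [y -> yx]; exists y. Qed.

Lemma to_piece i x : fol_dom i x -> exists y : piece i, set_val y = fol_map i x.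
Proof.
move=> Vx; have px : fol_map i x \in piece i by apply: mem_set; exists x.
by exists (SigSub px).
Qed.

Lemma map_graph_smooth i : @smooth_graph R (space_of M) T (map_graph i).
Proof.
have cf x : fol_dom i x -> {for x, continuous (fol_map i)}.
  by move=> Vx; have [[h _] _] := fol_map_submersion i; exact: h.
have [_ _ _ Gs] := fol_graph_smooth i.
split.
- move=> x t t' /map_graphE[y [-> yx _]] /map_graphE[y' [-> y'x _]].
  by congr existT; apply: val_inj; rewrite /= -!set_valE yx y'x.
- move=> x t [Vx _]; apply: open_near (fol_dom_open i) Vx _ => x' Vx'.
  by have [y' y'x] := to_piece Vx'; exists (existT _ i y'); split => //; exists y'.
- move=> x t B /map_graphE[y [-> yx Vx]] /nearP_transverse; rewrite yx => nB.
  have n1 : \forall x' \near x, forall y' : piece i, set_val y' = fol_map i x' ->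
    B (existT _ i y') := cf _ Vx _ nB.
  move: n1; apply: filterS => x' h t' /map_graphE[y' [-> y'x' _]]; exact: h.
- move=> h x t /map_graphE[y [_ yx Vx]]; have [h' hh'] := target_near h y.
  rewrite yx in hh'; have [g hg] := Gs h' x _ (conj Vx erefl).
  exists g; apply: filterS2 hg (cf _ Vx _ hh') => x' e h1 t' /map_graphE[y' [-> y'x' Vx']].
  by rewrite (e (fol_map i x')) // (h1 y').
Qed.

(** The submersion property of the foliation concerns fields on T_0. The value of Y is moved there
    as the derivation h |-> Y (pull h), realised by a field, and then lifted to M. *)
Lemma map_graph_submersive i : @submersive R (space_of M) T (map_graph i).
Proof.
move=> x t /map_graphE[y [-> yx Vx]] Y.
have [pull hpull] := choice transverse_of_target.
have pY : pder (S := space_of N) (set_val y) (fun h => Y (pull h) (existT _ i y)).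
  split=> [f g|r f|f g].
  - have -> : pull (f + g) = pull f + pull g by apply: CinfP => s; rewrite CvalD !hpull.
    by rewrite vactD CvalD.
  - have -> : pull (Ccst _ r * f) = Ccst _ r * pull f by apply: CinfP => s; rewrite CvalM !hpull.
    by rewrite vactC CvalM.
  - have -> : pull (f * g) = pull f * pull g by apply: CinfP => s; rewrite CvalM !hpull.
    by rewrite vactM CvalD !CvalM !hpull.
have [Y' hY'] := pder_vfield (manifold_leuclid N) pY.
have Gxy : fol_graph i x (set_val y) by split.
have [X hX] := fol_graph_submersive Gxy Y'.
exists X => h g hg; have [h' hh'] := target_near h y.
have cf : {for x, continuous (fol_map i)} by have [[+ _] _] := fol_map_submersion i; apply.
rewrite (hX h' g); last first.
  have n1 : \forall x' \near x, forall y' : piece i, set_val y' = fol_map i x' ->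
    h' (fol_map i x') = h (existT _ i y').
    by rewrite yx in hh'; exact: (cf _ hh').
  apply: filterS2 n1 hg => x' e1 e2 z [Vx' ->]; have [y' y'x'] := to_piece Vx'.
  by rewrite (e2 (existT _ i y')) ?(e1 y') //; split => //; exists y'.
rewrite hY'; apply: (vlocal transverse_leuclid); apply/nearP_transverse.
by apply: filterS hh' => z e y' y'z; rewrite hpull -(e y') // -y'z.
Qed.
End TransverseSpace.

(** * Related vector fields and naturality of the exterior derivative *)

Section RelatedFields.
Context {R : realType} {m m' : nat} {S S' : smoothSpace R}.
Hypotheses (HS : leuclid m S) (HS' : leuclid m' S').
Variable G : S -> S' -> Prop.
Hypothesis sG : smooth_graph G.

(** Pulling functions back along G and applying X is a derivation at y, hence the value of some
    field. The relation holds at this one point only. *)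
Lemma related_push x y X : G x y -> exists Y, related G x y X Y.
Proof.
move=> Gxy; have [_ Gd _ Gs] := sG.
have [g hg] := choice (fun h => Gs h _ _ Gxy).
have Gnear : \forall x' \near x, exists y', G x' y' by exact: Gd Gxy.
have ext (k : Cinf S) (h : Cinf S') : (\forall x' \near x, forall y', G x' y' -> k x' = h y') ->
  X (g h) x = X k x.
  move=> hk; apply: (vlocal HS); apply: filterS3 Gnear (hg h) hk => x' [y' Gy'] e1 e2.
  by rewrite (e1 _ Gy') (e2 _ Gy').
have [|Y hY] := @pder_vfield _ _ _ HS' y (fun h => X (g h) x).
  split=> [f k|r f|f k].
  - rewrite (ext (g f + g k)) ?vactD //; apply: filterS2 (hg f) (hg k) => x' e1 e2 y' Gy'.
    by rewrite !CvalD (e1 _ Gy') (e2 _ Gy').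
  - rewrite (ext (Ccst S r * g f)) ?vactC //; apply: filterS (hg f) => x' e1 y' Gy'.
    by rewrite !CvalM (e1 _ Gy').
  - rewrite (ext (g f * g k)); last first.
      by apply: filterS2 (hg f) (hg k) => x' e1 e2 y' Gy'; rewrite !CvalM (e1 _ Gy') (e2 _ Gy').
    by rewrite vactM CvalD !CvalM (nbhs_singleton (hg f) _ Gxy) (nbhs_singleton (hg k) _ Gxy).
by exists Y => h k hk; rewrite hY; rewrite (ext k).
Qed.

Lemma related_uniq x y X Y Y' : G x y -> related G x y X Y -> related G x y X Y' -> vfeq y Y Y'.
Proof.
move=> Gxy r1 r2 h; have [_ _ _ Gs] := sG; have [g hg] := Gs h _ _ Gxy.
by rewrite -(r1 h g hg) (r2 h g hg).
Qed.

Lemma relatedD x y X X' Y Y' : related G x y X Y -> related G x y X' Y' ->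
  related G x y (X + X') (Y + Y').
Proof. by move=> r1 r2 h g hg; rewrite !vfaddE !CvalD (r1 h g) // (r2 h g). Qed.
Lemma relatedN x y X Y : related G x y X Y -> related G x y (- X) (- Y).
Proof. by move=> r h g hg; rewrite -[LHS]/(- (X g x)) -[RHS]/(- (Y h y)) (r h g). Qed.
Lemma relatedB x y X X' Y Y' : related G x y X Y -> related G x y X' Y' ->
  related G x y (X - X') (Y - Y').
Proof. by move=> r1 r2; apply: relatedD => //; exact: relatedN. Qed.
Lemma relatedZ x y (f : Cinf S) (k : Cinf S') X Y : f x = k y -> related G x y X Y ->
  related G x y (f *: X) (k *: Y).
Proof. by move=> e r h g hg; rewrite !vact_scale !CvalM e (r h g). Qed.

Definition related_near (x : S) (X : vfield S) (Y : vfield S') : Prop :=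
  \forall x' \near x, forall y', G x' y' -> related G x' y' X Y.

Lemma related_lie x y X X' Y Y' : G x y -> related_near x X Y -> related_near x X' Y' ->
  related G x y (lie X X') (lie Y Y').
Proof.
move=> Gxy r1 r2 h g hg; rewrite !lieE !CvalB.
have n1 := nbhs_interior hg.
congr (_ - _).
  apply: (nbhs_singleton r1 _ Gxy); apply: filterS2 n1 r2 => x' e1 e2 y' Gy'; exact: e2 Gy' _ _ e1.
apply: (nbhs_singleton r2 _ Gxy); apply: filterS2 n1 r1 => x' e1 e2 y' Gy'; exact: e2 Gy' _ _ e1.
Qed.

Definition pullback_near (x : S) (w : form S) (t : form S') : Prop :=
  \forall x' \near x, forall y', G x' y' -> pullback_at G x' y' w t.

Lemma pullback_near_contract x X Y w t : pullback_near x w t -> related_near x X Y ->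
  pullback_near x (contract X w) (contract Y t).
Proof.
move=> p r; apply: filterS2 p r => x' e1 e2 y' Gy' s hs; rewrite !contractE.
by apply: (e1 _ Gy' ((X, Y) :: s)) => p; rewrite inE => /predU1P[->|/hs //]; exact: e2.
Qed.

Lemma pullback_near_lieD x y X Y (l : seq (vfield S * vfield S')) w t : G x y ->
  related_near x X Y -> pullback_near x w t ->
  (forall p, p \in l -> related_near x p.1 p.2) -> lieD_fun X w (unzip1 l) x =
    lieD_fun Y t (unzip2 l) y.
Proof.
move=> Gxy r; elim: l w t => [|[Z Z'] l IH] w t p hl.
  rewrite /lieD_fun /= !big_ord0 !subr0; apply: (nbhs_singleton r _ Gxy).
  by apply: filterS p => x' e y' Gy'; exact: (e _ Gy' [::]).
have rZ : related_near x Z Z' by apply: (hl (Z, Z')); rewrite inE eqxx.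
have hl' p' : p' \in l -> related_near x p'.1 p'.2 by move=> p'l; apply: hl; rewrite inE p'l orbT.
change (lieD_fun X w (Z :: unzip1 l) x = lieD_fun Y t (Z' :: unzip2 l) y).
rewrite !lieD_cons !CvalB; congr (_ - _); first exact: (IH _ _ (pullback_near_contract p rZ) hl').
apply: (nbhs_singleton p _ Gxy ((lie X Z, lie Y Z') :: l)) => p'.
rewrite inE => /predU1P[->|/hl' h]; first exact: related_lie.
exact: (nbhs_singleton h _ Gxy).
Qed.

(** Induction on the arguments through Cartan's formula i_X d = L_X - d i_X, which avoids matching
    the double sum of Koszul's formula term by term. *)
Lemma pullback_near_ext_d x y (l : seq (vfield S * vfield S')) w t : G x y -> pullback_near x w t ->
  (forall p, p \in l -> related_near x p.1 p.2) -> ext_d w (unzip1 l) x = ext_d t (unzip2 l) y.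
Proof.
move=> Gxy; elim: l w t => [|[Z Z'] l IH] w t p hl.
  by rewrite -[ext_d w _]/(ext_d_fun w [::]) -[ext_d t _]/(ext_d_fun t [::]) !ext_d_nil.
have rZ : related_near x Z Z' by apply: (hl (Z, Z')); rewrite inE eqxx.
have hl' p' : p' \in l -> related_near x p'.1 p'.2 by move=> p'l; apply: hl; rewrite inE p'l orbT.
rewrite -[ext_d w _]/(ext_d_fun w (Z :: unzip1 l)) -[ext_d t _]/(ext_d_fun t (Z' :: unzip2 l))
  !ext_d_cons !CvalB.
congr (_ - _); first exact: pullback_near_lieD.
exact: IH (pullback_near_contract p rZ) hl'.
Qed.
End RelatedFields.

Section Submersions.
Context {R : realType} {m r : nat} {S S' : smoothSpace R}.
Hypotheses (HS : leuclid (m + r) S) (HS' : leuclid m S').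
Variable G : S -> S' -> Prop.
Hypotheses (sG : smooth_graph G) (subG : submersive G).

(** X differs at x from a lift of Y by a vertical vector; both the lift and the vertical vector
    extend to fields with the required relation near x. *)
Lemma related_extend x y X Y : G x y -> related G x y X Y ->
  exists X', vfeq x X X' /\ related_near G x X' Y.
Proof.
move=> Gxy rXY; have [X1 hX1] := related_lift HS HS' sG subG Gxy Y.
have rV : related G x y (X - X1) 0.
  by rewrite -(subrr Y); apply: relatedB rXY (nbhs_singleton hX1 _ Gxy).
have [V [eV hV]] := related0_extend HS HS' sG subG Gxy rV.
exists (V + X1); split.
  by move=> f; rewrite vfaddE CvalD -eV vfaddE CvalD -[(- X1) f]/(- X1 f) CvalN; ring.
by apply: filterS2 hV hX1 => x' e1 e2 y' Gy'; rewrite -(add0r Y); apply: relatedD;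
  [exact: e1|exact: e2].
Qed.

Lemma related_extend_list x y (l : seq (vfield S * vfield S')) : G x y ->
  (forall p, p \in l -> related G x y p.1 p.2) ->
  exists l' : seq (vfield S * vfield S'),
    [/\ unzip2 l' = unzip2 l, forall p, p \in l' -> related_near G x p.1 p.2
    & forall w : form S, w (unzip1 l) x = w (unzip1 l') x].
Proof.
move=> Gxy; elim: l => [|[X Y] l IH] hl; first by exists [::].
have [|X' [eX rX]] := related_extend Gxy (X := X) (Y := Y).
  by apply: (hl (X, Y)); rewrite inE eqxx.
have [|l' [e1 e2 e3]] := IH; first by move=> p pl; apply: hl; rewrite inE pl orbT.
exists ((X', Y) :: l'); split=> [|p|w] /=; first by rewrite e1.
  by rewrite inE => /predU1P[->|/e2].
change (contract X w (unzip1 l) x = w (X' :: unzip1 l') x).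
rewrite e3 contractE; exact: (Alin_eq HS (form_slot w [::] _) eX).
Qed.

(** The exterior derivative differentiates its arguments, so arguments related only at x are
    exchanged for fields related near x; this does not change the value, because forms are
    tensorial. *)
Lemma pullback_ext_d x y w t : G x y -> pullback_near G x w t ->
  pullback_at G x y (ext_d w) (ext_d t).
Proof.
move=> Gxy p l hl; have [l' [<- h2 ->]] := related_extend_list Gxy hl.
exact: pullback_near_ext_d Gxy p h2.
Qed.
End Submersions.

(** * Composition, gluing and inversion of graphs *)

Section GraphOperations.
Context {R : realType}.
Implicit Types (S : smoothSpace R).

Lemma smooth_graph_id S : smooth_graph (fun x y : S => y = x).
Proof.
split=> [x y y' -> -> //|x y _|x y B -> nB|h x y _].
- by apply: filterE => x'; exists x'.
- by apply: filterS nB => x' Bx' _ ->.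
- by exists h; apply: filterE => x' _ ->.
Qed.

Lemma smooth_graph_comp S1 S2 S3 (G : S1 -> S2 -> Prop) (G' : S2 -> S3 -> Prop) :
  smooth_graph G -> smooth_graph G' -> smooth_graph (fun x z => exists2 y, G x y & G' y z).
Proof.
move=> [Gf Gd Gc Gs] [G'f G'd G'c G's]; split.
- by move=> x z z' [y Gxy G'yz] [y' Gxy' G'yz']; rewrite -(Gf _ _ _ Gxy Gxy') in G'yz';
  exact: G'f G'yz G'yz'.
- move=> x z [y Gxy G'yz]; apply: filterS2 (Gd _ _ Gxy) (Gc _ _ _ Gxy (G'd _ _ G'yz)) =>
  x' [y' Gy'] h.
  by have [z' G'z'] := h _ Gy'; exists z', y'.
- move=> x z B [y Gxy G'yz] nB; apply: filterS (Gc _ _ _ Gxy (G'c _ _ _ G'yz nB)) =>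
  x' h z' [y' Gy' G'z'].
  exact: h Gy' _ G'z'.
- move=> h x z [y Gxy G'yz]; have [g' hg'] := G's h _ _ G'yz; have [g hg] := Gs g' _ _ Gxy.
  exists g; apply: filterS2 hg (Gc _ _ _ Gxy hg') => x' e1 e2 z' [y' Gy' G'z'].
  by rewrite (e1 _ Gy') (e2 _ Gy' _ G'z').
Qed.

Lemma smooth_graph_glue S1 S2 (K : Type) (G : K -> S1 -> S2 -> Prop) :
  (forall k, smooth_graph (G k)) ->
  (forall k l t t' t'', G k t t' -> G l t t'' -> t' = t'') ->
    smooth_graph (fun t t' => exists k, G k t t').
Proof.
move=> sG GG; split.
- by move=> x y y' [k Gy] [l Gy']; exact: GG Gy Gy'.
- move=> x y [k Gy]; have [_ Gd _ _] := sG k; apply: filterS (Gd _ _ Gy) => x' [y' Gy'].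
  by exists y', k.
- move=> x y B [k Gy] nB; have [_ Gd Gc _] := sG k.
  apply: filterS2 (Gd _ _ Gy) (Gc _ _ _ Gy nB) => x' [y1 Gy1] h y' [l Gy'].
  by rewrite -(GG _ _ _ _ _ Gy1 Gy'); exact: h.
- move=> h x y [k Gy]; have [_ Gd _ Gs] := sG k; have [g hg] := Gs h _ _ Gy.
  exists g; apply: filterS2 (Gd _ _ Gy) hg => x' [y1 Gy1] e y' [l Gy'].
  by rewrite -(GG _ _ _ _ _ Gy1 Gy'); exact: e.
Qed.

Lemma smooth_graph_restrict S1 S2 (G : S1 -> S2 -> Prop) (O : set S1) : open O ->
  smooth_graph G -> smooth_graph (fun x y => O x /\ G x y).
Proof.
move=> oO [Gf Gd Gc Gs]; split.
- by move=> x y y' [_ Gy] [_]; exact: Gf.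
- move=> x y [Ox Gy]; apply: filterS2 (open_nbhs_nbhs (conj oO Ox)) (Gd _ _ Gy) => x' Ox' [y' Gy'].
  by exists y'.
- by move=> x y B [Ox Gy] nB; apply: filterS (Gc _ _ _ Gy nB) => x' h y' [_]; exact: h.
- by move=> h x y [Ox Gy]; have [g hg] := Gs h _ _ Gy; exists g; apply: filterS hg => x' e y' [_];
  exact: e.
Qed.

Lemma smooth_graph_corestrict S1 S2 (G : S1 -> S2 -> Prop) (O : set S2) : open O ->
  smooth_graph G -> smooth_graph (fun x y => O y /\ G x y).
Proof.
move=> oO [Gf Gd Gc Gs]; split.
- by move=> x y y' [_ Gy] [_]; exact: Gf.
- move=> x y [Oy Gy]; apply: filterS2 (Gc _ _ _ Gy (open_nbhs_nbhs (conj oO Oy))) (Gd _ _ Gy) =>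
  x' Ox' [y' Gy'].
  by exists y'; split => //; exact: Ox'.
- by move=> x y B [Ox Gy] nB; apply: filterS (Gc _ _ _ Gy nB) => x' h y' [_]; exact: h.
- by move=> h x y [Ox Gy]; have [g hg] := Gs h _ _ Gy; exists g; apply: filterS hg => x' e y' [_];
  exact: e.
Qed.

Definition flip_graph (A B : Type) (G : A -> B -> Prop) : B -> A -> Prop := fun b a => G a b.

Definition local_diffeo_graph S1 S2 (G : S1 -> S2 -> Prop) : Prop :=
  smooth_graph G /\ smooth_graph (flip_graph G).

Section Factor.
Context {m1 m2 m3 : nat} {S1 S2 S3 : smoothSpace R}.
Hypotheses (HS1 : leuclid m1 S1) (HS2 : leuclid m2 S2).

Lemma related_flip (G : S1 -> S2 -> Prop) x y X Y : local_diffeo_graph G -> G x y ->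
  related G x y X Y -> related (flip_graph G) y x Y X.
Proof.
move=> [[_ _ Gc _] _] Gxy r h g hg; rewrite (r g h) //.
by apply: filterS (Gc _ _ _ Gxy hg) => x' e y' Gy'; rewrite (e _ Gy' x').
Qed.

Lemma related_comp (G : S1 -> S2 -> Prop) (G' : S2 -> S3 -> Prop) (G'' : S1 -> S3 -> Prop) x y z X
  Y Z :
  smooth_graph G -> smooth_graph G' -> G x y -> G' y z ->
  (\forall x' \near x, forall y' z', G x' y' -> G' y' z' -> G'' x' z') ->
  related G x y X Y -> related G' y z Y Z -> related G'' x z X Z.
Proof.
move=> [_ Gd Gc Gs] [_ G'd G'c G's] Gxy G'yz GG r r' h g hg.
have [g' hg'] := G's h _ _ G'yz; rewrite -(r' h g' hg'); apply: r.
apply: filterS3 (filterI GG hg) (Gc _ _ _ Gxy (G'd _ _ G'yz)) (Gc _ _ _ Gxy hg').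
move=> x' [e1 e2] e3 e4 y' Gy'; have [z' G'z'] := e3 _ Gy'.
by rewrite (e4 _ Gy' _ G'z'); apply: e2; exact: e1 Gy' G'z'.
Qed.

Lemma related_factor (G : S1 -> S2 -> Prop) (G' : S2 -> S3 -> Prop) (G'' : S1 -> S3 -> Prop) x y z
  X Z :
  smooth_graph G -> G x y ->
  (\forall x' \near x, forall y' z', G x' y' -> G'' x' z' -> G' y' z') ->
  related G'' x z X Z -> exists Y, related G x y X Y /\ related G' y z Y Z.
Proof.
move=> sG Gxy GG r; have [Y rY] := related_push HS1 HS2 sG X Gxy.
exists Y; split=> // h g' hg'; have [_ Gd Gc Gs] := sG.
have [g hg] := Gs g' _ _ Gxy; rewrite -(rY g' g hg); apply: r.
apply: filterS3 (filterI GG hg) (Gd _ _ Gxy) (Gc _ _ _ Gxy hg') => x' [e1 e2] [y' Gy'] e4 z' G''z'.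
by rewrite (e2 _ Gy') (e4 _ Gy' z') //; exact: e1 Gy' G''z'.
Qed.
End Factor.

Lemma local_diffeo_submersive m1 m2 S1 S2 (G : S1 -> S2 -> Prop) : leuclid m1 S1 -> leuclid m2 S2 ->
  local_diffeo_graph G -> submersive G.
Proof.
move=> HS1 HS2 lG x y Gxy Y; have [sG sG'] := lG.
have [X rX] := related_push HS2 HS1 sG' Y Gxy.
exists X; have lG' : local_diffeo_graph (flip_graph G) by split.
exact: related_flip lG' Gxy rX.
Qed.
End GraphOperations.

(** * Holonomy elements are local diffeomorphisms *)

Section Holonomy.
Context {R : realType} {n q : nat} {M : manifold R n} (F : foliation q M).
Local Notation T := (transverse F).
Local Notation N := (fol_target F).

Lemma trans_graph_flip i j : flip_graph (@trans_graph R n q M F i j) = trans_graph j i.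
Proof.
have fl k l t t' : @trans_graph R n q M F k l t t' -> trans_graph l k t' t.
  move=> [y [y' [-> -> [x [Vx Vx'] xy] y'E]]]; exists y', y.
  have y'x : set_val y' = fol_map l x by rewrite y'E -xy -fol_transP.
  split => //; first by exists x.
  by rewrite y'x -xy -fol_transP.
by apply/funext => t; apply/funext => t'; apply/propext; split; exact: fl.
Qed.

Lemma trans_graph_smooth i j : smooth_graph (@trans_graph R n q M F i j).
Proof.
set W := fol_map i @` (fol_dom i `&` fol_dom j).
have oW : open W by rewrite /W setIC; apply: fol_image_open; exact: fol_dom_open.
have sub z : W z -> exists y' : @piece R n q M F j, set_val y' = fol_trans i j z.
  move=> [x [Vx Vx'] <-]; rewrite -fol_transP //; exact: to_piece.
have sm t t' : trans_graph i j t t' -> smooth_map W (@fol_trans R n q M F i j).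
  move=> [y [y' [_ _ [x Vx _] _]]]; by have [|] := @fol_trans_diffeo R n q M F i j;
    first by exists x.
split.
- move=> t t1 t2 [y [y1 [-> -> _ e1]]] [y' [y2 [/eqP + -> _ e2]]].
  rewrite eq_Tagged => /eqP /= yy'; rewrite -yy' in e2.
  by congr existT; apply: val_inj; rewrite -!set_valE e1 e2.
- move=> _ _ [y [_ [-> _ Wy _]]]; apply/nearP_transverse; apply: open_near oW Wy _ => z Wz v vz.
  have [v' v'E] := sub _ Wz; exists (existT _ j v'), v, v'; split => //; first by rewrite vz.
  by rewrite v'E vz.
- move=> t t' B tg nB; have [cf _] := sm _ _ tg; move: tg nB => [y [y' [-> -> Wy y'E]]].
  move=> /nearP_transverse; rewrite y'E => /(cf _ Wy) nB; apply/nearP_transverse.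
  have nB' : \forall z \near set_val y, forall v' : piece j, set_val v' = fol_trans i j z ->
    B (existT _ j v') := nB.
  move: nB'; apply: filterS => z h v vz _ [v1 [v2 [/eqP + -> _ v2E]]].
  by rewrite eq_Tagged => /eqP /= vv1; apply: h; rewrite v2E -vv1 vz.
- move=> h t t' tg; have smt := sm _ _ tg; move: tg => [y [y' [-> _ Wy y'E]]].
  have [cf _] := smt.
  have [h' hh'] := target_near h y'.
  have [_ _ _ Gs] := graph_on_smooth oW smt.
  have [k hk] := Gs h' _ _ (conj Wy erefl).
  have [g hg] := transverse_of_target k.
  exists g; apply/nearP_transverse; rewrite y'E in hh'.
  have n1 : \forall z \near set_val y, forall v' : piece j, set_val v' = fol_trans i j z ->
    h' (fol_trans i j z) = h (existT _ j v').
    exact: (cf _ Wy _ hh').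
  apply: filterS2 hk n1 => z e1 e2 v vz _ [v1 [v2 [/eqP + -> Wv1 v2E]]].
  rewrite eq_Tagged => /eqP /= vv1; rewrite -vv1 vz in Wv1 v2E.
  by rewrite hg /forget_piece /= vz (e1 (fol_trans i j z)) // (e2 v2).
Qed.

(** The induction carries a graph together with its inverse, since inversion exchanges them; of the
    two compatibility conditions in gluing, each makes one of the directions functional. *)
Lemma holonomy_local_diffeo G : @holonomy R n q M F G -> local_diffeo_graph G.
Proof.
elim=> {G}.
- by move=> i j; split; rewrite ?trans_graph_flip; exact: trans_graph_smooth.
- split; first exact: smooth_graph_id.
  have -> : flip_graph (fun t t' : T => t' = t) = (fun t t' => t' = t).
    by apply/funext => t; apply/funext => t'; apply/propext; split.
  exact: smooth_graph_id.
- by move=> G _ [s1 s2]; split.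
- move=> G G' _ [s1 s2] _ [s1' s2']; split; first exact: smooth_graph_comp.
  have -> : flip_graph (fun t t'' => exists2 t', G t t' & G' t' t'') =
    (fun t'' t => exists2 t', flip_graph G' t'' t' & flip_graph G t' t).
    by apply/funext => t; apply/funext => t''; apply/propext; split=> -[t' h1 h2]; exists t'.
  exact: smooth_graph_comp.
- move=> G O oO _ [s1 s2]; split; first exact: smooth_graph_restrict.
  exact: smooth_graph_corestrict.
- move=> K G _ IH h1 h2; split; first by apply: smooth_graph_glue => // k; have [] := IH k.
  apply: (@smooth_graph_glue _ _ _ _ (fun k => flip_graph (G k))) => [k|k l t t' t'' g1 g2];
    first by have [] := IH k.
  exact: h2 g1 g2.
Qed.
End Holonomy.

(** * Clifford action on forms *)

Section Clifford.
Context {R : realType} {S : smoothSpace R}.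
Local Notation A := (Cinf S).
Local Notation V := (vfield S).
Local Notation form := (form S).
Local Notation gtan := (gtan S).
Implicit Types (f g : A) (X Y : V) (al be : oneform S) (w v : form) (u : gtan).

Lemma wedgeE al w s : wedge al w s = wedge_fun al w s. Proof. by []. Qed.
Lemma wedge_nil al w : wedge al w [::] = 0.
Proof. by rewrite wedgeE /wedge_fun big_ord0. Qed.
Lemma wedge_at_cons al w X s : wedge al w (X :: s) = al X * w s - wedge al (contract X w) s.
Proof. exact: wedge_cons. Qed.
Lemma contract_wedge al w X : contract X (wedge al w) = al X *: w - wedge al (contract X w).
Proof. by apply: formE => s; rewrite contractE wedge_at_cons. Qed.

Lemma formNE w s : (- w) s = - w s. Proof. by []. Qed.
Lemma formDE w v s : (w + v) s = w s + v s. Proof. by []. Qed.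
Lemma formZE f w s : (f *: w) s = f * w s. Proof. by []. Qed.
Lemma form0E s : (0 : form) s = 0. Proof. by []. Qed.
Lemma form_sumE (I : Type) (r : seq I) (P : pred I) (F : I -> form) s :
  (\sum_(i <- r | P i) F i) s = \sum_(i <- r | P i) F i s.
Proof. by elim/big_rec2: _ => // i y1 y2 _ <-. Qed.

Lemma form_sumD (I : finType) (F G : I -> form) : \sum_i (F i + G i) = \sum_i F i + \sum_i G i.
Proof.
apply: formE => s; rewrite formDE !form_sumE -big_split; apply: eq_bigr => i _; exact: formDE.
Qed.

Lemma wedge_linr al f w v : wedge al (f *: w + v) = f *: wedge al w + wedge al v.
Proof.
by apply: formE => s; rewrite wedgeE (@wedge_lin _ _ al w v _ f) // => t; rewrite faddE.
Qed.
Lemma wedge_linl al be f w : wedge (f *: al + be) w = f *: wedge al w + wedge be w.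
Proof.
apply: formE => s; rewrite formDE formZE !wedgeE /wedge_fun mulr_sumr -big_split /=;
  apply: eq_bigr => i _.
transitivity ((-1) ^+ i * ((f * al (nth 0 s i) + be (nth 0 s i)) * w (remove_nth i s)));
  [by []|ring].
Qed.
Lemma contract_linr X f w v : contract X (f *: w + v) = f *: contract X w + contract X v.
Proof. exact: formE. Qed.

Lemma wedgeD al w v : wedge al (w + v) = wedge al w + wedge al v.
Proof. by have := wedge_linr al 1 w v; rewrite !scale1r. Qed.
Lemma wedge0 al : wedge al 0 = 0.
Proof. by apply: (addrI (wedge al 0)); rewrite -wedgeD !addr0. Qed.
Lemma wedgeZ al f w : wedge al (f *: w) = f *: wedge al w.
Proof. by rewrite -[f *: w]addr0 wedge_linr wedge0 addr0. Qed.
Lemma wedgeN al w : wedge al (- w) = - wedge al w.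
Proof. by rewrite -scaleN1r wedgeZ scaleN1r. Qed.

Lemma wedge_anti al be w : wedge al (wedge be w) = - wedge be (wedge al w).
Proof.
apply: formE => s; elim: s w => [|X s IH] w; first by rewrite formNE !wedge_nil oppr0.
rewrite formNE !wedge_at_cons !contract_wedge.
rewrite !(wedgeD, wedgeN, wedgeZ) !(formDE, formNE, formZE) IH formNE; ring.
Qed.

(** Twice [pairing], so that the Clifford relation holds without a factor. *)
Definition clifB u1 u2 : A := u1.2 u2.1 + u2.2 u1.1.

Lemma clifB_sym u1 u2 : clifB u1 u2 = clifB u2 u1. Proof. exact: addrC. Qed.
Lemma clifB_linl f u1 u2 u : clifB (f *: u1 + u2) u = f * clifB u1 u + clifB u2 u.
Proof. by rewrite /clifB oneformP oaddE; ring. Qed.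
Lemma clifB_linr f u1 u2 u : clifB u (f *: u1 + u2) = f * clifB u u1 + clifB u u2.
Proof. by rewrite ![clifB u _]clifB_sym clifB_linl. Qed.

Lemma cliffE u w : cliff u w = contract u.1 w + wedge u.2 w. Proof. by []. Qed.
Lemma cliff_linl f u1 u2 w : cliff (f *: u1 + u2) w = f *: cliff u1 w + cliff u2 w.
Proof. by rewrite /cliff contract_lin wedge_linl scalerDr addrACA. Qed.
Lemma cliff_linr f u w v : cliff u (f *: w + v) = f *: cliff u w + cliff u v.
Proof. by rewrite /cliff contract_linr wedge_linr scalerDr addrACA. Qed.
Lemma cliffD u w v : cliff u (w + v) = cliff u w + cliff u v.
Proof. by have := cliff_linr 1 u w v; rewrite !scale1r. Qed.
Lemma cliff0 u : cliff u 0 = 0.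
Proof. by apply: (addrI (cliff u 0)); rewrite -cliffD !addr0. Qed.
Lemma cliffZ u f w : cliff u (f *: w) = f *: cliff u w.
Proof. by rewrite -[f *: w]addr0 cliff_linr cliff0 addr0. Qed.
Lemma cliffN u w : cliff u (- w) = - cliff u w.
Proof. by rewrite -scaleN1r cliffZ scaleN1r. Qed.
Lemma cliffB u w v : cliff u (w - v) = cliff u w - cliff u v.
Proof. by rewrite cliffD cliffN. Qed.
Lemma cliff_sum u (I : Type) (r : seq I) (P : pred I) (F : I -> form) :
  cliff u (\sum_(i <- r | P i) F i) = \sum_(i <- r | P i) cliff u (F i).
Proof. exact: (big_morph (cliff u) (cliffD u) (cliff0 u)). Qed.
Lemma cliffDl u1 u2 w : cliff (u1 + u2) w = cliff u1 w + cliff u2 w.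
Proof. by have := cliff_linl 1 u1 u2 w; rewrite !scale1r. Qed.
Lemma cliff0l w : cliff 0 w = 0.
Proof. by apply: (addrI (cliff 0 w)); rewrite -cliffDl !addr0. Qed.
Lemma cliffNl u w : cliff (- u) w = - cliff u w.
Proof. by apply: (addrI (cliff u w)); rewrite -cliffDl !subrr cliff0l. Qed.

Lemma cliff_rel u1 u2 w : cliff u1 (cliff u2 w) + cliff u2 (cliff u1 w) = clifB u1 u2 *: w.
Proof.
have cD X v1 v2 : contract X (v1 + v2) = contract X v1 + contract X v2 by exact: formE.
rewrite /cliff !wedgeD !cD !contract_wedge [wedge u2.2 (wedge _ _)]wedge_anti.
have -> : contract u2.1 (contract u1.1 w) = - contract u1.1 (contract u2.1 w).
  by apply: formE => s; rewrite formNE !contractE form_swap.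
rewrite /clifB scalerDl.
set a := contract _ (contract _ _); set b := _ *: w; set c := _ *: w; set d := wedge _ (wedge _ _).
set e := wedge _ (contract _ _); set k := wedge _ (contract _ _).
by rewrite [LHS](AC ((1*2)*2*((1*2)*2)) ((7*2)*(1*6)*(9*3)*(4*8)*(5*10)))/= !subrr !addr0.
Qed.

Section Structure.
Variable J : gcs S.

Lemma gcs0 : J 0 = 0.
Proof. by have := gcs_linear J (-1) 0 0; rewrite scaler0 addr0 scaleN1r addNr. Qed.
Lemma gcsD u1 u2 : J (u1 + u2) = J u1 + J u2.
Proof. by have := gcs_linear J 1 u1 u2; rewrite !scale1r. Qed.
Lemma gcsN u : J (- u) = - J u.
Proof. by apply: (addrI (J u)); rewrite -gcsD !subrr gcs0. Qed.
Lemma gcsB u1 u2 : J (u1 - u2) = J u1 - J u2. Proof. by rewrite gcsD gcsN. Qed.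

Lemma clifB_pairing u1 u2 : clifB u1 u2 = Ccst S 2 * pairing u1 u2.
Proof. by rewrite /pairing mulrA -CcstM divff ?pnatr_eq0 // Ccst1 mul1r. Qed.
Lemma clifB_orth u1 u2 : clifB (J u1) (J u2) = clifB u1 u2.
Proof. by rewrite !clifB_pairing gcs_orthogonal. Qed.
Lemma clifBNr u1 u2 : clifB u1 (- u2) = - clifB u1 u2.
Proof.
have clifB0 : clifB u1 0 = 0.
  by have := clifB_linr (-1) 0 0 u1; rewrite scaler0 addr0 mulN1r addNr.
by rewrite -scaleN1r -[_ *: u2]addr0 clifB_linr clifB0 addr0 mulN1r.
Qed.
Lemma clifBNl u1 u2 : clifB (- u1) u2 = - clifB u1 u2.
Proof. by rewrite clifB_sym clifBNr clifB_sym. Qed.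
Lemma clifB_skew u1 u2 : clifB (J u1) u2 = - clifB u1 (J u2).
Proof. by rewrite -clifB_orth gcs_square clifB_sym clifBNr clifB_sym. Qed.
End Structure.
End Clifford.

Lemma subACA (E : zmodType) (a b c d : E) : a - b - (c - d) = a - c - (b - d).
Proof. by rewrite !opprD !opprK addrACA. Qed.

(* The abstract setting of annihilation operators [l a] and a number operator [K]
   vanishing where they all do, with a conjugation [cj] reversing the spectrum. The
   subgroup [Z] stands for the forms vanishing at a point, so that no fibre of the
   bundle of forms has to be constructed. *)
Section Fock.
Variables (E : zmodType) (Z : E -> Prop) (A : finType) (l : A -> E -> E) (K cj : E -> E) (d : nat).
Hypotheses (Z0 : Z 0) (ZB : forall v w, Z v -> Z w -> Z (v - w))
  (Ztf : forall w n, Z (w *+ n.+1) -> Z w).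
Hypotheses (lB : forall a, {morph l a : v w / v - w}) (KB : {morph K : v w / v - w}).
Hypotheses (Zl : forall a w, Z w -> Z (l a w)) (ZK : forall w, Z w -> Z (K w))
  (Zcj : forall w, Z w <-> Z (cj w)).
Hypothesis l_anti : forall a b w, l a (l b w) = - l b (l a w).
Hypothesis K_l : forall a w, K (l a w) = l a (K w) - l a w.
Hypothesis K_quadratic : forall w, (forall a, Z (l a w)) -> Z (K w).
Hypothesis K_cj : forall w, K (cj w) = cj w *+ d - cj (K w).
Hypothesis cjB : {morph cj : v w / v - w}.

Lemma ZN w : Z w -> Z (- w). Proof. by move=> Zw; rewrite -sub0r; exact: ZB. Qed.
Lemma ZD v w : Z v -> Z w -> Z (v + w). Proof. by move=> Zv Zw; rewrite -[w]opprK;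
  apply: ZB => //; exact: ZN. Qed.
Lemma ZMn w n : Z w -> Z (w *+ n).
Proof. by move=> Zw; elim: n => [|n IH]; rewrite ?mulr0n // mulrS; exact: ZD. Qed.
Lemma ZMz w (e : int) : Z w -> Z (w *~ e).
Proof. by move=> Zw; case: e => n; [exact: ZMn|apply: ZN; exact: ZMn]. Qed.
Lemma Ztfz w (e : int) : e != 0 -> Z (w *~ e) -> Z w.
Proof.
case: e => [[|n]|n] // _; first exact: Ztf.
by rewrite NegzE mulrNz => /ZN; rewrite opprK; exact: Ztf.
Qed.

Section Morph.
Variable f : E -> E.
Hypothesis fB : {morph f : v w / v - w}.
Lemma mB0 : f 0 = 0. Proof. by have := fB 0 0; rewrite !subrr. Qed.
Lemma mBN w : f (- w) = - f w. Proof. by rewrite -sub0r fB mB0 sub0r. Qed.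
Lemma mBD v w : f (v + w) = f v + f w. Proof. by rewrite -[w in LHS]opprK fB mBN opprK. Qed.
Lemma mBMn w n : f (w *+ n) = f w *+ n.
Proof. by elim: n => [|n IH]; rewrite ?mulr0n ?mB0 // !mulrS mBD IH. Qed.
Lemma mBMz w (e : int) : f (w *~ e) = f w *~ e.
Proof. by case: e => n; rewrite ?NegzE ?mulrNz ?mBN mBMn. Qed.
End Morph.

Definition shift_op (k : nat) (w : E) := K w - w *+ k.
(** The product of the operators K - k for k in s; for [iota 0 r] it is a falling factorial of K. *)
Definition fall (s : seq nat) (w : E) : E := foldr shift_op w s.

Lemma shift_opB k : {morph shift_op k : v w / v - w}.
Proof. by move=> v w; rewrite /shift_op KB mulrnBl subACA. Qed.
Lemma fallB s : {morph fall s : v w / v - w}.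
Proof. by elim: s => [|k s IH] v w //=; rewrite IH shift_opB. Qed.
Lemma Z_shift k w : Z w -> Z (shift_op k w).
Proof. by move=> Zw; apply: ZB; [exact: ZK|exact: ZMn]. Qed.
Lemma Z_fall s w : Z w -> Z (fall s w).
Proof. by elim: s => [|k s IH] // Zw; apply: Z_shift; exact: IH. Qed.
Lemma fall_shift k s w : fall s (shift_op k w) = shift_op k (fall s w).
Proof.
elim: s => [|j s IH] //=; rewrite IH /shift_op !KB !(mBMn KB) !mulrnBl -!mulrnA mulnC.
by rewrite subACA.
Qed.

Lemma fall_l a s w : l a (fall (map S s) w) = fall s (l a w).
Proof.
elim: s => [|k s IH] //=; rewrite -IH /shift_op (lB a) (mBMn (lB a)) K_l mulrS opprD addrA.
by rewrite -!addrA [- l a _ + - _]addrC.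
Qed.

Definition words (s : seq A) (w : E) : E := foldr l w s.

(** Moving [l a] through a factor K - k lowers k by one. By induction every [l a] kills (K - 1)...(K
    - r + 1) w, and [K_quadratic] then supplies the missing factor K. *)
Lemma Z_nil_fall r w : (forall s, size s = r -> Z (words s w)) -> Z (fall (iota 0 r) w).
Proof.
elim: r w => [|r IH] w hw; first exact: (hw [::]).
pose u := fall (iota 1 r) w.
have lu a : Z (l a u).
  rewrite /u (iotaDl 1 0 r) fall_l; apply: IH => s ss.
  have := hw (rcons s a); rewrite size_rcons ss => /(_ erefl).
  by rewrite /words -cats1 foldr_cat.
by rewrite /= /shift_op mulr0n subr0; exact: K_quadratic.
Qed.

Lemma l_sqr a w : Z (l a (l a w)).
Proof.
apply: (@Ztf _ 1); rewrite mulr2n {1}l_anti addNr; exact: Z0.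
Qed.

Lemma words_mem a s w : a \in s -> Z (l a (words s w)).
Proof.
elim: s => [|b s IH] //; rewrite inE => /orP[/eqP->|as_]; first exact: l_sqr.
by rewrite /= l_anti; apply: ZN; apply: Zl; exact: IH.
Qed.

Lemma words_nuniq s w : ~~ uniq s -> Z (words s w).
Proof.
elim: s => [|b s IH] //=; rewrite negb_and negbK => /orP[bs|us]; first exact: words_mem.
by apply: Zl; exact: IH.
Qed.

(** A word longer than the number of annihilation operators repeats one of them, and anticommutation
    makes it vanish. *)
Lemma fall_nil w : Z (fall (iota 0 #|A|.+1) w).
Proof.
apply: Z_nil_fall => s ss; apply: words_nuniq; apply/negP => us.
by have := max_card (mem s); rewrite (card_uniqP us) ss ltnn.
Qed.

Lemma fall_eigen (e : int) s w : Z (K w - w *~ e) ->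
  Z (fall s w - w *~ (\prod_(k <- s) (e - k%:Z))).
Proof.
move=> he; elim: s => [|k s IH]; first by rewrite big_nil mulr1z subrr.
rewrite big_cons /=; set P := \prod_(_ <- _) _ in IH *.
have h1 : Z (shift_op k (fall s w) - shift_op k (w *~ P)).
  by rewrite -shift_opB; exact: Z_shift.
have h2 : Z (shift_op k (w *~ P) - w *~ ((e - k%:Z) * P)).
  rewrite /shift_op (mBMz KB).
  have -> : K w *~ P - w *~ P *+ k - w *~ ((e - k%:Z) * P) = (K w - w *~ e) *~ P.
    by rewrite mulrBl mulrzBr mulrzBl pmulrn -!mulrzA [P * _]mulrC opprB addrA subrK.
  exact: ZMz.
by have := ZD h1 h2; rewrite addrA subrK.
Qed.

Lemma spectrum_pos w (e : int) : Z (K w - w *~ e) -> (forall k : nat, e != k%:Z) -> Z w.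
Proof.
move=> he ek; have := fall_eigen (iota 0 #|A|.+1) he; set P := \prod_(_ <- _) _ => h.
apply: (@Ztfz _ P); last first.
  have := ZB (fall_nil w) h; by rewrite opprB addrCA subrr addr0.
by rewrite prodf_seq_neq0; apply/allP => k _ /=; rewrite subr_eq0.
Qed.

(** Conjugation turns an eigenvalue k > d into the negative number d - k, which [spectrum_pos]
    excludes. Counting words alone would only bound the spectrum by the number of operators, which
    is 2d in the application, where a basis of the whole double bundle is used instead of one of
    L. *)
Lemma spectrum w (e : int) : Z (K w - w *~ e) -> (forall k : nat, (k <= d)%N -> e != k%:Z) -> Z w.
Proof.
move=> he ek; have [[k ekk]|nk] := pselect (exists k : nat, e = k%:Z); last first.
  by apply: spectrum_pos he _ => k; apply/eqP => ekk; apply: nk; exists k.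
have dk : (d < k)%N by rewrite ltnNge; apply/negP => kd; have := ek _ kd; rewrite ekk eqxx.
apply/Zcj; apply: (@spectrum_pos _ (d%:Z - k%:Z)) => [|j].
  rewrite K_cj mulrzBr -pmulrn subACA subrr sub0r.
  apply: ZN.
  by have := (Zcj _).1 he; rewrite ekk cjB (mBMz cjB).
apply/eqP => h; have /eqP dE : (d == j + k)%N by rewrite -eqz_nat PoszD -h subrK.
by move: dk; rewrite dE ltnNge leq_addl.
Qed.

Lemma fall_spectrum w : Z (fall (iota 0 d.+1) w).
Proof.
have main s v : (forall k, k \in s -> (d < k)%N) -> forall t, Z (fall (t ++ s) v) -> Z (fall t v).
  elim: s v => [|k s IH] v hs t; first by rewrite cats0.
  rewrite /fall foldr_cat /= -/(fall s v) -/(fall t _) fall_shift => h.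
  apply: (IH v); first by move=> j js; apply: hs; rewrite inE js orbT.
  apply: (@spectrum _ k%:Z); first by rewrite /fall foldr_cat -pmulrn.
  by move=> j jd; apply/eqP => -[kj]; have := hs k; rewrite inE eqxx kj ltnNge jd => /(_ isT).
have [Ad|dA] := leqP #|A|.+1 d.+1.
  have -> : d.+1 = (d.+1 - #|A|.+1 + #|A|.+1)%N by rewrite subnK.
  have comm s t v : fall s (fall t v) = fall t (fall s v).
    by elim: s => [|k s IH] //=; rewrite IH fall_shift.
  rewrite addnC iotaD /fall foldr_cat -/(fall _ w) -/(fall _ (fall _ _)) comm.
  by apply: Z_fall; exact: fall_nil.
apply: (main (iota d.+1 (#|A| - d))); first by move=> k; rewrite mem_iota => /andP[].
rewrite -[iota d.+1 _]/(iota (0 + d.+1) _) -iotaD addSn subnKC //; first exact: fall_nil.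
by rewrite -ltnS ltnW.
Qed.

(** Annihilation operators are applied as long as the result is nonzero; anticommutation preserves
    the property of being killed by the operators already treated. *)
Lemma vacuum_exists w : ~ Z w -> exists2 s, ~ Z (words s w) & forall a, Z (l a (words s w)).
Proof.
move=> nw; suff: forall t : seq A, exists2 s, ~ Z (words s w) & forall a, a \in t ->
  Z (l a (words s w)).
  by move=> /(_ (enum A))[s s1 s2]; exists s => // a; apply: s2; rewrite mem_enum.
elim=> [|a t [s s1 s2]]; first by exists [::].
have [h|h] := pselect (Z (l a (words s w))).
  by exists s => // b; rewrite inE => /orP[/eqP->|/s2].
exists (a :: s) => // b; rewrite inE => /orP[/eqP->|/s2 hb]; first exact: l_sqr.
by rewrite /= l_anti; apply: ZN; exact: Zl.
Qed.
End Fock.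

(** * The number operator of a generalized complex structure *)

Section PointFrames.
Context {R : realType} {m : nat} {S : smoothSpace R}.
Hypothesis HS : leuclid m S.
Local Notation A := (Cinf S).
Local Notation V := (vfield S).
Local Notation form := (form S).
Local Notation gtan := (gtan S).
Implicit Types (x : S) (f : A) (X Y : V) (al be : oneform S) (w v : form) (u : gtan).

Definition pframe x (xs : 'I_m -> A) (D : 'I_m -> V) : Prop :=
  (forall X f, X f x = \sum_j X (xs j) x * D j f x) /\ forall i j, D i (xs j) x = (i == j)%:R.

Lemma frame_on_pframe O xs D x : frame_on O xs D -> O x -> pframe x xs D.
Proof.
by move=> [_ h1 h2] Ox; split=> [X f|i j]; [exact: (h2 x _ f Ox (vfield_pder X x))|exact: h1].
Qed.

Lemma pframe_expand x xs D (L : V -> A) X : pframe x xs D -> Alin L ->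
  L X x = \sum_j X (xs j) x * L (D j) x.
Proof.
move=> [h1 _] hL; rewrite (@Alin_eq _ _ _ HS L X (\sum_j Ccst S (X (xs j) x) *: D j) x hL).
  by rewrite (Alin_sum _ _ hL) Cval_sum; apply: eq_bigr => j _; rewrite (AlinZ _ _ hL) CvalM.
move=> f; rewrite h1 vact_sum Cval_sum; apply: eq_bigr => j _.
by rewrite vact_scale CvalM.
Qed.

Lemma oneDE al be X : (al + be) X = al X + be X. Proof. by []. Qed.
Lemma oneZE f al X : (f *: al) X = f * al X. Proof. by []. Qed.
Lemma one_sumE (I : Type) (r : seq I) (F : I -> oneform S) X : (\sum_(i <- r) F i) X =
  \sum_(i <- r) F i X.
Proof. by elim: r => [|i r IH]; rewrite ?big_nil // !big_cons oneDE IH. Qed.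

Section OneformFunctional.
Variable L : oneform S -> A.
Hypothesis hL : forall f al be, L (f *: al + be) = f * L al + L be.
Lemma oneL0 : L 0 = 0.
Proof. by have := hL (-1) 0 0; rewrite scaler0 addr0 mulN1r addNr. Qed.
Lemma oneLZ f al : L (f *: al) = f * L al.
Proof. by rewrite -[f *: al]addr0 hL oneL0 addr0. Qed.
Lemma oneLD al be : L (al + be) = L al + L be.
Proof. by have := hL 1 al be; rewrite scale1r mul1r. Qed.
Lemma oneL_sum (I : Type) (r : seq I) (F : I -> oneform S) : L (\sum_(i <- r) F i) =
  \sum_(i <- r) L (F i).
Proof. by elim: r => [|i r IH]; rewrite ?big_nil ?oneL0 // !big_cons oneLD IH. Qed.

Lemma oneL_eq al be x : (forall X, al X x = be X x) -> L al x = L be x.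
Proof.
move=> e; have [ O [xs [D [Ox hf]]]] := frame_exists HS x.
have main ga : L ga x = \sum_j ga (D j) x * L (differential (xs j)) x.
  have [oO _ _] := hf.
  have [chi [c1 c0]] := bump_at HS (open_nbhs_nbhs (conj oO Ox)).
  have E : chi *: ga = \sum_j (chi * ga (D j)) *: differential (xs j).
    apply: val_inj; apply/funext => X.
    change ((chi *: ga) X = (\sum_j (chi * ga (D j)) *: differential (xs j)) X).
    rewrite oneZE one_sumE; apply: CinfP => y; rewrite CvalM Cval_sum.
    have [Oy|nOy] := pselect (O y); last first.
      rewrite (nbhs_singleton (c0 _ nOy)) mul0r big1 // => j _.
      by rewrite oneZE !CvalM (nbhs_singleton (c0 _ nOy)) !mul0r.
    rewrite (frame_expand HS X hf (oneform_Alin ga) Oy) mulr_sumr; apply: eq_bigr => j _.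
    by rewrite oneZE !CvalM -mulrA; congr (_ * _); rewrite mulrC.
  have := congr1 (fun b => L b x) E; rewrite oneLZ CvalM (nbhs_singleton c1) mul1r => ->.
  rewrite oneL_sum Cval_sum; apply: eq_bigr => j _.
  by rewrite oneLZ !CvalM (nbhs_singleton c1) mul1r.
by rewrite !main; apply: eq_bigr => j _; rewrite e.
Qed.
End OneformFunctional.

(** Sends the index of a basis element of the double bundle to that of its dual element for
    [clifB]. *)
Definition gswap (a : 'I_m + 'I_m) : 'I_m + 'I_m := match a with inl j => inr j | inr j =>
  inl j end.
Lemma gswapK : involutive gswap. Proof. by case. Qed.
Definition gbasis (xs : 'I_m -> A) (D : 'I_m -> V) (a : 'I_m + 'I_m) : gtan :=
  match a with inl j => (D j, 0) | inr j => (0, differential (xs j)) end.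

Lemma big_gswap (T : nmodType) (F : 'I_m + 'I_m -> T) : \sum_a F (gswap a) = \sum_a F a.
Proof. by rewrite [RHS](reindex_inj (inv_inj gswapK)). Qed.

Definition Glin (L : gtan -> A) : Prop := forall f u1 u2, L (f *: u1 + u2) = f * L u1 + L u2.

Lemma Glin_eq L x u1 u2 : Glin L -> (forall f, u1.1 f x = u2.1 f x) ->
  (forall X, u1.2 X x = u2.2 X x) -> L u1 x = L u2 x.
Proof.
move=> hL e1 e2.
have split_ u : L u = L (u.1, 0) + L (0, u.2).
  have := hL 1 (u.1, 0) (0, u.2); rewrite scale1r mul1r => <-; congr L.
  by case: u => X al; congr (_, _); rewrite /= ?addr0 ?add0r.
rewrite [L u1]split_ [L u2]split_ !CvalD; congr (_ + _).
  apply: (@Alin_eq _ _ _ HS (fun X => L (X, 0)) u1.1 u2.1 x) => // f X Y.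
  by rewrite -hL; congr (L (_, _)); rewrite /= scaler0 addr0.
apply: (@oneL_eq (fun al => L (0, al)) _ u1.2 u2.2 x e2) => f al be.
by rewrite -hL; congr (L (_, _)); rewrite /= scaler0 addr0.
Qed.

Lemma gexpand L x xs D u : pframe x xs D -> Glin L ->
  L u x = \sum_a clifB (gbasis xs D (gswap a)) u x * L (gbasis xs D a) x.
Proof.
move=> hf hL; have L0 : L 0 = 0.
  by have := hL (-1) 0 0; rewrite scaler0 addr0 mulN1r addNr.
have LD u1 u2 : L (u1 + u2) = L u1 + L u2 by have := hL 1 u1 u2; rewrite scale1r mul1r.
have LZ f u1 : L (f *: u1) = f * L u1 by rewrite -[f *: u1]addr0 hL L0 addr0.
rewrite (@Glin_eq L x u (\sum_a Ccst S (clifB (gbasis xs D (gswap a)) u x) *: gbasis xs D a) hL).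
- rewrite (big_morph L LD L0) Cval_sum; apply: eq_bigr => a _; by rewrite LZ CvalM.
- move=> f; have h1 := hf.1.
  have -> : (\sum_a Ccst S (clifB (gbasis xs D (gswap a)) u x) *: gbasis xs D a).1 =
     \sum_a (Ccst S (clifB (gbasis xs D (gswap a)) u x) *: gbasis xs D a).1 by rewrite
       (big_morph fst (id1 := 0) (op1 := +%R)).
  rewrite vact_sum Cval_sum big_sumType /= [X in _ + X]big1 ?addr0 => [|j _]; last first.
    exact: mulr0.
  rewrite h1; apply: eq_bigr => j _; transitivity ((u.1 (xs j) x + u.2 0 x) * D j f x); last by [].
  by rewrite (Alin0 (oneform_Alin u.2)) addr0.
- move=> X; have e := pframe_expand X hf (oneform_Alin u.2).
  have -> : (\sum_a Ccst S (clifB (gbasis xs D (gswap a)) u x) *: gbasis xs D a).2 =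
     \sum_a (Ccst S (clifB (gbasis xs D (gswap a)) u x) *: gbasis xs D a).2 by rewrite
       (big_morph snd (id1 := 0) (op1 := +%R)).
  rewrite one_sumE Cval_sum big_sumType /= big1 ?add0r => [|j _]; last exact: mulr0.
  rewrite e; apply: eq_bigr => j _; transitivity ((0 + u.2 (D j) x) * X (xs j) x); last by [].
  by rewrite add0r mulrC.
Qed.

(** The sum contracts T with the bilinear form [clifB]: one slot is expanded in the other frame and
    the dual slot is reassembled. *)
Lemma trace_indep x xs D xs' D' (T : gtan -> gtan -> A) : pframe x xs D -> pframe x xs' D' ->
  (forall u, Glin (T u)) -> (forall u, Glin (T^~ u)) ->
  \sum_a T (gbasis xs D a) (gbasis xs D (gswap a)) x =
    \sum_a T (gbasis xs' D' a) (gbasis xs' D' (gswap a)) x.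
Proof.
move=> h h' T1 T2; set e := gbasis xs D; set e' := gbasis xs' D'.
transitivity (\sum_a \sum_b clifB (e' (gswap b)) (e a) x * T (e' b) (e (gswap a)) x).
  by apply: eq_bigr => a _; exact: (gexpand (e a) h' (T2 (e (gswap a)))).
rewrite exchange_big /=; apply: eq_bigr => b _.
rewrite (gexpand (e' (gswap b)) h (T1 (e' b))) -big_gswap; apply: eq_bigr => a _.
by rewrite gswapK clifB_sym.
Qed.

Lemma clifB_dual x xs D a : pframe x xs D -> clifB (gbasis xs D (gswap a)) (gbasis xs D a) x = 1.
Proof.
move=> [_ h]; case: a => j.
  change (D j (xs j) x + (0 : oneform S) 0 x = 1).
  by rewrite h eqxx addr0.
change ((0 : oneform S) 0 x + D j (xs j) x = 1).
by rewrite h eqxx add0r.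
Qed.

Definition eqx x (w v : form) : Prop := forall s, w s x = v s x.

Lemma eqx_cliff x u w v : eqx x w v -> eqx x (cliff u w) (cliff u v).
Proof.
move=> e s; rewrite /cliff !formDE !CvalD !contractE e; congr (_ + _).
rewrite !wedgeE /wedge_fun !Cval_sum; apply: eq_bigr => i _.
by rewrite !CvalM e.
Qed.

Section NumberOperator.
Variable J : gcs S.

(** J is skew for [clifB], hence an element of the orthogonal Lie algebra; this is its action in the
    spin representation, with e_a and its dual in the usual quadratic expression. *)
Definition Nframe xs D w : form :=
  Ccst S 2^-1 *: \sum_a cliff (J (gbasis xs D a)) (cliff (gbasis xs D (gswap a)) w).

Lemma cliff_Glin w s : Glin (fun u => cliff u w s).
Proof. by move=> f u1 u2; rewrite cliff_linl formDE formZE. Qed.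
Lemma cliffJ_Glin w s : Glin (fun u => cliff (J u) w s).
Proof. by move=> f u1 u2; rewrite gcs_linear cliff_linl formDE formZE. Qed.

Lemma Nframe_indep x xs D xs' D' w : pframe x xs D -> pframe x xs' D' ->
  eqx x (Nframe xs D w) (Nframe xs' D' w).
Proof.
move=> h h' s; rewrite /Nframe !formZE !CvalM !form_sumE !Cval_sum; congr (_ * _).
apply: (@trace_indep _ _ _ _ _ (fun u1 u2 => cliff (J u1) (cliff u2 w) s)) => //.
  by move=> u f u1 u2; rewrite cliff_linl cliff_linr formDE formZE.
by move=> u; exact: cliffJ_Glin.
Qed.

(** The value at each x is computed in a chosen frame at x. Independence of the frame allows a local
    frame to be used near any given point, and this gives smoothness. *)
Lemma number_operator_exists : exists N : form -> form, forall x xs D w, pframe x xs D ->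
  eqx x (N w) (Nframe xs D w).
Proof.
have ex x : exists p : ('I_m -> A) * ('I_m -> V), pframe x p.1 p.2.
  have [ O [xs [D [Ox hf]]]] := frame_exists HS x.
  by exists (xs, D); exact: frame_on_pframe hf Ox.
have [p hp] := choice ex.
pose g w (s : seq V) x := Nframe (p x).1 (p x).2 w s x.
have [|N hN] := @choice form form (fun w N => forall s x, N s x = g w s x).
  move=> w; apply: (mk_form HS) => [s x|s1 s2 f X Y x|s1 s2 s3 X x].
  - have [ O [xs [D [Ox hf]]]] := frame_exists HS x; have [oO _ _] := hf.
    exists (Nframe xs D w s); apply: open_near oO Ox _ => y Oy.
    exact: Nframe_indep (hp y) (frame_on_pframe hf Oy) s.
  - by rewrite /g (formP _).1.
  - by rewrite /g (formP _).2.
by exists N => x xs D w hf s; rewrite hN; exact: Nframe_indep.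
Qed.
End NumberOperator.
End PointFrames.

Section NumberOperatorTheory.
Context {R : realType} {m : nat} {S : smoothSpace R}.
Hypothesis HS : leuclid m S.
Local Notation A := (Cinf S).
Local Notation V := (vfield S).
Local Notation form := (form S).
Local Notation gtan := (gtan S).
Local Notation cform := (cform S).
Implicit Types (x : S) (f : A) (X Y : V) (w v : form) (u : gtan) (z : cform).
Variables (J : gcs S) (N : form -> form).
Hypothesis hN : forall x (xs : 'I_m -> A) D w, pframe x xs D -> eqx x (N w) (Nframe J xs D w).

Lemma pframe_exists x : exists (xs : 'I_m -> A) D, pframe x xs D.
Proof.
have [ O [xs [D [Ox hf]]]] := frame_exists HS x.
by exists xs, D; exact: frame_on_pframe hf Ox.
Qed.

Lemma form_eqx w v : (forall x, eqx x w v) -> w = v.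
Proof. by move=> e; apply: formE => s; apply: CinfP => x; exact: e. Qed.

Lemma Nframe_lin xs (D : 'I_m -> V) f w v : Nframe J xs D (f *: w + v) = f *: Nframe J xs D w +
  Nframe J xs D v.
Proof.
rewrite /Nframe scalerA [f * _]mulrC -scalerA -scalerDr; congr (_ *: _).
rewrite scaler_sumr (eq_bigr
  (fun a => f *: cliff (J (gbasis xs D a)) (cliff (gbasis xs D (gswap a)) w) +
   cliff (J (gbasis xs D a)) (cliff (gbasis xs D (gswap a)) v))) ?big_split // => a _.
by rewrite !cliff_linr.
Qed.

Lemma Nlin f w v : N (f *: w + v) = f *: N w + N v.
Proof.
apply: form_eqx => x s; have [xs [D hf]] := pframe_exists x.
by rewrite (hN _ hf) Nframe_lin !formDE !formZE !CvalD !CvalM !(hN _ hf).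
Qed.
Lemma ND w v : N (w + v) = N w + N v.
Proof. by have := Nlin 1 w v; rewrite !scale1r. Qed.
Lemma N0 : N 0 = 0.
Proof. by apply: (addrI (N 0)); rewrite -ND !addr0. Qed.
Lemma NZ f w : N (f *: w) = f *: N w.
Proof. by rewrite -[f *: w]addr0 Nlin N0 addr0. Qed.
Lemma NN w : N (- w) = - N w. Proof. by rewrite -scaleN1r NZ scaleN1r. Qed.
Lemma NB w v : N (w - v) = N w - N v. Proof. by rewrite ND NN. Qed.

Lemma eqx_N x w v : eqx x w v -> eqx x (N w) (N v).
Proof.
move=> e s; have [xs [D hf]] := pframe_exists x; rewrite !(hN _ hf) /Nframe !formZE !CvalM.
rewrite !form_sumE !Cval_sum; congr (_ * _); apply: eq_bigr => a _.
by do 2!apply: eqx_cliff.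
Qed.

(** Moving u through the two factors of each term gives two sums, each of which is the expansion of
    J u in the frame; the second uses that J is skew. The factor 1/2 of [Nframe] compensates for the
    double count. *)
Lemma N_cliff u w : N (cliff u w) = cliff u (N w) + cliff (J u) w.
Proof.
apply: form_eqx => x s; have [xs [D hf]] := pframe_exists x.
set e := gbasis xs D.
have E a : cliff (J (e a)) (cliff (e (gswap a)) (cliff u w)) =
  cliff u (cliff (J (e a)) (cliff (e (gswap a)) w)) + (clifB (e (gswap a)) u *: cliff (J (e a)) w +
   clifB (e a) (J u) *: cliff (e (gswap a)) w).
  have h1 (u1 u2 : gtan) (v : form) : cliff u1 (cliff u2 v) =
    clifB u1 u2 *: v - cliff u2 (cliff u1 v).
    by rewrite -cliff_rel addrK.
  rewrite [cliff (e _) (cliff u w)]h1 cliffB cliffZ [cliff (J _) (cliff u _)]h1.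
  by rewrite [clifB (J _) u]clifB_skew scaleNr opprD !opprK addrA [LHS]addrC.
rewrite (hN _ hf) formDE CvalD (eqx_cliff u (hN w hf)) /Nframe (eq_bigr _ (fun a _ => E a)).
rewrite form_sumD scalerDr formDE CvalD cliffZ cliff_sum; congr (_ + _).
rewrite form_sumD formZE formDE CvalM CvalD Cval_cst.
have e1 := gexpand HS u hf (cliffJ_Glin J w s).
have e2 := gexpand HS (J u) hf (cliff_Glin w s).
rewrite -[X in X + _](_ : cliff (J u) w s x = _); last first.
  by rewrite form_sumE Cval_sum e1; apply: eq_bigr => a _; rewrite formZE CvalM.
rewrite -[X in _ + X](_ : cliff (J u) w s x = _); last first.
  rewrite form_sumE Cval_sum e2 -big_gswap; apply: eq_bigr => a _; rewrite formZE CvalM gswapK.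
  by [].
by field.
Qed.

Definition fparity (e : bool) w : Prop := forall s, odd (size s) != e -> w s = 0.

Lemma size_remove_nth (T : Type) i (s : seq T) : (i < size s)%N -> (size (remove_nth i s)).+1 =
  size s.
Proof.
by move=> h; rewrite /remove_nth size_cat size_drop size_takel 1?ltnW // -addSn subnKC.
Qed.

Lemma fparity_cliff e u w : fparity e w -> fparity (~~ e) (cliff u w).
Proof.
move=> h s hs; rewrite cliffE formDE contractE h ?add0r;
  last by rewrite /= -(inj_eq negb_inj) negbK.
rewrite wedgeE /wedge_fun big1 // => i _; rewrite h ?mulr0 //.
by rewrite -(inj_eq negb_inj) -[~~ odd _]/(odd (size _).+1) size_remove_nth.
Qed.

Lemma fparity_N e w : fparity e w -> fparity e (N w).
Proof.
move=> h s hs; apply: CinfP => x; have [xs [D hf]] := pframe_exists x.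
rewrite (hN _ hf) /Nframe formZE form_sumE big1 ?mulr0 // => a _.
by rewrite -[e]negbK in hs; apply: fparity_cliff hs; apply: fparity_cliff.
Qed.

Lemma cliffBl u1 u2 w : cliff (u1 - u2) w = cliff u1 w - cliff u2 w.
Proof. by rewrite cliffDl cliffNl. Qed.

(* [Mop] is [- i N]; [lam u] and [nu u] are twice the components of [u] in L and
   in the conjugate of L. *)
Definition Mop (w : cform) : cform := (N w.2, - N w.1).
Definition lam u : cgtan S := (u, - J u).
Definition nu u : cgtan S := (u, J u).
Definition eqc x (w v : cform) : Prop := eqx x w.1 v.1 /\ eqx x w.2 v.2.

Lemma ccliffB e : {morph (@ccliff R S e) : w v / w - v}.
Proof.
move=> w v; congr (_, _); rewrite /= !cliffB; first by rewrite subACA.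
by rewrite [in RHS]opprD addrACA.
Qed.
Lemma MopB : {morph Mop : w v / w - v}.
Proof. by move=> w v; rewrite /Mop /= !NB opprD. Qed.

Lemma eqc_ccliff x e z z' : eqc x z z' -> eqc x (ccliff e z) (ccliff e z').
Proof.
move=> [h1 h2]; split=> s; rewrite /ccliff /= ?formDE ?formNE ?CvalD ?CvalN.
  by congr (_ - _); exact: eqx_cliff.
by congr (_ + _); exact: eqx_cliff.
Qed.

Lemma eqc_Mop x z z' : eqc x z z' -> eqc x (Mop z) (Mop z').
Proof.
by move=> [h1 h2]; split=> s; rewrite /Mop /= ?formNE ?CvalN; [|congr (- _)]; exact: eqx_N.
Qed.

Ltac form_ring := repeat match goal with |- context [cliff ?u ?w] => generalize (cliff u w);
  intro end;
  apply: formE => ?; rewrite !(formDE, formNE); ring.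

Lemma Mop_lam u z : Mop (ccliff (lam u) z) = ccliff (lam u) (Mop z) + ccliff (lam u) z.
Proof.
by congr (_, _); rewrite /= !(cliffNl, NB, ND, NN, N_cliff, gcsN, gcs_square, cliffN, opprK);
  form_ring.
Qed.

Lemma Mop_nu u z : Mop (ccliff (nu u) z) = ccliff (nu u) (Mop z) - ccliff (nu u) z.
Proof.
by congr (_, _); rewrite /= !(cliffNl, NB, ND, NN, N_cliff, gcs_square, cliffN, opprK); form_ring.
Qed.

Lemma cliff_swap u1 u2 w : cliff u1 (cliff u2 w) = clifB u1 u2 *: w - cliff u2 (cliff u1 w).
Proof. by rewrite -cliff_rel addrK. Qed.

Ltac scaled_ring := rewrite ?mulr2n ?scalerDl ?scaleNr;
  repeat match goal with |- context [cliff ?u ?w] => generalize (cliff u w); intro end;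
  repeat match goal with |- context [clifB ?u ?w *: ?v] => generalize (clifB u w *: v); intro end;
  apply: formE => ?; rewrite !(formDE, formNE); ring.

Lemma ccliff_rel (e1 e2 : cgtan S) z : ccliff e1 (ccliff e2 z) + ccliff e2 (ccliff e1 z) =
  ((clifB e1.1 e2.1 - clifB e1.2 e2.2) *: z.1 - (clifB e1.1 e2.2 + clifB e1.2 e2.1) *: z.2,
   (clifB e1.1 e2.1 - clifB e1.2 e2.2) *: z.2 + (clifB e1.1 e2.2 + clifB e1.2 e2.1) *: z.1).
Proof.
have main (f1 g1 f2 g2 : form -> form) : (forall v w, f1 (v + w) = f1 v + f1 w) ->
  (forall v w, g1 (v + w) = g1 v + g1 w) ->
  (forall v w, f2 (v + w) = f2 v + f2 w) -> (forall v w, g2 (v + w) = g2 v + g2 w) ->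
  (forall v, f1 (- v) = - f1 v) -> (forall v, g1 (- v) = - g1 v) ->
    (forall v, f2 (- v) = - f2 v) -> (forall v, g2 (- v) = - g2 v) ->
  (f1 (f2 z.1 - g2 z.2) - g1 (f2 z.2 + g2 z.1) + (f2 (f1 z.1 - g1 z.2) - g2 (f1 z.2 + g1 z.1)),
   f1 (f2 z.2 + g2 z.1) + g1 (f2 z.1 - g2 z.2) + (f2 (f1 z.2 + g1 z.1) + g2 (f1 z.1 - g1 z.2))) =
  ((f1 (f2 z.1) + f2 (f1 z.1)) - (g1 (g2 z.1) + g2 (g1 z.1)) - ((f1 (g2 z.2) + g2 (f1 z.2)) +
    (g1 (f2 z.2) + f2 (g1 z.2))),
   (f1 (f2 z.2) + f2 (f1 z.2)) - (g1 (g2 z.2) + g2 (g1 z.2)) +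
     ((f1 (g2 z.1) + g2 (f1 z.1)) + (g1 (f2 z.1) + f2 (g1 z.1)))).
  by move=> h1 h2 h3 h4 n1 n2 n3 n4; congr (_, _); rewrite !(h1, h2, h3, h4, n1, n2, n3, n4);
    apply: formE => s; rewrite !(formDE, formNE); ring.
rewrite [LHS](main (cliff e1.1) (cliff e1.2) (cliff e2.1) (cliff e2.2)); try exact: cliffD;
  try exact: cliffN.
by rewrite !cliff_rel -!scalerBl -!scalerDl.
Qed.

Lemma clifB_zero_pair z : (0 *: z.1 - 0 *: z.2, 0 *: z.2 + 0 *: z.1) = (0 : cform).
Proof. by rewrite !scale0r subr0 addr0. Qed.

Lemma lam_anti u1 u2 z : ccliff (lam u1) (ccliff (lam u2) z) =
  - ccliff (lam u2) (ccliff (lam u1) z).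
Proof.
apply/eqP; rewrite -addr_eq0 ccliff_rel /= clifBNl clifBNr opprK clifB_orth subrr.
by rewrite clifBNr clifBNl clifB_skew opprK addNr clifB_zero_pair.
Qed.

Section QuadraticSums.
Variables (x : S) (xs : 'I_m -> A) (D : 'I_m -> V).
Hypothesis hf : pframe x xs D.
Local Notation e := (gbasis xs D).

(** Adding the sum to its image under [gswap] makes each of the 2m terms a Clifford relation between
    dual elements, of value 1. *)
Lemma sum_dual (G : gtan -> gtan) w s : (forall u1 u2, clifB (G u1) (G u2) = clifB u1 u2) ->
  (\sum_a cliff (G (e (gswap a))) (cliff (G (e a)) w)) s x = w s x *+ m.
Proof.
move=> hG; set X := (X in X = _).
have h : X + X = \sum_(a : 'I_m + 'I_m) w s x.
  rewrite {2}/X -big_gswap /X !form_sumE !Cval_sum -big_split; apply: eq_bigr => a _.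
  have := congr1 (fun v : form => v s x) (cliff_rel (G (e (gswap a))) (G (e a)) w).
  by rewrite gswapK hG formZE CvalM clifB_dual // mul1r.
rewrite sumr_const card_sum card_ord mulrnDr in h; lra.
Qed.

Lemma sum_JN w s : (\sum_a cliff (J (e (gswap a))) (cliff (e a) w)) s x = N w s x *+ 2.
Proof.
have -> : \sum_a cliff (J (e (gswap a))) (cliff (e a) w) =
  \sum_a cliff (J (e a)) (cliff (e (gswap a)) w).
  by rewrite -[LHS]big_gswap; apply: eq_bigr => a _; rewrite gswapK.
rewrite (hN w hf) /Nframe formZE CvalM Cval_cst; by field.
Qed.

Lemma trace_J : \sum_a clifB (e (gswap a)) (J (e a)) x = 0.
Proof.
set t := \sum_a _; suff : t = - t by move=> h; lra.
rewrite {1}/t -big_gswap -sumrN; apply: eq_bigr => a _.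
by rewrite gswapK clifB_sym clifB_skew.
Qed.

Lemma sum_NJ w s : (\sum_a cliff (e (gswap a)) (cliff (J (e a)) w)) s x = - (N w s x *+ 2).
Proof.
rewrite -sum_JN.
rewrite (eq_bigr (fun a => clifB (e (gswap a)) (J (e a)) *: w +
  - cliff (J (e a)) (cliff (e (gswap a)) w))).
  rewrite form_sumD formDE CvalD form_sumE Cval_sum.
  rewrite (eq_bigr (fun a => clifB (e (gswap a)) (J (e a)) x * w s x)); last by move=> a _;
    rewrite formZE CvalM.
  rewrite -mulr_suml trace_J mul0r add0r sumrN formNE CvalN; congr (- (_ : form) s x).
  by rewrite -[LHS]big_gswap; apply: eq_bigr => a _; rewrite gswapK.
by move=> a _; rewrite cliff_swap.
Qed.

(** For m = 2q the right-hand side is 4 (q - [Mop]), four times the level operator. Thus the level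
    operator vanishes wherever all [lam] do, and it factors through the annihilation operators. *)
Lemma sum_nu_lam z : eqc x (\sum_a ccliff (nu (e (gswap a))) (ccliff (lam (e a)) z))
  (z *+ (2 * m) - Mop z *+ 4).
Proof.
have p1 (I : finType) (F : I -> cform) : (\sum_a F a).1 =
  \sum_a (F a).1 by exact: (big_morph fst (id1 := 0) (op1 := +%R)).
have p2 (I : finType) (F : I -> cform) : (\sum_a F a).2 =
  \sum_a (F a).2 by exact: (big_morph snd (id1 := 0) (op1 := +%R)).
have pB1 (v w : cform) t : (v - w).1 t x = v.1 t x - w.1 t x by [].
have pB2 (v w : cform) t : (v - w).2 t x = v.2 t x - w.2 t x by [].
have id_ u1 u2 : clifB (id u1) (id u2) = clifB u1 u2 by [].
have Mn (p : cform) k : (p *+ k).1 = p.1 *+ k /\ (p *+ k).2 = p.2 *+ k.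
  by elim: k => // k [h1 h2]; rewrite !mulrS /= h1 h2.
have MnE (w : form) k s : (w *+ k) s x = w s x *+ k.
  by elim: k => [|k IH]; rewrite ?mulr0n // !mulrS formDE CvalD IH.
have sum4 (I : finType) (F1 F2 F3 F4 : I -> form) t : (\sum_a (F1 a + (F2 a + (F3 a + F4 a)))) t x =
    (\sum_a F1 a) t x + ((\sum_a F2 a) t x + ((\sum_a F3 a) t x + (\sum_a F4 a) t x)).
  by rewrite !form_sumD.
have d0 w t : (\sum_a cliff (e (gswap a)) (cliff (e a) w)) t x = w t x *+ m := @sum_dual id w t id_.
have dJ w t := @sum_dual J w t (clifB_orth J).
split=> s; rewrite ?p1 ?p2.
  rewrite (eq_bigr (fun a => cliff (e (gswap a)) (cliff (e a) z.1) +
    (cliff (J (e (gswap a))) (cliff (J (e a)) z.1) +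
    (cliff (e (gswap a)) (cliff (J (e a)) z.2) + - cliff (J (e (gswap a))) (cliff (e a) z.2)))));
      last first.
    move=> a _; rewrite [LHS]/= !cliffNl opprK cliffD cliffB opprB; form_ring.
  rewrite sum4 d0 dJ sum_NJ sumrN formNE CvalN sum_JN.
  have -> : (z *+ (2 * m) - Mop z *+ 4).1 s x = z.1 s x *+ (2 * m) - N z.2 s x *+ 4.
    by rewrite pB1 (Mn z _).1 (Mn (Mop z) _).1 !MnE.
  rewrite mul2n -addnn mulrnDr; ring.
rewrite (eq_bigr (fun a => cliff (e (gswap a)) (cliff (e a) z.2) +
  (cliff (J (e (gswap a))) (cliff (J (e a)) z.2) +
    (- cliff (e (gswap a)) (cliff (J (e a)) z.1) + cliff (J (e (gswap a))) (cliff (e a) z.1)))));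
      last first.
  move=> a _; rewrite [LHS]/= !cliffNl opprK cliffB [cliff (J _) (_ + _)]cliffD; form_ring.
rewrite sum4 d0 dJ sumrN formNE CvalN sum_NJ sum_JN.
have -> : (z *+ (2 * m) - Mop z *+ 4).2 s x = z.2 s x *+ (2 * m) + N z.1 s x *+ 4.
  have M2 : (Mop z).2 s x = - N z.1 s x by [].
  by rewrite pB2 (Mn z _).2 (Mn (Mop z) _).2 !MnE M2 mulNrn opprK.
rewrite mul2n -addnn mulrnDr; ring.
Qed.
End QuadraticSums.
End NumberOperatorTheory.

(** * Degrees of forms and irreducibility of the Clifford module *)

Section Degrees.
Context {R : realType} {m : nat} {S : smoothSpace R}.
Hypothesis HS : leuclid m S.
Local Notation A := (Cinf S).
Local Notation V := (vfield S).
Local Notation form := (form S).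
Local Notation cform := (cform S).
Implicit Types (x : S) (f : A) (X Y : V) (w v : form) (z : cform).

Lemma one_form_subproof : ((fun s : seq V => if s is [::] then 1 else 0) : seq V -> A^o) \in
  is_form S.
Proof.
by apply/asboolP; split=> [[|X0 s1] s2 f X Y|[|X0 s1] s2 s3 X] //=; rewrite mulr0 addr0.
Qed.
Definition one_form : form := MkForm one_form_subproof.

Lemma degscale_subproof (c : nat -> R) w :
  ((fun s : seq V => Ccst S (c (size s)) * w s) : seq V -> A^o) \in is_form S.
Proof.
apply/asboolP; split=> [s1 s2 f X Y|s1 s2 s3 X].
  by rewrite !size_cat /= (formP w).1; ring.
by rewrite (formP w).2 mulr0.
Qed.
Definition degscale c w : form := MkForm (degscale_subproof c w).
Lemma degscaleE c w s : degscale c w s = Ccst S (c (size s)) * w s. Proof. by []. Qed.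

Lemma form_move_front w s i : (i < size s)%N -> w (nth 0 s i :: remove_nth i s) = (-1) ^+ i * w s.
Proof.
elim: s i w => [|X s IH] [|i] w //= si; first by rewrite /remove_nth /= drop0 mul1r.
rewrite /remove_nth /= form_swap -contractE IH // contractE exprS; ring.
Qed.

(** The Euler operator: each argument is expanded in the frame, moved to the front and counted
    once. *)
Lemma sum_wedge_contract x (xs : 'I_m -> A) D w s : pframe x xs D ->
  (\sum_j wedge (differential (xs j)) (contract (D j) w)) s x = (size s)%:R * w s x.
Proof.
move=> hf; rewrite form_sumE Cval_sum.
under eq_bigr => j _ do rewrite wedgeE /wedge_fun Cval_sum.
rewrite exchange_big /= (eq_bigr (fun=> w s x)) => [|i _].
  by rewrite sumr_const card_ord mulr_natl.
have e := pframe_expand HS (nth 0 s i) hf (form_slot w [::] (remove_nth i s)).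
have -> : w s = (-1) ^+ i * w (nth 0 s i :: remove_nth i s).
  by rewrite form_move_front // mulrA -exprMn mulrN1 opprK expr1n mul1r.
by rewrite CvalM e mulr_sumr; apply: eq_bigr => j _.
Qed.

(** After expansion of every argument in a frame, more than m arguments repeat a frame field. *)
Lemma form_dim w x s : (m < size s)%N -> w s x = 0.
Proof.
have [xs [D hf]] := pframe_exists HS x.
have red k v : (forall js : seq 'I_m, size js = k -> v (map D js) x = 0) -> forall t,
  size t = k -> v t x = 0.
  elim: k v => [|k IH] v hv [|X t] //= st; first exact: (hv [::]).
  rewrite (pframe_expand HS X hf (form_slot v [::] t)) big1 // => j _.
  rewrite -[v ([::] ++ D j :: t)]/(contract (D j) v t) (IH (contract (D j) v)) ?mulr0 //;
    last by case: st.
  by move=> js sjs; rewrite contractE; apply: (hv (j :: js)); rewrite /= sjs.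
move=> ms; apply: (red (size s) w) => // js sjs.
have : ~~ uniq js.
  by apply/negP => u; have := max_card (mem js); rewrite (card_uniqP u) sjs card_ord leqNgt ms.
elim: js w {sjs} => [|j js IH] v //=; rewrite negb_and negbK => /orP[/splitPr[p1 p2]|u].
  by rewrite map_cat /=; have [_ h] := formP v; rewrite (h [::]).
by rewrite -contractE; exact: IH.
Qed.

Lemma degree_decomposition w x : eqx x w (\sum_(k < m.+1) degscale (fun j => (j == k)%:R) w).
Proof.
move=> s; rewrite form_sumE Cval_sum; have [sm|ms] := ltnP (size s) m.+1.
  rewrite (bigD1 (Ordinal sm)) //= big1 ?addr0 => [|k nk].
    by rewrite -[RHS]/((size s == size s)%:R * w s x) eqxx mul1r.
  rewrite -[LHS]/((size s == k)%:R * w s x); move: nk; rewrite -val_eqE eq_sym /= => /negPf ->.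
  by rewrite mul0r.
by rewrite form_dim // big1 // => k _; rewrite degscaleE CvalM form_dim ?mulr0.
Qed.

(* The forms at x are an irreducible Clifford module: a complex subspace stable under
   all [cliff u] and containing a form that does not vanish at x is everything. *)
Section Irreducible.
Variables (x : S) (W : cform -> Prop).
Hypotheses (Weq : forall z z', eqc x z z' -> W z -> W z') (WD : forall z z', W z -> W z' ->
  W (z + z'))
  (WZ : forall (r : R) z, W z -> W (Ccst S r *: z)) (Wi : forall z, W z -> W (muli z))
  (Wcl : forall u z, W z -> W (ccliff (u, 0) z)).

Lemma ccliff_real u z : ccliff (u, 0) z = (cliff u z.1, cliff u z.2).
Proof. by rewrite /ccliff /= !cliff0l subr0 addr0. Qed.
Lemma cliff_contract X w : cliff (X, 0) w = contract X w.
Proof.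
apply: formE => s; rewrite cliffE formDE -[RHS]addr0; congr (_ + _).
rewrite wedgeE /wedge_fun big1 // => i _; rewrite -[_ (nth 0 s i)]/(0 : A); by rewrite mul0r mulr0.
Qed.
Lemma cliff_wedge al w : cliff (0, al) w = wedge al w.
Proof.
by apply: formE => s; rewrite cliffE formDE -[RHS]add0r; congr (_ + _); rewrite contractE form0.
Qed.

Lemma ccliff_contract X z : ccliff ((X, 0), 0) z = (contract X z.1, contract X z.2).
Proof. by rewrite ccliff_real !cliff_contract. Qed.
Lemma ccliff_wedge al z : ccliff ((0, al), 0) z = (wedge al z.1, wedge al z.2).
Proof. by rewrite ccliff_real !cliff_wedge. Qed.

(** Contracting phi along a longest sequence on which it does not vanish at x leaves a nonzero
    complex constant. Its multiples are all constants, and the Euler operator builds a form of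
    degree j + 1 from contractions, of degree j, by wedging with differentials. *)
Lemma irreducible phi : W phi -> ~ eqc x phi 0 -> forall z, W z.
Proof.
move=> Wphi nphi.
have W0 : W 0 by have := WZ 0 Wphi; rewrite Ccst0 scale0r.
have pZ1 (f : A) z : (f *: z).1 = f *: z.1 by [].
have pZ2 (f : A) z : (f *: z).2 = f *: z.2 by [].
pose P k := `[< exists s, size s = k /\ (phi.1 s x != 0) || (phi.2 s x != 0) >].
have exP : exists k, P k.
  have [[s hs]|ns] := pselect (exists s, (phi.1 s x != 0) || (phi.2 s x != 0)).
    by exists (size s); apply/asboolP; exists s.
  case: nphi; split=> s; apply/eqP/negPn/negP => h; apply: ns; exists s; by rewrite h ?orbT.
have ubP k : P k -> (k <= m)%N.
  move=> /asboolP[s [<- h]]; rewrite leqNgt; apply/negP => ms.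
  by move: h; rewrite !form_dim // eqxx.
have [k /asboolP[s [sk hs]] kmax] := ex_maxnP exP ubP.
pose ctr (t : seq V) z := foldl (fun z X => ccliff ((X, 0), 0) z) z t.
have ctrE t z u : (ctr t z).1 u = z.1 (t ++ u) /\ (ctr t z).2 u = z.2 (t ++ u).
  elim: t z => [|X t IH] z //=; have [-> ->] := IH (ccliff ((X, 0), 0) z).
  by rewrite ccliff_real !cliff_contract.
have Wctr t z : W z -> W (ctr t z).
  by elim: t z => [|X t IH] z //= Wz; apply: IH; exact: Wcl.
pose a := phi.1 s x; pose b := phi.2 s x.
have c1 : W (Ccst S a *: one_form, Ccst S b *: one_form).
  apply: Weq (Wctr s _ Wphi); have z0 u : u != [::] -> phi.1 (s ++ u) x = 0 /\ phi.2 (s ++ u) x = 0.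
    move=> nu; have : ~~ P (size (s ++ u)).
      by apply/negP => /kmax;
        rewrite size_cat sk -[X in (_ <= X)%N]addn0 leq_add2l leqn0 size_eq0 (negPf nu).
    move=> /asboolPn h; split; apply/eqP/negPn/negP => e; apply: h; exists (s ++ u);
      by rewrite e ?orbT.
  split=> u; have [e1 e2] := ctrE s phi u; rewrite ?e1 ?e2.
    change (phi.1 (s ++ u) x = a * one_form u x).
    by case: u {e1 e2} => [|X u]; [rewrite cats0 mulr1|rewrite mulr0; have [] := z0 (X :: u) isT].
  change (phi.2 (s ++ u) x = b * one_form u x).
  by case: u {e1 e2} => [|X u]; [rewrite cats0 mulr1|rewrite mulr0; have [] := z0 (X :: u) isT].
have ab : a ^+ 2 + b ^+ 2 != 0.
  by rewrite paddr_eq0 ?sqr_ge0 // !sqrf_eq0 negb_and; exact: hs.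
have Wc (c d : R) : W (Ccst S c *: one_form, Ccst S d *: one_form).
  (* These are the real and imaginary parts of (c + i d) / (a + i b). *)
  pose p := (c * a + d * b) / (a ^+ 2 + b ^+ 2); pose r := (d * a - c * b) / (a ^+ 2 + b ^+ 2).
  apply: Weq (WD (WZ p c1) (Wi (WZ r c1))).
  split=> u.
    change (p * (a * one_form u x) + - (r * (b * one_form u x)) = c * one_form u x);
      rewrite /p /r; by field.
  change (p * (b * one_form u x) + r * (a * one_form u x) = d * one_form u x); rewrite /p /r;
    by field.
have Wdeg j z : (forall t, size t != j -> z.1 t x = 0 /\ z.2 t x = 0) -> W z.
  elim: j z => [|j IH] z hz.
    apply: Weq (Wc (z.1 [::] x) (z.2 [::] x)); split=> -[|X t].
    - exact: mulr1.
    - by have [-> _] := hz (X :: t) isT; exact: mulr0.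
    - exact: mulr1.
    - by have [_ ->] := hz (X :: t) isT; exact: mulr0.
  have [xs [D hf]] := pframe_exists HS x.
  have Wsum (I : Type) (r : seq I) (F : I -> cform) : (forall i, W (F i)) -> W (\sum_(i <- r) F i).
    move=> hF; elim: r => [|i r IHr]; last by rewrite big_cons; exact: WD.
    by rewrite big_nil.
  have Wj i : W (ccliff ((0, differential (xs i)), 0) (ccliff ((D i, 0), 0) z)).
    apply: Wcl; apply: IH => t tj; rewrite ccliff_contract !contractE.
    by apply: hz; rewrite /= eqSS.
  apply: Weq (WZ (j.+1%:R^-1) (Wsum _ (index_enum 'I_m) _ Wj)).
  have p1 (F : 'I_m -> cform) : (\sum_a F a).1 =
    \sum_a (F a).1 by exact: (big_morph fst (id1 := 0) (op1 := +%R)).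
  have p2 (F : 'I_m -> cform) : (\sum_a F a).2 =
    \sum_a (F a).2 by exact: (big_morph snd (id1 := 0) (op1 := +%R)).
  have jn : (j.+1%:R : R) != 0 by rewrite pnatr_eq0.
  split=> t.
    rewrite pZ1 formZE CvalM Cval_cst p1.
    under eq_bigr => i _ do rewrite ccliff_contract ccliff_wedge.
    rewrite (sum_wedge_contract _ _ hf); have [->|tj] := eqVneq (size t) j.+1;
      first by rewrite mulKf.
    by have [-> _] := hz _ tj; rewrite !mulr0.
  rewrite pZ2 formZE CvalM Cval_cst p2.
  under eq_bigr => i _ do rewrite ccliff_contract ccliff_wedge.
  rewrite (sum_wedge_contract _ _ hf); have [->|tj] := eqVneq (size t) j.+1; first by rewrite mulKf.
  by have [_ ->] := hz _ tj; rewrite !mulr0.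
move=> z.
have Wk (j : nat) : W (degscale (fun i => (i == j)%:R) z.1, degscale (fun i => (i == j)%:R) z.2).
  apply: (Wdeg j) => t tj; split.
    by change ((size t == j)%:R * z.1 t x = 0); rewrite (negPf tj) mul0r.
  by change ((size t == j)%:R * z.2 t x = 0); rewrite (negPf tj) mul0r.
have Wsum j : W (\sum_(k < j) degscale (fun i => (i == k)%:R) z.1,
  \sum_(k < j) degscale (fun i => (i == k)%:R) z.2).
  elim: j => [|j IH]; last by rewrite !big_ord_recr; exact: (WD IH (Wk j)).
  by rewrite !big_ord0.
by apply: Weq (Wsum m.+1); split=> t; rewrite -degree_decomposition.
Qed.
End Irreducible.
End Degrees.

(** * Eigenvector decompositions modulo a subgroup *)

Section EigenDecomposition.
Variables (E : zmodType) (Z : E -> Prop) (K : E -> E).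
Hypotheses (Z0 : Z 0) (ZB : forall v w, Z v -> Z w -> Z (v - w))
  (Ztf : forall w n, Z (w *+ n.+1) -> Z w).
Hypotheses (KB : {morph K : v w / v - w}) (ZK : forall w, Z w -> Z (K w)).

(** Applying K - k0 to the sum removes the term k0 and multiplies each other term by the nonzero
    integer k - k0, which torsion-freeness of the quotient by Z allows to be cancelled. *)
Lemma eigen_indep (s : seq nat) (c : nat -> E) : uniq s ->
  (forall k, k \in s -> Z (K (c k) - c k *+ k)) ->
  Z (\sum_(k <- s) c k) -> forall k, k \in s -> Z (c k).
Proof.
elim: s c => [|k0 s IH] c //= /andP[k0s us] hc hs.
have Kb (F : nat -> E) (t : seq nat) : K (\sum_(k <- t) F k) = \sum_(k <- t) K (F k).
  by elim: t => [|k t IHt]; rewrite ?big_nil ?(mB0 KB) // !big_cons (mBD KB) IHt.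
have Zsum (F : nat -> E) (t : seq nat) : (forall k, k \in t -> Z (F k)) -> Z (\sum_(k <- t) F k).
  elim: t => [|k t IHt] hF; first by rewrite big_nil.
  rewrite big_cons; apply: (ZD Z0 ZB); first by apply: hF; rewrite inE eqxx.
  by apply: IHt => j jt; apply: hF; rewrite inE jt orbT.
have hall k : k \in s -> Z (c k).
  move=> ks; have kk0 : k%:Z - k0%:Z != 0.
    by rewrite subr_eq0 eqz_nat; apply/eqP => e; move: k0s; rewrite -e ks.
  apply: (Ztfz Z0 ZB Ztf kk0); move: k ks {kk0}.
  apply: (IH (fun k => c k *~ (k%:Z - k0%:Z)) us) => [k ks|].
    rewrite (mBMz KB) [_ *~ _ *+ k]pmulrn -mulrzA mulrC mulrzA -pmulrn -mulrzBl; apply: (ZMz Z0 ZB).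
    by apply: hc; rewrite inE ks orbT.
  set t := \sum_(k <- k0 :: s) c k in hs.
  have h1 : Z (K t - t *+ k0) by apply: ZB; [exact: ZK|exact: (ZMn Z0 ZB)].
  have h2 : Z (K t - t *+ k0 - \sum_(k <- k0 :: s) c k *~ (k%:Z - k0%:Z)).
    rewrite /t Kb -sumrMnl -sumrB -sumrB; apply: Zsum => k ks.
    by rewrite mulrzBr -!pmulrn opprB addrA subrK; exact: hc.
  have := ZB h1 h2; rewrite opprB addrCA subrr addr0 big_cons subrr mulr0z add0r; exact.
move=> k; rewrite inE => /orP[/eqP->|]; last exact: hall.
by rewrite big_cons in hs; have := ZB hs (Zsum _ _ hall); rewrite addrK.
Qed.

Variable dv : int -> E -> E.
Hypotheses (dvK : forall e w, e != 0 -> dv e w *~ e = w) (K_dv : forall e w, K (dv e w) =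
  dv e (K w))
  (dvMn : forall e w n, dv e (w *+ n) = dv e w *+ n).

(** Lagrange interpolation by induction: (K - k0) w decomposes over the other eigenvalues; after
    division of its components by k - k0 they account for w up to an eigenvector for k0. *)
Lemma eigen_decomp (s : seq nat) w : uniq s -> fall K s w = 0 ->
  exists c : nat -> E, w = \sum_(k <- s) c k /\ forall k, k \in s -> K (c k) = c k *+ k.
Proof.
elim: s w => [|k0 s IH] w us hw; first by exists (fun=> 0); rewrite big_nil.
have /andP[k0s us'] := us.
have [|c [cw cE]] := IH (shift_op K k0 w) us'; first by rewrite (fall_shift KB).
have nz k : k \in s -> k%:Z - k0%:Z != 0.
  move=> ks; rewrite subr_eq0 eqz_nat; apply/eqP => e; move: k0s; by rewrite -e ks.
pose c' k := dv (k%:Z - k0%:Z) (c k).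
have c'E k : k \in s -> K (c' k) = c' k *+ k by move=> ks; rewrite /c' K_dv cE // dvMn.
pose w0 := w - \sum_(k <- s) c' k.
have Kw0 : K w0 = w0 *+ k0.
  have : shift_op K k0 w0 = 0.
    rewrite /w0 (shift_opB KB) cw big_seq [X in _ - shift_op _ _ X]big_seq.
    have sD v1 v2 : shift_op K k0 (v1 + v2) = shift_op K k0 v1 + shift_op K k0 v2 :=
      mBD (shift_opB KB k0) v1 v2.
    rewrite (big_morph _ sD (mB0 (shift_opB KB k0))) -sumrB big1 // => k ks.
    rewrite /shift_op c'E // /c' -{1}(dvK (c k) (nz _ ks)) mulrzBr -!pmulrn subrr //.
  by move/eqP; rewrite subr_eq0 => /eqP.
exists (fun k => if k == k0 then w0 else c' k); split.
  rewrite big_cons eqxx /w0 big_seq [X in _ + X](_ : _ = \sum_(k <- s | k \in s) c' k) ?subrK //.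
  by rewrite big_seq; apply: eq_bigr => k ks; case: eqP => // e; move: k0s; rewrite -e ks.
move=> k; rewrite inE; case: eqP => [->|_] //=; exact: c'E.
Qed.
End EigenDecomposition.

(** * The eigenbundles [U ^ k] *)

Section PointSpectrum.
Context {R : realType} {q : nat} {S : smoothSpace R}.
Hypothesis HS : leuclid (2 * q) S.
Local Notation A := (Cinf S).
Local Notation V := (vfield S).
Local Notation form := (form S).
Local Notation gtan := (gtan S).
Local Notation cform := (cform S).
Implicit Types (x : S) (f : A) (X Y : V) (w v : form) (u : gtan) (z : cform).
Variables (J : gcs S) (N : form -> form).
Hypothesis hN : forall x (xs : 'I_(2 * q) -> A) D w, pframe x xs D -> eqx x (N w) (Nframe J xs D w).

(* [level = k] cuts out U^(q - k). *)
Definition level z : cform := z *+ q - Mop N z.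
Local Notation Kop := level.
Definition cconj z : cform := (z.1, - z.2).
Definition Zx x z : Prop := eqc x z 0.

Lemma Zx0 x : Zx x 0. Proof. by []. Qed.
Lemma ZxB x z z' : Zx x z -> Zx x z' -> Zx x (z - z').
Proof.
move=> [h1 h2] [h3 h4]; split=> s.
  by change (z.1 s x - z'.1 s x = 0); rewrite h1 h3 subrr.
by change (z.2 s x - z'.2 s x = 0); rewrite h2 h4 subrr.
Qed.
Lemma eqcP x z z' : eqc x z z' <-> Zx x (z - z').
Proof.
split=> -[h1 h2]; split=> s.
- by change (z.1 s x - z'.1 s x = 0); rewrite h1 subrr.
- by change (z.2 s x - z'.2 s x = 0); rewrite h2 subrr.
- by apply/eqP; rewrite -subr_eq0; apply/eqP; exact: h1 s.
- by apply/eqP; rewrite -subr_eq0; apply/eqP; exact: h2 s.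
Qed.
Lemma cformMn1 z n s x : (z *+ n).1 s x = z.1 s x *+ n.
Proof. by elim: n => [|n IH] //; rewrite !mulrS -IH. Qed.
Lemma cformMn2 z n s x : (z *+ n).2 s x = z.2 s x *+ n.
Proof. by elim: n => [|n IH] //; rewrite !mulrS -IH. Qed.
Lemma Zxtf x z n : Zx x (z *+ n.+1) -> Zx x z.
Proof.
move=> [h1 h2]; split=> s.
  by have := h1 s; rewrite cformMn1 => /eqP; rewrite mulrn_eq0 /= => /eqP.
by have := h2 s; rewrite cformMn2 => /eqP; rewrite mulrn_eq0 /= => /eqP.
Qed.
Lemma ccliff0 e : ccliff e 0 = 0 :> cform. Proof. exact: mB0 (ccliffB e). Qed.
Lemma Zx_ccliff x e z : Zx x z -> Zx x (ccliff e z).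
Proof. by move=> h; rewrite /Zx -(ccliff0 e); exact: eqc_ccliff. Qed.
Lemma Zx_Mop x z : Zx x z -> Zx x (Mop N z).
Proof. by move=> h; rewrite /Zx -(mB0 (MopB HS hN)); exact: (eqc_Mop HS hN). Qed.

Lemma KopB : {morph Kop : z z' / z - z'}.
Proof. by move=> z z'; rewrite /Kop (MopB HS hN) mulrnBl subACA. Qed.
Lemma Zx_Kop x z : Zx x z -> Zx x (Kop z).
Proof. by move=> h; apply: ZxB; [exact: (ZMn (@Zx0 x) (@ZxB x))|exact: Zx_Mop]. Qed.
Lemma Zx_cconj x z : Zx x z <-> Zx x (cconj z).
Proof.
split=> -[h1 h2]; split=> s //.
  by change (- z.2 s x = 0); rewrite h2 oppr0.
by apply/eqP; rewrite -oppr_eq0; apply/eqP; exact: h2 s.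
Qed.
Lemma cconjB : {morph cconj : z z' / z - z'}.
Proof. by move=> z z'; rewrite /cconj /= opprD. Qed.
Lemma Kop_cconj z : Kop (cconj z) = cconj z *+ (2 * q) - cconj (Kop z).
Proof.
have hM : Mop N (cconj z) = - cconj (Mop N z) by rewrite /cconj /Mop; congr (_, _);
  rewrite /= ?(NN HS hN) ?opprK.
by rewrite /Kop hM opprK cconjB (mBMn cconjB) mul2n -addnn mulrnDr opprB addrACA subrr addr0.
Qed.
Lemma Kop_lam u z : Kop (ccliff (lam J u) z) = ccliff (lam J u) (Kop z) - ccliff (lam J u) z.
Proof. by rewrite /Kop (Mop_lam HS hN) ccliffB (mBMn (ccliffB _)) opprD addrA. Qed.
Lemma Kop_nu u z : Kop (ccliff (nu J u) z) = ccliff (nu J u) (Kop z) + ccliff (nu J u) z.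
Proof. by rewrite /Kop (Mop_nu HS hN) ccliffB (mBMn (ccliffB _)) opprB addrCA addrC. Qed.

Lemma Kop_quadratic x (xs : 'I_(2 * q) -> A) (D : 'I_(2 * q) -> V) z : pframe x xs D ->
  (forall a, Zx x (ccliff (lam J (gbasis xs D a)) z)) -> Zx x (Kop z).
Proof.
move=> hf h; apply: (@Zxtf _ _ 3).
have Zsum (I : Type) (r : seq I) (F : I -> cform) : (forall i, Zx x (F i)) ->
  Zx x (\sum_(i <- r) F i).
  by move=> hF; elim: r => [|i r IH]; rewrite ?big_nil // big_cons; exact: (ZD (@Zx0 x) (@ZxB x)).
have /eqcP := sum_nu_lam hN hf z.
set t := \sum_a _; have Zt : Zx x t by apply: Zsum => a; exact: Zx_ccliff.
move=> /(ZxB Zt); rewrite opprB addrCA subrr addr0 [(2 * (2 * q))%N](_ : _ = (q * 4)%N);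
  last by rewrite mulnA mulnC.
by rewrite mulrnA -mulrnBl.
Qed.

Lemma spectrum_at x z (e : int) : Zx x (Kop z - z *~ e) ->
  (forall k : nat, (k <= 2 * q)%N -> e != k%:Z) -> Zx x z.
Proof.
have [xs [D hf]] := pframe_exists HS x.
apply: (@spectrum _ (Zx x) _ (fun a => ccliff (lam J (gbasis xs D a))) Kop cconj (2 * q) (@Zx0 x)
  (@ZxB x) (@Zxtf x)).
- by move=> a; exact: ccliffB.
- exact: KopB.
- by move=> a w; exact: Zx_ccliff.
- exact: Zx_Kop.
- exact: Zx_cconj.
- by move=> a b w; exact: lam_anti.
- by move=> a w; exact: Kop_lam.
- by move=> w; exact: Kop_quadratic hf.
- exact: Kop_cconj.
- exact: cconjB.
Qed.

Lemma cform_eq0 z : (forall x, Zx x z) -> z = 0.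
Proof.
by move=> h; case: z h => a b h; congr (_, _); apply: form_eqx => x; have [] := h x.
Qed.

Lemma fall_Kop z : fall Kop (iota 0 (2 * q).+1) z = 0.
Proof.
apply: cform_eq0 => x; have [xs [D hf]] := pframe_exists HS x.
apply: (@fall_spectrum _ (Zx x) _ (fun a => ccliff (lam J (gbasis xs D a))) Kop cconj (2 * q)
  (@Zx0 x) (@ZxB x) (@Zxtf x)).
- by move=> a; exact: ccliffB.
- exact: KopB.
- by move=> a w; exact: Zx_ccliff.
- exact: Zx_Kop.
- exact: Zx_cconj.
- by move=> a b w; exact: lam_anti.
- by move=> a w; exact: Kop_lam.
- by move=> w; exact: Kop_quadratic hf.
- exact: Kop_cconj.
- exact: cconjB.
Qed.

(** The result would have level -1, which is outside the spectrum. *)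
Lemma vacuum_lam x u z : Zx x (Kop z) -> Zx x (ccliff (lam J u) z).
Proof.
move=> h; apply: (@spectrum_at x _ (-1)) => [|k _]; last by case: k.
by rewrite mulrNz mulr1z opprK Kop_lam subrK; exact: Zx_ccliff.
Qed.

Definition cdiv (e : int) z : cform := Ccst S (e%:~R)^-1 *: z.

Lemma KopZ (f : A) z : Kop (f *: z) = f *: Kop z.
Proof.
rewrite /Kop scalerBr -scalerMnr; congr (_ - _).
by rewrite /Mop /= !(NZ HS hN) -scalerN.
Qed.

Lemma eigen_decomp_Kop z : exists c : nat -> cform, z = \sum_(k <- iota 0 (2 * q).+1) c k /\
  forall k, k \in iota 0 (2 * q).+1 -> Kop (c k) = c k *+ k.
Proof.
apply: (@eigen_decomp _ Kop KopB cdiv) => [e w e0|e w|e w n||].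
- rewrite /cdiv -scaler_int scalerA.
  have -> : (e%:~R : A) = Ccst S e%:~R.
    have CMn n : (n%:R : A) = Ccst S n%:R by elim: n => [|n IH];
      rewrite ?Ccst0 // !mulrSr CcstD IH Ccst1.
    by case: e {e0} => n; [exact: CMn|rewrite NegzE !mulrNz CcstN -!pmulrn CMn].
  by rewrite -CcstM divff ?Ccst1 ?scale1r // intr_eq0.
- exact: KopZ.
- by rewrite /cdiv scalerMnr.
- exact: iota_uniq.
- exact: fall_Kop.
Qed.

(** The level 0 component of z is the required global form; independence of the levels at x shows
    that it has the same value there as z. *)
Lemma vacuum_global x z : Zx x (Kop z) -> exists z', Kop z' = 0 /\ eqc x z' z.
Proof.
move=> Kw; have [c [cw cE]] := eigen_decomp_Kop z.
exists (c 0); split; first by rewrite cE ?mem_iota.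
apply/eqcP; pose c' k := if k == 0%N then c 0%N - z else c k.
have m0 : 0%N \in iota 0 (2 * q).+1 by rewrite mem_iota.
apply: (@eigen_indep _ (Zx x) Kop (@Zx0 x) (@ZxB x) (@Zxtf x) KopB (@Zx_Kop x) (iota 0 (2 * q).+1)
  c' (iota_uniq _ _) _ _ 0%N m0) => [k km|].
  rewrite /c'; case: eqP => [->|_]; last by rewrite cE ?subrr.
  by rewrite mulr0n subr0 KopB cE // mulr0n sub0r; apply: (ZN (@Zx0 x) (@ZxB x)).
rewrite big_cons /= (eq_big_seq c); last by move=> k; rewrite mem_iota; case: k.
rewrite /c' eqxx [X in X + _]addrC -addrA -[c 0%N + _]/(c 0%N + \sum_(j <- iota 1 (2 * q)) c j).
by have -> : c 0%N + \sum_(j <- iota 1 (2 * q)) c j = z; [rewrite cw big_cons|rewrite addNr].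
Qed.

(** Starting from the constant function 1, annihilation operators are applied until all of them give
    zero at x; the value so reached is then extended to a global form of level 0. *)
Lemma vacuum_exists_at x : exists z, ~ Zx x z /\ Kop z = 0.
Proof.
have [xs [D hf]] := pframe_exists HS x.
have n1 : ~ Zx x (one_form, 0) by move=> [/(_ [::]) /eqP]; rewrite [_ == _]oner_eq0.
have [s ns hs] := @vacuum_exists _ (Zx x) _ (fun a => ccliff (lam J (gbasis xs D a))) (@Zx0 x)
  (@ZxB x) (@Zxtf x)
   (fun a (z : cform) => @Zx_ccliff x _ z) (fun a b (z : cform) => lam_anti J _ _ z) _ n1.
have [z [Kz ez]] := vacuum_global (Kop_quadratic hf hs).
exists z; split => // Zz; apply: ns; have := ZxB Zz ((eqcP _ _ _).1 ez).
by rewrite opprB addrCA subrr addr0.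
Qed.
End PointSpectrum.

Lemma Cinf_continuous (R : realType) m (S : smoothSpace R) (HS : leuclid m S) (f : Cinf S) (x : S)
  : {for x, continuous (f : S -> R)}.
Proof.
have [_ /(_ x)[ O [phi [psi [Ox hc]]]] _] := HS.
have n1 : \forall y \near x, (f \o psi \o phi) y = f y.
  by apply: open_near (chart_open hc) Ox _ => y Oy /=; rewrite (chartK hc).
apply: near_continuous n1 _; apply: continuous_comp; first exact: (chart_cont hc).
by apply: smooth_in_continuous (chart_read hc f) _; exists x.
Qed.

(** * The level 0 values at a point form a complex line *)

Section SpinorLine.
Context {R : realType} {q : nat} {S : smoothSpace R}.
Hypothesis HS : leuclid (2 * q) S.
Local Notation A := (Cinf S).
Local Notation V := (vfield S).
Local Notation form := (form S).
Local Notation gtan := (gtan S).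
Local Notation cform := (cform S).
Implicit Types (x : S) (f : A) (X Y : V) (w v : form) (u : gtan) (z : cform).
Variables (J : gcs S) (N : form -> form).
Hypothesis hN : forall x (xs : 'I_(2 * q) -> A) D w, pframe x xs D -> eqx x (N w) (Nframe J xs D w).
Local Notation Kop := (level (q := q) N).
Local Notation KB := (KopB HS hN).

Local Ltac form_ring := repeat match goal with |- context [cliff ?u ?w] => generalize (cliff u w);
  intro end;
  apply: formE => ?; rewrite !(formDE, formNE, form0E); ring.

Lemma ZxD x z z' : Zx x z -> Zx x z' -> Zx x (z + z').
Proof. exact: (ZD (@Zx0 _ _ x) (@ZxB _ _ x)). Qed.
Lemma ZxN x z : Zx x z -> Zx x (- z).
Proof. exact: (ZN (@Zx0 _ _ x) (@ZxB _ _ x)). Qed.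
Lemma eqc_refl x z : eqc x z z. Proof. by []. Qed.
Lemma eqc_sym x z z' : eqc x z z' -> eqc x z' z.
Proof. by move=> [h1 h2]; split=> s; rewrite ?h1 ?h2. Qed.
Lemma eqc_trans x z1 z2 z3 : eqc x z1 z2 -> eqc x z2 z3 -> eqc x z1 z3.
Proof. by move=> [h1 h2] [h3 h4]; split=> s; rewrite ?h1 ?h2 ?h3 ?h4. Qed.

Lemma Ccst_int (e : int) : Ccst S e%:~R = e%:~R.
Proof.
have CMn n : Ccst S n%:R = n%:R by elim: n => [|n IH]; rewrite ?Ccst0 // !mulrSr CcstD IH Ccst1.
by case: e => n; [exact: CMn|rewrite NegzE !mulrNz CcstN -!pmulrn CMn].
Qed.

Lemma at_ptP x z z' : at_pt x z = at_pt x z' <-> eqc x z z'.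
Proof.
split=> [[h1 h2]|[h1 h2]].
  by split=> s; [have := congr1 (fun f : seq V -> R => f s) h1|have :=
    congr1 (fun f : seq V -> R => f s) h2].
by congr (_, _); apply/funext => s; [exact: h1|exact: h2].
Qed.
Lemma at_ptD x z z' : at_pt x (z + z') = at_pt x z + at_pt x z'. Proof. by []. Qed.
Lemma at_pt0 x z : at_pt x z = 0 <-> Zx x z.
Proof. exact: (at_ptP x z 0). Qed.

Lemma Mop_ccliff e z : Mop N (ccliff e z) = ccliff e (Mop N z) + ccliff (J e.2, - J e.1) z.
Proof.
have c1 : N (cliff e.1 z.2 + cliff e.2 z.1) = (cliff e.1 (N z.2) - cliff e.2 (- N z.1)) +
  (cliff (J e.2) z.1 - cliff (- J e.1) z.2).
  by rewrite (ND HS hN (cliff e.1 z.2)) !(N_cliff HS hN) [cliff (- _) _]cliffNl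
    [cliff e.2 (- _)]cliffN; form_ring.
have c2 : - N (cliff e.1 z.1 - cliff e.2 z.2) = (cliff e.1 (- N z.1) + cliff e.2 (N z.2)) +
  (cliff (J e.2) z.2 + cliff (- J e.1) z.1).
  by rewrite (NB HS hN (cliff e.1 z.1)) !(N_cliff HS hN) [cliff (- _) _]cliffNl
    [cliff e.1 (- _)]cliffN; form_ring.
by congr (_, _); [exact: c1|exact: c2].
Qed.

Lemma eqx_cliff_eq x u u' w : eq_at x u u' -> eqx x (cliff u w) (cliff u' w).
Proof. by move=> [h1 h2] s; exact: (Glin_eq HS (cliff_Glin w s) h1 h2). Qed.

Lemma eqc_ccliff_eq x (e e' : cgtan S) z : eq_at x e.1 e'.1 -> eq_at x e.2 e'.2 ->
  eqc x (ccliff e z) (ccliff e' z).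
Proof.
move=> h1 h2; split=> s.
  change (cliff e.1 z.1 s x - cliff e.2 z.2 s x = cliff e'.1 z.1 s x - cliff e'.2 z.2 s x).
  by rewrite (eqx_cliff_eq _ h1) (eqx_cliff_eq _ h2).
change (cliff e.1 z.2 s x + cliff e.2 z.1 s x = cliff e'.1 z.2 s x + cliff e'.2 z.1 s x).
by rewrite (eqx_cliff_eq _ h1) (eqx_cliff_eq _ h2).
Qed.

Lemma Kop_ccliff e z : Kop (ccliff e z) = ccliff e (Kop z) - ccliff (J e.2, - J e.1) z.
Proof. by rewrite /level Mop_ccliff ccliffB (mBMn (ccliffB _)) opprD addrA. Qed.

Lemma ccliffNl e z : ccliff (- e.1, - e.2) z = - ccliff e z.
Proof.
have c1 : cliff (- e.1) z.1 - cliff (- e.2) z.2 = - (cliff e.1 z.1 - cliff e.2 z.2).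
  by rewrite [cliff (- e.1) _]cliffNl [cliff (- e.2) _]cliffNl; form_ring.
have c2 : cliff (- e.1) z.2 + cliff (- e.2) z.1 = - (cliff e.1 z.2 + cliff e.2 z.1).
  by rewrite [cliff (- e.1) _]cliffNl [cliff (- e.2) _]cliffNl; form_ring.
by congr (_, _); [exact: c1|exact: c2].
Qed.

Lemma eq_atN x u u' : eq_at x u u' -> eq_at x (- u) (- u').
Proof.
move=> [h1 h2]; split=> f.
  by change (- u.1 f x = - u'.1 f x); rewrite h1.
by change (- u.2 f x = - u'.2 f x); rewrite h2.
Qed.

Lemma Kop_Lbar x e z : eigenLbar J x e -> Zx x (Kop (ccliff e z) - (ccliff e (Kop z) + ccliff e z)).
Proof.
move=> [/= h1 h2]; rewrite Kop_ccliff opprD addrACA subrr add0r -opprD; apply: ZxN.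
rewrite -[ccliff e z]opprK -ccliffNl; apply: (eqcP _ _ _).1;
  apply: (@eqc_ccliff_eq x (J e.2, - J e.1) (- e.1, - e.2) z) => /=.
  by move/eq_atN: h2; rewrite gcsN opprK.
by move: (eq_atN h1); rewrite opprK.
Qed.

Lemma Kop_L x e z : eigenL J x e -> Zx x (Kop (ccliff e z) - (ccliff e (Kop z) - ccliff e z)).
Proof.
move=> [h1 h2]; rewrite Kop_ccliff subACA subrr sub0r opprB; apply: (eqcP _ _ _).1;
  apply: eqc_sym; apply: (@eqc_ccliff_eq x (J e.2, - J e.1) e z) => //=.
by move/eq_atN: h1; rewrite opprK.
Qed.

Lemma vacuum_L x e z : eigenL J x e -> Zx x (Kop z) -> Zx x (ccliff e z).
Proof.
move=> Le Kz; apply: (spectrum_at HS hN (e := -1)) => [|k _]; last by case: k.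
rewrite mulrNz mulr1z opprK; have := ZxD (Kop_L z Le) (Zx_ccliff e Kz).
by rewrite opprB addrA subrK.
Qed.

Lemma Kop_word x t z : (forall e, e \in t -> eigenLbar J x e) -> Zx x (Kop z) ->
  Zx x (Kop (foldr (@ccliff R S) z t) - foldr (@ccliff R S) z t *+ size t).
Proof.
elim: t => [|e t IH] ht Kz /=; first by rewrite mulr0n subr0.
have h1 := IH _ Kz; have h2 := Kop_Lbar (foldr (@ccliff R S) z t) (ht e (mem_head _ _)).
have {}h1 : Zx x (Kop (foldr (@ccliff R S) z t) - foldr (@ccliff R S) z t *+ size t).
  by apply: h1 => e' e't; apply: ht; rewrite inE e't orbT.
have h3 := Zx_ccliff e h1; rewrite ccliffB (mBMn (ccliffB e)) in h3.
have zl (E : zmodType) (a b c : E) n : a - (b + c) + (b - c *+ n) = a - c *+ n.+1.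
  by rewrite mulrS !opprD !addrA [a - b - c + b]addrAC subrK.
by have := ZxD h2 h3; rewrite zl.
Qed.

Lemma Kop_muli z : Kop (muli z) = muli (Kop z).
Proof.
have mB : {morph (@muli R S) : v w / v - w} by move=> v w; rewrite /muli /= !opprD.
rewrite /level mB (mBMn mB); congr (_ - _).
by rewrite /Mop /muli /= (NN HS hN) !opprK.
Qed.
Lemma muliB : {morph (@muli R S) : v w / v - w}. Proof. by move=> v w; rewrite /muli /= !opprD. Qed.
Lemma ccliff_muli e z : ccliff e (muli z) = muli (ccliff e z).
Proof.
have c1 : cliff e.1 (- z.2) - cliff e.2 z.1 = - (cliff e.1 z.2 + cliff e.2 z.1).
  by rewrite [cliff e.1 _]cliffN; form_ring.
have c2 : cliff e.1 z.1 + cliff e.2 (- z.2) = cliff e.1 z.1 - cliff e.2 z.2 by rewrite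
  [cliff e.2 (- _)]cliffN.
by congr (_, _); [exact: c1|exact: c2].
Qed.
Lemma ccliffZ e f z : ccliff e (f *: z) = f *: ccliff e z.
Proof.
have c1 : cliff e.1 (f *: z.1) - cliff e.2 (f *: z.2) = f *: (cliff e.1 z.1 - cliff e.2 z.2).
  by rewrite scalerBr !(cliffZ _ f).
have c2 : cliff e.1 (f *: z.2) + cliff e.2 (f *: z.1) = f *: (cliff e.1 z.2 + cliff e.2 z.1).
  by rewrite scalerDr !(cliffZ _ f).
by congr (_, _); [exact: c1|exact: c2].
Qed.
Lemma muliZ f z : muli (f *: z) = f *: muli z.
Proof. by congr (_, _); rewrite /= ?scalerN. Qed.
Lemma eqc_muli x z z' : eqc x z z' -> eqc x (muli z) (muli z').
Proof.
move=> [h1 h2]; split=> s; last exact: h1.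
by change (- z.2 s x = - z'.2 s x); rewrite h2.
Qed.
Lemma eqcD x z1 z2 z1' z2' : eqc x z1 z1' -> eqc x z2 z2' -> eqc x (z1 + z2) (z1' + z2').
Proof. by move=> /eqcP h1 /eqcP h2; apply/eqcP; rewrite opprD addrACA; exact: ZxD. Qed.
Lemma eqcZ x f z z' : eqc x z z' -> eqc x (f *: z) (f *: z').
Proof.
move=> [h1 h2]; split=> s.
  by change (f x * z.1 s x = f x * z'.1 s x); rewrite h1.
by change (f x * z.2 s x = f x * z'.2 s x); rewrite h2.
Qed.

Lemma eqc_cst x f z : eqc x (Ccst S (f x) *: z) (f *: z).
Proof.
split=> s.
  by change (f x * z.1 s x = f x * z.1 s x).
by change (f x * z.2 s x = f x * z.2 s x).
Qed.

Lemma half_double z : Ccst S 2^-1 *: (z + z) = z.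
Proof.
have h : Ccst S 2^-1 + Ccst S 2^-1 = 1 by rewrite -CcstD -[RHS]Ccst1; congr Ccst; field.
by rewrite scalerDr -scalerDl h scale1r.
Qed.

Definition clin (z : cform) (a b : R) : cform := Ccst S a *: z + Ccst S b *: muli z.
Lemma clinD z a b a' b' : clin z (a + a') (b + b') = clin z a b + clin z a' b'.
Proof. by rewrite /clin (CcstD _ a) (CcstD _ b) (scalerDl z) (scalerDl (muli z)) addrACA. Qed.
Lemma clinZ z r a b : clin z (r * a) (r * b) = Ccst S r *: clin z a b.
Proof. by rewrite /clin scalerDr !CcstM !scalerA. Qed.
Lemma muli_muli z : muli (muli z) = - z. Proof. by []. Qed.
Lemma clin_muli z a b : clin z (- b) a = muli (clin z a b).
Proof.
have mD := mBD muliB.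
by rewrite /clin (mD (Ccst S a *: z)) (muliZ (Ccst S a) z) (muliZ (Ccst S b)) muli_muli CcstN
  scaleNr scalerN addrC.
Qed.
Lemma clin0 z : clin z 0 0 = 0.
Proof. by rewrite /clin Ccst0 !scale0r addr0. Qed.

Lemma fall_muli s z : fall Kop s (muli z) = muli (fall Kop s z).
Proof.
elim: s z => [|k s IH] z; first by [].
change (shift_op Kop k (fall Kop s (muli z)) = muli (shift_op Kop k (fall Kop s z))).
by rewrite IH /shift_op Kop_muli (muliB (Kop _)) (mBMn muliB).
Qed.
Lemma fall_scale s f z : fall Kop s (f *: z) = f *: fall Kop s z.
Proof.
elim: s z => [|k s IH] z; first by [].
change (shift_op Kop k (fall Kop s (f *: z)) = f *: (shift_op Kop k (fall Kop s z))).
by rewrite IH /shift_op (KopZ HS hN) (scalerBr _ (Kop _)) scalerMnr.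
Qed.
Lemma eqc_fall x s z z' : eqc x z z' -> eqc x (fall Kop s z) (fall Kop s z').
Proof.
move=> /eqcP h; apply/eqcP; rewrite -(fallB KB).
exact: (Z_fall (@Zx0 _ _ x) (@ZxB _ _ x) (@Zx_Kop _ _ _ HS _ _ hN x)).
Qed.
Lemma fall_nu u s z : fall Kop (map succn s) (ccliff (nu J u) z) = ccliff (nu J u) (fall Kop s z).
Proof.
elim: s z => [|k s IH] z; first by [].
change (shift_op Kop k.+1 (fall Kop (map succn s) (ccliff (nu J u) z)) =
  ccliff (nu J u) (shift_op Kop k (fall Kop s z))).
rewrite IH /shift_op (Kop_nu HS hN) (ccliffB _ (Kop _)) (mBMn (ccliffB _)) mulrS opprD addrA addrK
  //.
Qed.

Lemma at_pt_clin x z a b : at_pt x (clin z a b) = cscale a b (at_pt x z).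
Proof.
congr (_, _); apply/funext => s.
  change (a * z.1 s x + b * (- z.2 s x) = a * z.1 s x - b * z.2 s x); ring.
Qed.

Section OneDim.
Variables (x : S) (phi : cform).
Hypotheses (phi0 : ~ Zx x phi) (Kphi : Kop phi = 0).

(** Forms whose value at x arises from phi by complex combinations and creation operators. Closure
    under [gen_eq] takes the place of passing to the fibre at x. *)
Inductive gen : cform -> Prop :=
| gen_vac : gen phi
| gen_eq z z' : eqc x z z' -> gen z -> gen z'
| gen_D z z' : gen z -> gen z' -> gen (z + z')
| gen_Z (r : R) z : gen z -> gen (Ccst S r *: z)
| gen_i z : gen z -> gen (muli z)
| gen_nu u z : gen z -> gen (ccliff (nu J u) z).

Lemma gen0 : gen 0.
Proof. by have := gen_Z 0 gen_vac; rewrite Ccst0 scale0r. Qed.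

(** [lam u] is moved inwards through the creation operators until it reaches phi, which it kills at
    x; the function coefficients from the Clifford relation may be replaced by their values at x. *)
Lemma gen_lam u z : gen z -> gen (ccliff (lam J u) z).
Proof.
elim=> {z} [|z z' e _ h|z z' _ h _ h'|r z _ h|z _ h|u' z gz h].
- by apply: gen_eq gen0; apply: eqc_sym; apply: (vacuum_lam HS hN); rewrite Kphi; exact: Zx0.
- exact: gen_eq (eqc_ccliff _ e) h.
- by rewrite (mBD (ccliffB _)); exact: gen_D.
- by rewrite ccliffZ; exact: gen_Z.
- by rewrite ccliff_muli; exact: gen_i.
have e := ccliff_rel (lam J u) (nu J u') z.
set al := (X in _ = (X *: _ - _, _)) in e; set be := (X in _ = (_ - X *: _, _)) in e.
apply: gen_eq (gen_D (gen_Z (-1) (gen_nu u' h))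
  (gen_D (gen_Z (al x) gz) (gen_Z (be x) (gen_i gz)))).
have -> : ccliff (lam J u) (ccliff (nu J u') z) = (-1) *: ccliff (nu J u') (ccliff (lam J u) z) +
  (al *: z + be *: muli z).
  rewrite scaleN1r addrC; apply/eqP; rewrite eq_sym subr_eq eq_sym e; apply/eqP.
  by congr (_, _); rewrite /= ?scalerN.
apply: eqcD; first by rewrite CcstN Ccst1; exact: eqc_refl.
by apply: eqcD; exact: eqc_cst.
Qed.

(** [lam u] and [nu u] add up to twice the action of u, so [gen] is stable under the whole Clifford
    action and irreducibility applies. *)
Lemma gen_all z : gen z.
Proof.
apply: (irreducible HS (W := gen) gen_eq gen_D gen_Z gen_i) gen_vac phi0 z => u z gz.
have := gen_Z 2^-1 (gen_D (gen_lam u gz) (gen_nu u gz)); congr gen.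
have -> : ccliff (lam J u) z + ccliff (nu J u) z = ccliff (u, 0) z + ccliff (u, 0) z.
  have c1 : cliff u z.1 - cliff (- J u) z.2 + (cliff u z.1 - cliff (J u) z.2) =
    cliff u z.1 - cliff 0 z.2 + (cliff u z.1 - cliff 0 z.2).
    by rewrite [cliff (- J u) _]cliffNl !cliff0l; form_ring.
  have c2 : cliff u z.2 + cliff (- J u) z.1 + (cliff u z.2 + cliff (J u) z.1) = cliff u z.2 +
    cliff 0 z.1 + (cliff u z.2 + cliff 0 z.1).
    by rewrite [cliff (- J u) _]cliffNl !cliff0l; form_ring.
  by congr (_, _); [exact: c1|exact: c2].
exact: half_double.
Qed.

(** The product (K - 1)...(K - 2q) multiplies level 0 by the nonzero integer P and kills every
    [nu u z] at x, since what remains would have level 2q + 1. Applied to generated forms it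
    therefore gives multiples of phi at x. *)
Lemma vacuum_line psi : Kop psi = 0 -> exists a b : R, at_pt x psi = cscale a b (at_pt x phi).
Proof.
move=> Kpsi; pose P := \prod_(k <- iota 1 (2 * q)) (0 - k%:Z).
have P0 : P != 0.
  by rewrite prodf_seq_neq0; apply/allP => k; rewrite mem_iota => /andP[k0 _] /=;
    rewrite sub0r oppr_eq0 eqz_nat -lt0n.
have fE z : Kop z = 0 -> eqc x (fall Kop (iota 1 (2 * q)) z) (z *~ P).
  move=> Kz; apply/eqcP.
  apply: (fall_eigen (@Zx0 _ _ x) (@ZxB _ _ x) KB (@Zx_Kop _ _ _ HS _ _ hN x)).
  by rewrite Kz mulr0z subr0; exact: Zx0.
have main z : gen z -> exists a b : R, eqc x (fall Kop (iota 1 (2 * q)) z) (clin phi a b).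
  elim=> {z} [|z z' e _ [a [b h]]|z z' _ [a [b h]] _ [a' [b' h']]|r z _ [a [b h]]|z _ [a [b h]]|u
    z _ _].
  - exists P%:~R, 0; apply: eqc_trans (fE _ Kphi) _.
    rewrite /clin Ccst0 scale0r addr0.
    have -> : Ccst S P%:~R *: phi = phi *~ P.
      by rewrite -[RHS]scaler_int Ccst_int.
    exact: eqc_refl.
  - exists a, b; exact: eqc_trans (eqc_fall _ (eqc_sym e)) h.
  - exists (a + a'), (b + b'); rewrite clinD (mBD (fallB KB _) z); exact: eqcD.
  - exists (r * a), (r * b); rewrite clinZ fall_scale; exact: eqcZ.
  - exists (- b), a; rewrite clin_muli fall_muli; exact: eqc_muli h.
  - exists 0, 0; rewrite clin0 (iotaDl 1 0 (2 * q)) fall_nu.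
    set y := fall Kop _ z.
    have Ky : Kop y = y *+ (2 * q).
      apply/eqP; rewrite -subr_eq0 -/(shift_op Kop (2 * q) y) /y -(fall_shift KB).
      rewrite -[fall _ _ _]/(fall Kop (iota 0 (2 * q)) (fall Kop [:: (2 * q)%N] z)) /fall
        -foldr_cat.
      by rewrite -(iotaD 0 (2 * q) 1) addn1; apply/eqP; exact: (fall_Kop HS hN z).
    apply: (spectrum_at HS hN (e := (2 * q).+1)) => [|k kq];
      last by rewrite eqz_nat gtn_eqF // ltnS.
    rewrite (Kop_nu HS hN) Ky (mBMn (ccliffB _)) -pmulrn mulrSr subrr; exact: Zx0.
have [a [b h]] := main _ (gen_all psi).
have P0' : (P%:~R : R) != 0 by rewrite intr_eq0.
exists (P%:~R^-1 * a), (P%:~R^-1 * b).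
have e : eqc x psi (clin phi (P%:~R^-1 * a) (P%:~R^-1 * b)).
  rewrite clinZ; apply: eqc_trans (eqcZ _ (eqc_trans (eqc_sym (fE _ Kpsi)) h)).
  rewrite -(scaler_int P psi) scalerA -Ccst_int -CcstM mulVf // Ccst1 scale1r; exact: eqc_refl.
by rewrite ((at_ptP _ _ _).2 e) at_pt_clin.
Qed.
End OneDim.
End SpinorLine.

(** * Identification of the spinor line and of the bundles U^j *)

Section BundleU.
Context {R : realType} {q : nat} {S : smoothSpace R}.
Hypothesis HS : leuclid (2 * q) S.
Local Notation A := (Cinf S).
Local Notation V := (vfield S).
Local Notation form := (form S).
Local Notation gtan := (gtan S).
Local Notation cform := (cform S).
Implicit Types (x : S) (f : A) (X Y : V) (w v : form) (u : gtan) (z : cform).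
Variables (J : gcs S) (N : form -> form).
Hypothesis hN : forall x (xs : 'I_(2 * q) -> A) D w, pframe x xs D -> eqx x (N w) (Nframe J xs D w).
Local Notation Kop := (level (q := q) N).
Local Notation KB := (KopB HS hN).

Lemma Zx_near x z : ~ Zx x z -> \forall y \near x, ~ Zx y z.
Proof.
move=> nz; have [s] : exists s, z.1 s x != 0 \/ z.2 s x != 0.
  apply: contrapT => h; apply: nz; split=> s; apply: contrapT => /eqP n; apply: h; exists s;
    [left|right]; exact: n.
have main (f : A) : f x != 0 -> \forall y \near x, f y != 0.
  move=> fx; have c : (f : S -> R) @ x --> f x := @Cinf_continuous _ _ _ HS f x.
  exact: c _ (open_nbhs_nbhs (conj (@open_neq _ 0) fx)).
case=> /main; apply: filterS => y /eqP n [h1 h2]; apply: n; first [exact: h1 s|exact: h2 s].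
Qed.

Lemma complex_scale_eq0 x z (a b : A) : ~ Zx x z ->
  Zx x (a *: z.1 - b *: z.2, a *: z.2 + b *: z.1) -> a x = 0 /\ b x = 0.
Proof.
move=> nz [h1 h2]; have key s : (a x ^+ 2 + b x ^+ 2) * z.1 s x = 0 /\
  (a x ^+ 2 + b x ^+ 2) * z.2 s x = 0.
  have e1 : a x * z.1 s x - b x * z.2 s x = 0 := h1 s.
  have e2 : a x * z.2 s x + b x * z.1 s x = 0 := h2 s.
  split.
    by transitivity (a x * (a x * z.1 s x - b x * z.2 s x) +
      b x * (a x * z.2 s x + b x * z.1 s x)); [ring|rewrite e1 e2; ring].
  by transitivity (a x * (a x * z.2 s x + b x * z.1 s x) - b x * (a x * z.1 s x - b x * z.2 s x));
    [ring|rewrite e1 e2; ring].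
have : a x ^+ 2 + b x ^+ 2 = 0.
  apply: contrapT => /eqP n; apply: nz; split=> s; have [/eqP k1 /eqP k2] := key s.
    by move: k1; rewrite mulf_eq0 (negPf n) => /eqP.
  by move: k2; rewrite mulf_eq0 (negPf n) => /eqP.
by move/eqP; rewrite paddr_eq0 ?sqr_ge0 // !sqrf_eq0 => /andP[/eqP -> /eqP ->].
Qed.

Lemma eq_at_clifB x u : (forall u', clifB u' u x = 0) -> eq_at x u 0.
Proof.
move=> h; split=> [f|Y].
  have := h (0, differential f); rewrite /clifB /=.
  have -> : u.2 0 = 0 by have := oneformP u.2 (-1) 0 0; rewrite scaler0 addr0 mulN1r addNr.
  by rewrite addr0.
have e : 0 + u.2 Y x = 0 := h (Y, 0).
by rewrite -[LHS]add0r e.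
Qed.

Lemma eq_at_subr x u u' : eq_at x (u - u') 0 -> eq_at x u u'.
Proof.
move=> [h1 h2]; split=> f; apply/eqP; rewrite -subr_eq0; apply/eqP; [exact: h1 f|exact: h2 f].
Qed.

Local Ltac form_ring := repeat match goal with |- context [cliff ?u ?w] => generalize (cliff u w);
  intro end;
  apply: formE => ?; rewrite !(formDE, formNE, form0E); ring.

Lemma ccliff_Lbar_part (e : cgtan S) z :
  ccliff (nu J (e.1 - J e.2)) z = ccliff e z + ccliff e z - ccliff (lam J (e.1 + J e.2)) z.
Proof.
have e1 : J (e.1 - J e.2) = J e.1 + e.2 by rewrite gcsB gcs_square opprK.
have e2 : - J (e.1 + J e.2) = e.2 - J e.1 by rewrite gcsD gcs_square opprB.
rewrite /lam /nu e1 e2.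
have c1 : cliff (e.1 - J e.2) z.1 - cliff (J e.1 + e.2) z.2 =
  cliff e.1 z.1 - cliff e.2 z.2 + (cliff e.1 z.1 - cliff e.2 z.2) -
    (cliff (e.1 + J e.2) z.1 - cliff (e.2 - J e.1) z.2).
  rewrite (cliffBl e.1) (cliffDl (J e.1)) (cliffDl e.1) (cliffBl e.2); form_ring.
have c2 : cliff (e.1 - J e.2) z.2 + cliff (J e.1 + e.2) z.1 =
  cliff e.1 z.2 + cliff e.2 z.1 + (cliff e.1 z.2 + cliff e.2 z.1) -
    (cliff (e.1 + J e.2) z.2 + cliff (e.2 - J e.1) z.1).
  rewrite (cliffBl e.1) (cliffDl (J e.1)) (cliffDl e.1) (cliffBl e.2); form_ring.
by congr (_, _); [exact: c1|exact: c2].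
Qed.

(** The part of e in the conjugate of L also kills z, as do all [lam u]; their anticommutators are
    scalars and must vanish at x. So this part pairs to zero with every section and is zero at x. *)
Lemma annihilator_L x z (e : cgtan S) : ~ Zx x z -> Zx x (Kop z) -> Zx x (ccliff e z) ->
  eigenL J x e.
Proof.
move=> nz Kz ez; pose p := e.1 - J e.2.
have np : Zx x (ccliff (nu J p) z).
  by rewrite ccliff_Lbar_part; exact: ZxB (ZxD ez ez) (vacuum_lam HS hN (e.1 + J e.2) Kz).
have key u : clifB u p x = 0 /\ clifB u (J p) x = 0.
  have := ZxD (Zx_ccliff (lam J u) np) (Zx_ccliff (nu J p) (vacuum_lam HS hN u Kz)).
  rewrite (ccliff_rel (lam J u) (nu J p) z) => /(complex_scale_eq0 nz)[h1 h2].
  have {}h1 : clifB u p x - clifB (- J u) (J p) x = 0 := h1.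
  have {}h2 : clifB u (J p) x + clifB (- J u) p x = 0 := h2.
  rewrite clifBNl clifB_orth CvalN in h1; rewrite clifBNl clifB_skew opprK in h2.
  by split; lra.
have /eq_at_subr h1 := eq_at_clifB (fun u => (key u).1).
have /eq_at_subr h2 : eq_at x (J e.1 - - e.2) 0.
  have -> : J e.1 - - e.2 = J p by rewrite /p gcsB gcs_square.
  exact: eq_at_clifB (fun u => (key u).2).
split; first exact: h2.
by split=> f; [rewrite h1.1|rewrite h1.2].
Qed.

Lemma Kop_clin z a b : Kop z = 0 -> Kop (clin z a b) = 0.
Proof.
move=> Kz; rewrite /clin (mBD KB (Ccst S a *: z)) !(KopZ HS hN) (Kop_muli HS hN) Kz.
by rewrite (mB0 muliB) !scaler0 addr0.
Qed.

Definition vacuum x : set (cfibre (S := S)) := [set p | exists z, Kop z = 0 /\ p = at_pt x z].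

Lemma at_pt_neq0 x z : at_pt x z <> 0 <-> ~ Zx x z.
Proof. by split=> h e; apply: h; apply/at_pt0. Qed.

Lemma vacuum_line_subbundle : line_subbundle vacuum.
Proof.
move=> x; have [z [nz Kz]] := vacuum_exists_at HS hN x; exists z.
apply: filterS (Zx_near nz) => y ny; split; first exact/at_pt_neq0.
apply/seteqP; split=> p.
  by move=> [v [Kv ->]]; exact: (vacuum_line HS hN ny Kz Kv).
by move=> [a [b ->]]; exists (clin z a b); rewrite at_pt_clin Kop_clin.
Qed.

Lemma vacuum_annihilator x : eigenL J x = annihilator vacuum x.
Proof.
apply/seteqP; split=> e.
  move=> Le w [z [Kz /at_ptP wz]]; apply/at_pt0/(vacuum_L HS hN Le).
  have /(Zx_Kop HS hN) := (eqcP _ _ _).1 wz.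
  by rewrite KB Kz subr0.
move=> he; have [z [nz Kz]] := vacuum_exists_at HS hN x.
apply: (annihilator_L nz); first by rewrite Kz; exact: Zx0.
by apply/at_pt0; apply: he; exists z.
Qed.

(** [spinor_line] is some line subbundle with annihilator L, so only these two properties can be
    used: its members are killed by L and hence have level 0 at x, and a line of level 0 values
    contains them all because these form a line themselves. *)
Lemma spinor_lineP x z : spinor_line J x (at_pt x z) <-> Zx x (Kop z).
Proof.
have [hl ha] : line_subbundle (spinor_line J) /\ forall x, eigenL J x =
  annihilator (spinor_line J) x.
  apply: (@xgetPex _ _ [set Phi | line_subbundle Phi /\ forall x, eigenL J x = annihilator Phi x]).
  by exists vacuum; split; [exact: vacuum_line_subbundle|exact: vacuum_annihilator].
have main (v : cform) : spinor_line J x (at_pt x v) -> Zx x (Kop v).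
  move=> hv; have [xs [D hf]] := pframe_exists HS x.
  apply: (Kop_quadratic hN hf) => a; apply/at_pt0.
  have : eigenL J x (lam J (gbasis xs D a)) by split=> /=;
    rewrite ?opprK ?gcsN ?gcs_square ?opprK; split.
  by rewrite ha; apply.
split; first exact: main.
have [w /nbhs_singleton[/at_pt_neq0 nw ew]] := hl x.
have Pw : spinor_line J x (at_pt x w) by rewrite ew; exists 1, 0; congr (_, _);
  apply/funext => s /=; rewrite !mul0r mul1r ?subr0 ?addr0.
have [w' [Kw' ww']] := vacuum_global HS hN (main _ Pw).
move=> /(vacuum_global HS hN)[z' [Kz' zz']].
have nw' : ~ Zx x w' by move=> h; apply: nw; exact: eqc_trans (eqc_sym ww') h.
have [a [b]] := vacuum_line HS hN nw' Kw' Kz'.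
by rewrite ew -!((at_ptP _ _ _).2 zz', (at_ptP _ _ _).2 ww') => ->; exists a, b.
Qed.

Lemma foldr_at x m k (w : 'I_m -> cform) (e : 'I_m -> k.-tuple (cgtan S)) :
  \sum_i at_pt x (foldr (@ccliff R S) (w i) (e i)) =
    at_pt x (\sum_i foldr (@ccliff R S) (w i) (e i)).
Proof. by elim/big_rec2: _ => // i y1 y2 _ ->. Qed.

Lemma cliff_power0 x z : Zx x (Kop z) -> cliff_power J 0 x (at_pt x z).
Proof.
move=> /spinor_lineP h; exists 1%N, (fun=> z), (fun=> [tuple]); split=> // [i l|]; first by case: l.
by rewrite big_ord1.
Qed.
Lemma cliff_power_zero k x : cliff_power J k x (at_pt x 0).
Proof.
exists 0%N, (fun=> 0), (fun=> [tuple of nseq k 0]); split=> [[]|[]|] //.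
by rewrite big_ord0.
Qed.
Lemma cliff_powerD k x z z' : cliff_power J k x (at_pt x z) -> cliff_power J k x (at_pt x z') ->
  cliff_power J k x (at_pt x (z + z')).
Proof.
move=> [m [w [e [hw he E]]]] [m' [w' [e' [hw' he' E']]]].
exists (m + m')%N, (fun i => match fintype.split i with inl j => w j | inr j => w' j end),
  (fun i => match fintype.split i with inl j => e j | inr j => e' j end); split=> [i|i l|].
- by case: (fintype.split i).
- by case: (fintype.split i).
rewrite at_ptD E E' big_split_ord /=; congr (_ + _); apply: eq_bigr => i _.
  by rewrite (unsplitK (inl i)).
by rewrite (unsplitK (inr i)).
Qed.
Lemma cliff_powerS k x (e : cgtan S) z : eigenLbar J x e -> cliff_power J k x (at_pt x z) ->
  cliff_power J k.+1 x (at_pt x (ccliff e z)).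
Proof.
move=> Le [m [w [e' [hw he E]]]]; exists m, w, (fun i => [tuple of e :: e' i]); split=> // [i l|].
  by case: (unliftP ord0 l) => [l'|] ->; rewrite ?tnthS ?tnth0.
rewrite foldr_at in E *; have {E} /at_ptP /(eqc_ccliff e) E := E.
rewrite ((at_ptP _ _ _).2 E) (foldr_at x w (fun i => [tuple of e :: e' i])); congr (at_pt x).
have cD := mBD (ccliffB e).
by elim/big_rec2: _ => [|i y1 y2 _ <-]; [exact: ccliff0|rewrite (cD (foldr _ _ _))].
Qed.

Lemma nu_Lbar x u : eigenLbar J x (nu J u).
Proof. by split=> /=; rewrite ?opprK ?gcsN ?gcs_square ?opprK; split. Qed.

Lemma Zx_eigenD x k z z' : Zx x (Kop z - z *+ k) -> Zx x (Kop z' - z' *+ k) ->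
  Zx x (Kop (z + z') - (z + z') *+ k).
Proof.
have -> : Kop (z + z') - (z + z') *+ k = (Kop z - z *+ k) + (Kop z' - z' *+ k) :=
  mBD (shift_opB KB k) z z'.
exact: ZxD.
Qed.

(** Products of k elements of the conjugate of L have level k because each raises the level by one.
    Conversely, [sum_nu_lam] writes a form of level k + 1, up to a factor, as a sum of terms [nu]
    applied to forms [lam] of level k. *)
Lemma cliff_powerP k x z : (k <= 2 * q)%N -> cliff_power J k x (at_pt x z) <->
  Zx x (Kop z - z *+ k).
Proof.
move=> kq; split=> [[m [w [e [hw he]]]]|].
  rewrite foldr_at => /at_ptP /eqcP hz.
  set t := \sum_i _ in hz.
  have ht : Zx x (Kop t - t *+ k).
    rewrite /t; elim/big_ind: _ => [|a b ha hb|i _].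
    - by rewrite (mB0 KB) mul0rn subr0; exact: Zx0.
    - exact: Zx_eigenD.
    rewrite -[X in _ *+ X](size_tuple (e i)); apply: (Kop_word HS hN); last exact/spinor_lineP.
    by move=> e0 /tnthP[l ->].
  have := Zx_eigenD (ZxB (Zx_Kop HS hN hz) (ZMn (@Zx0 _ _ x) (@ZxB _ _ x) k hz)) ht.
  by rewrite subrK.
elim: k kq z => [|k IH] kq z hz; first by apply: cliff_power0; rewrite mulr0n subr0 in hz.
have [xs [D hf]] := pframe_exists HS x.
(* The sum of the products equals four times the level operator, which is k + 1 on this form. *)
pose c : R := ((k.+1 * 4)%:R)^-1; pose y := Ccst S c *: z.
have hy : Zx x (Kop y - y *+ k.+1).
  rewrite /y (KopZ HS hN) scalerMnr -scalerBr.
  move: hz => /(eqcZ (Ccst S c)); by rewrite scaler0.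
have ez : eqc x z (\sum_a ccliff (nu J (gbasis xs D (gswap a))) (ccliff (lam J (gbasis xs D a)) y)).
  apply: eqc_sym; apply: (eqc_trans (sum_nu_lam hN hf y)).
  have -> : y *+ (2 * (2 * q)) - Mop N y *+ 4 = Kop y *+ 4.
    by rewrite /level mulrnBl -mulrnA mulnA mulnC.
  have -> : z = y *+ k.+1 *+ 4.
    rewrite -mulrnA -scaler_nat /y scalerA.
    have -> : (k.+1 * 4)%:R = Ccst S (k.+1 * 4)%:R := esym (Ccst_int (Posz (k.+1 * 4))).
    by rewrite -CcstM mulfV ?Ccst1 ?scale1r // pnatr_eq0.
  apply: (eqcP _ _ _).2; rewrite -mulrnBl; exact: (ZMn (@Zx0 _ _ x) (@ZxB _ _ x)).
rewrite ((at_ptP _ _ _).2 ez); elim/big_ind: _ => [|a b|a _].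
- exact: cliff_power_zero.
- exact: cliff_powerD.
apply: cliff_powerS; first exact: nu_Lbar.
apply: IH; first exact: ltnW.
rewrite (Kop_lam HS hN); have := Zx_ccliff (lam J (gbasis xs D a)) hy.
by rewrite ccliffB (mBMn (ccliffB _)) mulrSr opprD addrA addrAC.
Qed.
End BundleU.

(** * Components with respect to the decomposition into levels *)

Section Components.
Context {R : realType} {q : nat} {S : smoothSpace R}.
Hypothesis HS : leuclid (2 * q) S.
Local Notation A := (Cinf S).
Local Notation V := (vfield S).
Local Notation form := (form S).
Local Notation gtan := (gtan S).
Local Notation cform := (cform S).
Implicit Types (x : S) (f : A) (X Y : V) (w v : form) (u : gtan) (z : cform).
Variables (J : gcs S) (N : form -> form).
Hypothesis hN : forall x (xs : 'I_(2 * q) -> A) D w, pframe x xs D -> eqx x (N w) (Nframe J xs D w).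
Local Notation Kop := (level (q := q) N).
Local Notation KB := (KopB HS hN).

Lemma sectionUP k z : (k <= 2 * q)%N -> sectionU q J (q%:Z - k%:Z) z <-> Kop z = z *+ k.
Proof.
move=> kq; have hj : (`|q%:Z - k%:Z| <= q)%N by lia.
have hk : absz (q%:Z - (q%:Z - k%:Z))%R = k by lia.
have E x : bundleU q J (q%:Z - k%:Z) x (at_pt x z) <-> Zx x (Kop z - z *+ k).
  by rewrite /bundleU hj hk; exact: cliff_powerP.
split=> h; last by move=> x; apply/E; rewrite h subrr; exact: Zx0.
apply/eqP; rewrite -subr_eq0; apply/eqP; apply: (@cform_eq0 _ S) => x; apply/E; exact: h.
Qed.

Lemma sectionU_out j z : ~~ (`|j| <= q)%N -> sectionU q J j z -> z = 0.
Proof.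
move=> hj h; apply: (@cform_eq0 _ S) => x; have := h x; rewrite /bundleU (negPf hj).
by move=> /at_pt0.
Qed.

Lemma sectionU0 j : sectionU q J j 0.
Proof.
by move=> x; rewrite /bundleU; case: ifP => // _; exact: cliff_power_zero.
Qed.

Lemma eigen_uniq (c c' : nat -> cform) :
  (forall k, (k <= 2 * q)%N -> Kop (c k) = c k *+ k) ->
    (forall k, (k <= 2 * q)%N -> Kop (c' k) = c' k *+ k) ->
  \sum_(k < (2 * q).+1) c k = \sum_(k < (2 * q).+1) c' k -> forall k, (k <= 2 * q)%N -> c k = c' k.
Proof.
move=> hc hc' e k kq; apply/eqP; rewrite -subr_eq0; apply/eqP.
apply: (@eigen_indep _ (fun z : cform => z = 0) Kop erefl _ _ KB _ (iota 0 (2 * q).+1)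
  (fun k => c k - c' k) (iota_uniq _ _)).
- by move=> v w -> ->; rewrite subr0.
- by move=> w n h; apply: (@cform_eq0 _ S) => x; apply: (@Zxtf _ _ x _ n); rewrite h; exact: Zx0.
- by move=> w ->; rewrite (mB0 KB).
- move=> l; rewrite mem_iota add0n ltnS => /andP[_ lq].
  by rewrite (KB (c l)) hc // hc' // -mulrnBl subrr.
- by rewrite -[iota _ _]/(index_iota 0 (2 * q).+1) sumrB !big_mkord e subrr.
- by rewrite mem_iota.
Qed.

(** [component] selects some decomposition by [xget]; independence of the levels makes every
    selection agree with the given c. *)
Lemma componentE (c : nat -> cform) z : (forall k, (k <= 2 * q)%N -> Kop (c k) = c k *+ k) ->
  z = \sum_(k < (2 * q).+1) c k -> forall k, (k <= 2 * q)%N -> component q J (q%:Z - k%:Z) z = c k.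
Proof.
move=> hc ez k kq; rewrite /component.
set P := (X in xget 0 X).
have : P (xget 0 P).
  apply: xgetPex; exists (c k); exists (fun j => if (`|j| <= q)%N then c `|q%:Z - j|%N else 0);
    split.
  - move=> l; case: ifP => hl; last exact: sectionU0.
    have [k' [k'q ->]] : exists k' : nat, (k' <= 2 * q)%N /\ l = q%:Z - k'%:Z.
      by exists `|q%:Z - l|%N; split; lia.
    have -> : absz (q%:Z - (q%:Z - k'%:Z))%R = k' by lia.
    by apply/sectionUP => //; exact: hc.
  - rewrite ez; apply: eq_bigr => i _; have := ltn_ord i; rewrite ltnS => iq.
    rewrite ifT; last by lia.
    by congr c; lia.
  - rewrite ifT; last by lia.
    by congr c; lia.
case=> c' [hc' ez' ->].
rewrite (@eigen_uniq c (fun k => c' (q%:Z - k%:Z)) hc) //; last by rewrite -ez.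
by move=> l lq; apply/sectionUP.
Qed.

Lemma component_out j z : ~~ (`|j| <= q)%N -> component q J j z = 0.
Proof.
move=> hj; rewrite /component; set P := (X in xget 0 X).
have [[v Pv]|h] := pselect (exists v : cform, P v); last first.
  by rewrite xgetPN // => v Pv; apply: h; exists v.
have [c [hc _ ->]] : P (xget 0 P) by apply: xgetPex; exists v.
exact: (sectionU_out hj (hc j)).
Qed.

Definition level_comp k z : cform := component q J (q%:Z - k%:Z) z.
Local Notation kcomp := level_comp.

Lemma kcomp_spec z : z = \sum_(k < (2 * q).+1) kcomp k z /\ forall k, (k <= 2 * q)%N ->
  Kop (kcomp k z) = kcomp k z *+ k.
Proof.
have [c [ez hc]] := eigen_decomp_Kop HS hN z.
have {}ez : z = \sum_(k < (2 * q).+1) c k by rewrite ez -[iota _ _]/(index_iota 0 (2 * q).+1)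
  big_mkord.
have {}hc k : (k <= 2 * q)%N -> Kop (c k) = c k *+ k by move=> kq; apply: hc; rewrite mem_iota.
have E k : (k <= 2 * q)%N -> kcomp k z = c k by exact: componentE.
split; last by move=> k kq; rewrite E // hc.
by rewrite {1}ez; apply: eq_bigr => i _; rewrite E // -ltnS.
Qed.
Lemma kcomp_sum z : z = \sum_(k < (2 * q).+1) kcomp k z. Proof. by have [] := kcomp_spec z. Qed.
Lemma kcomp_eigen k z : (k <= 2 * q)%N -> Kop (kcomp k z) = kcomp k z *+ k. Proof.
  by have [_] := kcomp_spec z; apply. Qed.

Lemma kcompE c z : (forall k, (k <= 2 * q)%N -> Kop (c k) = c k *+ k) ->
  z = \sum_(k < (2 * q).+1) c k -> forall k, (k <= 2 * q)%N -> kcomp k z = c k.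
Proof. exact: componentE. Qed.

Lemma kcompD k z z' : (k <= 2 * q)%N -> kcomp k (z + z') = kcomp k z + kcomp k z'.
Proof.
move=> kq; apply: (kcompE (c := fun k => kcomp k z + kcomp k z')) => // [l lq|].
  by rewrite (mBD KB (kcomp l z)) !kcomp_eigen // mulrnDl.
by rewrite big_split /= -!kcomp_sum.
Qed.

Lemma kcomp_id k l z : (k <= 2 * q)%N -> (l <= 2 * q)%N -> Kop z = z *+ k -> kcomp l z = if l ==
  k then z else 0.
Proof.
move=> kq lq Kz; apply: (kcompE (c := fun l => if l == k then z else 0)) => // [i iq|].
  by case: eqP => [->|_]; rewrite ?Kz // (mB0 KB) mul0rn.
have kq' : (k < (2 * q).+1)%N by rewrite ltnS.
rewrite (bigD1 (Ordinal kq')) //= eqxx big1 ?addr0 // => i ik.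
by rewrite ifN //; apply: contra ik => /eqP e; apply/eqP/val_inj.
Qed.
End Components.

(** * Integrability and the splitting of [d] *)

Section CartanCalculus.
Context {R : realType} {S : smoothSpace R}.
Local Notation A := (Cinf S).
Local Notation V := (vfield S).
Local Notation form := (form S).
Local Notation gtan := (gtan S).
Implicit Types (f : A) (X Y : V) (al be : oneform S) (w v : form) (u : gtan).

Lemma contractD X w v : contract X (w + v) = contract X w + contract X v. Proof. exact: formE. Qed.
Lemma contractZ X f w : contract X (f *: w) = f *: contract X w. Proof. exact: formE. Qed.
Lemma ext_d_nil w : ext_d w [::] = 0.
Proof. by rewrite -[LHS]/(ext_d_fun w [::]) /ext_d_fun !big_ord0 addr0. Qed.
Lemma lieD_nil X w : lieD X w [::] = X (w [::]).
Proof. by rewrite -[LHS]/(lieD_fun X w [::]) /lieD_fun big_ord0 subr0. Qed.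
Lemma lieD_scaleD X f w v : lieD X (f *: w + v) = X f *: w + (f *: lieD X w + lieD X v).
Proof.
apply: formE => s; rewrite -[LHS]/(lieD_fun X (f *: w + v) s) (@lieD_lin _ _ X f w v);
  last by move=> t; exact: faddE.
by rewrite -addrA.
Qed.
Lemma lieDD X w v : lieD X (w + v) = lieD X w + lieD X v.
Proof.
have X1 : X 1 = 0 by rewrite -(Ccst1 S); exact: vact_cst.
by have := lieD_scaleD X 1 w v; rewrite X1 scale0r add0r !scale1r.
Qed.
Lemma lieD_0 X : lieD X 0 = 0. Proof. by apply: formE => s; exact: lieD0. Qed.
Lemma lieDN X w : lieD X (- w) = - lieD X w.
Proof. by apply: (addrI (lieD X w)); rewrite -lieDD !subrr lieD_0. Qed.
Lemma lieDZ X f w : lieD X (f *: w) = X f *: w + f *: lieD X w.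
Proof. by rewrite -[f *: w]addr0 lieD_scaleD lieD_0 addr0. Qed.
Lemma ext_dD w v : ext_d (w + v) = ext_d w + ext_d v.
Proof. by have := ext_dB w (- v); rewrite opprK => ->; congr (_ + _); have := ext_dB 0 v;
  rewrite !sub0r => ->; rewrite [ext_d 0](_ : _ = 0) ?sub0r ?opprK //; apply: formE => s;
  exact: ext_d_zero. Qed.
Lemma ext_dN w : ext_d (- w) = - ext_d w.
Proof. by have := ext_dB 0 w; rewrite !sub0r => ->; rewrite [ext_d 0](_ : _ = 0) ?sub0r //;
  apply: formE => s; exact: ext_d_zero. Qed.

Lemma ext_dZ f w : ext_d (f *: w) = wedge (differential f) w + f *: ext_d w.
Proof.
apply: formE => s; elim: s w => [|X s IH] w.
  by rewrite formDE formZE !ext_d_nil wedge_nil mulr0 addr0.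
rewrite -!contractE contractD contractZ !contract_ext_d contract_wedge contractZ lieDZ.
rewrite !(formDE, formNE, formZE) IH !(formDE, formNE, formZE) -[differential f X]/(X f); ring.
Qed.

Definition lie_one X al : oneform S := contract_d X al + differential (al X).
Lemma lie_oneE X al Y : lie_one X al Y = X (al Y) - al (lie X Y).
Proof.
change (X (al Y) - Y (al X) - al (lie X Y) + Y (al X) = X (al Y) - al (lie X Y)); ring.
Qed.

Lemma lieD_wedge X al w : lieD X (wedge al w) = wedge (lie_one X al) w + wedge al (lieD X w).
Proof.
apply: formE => s; elim: s w => [|Y s IH] w.
  by rewrite formDE lieD_nil !wedge_nil vact0 addr0.
rewrite -!contractE contractD contract_lieD !contract_wedge contract_lieD lieDD lieDN lieDZ
  lie_oneE.
rewrite !wedgeD !wedgeN !(formDE, formNE, formZE) IH !(formDE, formNE, formZE); ring.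
Qed.

Lemma wedgeBl al be w : wedge (al - be) w = wedge al w - wedge be w.
Proof. by have := wedge_linl be al (-1) w;
  rewrite !scaleN1r [- be + _]addrC [- wedge _ _ + _]addrC. Qed.

(* [d al /\ _], written without products of 2-forms. *)
Definition dwedge al w : form := ext_d (wedge al w) + wedge al (ext_d w).

Lemma dwedgeD al w v : dwedge al (w + v) = dwedge al w + dwedge al v.
Proof. by rewrite /dwedge !(wedgeD, ext_dD) addrACA. Qed.
Lemma dwedgeN al w : dwedge al (- w) = - dwedge al w.
Proof. by rewrite /dwedge !(wedgeN, ext_dN) opprD. Qed.
Lemma dwedgeZ al f w : dwedge al (f *: w) = f *: dwedge al w.
Proof.
rewrite /dwedge wedgeZ !ext_dZ wedgeD wedgeZ [wedge al (wedge _ _)]wedge_anti scalerDr.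
apply: formE => s; rewrite !(formDE, formNE, formZE); ring.
Qed.

Lemma contract_dwedge al Y w : contract Y (dwedge al w) = wedge (contract_d Y al) w +
  dwedge al (contract Y w).
Proof.
have e : contract_d Y al = lie_one Y al - differential (al Y) by rewrite /lie_one addrK.
rewrite /dwedge contractD contract_ext_d !contract_wedge contract_ext_d e wedgeBl.
rewrite !(ext_dD, ext_dN) ext_dZ lieD_wedge !(wedgeD, wedgeN).
apply: formE => s; rewrite !(formDE, formNE, formZE); ring.
Qed.

Lemma dwedge_nil al w : dwedge al w [::] = 0.
Proof. by rewrite /dwedge formDE ext_d_nil wedge_nil addr0. Qed.

Lemma dwedge_wedge al be w : dwedge al (wedge be w) = wedge be (dwedge al w).
Proof.
apply: formE => s; elim: s w => [|X s IH] w; first by rewrite dwedge_nil wedge_nil.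
rewrite -!contractE contract_dwedge !contract_wedge contract_dwedge dwedgeD dwedgeN dwedgeZ wedgeD.
have := IH (contract X w);
  move: (dwedge al (wedge be (contract X w))) (dwedge al w) (dwedge al (contract X w)) => a b c e.
rewrite !(formDE, formNE, formZE) e [wedge be (wedge _ _)]wedge_anti !formNE; ring.
Qed.

(* The derived bracket of d with the Clifford action: the Dorfman bracket. *)
Definition Lop u w : form := ext_d (cliff u w) + cliff u (ext_d w).
Definition dorfman u1 u2 : gtan := (lie u1.1 u2.1, lie_one u1.1 u2.2 - contract_d u2.1 u1.2).

Lemma LopE u w : Lop u w = lieD u.1 w + dwedge u.2 w.
Proof.
rewrite /Lop !cliffE ext_dD contract_ext_d /dwedge; apply: formE => s.
rewrite !(formDE, formNE); ring.
Qed.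

Lemma Lop_cliff u (v : gtan) w : Lop u (cliff v w) - cliff v (Lop u w) = cliff (dorfman u v) w.
Proof.
rewrite !LopE !cliffE contractD contract_lieD contract_dwedge lieDD lieD_wedge dwedgeD
  dwedge_wedge wedgeD.
rewrite /dorfman /= wedgeBl; apply: formE => s; rewrite !(formDE, formNE); ring.
Qed.

Lemma fparity_ext_d e w : fparity e w -> fparity (~~ e) (ext_d w).
Proof.
move=> h s hs; rewrite -[LHS]/(ext_d_fun w s) /ext_d_fun.
have hz t : (size t).+1 = size s -> w t = 0.
  by move=> st; apply: h; rewrite -(inj_eq negb_inj) -[~~ odd _]/(odd (size _).+1) st.
rewrite big1 ?add0r => [|i _]; last by rewrite hz ?vact0 ?mulr0 // size_remove_nth.
rewrite big1 // => i _; rewrite big1 // => j ij; rewrite hz ?mulr0 //=.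
rewrite size_remove_nth; first by rewrite size_remove_nth.
have := size_remove_nth (ltn_ord j); have := ltn_ord j; lia.
Qed.
End CartanCalculus.

(** * Commutators with the number operator *)

Section Commutators.
Context {R : realType} {S : smoothSpace R}.
Local Notation A := (Cinf S).
Local Notation form := (form S).
Local Notation gtan := (gtan S).
Variables (J : gcs S) (N : form -> form) (c : gtan -> form -> form).
Hypotheses (ND : forall w v, N (w + v) = N w + N v) (NN : forall w, N (- w) = - N w).
Hypotheses (cD : forall u w v, c u (w + v) = c u w + c u v) (cN : forall u w, c u (- w) = - c u w).
Hypotheses (cNl : forall u w, c (- u) w = - c u w) (N_c : forall u w, N (c u w) = c u (N w) +
  c (J u) w).

Definition adN (F : form -> form) w : form := N (F w) - F (N w).
Definition anticom (F : form -> form) u w : form := F (c u w) + c u (F w).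

Lemma cJJ u w : c (J (J u)) w = - c u w. Proof. by rewrite gcs_square cNl. Qed.

(** [adN] acts as a derivation on the anticommutator and takes u to J u. In the second derivative
    the term with J (J u) = - u is cancelled by the added F. *)
Lemma anti_adN (F : form -> form) u w : (forall w v, F (w + v) = F w + F v) ->
  (forall w, F (- w) = - F w) ->
  anticom (fun w => adN (adN F) w + F w) u w = adN (adN (anticom F u)) w - adN (anticom F (J u)) w
    - adN (anticom F (J u)) w.
Proof.
move=> FD FN; rewrite /anticom /adN.
rewrite !(ND, NN, N_c, FD, FN, cD, cN, cJJ); apply: formE => s; rewrite !(formDE, formNE); ring.
Qed.

Lemma adN_c (L : form -> form) (D : gtan -> gtan) : (forall w v, L (w + v) = L w + L v) ->
  (forall v w, L (c v w) = c v (L w) + c (D v) w) ->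
  forall v w, adN L (c v w) = c v (adN L w) + (c (J (D v)) w - c (D (J v)) w).
Proof.
move=> LD hD v w; rewrite /adN.
rewrite !(ND, NN, N_c, hD, LD, cD, cN); apply: formE => s; rewrite !(formDE, formNE); ring.
Qed.
Hypothesis cDl : forall u1 u2 w, c (u1 + u2) w = c u1 w + c u2 w.

(** The commutator of the combination with v is twice the action of the section in the hypothesis, a
    Nijenhuis expression for the brackets D v and D' v of v with L and L'. *)
Lemma adN2_c (L : form -> form) (D : gtan -> gtan) (L' : form -> form) (D' : gtan -> gtan) :
  (forall w v, L (w + v) = L w + L v) -> (forall w v, L' (w + v) = L' w + L' v) ->
  (forall v w, L (c v w) = c v (L w) + c (D v) w) ->
    (forall v w, L' (c v w) = c v (L' w) + c (D' v) w) ->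
  (forall v, D (- v) = - D v) ->
  forall v w, D' (J v) - J (D (J v)) - J (D' v) - D v = 0 ->
  adN (adN L) (c v w) - adN L' (c v w) - adN L' (c v w) = c v (adN (adN L) w - adN L' w - adN L' w).
Proof.
move=> LD L'D hD hD' DN v w h.
have cBl u1 u2 w' : c (u1 - u2) w' = c u1 w' - c u2 w' by rewrite cDl cNl.
have aD w1 w2 : adN L (w1 + w2) = adN L w1 + adN L w2.
  by rewrite /adN ND !LD ND opprD addrACA.
have h1 v' w' : adN L (c v' w') = c v' (adN L w') + c (J (D v') - D (J v')) w' by rewrite cBl
  (adN_c LD hD).
rewrite (adN_c aD h1) (adN_c L'D hD') -!cBl !gcsB !gcs_square DN.
have zm (E : zmodType) (a b e f : E) : f - b - e - a = 0 ->
  - a - b - (b - - a) - (e - f) - (e - f) = 0.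
  move=> hf; have -> : e - f = - (b + a).
    apply/eqP; rewrite -subr_eq0 opprK -oppr_eq0 -hf; apply/eqP.
    by rewrite !opprD !opprK !addrA [LHS](ACl (2*3*1*4))/=.
  by rewrite !opprK subrK -opprD [a + b]addrC addNr.
have {zm} := zm _ _ _ _ _ h.
set G1 := (X in X - _ - _); set G2 := (X in _ - X - X) => hG.
have -> : c (G1) w = c G2 w + c G2 w.
  by rewrite -cDl; congr c; apply/eqP; rewrite -subr_eq0 opprD addrA hG.
rewrite -/G2; move: (adN (adN L) w) (adN L' w) (c G2 w) => a b g.
rewrite !cD !cN; apply: formE => s; rewrite !(formDE, formNE); ring.
Qed.
End Commutators.

(** * The equation satisfied by d for an integrable structure *)

Section Integrability.
Context {R : realType} {m : nat} {S : smoothSpace R}.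
Hypothesis HS : leuclid m S.
Local Notation A := (Cinf S).
Local Notation V := (vfield S).
Local Notation form := (form S).
Local Notation gtan := (gtan S).
Implicit Types (x : S) (f : A) (X Y : V) (w v : form) (u : gtan).
Variables (J : gcs S) (N : form -> form).
Hypothesis hN : forall x (xs : 'I_m -> A) D w, pframe x xs D -> eqx x (N w) (Nframe J xs D w).

Definition gdiff f : gtan := (0, Ccst S 2^-1 *: differential f).

Lemma dorfman_courant (u1 u2 : gtan) : dorfman u1 u2 = courant u1 u2 + gdiff (clifB u1 u2).
Proof.
congr (_, _); first by rewrite addr0.
apply: val_inj; apply/funext => X.
change (contract_d u1.1 u2.2 X + X (u2.2 u1.1) - contract_d u2.1 u1.2 X =
  contract_d u1.1 u2.2 X - contract_d u2.1 u1.2 X + Ccst S 2^-1 * X (u2.2 u1.1 - u1.2 u2.1) +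
    Ccst S 2^-1 * X (u1.2 u2.1 + u2.2 u1.1)).
rewrite !vactD !vactN; set a := X _; set b := X _.
have h : Ccst S 2^-1 * (a - b) + Ccst S 2^-1 * (b + a) = a.
  have h2 : Ccst S 2^-1 + Ccst S 2^-1 = 1 by rewrite -CcstD -[RHS]Ccst1; congr Ccst; field.
  by transitivity ((Ccst S 2^-1 + Ccst S 2^-1) * a); [ring|rewrite h2 mul1r].
by rewrite -[RHS]addrA h addrAC.
Qed.

Lemma gdiffD f g : gdiff (f + g) = gdiff f + gdiff g.
Proof.
congr (_, _); first by rewrite addr0.
apply: val_inj; apply/funext => X.
by change (Ccst S 2^-1 * X (f + g) = Ccst S 2^-1 * X f + Ccst S 2^-1 * X g); rewrite vactD mulrDr.
Qed.
Lemma gdiff0 : gdiff 0 = 0.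
Proof. by apply: (addrI (gdiff 0)); rewrite -gdiffD !addr0. Qed.

(** The Dorfman and Courant brackets differ by an exact term in [clifB]. Orthogonality and skewness
    of J make these terms cancel in the Nijenhuis expression. *)
Lemma dorfman_integrable (u1 u2 : gtan) :
  dorfman (J u1) (J u2) - J (dorfman u1 (J u2)) - J (dorfman (J u1) u2) - dorfman u1 u2 = 0.
Proof.
have := gcs_integrable J u1 u2; rewrite gcs_square.
rewrite !dorfman_courant !gcsD clifB_orth.
have e : J (gdiff (clifB u1 (J u2))) + J (gdiff (clifB (J u1) u2)) = 0.
  by rewrite -gcsD -gdiffD clifB_skew subrr gdiff0 gcs0.
have zm (E : zmodType) (a b d l g h k : E) : h + k = 0 -> a - b - d - l = 0 ->
  a + g - (b + h) - (d + k) - (l + g) = 0.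
  move=> hk <-; rewrite (_ : k = - h); last by apply/eqP; rewrite -addr_eq0 addrC hk.
  by rewrite !opprD opprK !addrA [LHS](ACl (1*3*5*7*(2*8)*(4*6)))/= subrr addNr !addr0.
exact: zm e.
Qed.

Lemma dorfmanN (u1 u2 : gtan) : dorfman u1 (- u2) = - dorfman u1 u2.
Proof.
have lN X Y : lie X (- Y) = - lie X Y.
  by apply: vfE => f; rewrite lieE -[(- lie X Y) f]/(- lie X Y f) lieE -![(- Y) _]/(- Y _) vactN
    opprB opprK addrC.
have oN (al : oneform S) Y : al (- Y) = - al Y.
  have a0 : al 0 = 0 by have := oneformP al (-1) 0 0; rewrite scaler0 addr0 mulN1r addNr.
  by have := oneformP al (-1) Y 0; rewrite scaleN1r addr0 mulN1r a0 addr0.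
congr (_, _); first exact: lN.
apply: val_inj; apply/funext => X.
change (lie_one u1.1 (- u2.2) X - ((- u2.1) (u1.2 X) - X (u1.2 (- u2.1)) - u1.2 (lie (- u2.1) X)) =
  - (lie_one u1.1 u2.2 X - (u2.1 (u1.2 X) - X (u1.2 u2.1) - u1.2 (lie u2.1 X)))).
have lNl : lie (- u2.1) X = - lie u2.1 X.
  apply: vfE => f; rewrite lieE -[(- lie u2.1 X) f]/(- lie u2.1 X f) lieE.
  by rewrite -![(- u2.1) _]/(- u2.1 _) vactN opprK opprB addrC.
rewrite lNl !oN !lie_oneE -[(- u2.2) X]/(- u2.2 X) -[(- u2.2) (lie _ _)]/(- u2.2 (lie _ _)).
rewrite -[(- u2.1) _]/(- u2.1 _) !vactN; ring.
Qed.

(* Integrability makes the anticommutator of [type_defect] with the Clifford action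
   commute with [N]; this kills [type_defect2], i.e. (ad N ^ 2 + 1) ^ 2 d = 0. *)
Definition type_defect w : form := adN N (adN N (@ext_d R S)) w + ext_d w.
Definition type_defect2 w : form := adN N (adN N type_defect) w + type_defect w.
Local Notation ND := (ND HS hN).
Local Notation NN := (NN HS hN).
Local Notation NZ := (NZ HS hN).
Local Notation anti := (anticom (@cliff R S)).

Lemma adND F w v : (forall w v, F (w + v) = F w + F v) -> adN N F (w + v) = adN N F w + adN N F v.
Proof.
move=> FD; rewrite /adN ND FD FD ND; move: (N _) (N _) (F (N _)) (F _) => a b c d.
by rewrite opprD addrACA.
Qed.
Lemma type_defectD w v : type_defect (w + v) = type_defect w + type_defect v.
Proof.
have h := ext_dD (S := S); rewrite /type_defect h (adND _ _ (fun w v => adND w v h)).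
by rewrite addrACA.
Qed.
Lemma add_opp (F : form -> form) w : (forall w v, F (w + v) = F w + F v) -> F (- w) = - F w.
Proof.
move=> FD; have F0 : F 0 = 0 by apply: (addrI (F 0)); rewrite -FD !addr0.
by apply: (addrI (F w)); rewrite -FD !subrr.
Qed.
Lemma type_defectN w : type_defect (- w) = - type_defect w. Proof. exact: add_opp type_defectD. Qed.
Lemma type_defect2D w v : type_defect2 (w + v) = type_defect2 w + type_defect2 v.
Proof. by rewrite /type_defect2 type_defectD (adND _ _ (fun w v => adND w v type_defectD))
  addrACA. Qed.

Lemma adN_scale (F : form -> form) (e e' : gtan) f w : (forall w, F (f *: w) = cliff e w +
  f *: F w) ->
  J e = e' -> adN N F (f *: w) = cliff e' w + f *: adN N F w.
Proof.
move=> hF <-; rewrite /adN NZ !hF (ND (cliff e w)) NZ (N_cliff HS hN) scalerBr.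
move: (cliff e (N w)) (cliff (J e) w) (f *: N _) (f *: F _) => a b c d.
by rewrite opprD addrACA [a + b]addrC addrK addrA.
Qed.

(** The commutator of d with f is the Clifford action of the section df, and applying ad N twice
    turns df into J (J df) = - df. *)
Lemma type_defectZ f w : type_defect (f *: w) = f *: type_defect w.
Proof.
have d1 v : ext_d (f *: v) = cliff (0, differential f) v + f *: ext_d v by rewrite ext_dZ
  cliff_wedge.
have d2 v := adN_scale v d1 erefl.
rewrite /type_defect (adN_scale w d2 erefl) d1; move: (adN N (adN N _) w) (ext_d w) => a b.
by rewrite gcs_square [cliff (- _) w]cliffNl scalerDr addrACA addNr add0r.
Qed.

Definition defect_anticom u w : form := anti type_defect u w.

(** By [anti_adN] the operator is (ad N)^2 applied to [Lop u1], minus twice ad N applied to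
    [Lop (J u1)]. Since [Lop] brackets with sections through [dorfman], [adN2_c] reduces the claim
    to integrability. *)
Lemma defect_anticom_cliff u1 u2 w : defect_anticom u1 (cliff u2 w) =
  cliff u2 (defect_anticom u1 w).
Proof.
have dD := ext_dD (S := S); have dN := ext_dN (S := S).
have LD u w1 w2 : Lop u (w1 + w2) = Lop u w1 + Lop u w2.
  by rewrite /Lop (cliffD u w1) dD dD cliffD addrACA.
have TE u v : defect_anticom u v = adN N (adN N (Lop u)) v - adN N (Lop (J u)) v - adN N
  (Lop (J u)) v.
  exact: (@anti_adN R S J N (@cliff R S) ND NN (@cliffD R S) (@cliffN R S) (@cliffNl R S)
    (N_cliff HS hN) (@ext_d R S) u v dD dN).
have e u (v : gtan) v' : Lop u (cliff v v') = cliff v (Lop u v') + cliff (dorfman u v) v'.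
  by rewrite -Lop_cliff addrCA subrr addr0.
rewrite (TE u1 (cliff u2 w)) (TE u1 w).
exact: (@adN2_c R S J N (@cliff R S) ND (@cliffD R S) (@cliffN R S) (@cliffNl R S) (N_cliff HS hN)
  (@cliffDl R S) (Lop u1) (dorfman u1) (Lop (J u1)) (dorfman (J u1)) (LD u1) (LD (J u1)) (e u1)
  (e (J u1)) (dorfmanN u1) u2 w (dorfman_integrable u1 u2)).

Qed.

Lemma type_defect_parity e w : fparity e w -> fparity (~~ e) (type_defect w).
Proof.
have fD e' v v' : fparity e' v -> fparity e' v' -> fparity e' (v + v').
  by move=> h h' s hs; rewrite formDE h ?h' ?addr0.
have fN e' v : fparity e' v -> fparity e' (- v) by move=> h s hs; rewrite formNE h ?oppr0.
move=> hw; have a1 v e' : fparity e' v -> fparity (~~ e') (adN N (@ext_d R S) v).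
  move=> hv; apply: (fD); first by apply: (fparity_N HS hN); exact: fparity_ext_d.
  by apply: (fN); apply: fparity_ext_d; exact: (fparity_N HS hN).
apply: (fD); last exact: fparity_ext_d.
by apply: (fD); [apply: (fparity_N HS hN); exact: (a1)|apply: (fN); apply: (a1);
  exact: (fparity_N HS hN)].
Qed.
Lemma type_defect2_parity e w : fparity e w -> fparity (~~ e) (type_defect2 w).
Proof.
have fD e' v v' : fparity e' v -> fparity e' v' -> fparity e' (v + v').
  by move=> h h' s hs; rewrite formDE h ?h' ?addr0.
have fN e' v : fparity e' v -> fparity e' (- v) by move=> h s hs; rewrite formNE h ?oppr0.
move=> hw; have a1 v e' : fparity e' v -> fparity (~~ e') (adN N type_defect v).
  move=> hv; apply: (fD); first by apply: (fparity_N HS hN); exact: type_defect_parity.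
  by apply: (fN); apply: type_defect_parity; exact: (fparity_N HS hN).
apply: (fD); last exact: type_defect_parity.
by apply: (fD); [apply: (fparity_N HS hN); exact: (a1)|apply: (fN); apply: (a1);
  exact: (fparity_N HS hN)].
Qed.

Lemma type_defect2Z f w : type_defect2 (f *: w) = f *: type_defect2 w.
Proof.
have a (F : form -> form) : (forall w, F (f *: w) = f *: F w) -> forall w, adN N F (f *: w) =
  f *: adN N F w.
  by move=> hF v; rewrite /adN NZ !hF NZ scalerBr.
by rewrite [LHS]/type_defect2 (a _ (a _ (type_defectZ f))) type_defectZ -scalerDr.
Qed.

(** Near each point N is a combination of products of two Clifford actions, with which the operator
    commutes; it is linear over functions, so a bump function makes that local expression usable. *)
Lemma defect_anticom_N u w : defect_anticom u (N w) = N (defect_anticom u w).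
Proof.
have TZ f v : defect_anticom u (f *: v) = f *: defect_anticom u v by rewrite
  [LHS]/(anti type_defect u _) /anticom cliffZ !type_defectZ cliffZ -scalerDr.
have TD v v' : defect_anticom u (v + v') = defect_anticom u v + defect_anticom u v'.
  by rewrite /defect_anticom /anticom (cliffD u v) !type_defectD (cliffD u (type_defect v)) addrACA.
have T0 : defect_anticom u 0 = 0 by apply: (addrI (defect_anticom u 0)); rewrite -TD !addr0.
apply: form_eqx => x s; have [ O [xs [D [Ox hf]]]] := frame_exists HS x.
have [oO _ _] := hf; have [chi [c1 c0]] := bump_at HS (open_nbhs_nbhs (conj oO Ox)).
have e : chi *: N w = chi *: Nframe J xs D w.
  apply: form_eqx => y t; rewrite !formZE !CvalM.
  have [Oy|nOy] := pselect (O y); first by rewrite (hN _ (frame_on_pframe hf Oy)).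
  by rewrite (nbhs_singleton (c0 _ nOy)) !mul0r.
have := congr1 (fun v => defect_anticom u v s x) e;
  rewrite !TZ !formZE !CvalM (nbhs_singleton c1) !mul1r => ->.
rewrite (hN _ (frame_on_pframe hf Ox)) /Nframe formZE CvalM (big_morph (defect_anticom u) TD T0).
by congr (_ * (_ : form) s x); apply: eq_bigr => a _; rewrite !defect_anticom_cliff.
Qed.

(** [anti_adN] expresses the anticommutator through ad N of operators [defect_anticom], all of which
    commute with N. *)
Lemma type_defect2_cliff u w : type_defect2 (cliff u w) = - cliff u (type_defect2 w).
Proof.
apply/eqP; rewrite -addr_eq0; apply/eqP.
have Tz u' v : adN N (defect_anticom u') v = 0 by rewrite /adN defect_anticom_N subrr.
rewrite -[LHS]/(anti (fun w => adN N (adN N type_defect) w + type_defect w) u w).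
rewrite (@anti_adN R S J N (@cliff R S) ND NN (@cliffD R S) (@cliffN R S) (@cliffNl R S)
  (N_cliff HS hN) type_defect u w type_defectD type_defectN).
change (N (adN N (defect_anticom u) w) - adN N (defect_anticom u) (N w) - adN N
  (defect_anticom (J u)) w - adN N (defect_anticom (J u)) w = 0).
by rewrite !Tz (N0 HS hN) !subr0.
Qed.

(** The operator reverses parity, which settles even forms. By the Euler operator an odd form is
    locally a sum of products of differentials with other forms; a differential passes through the
    operator up to sign and leaves no component of degree 0. *)
Lemma type_defect2_nil w : type_defect2 w [::] = 0.
Proof.
apply: CinfP => x.
have [w0 [w1 [ew p0 p1]]] : exists w0 w1, [/\ w = w0 + w1, fparity false w0 & fparity true w1].
  exists (degscale (fun k => (~~ odd k)%:R) w), (degscale (fun k => (odd k)%:R) w); split.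
  - by apply: formE => s; rewrite formDE !degscaleE; case: (odd _);
    rewrite Ccst0 Ccst1 mul0r mul1r ?addr0 ?add0r.
  - by move=> s hs; rewrite degscaleE (_ : ~~ odd _ = false) ?Ccst0 ?mul0r //; case: (odd _) hs.
  - by move=> s hs; rewrite degscaleE (_ : odd _ = false) ?Ccst0 ?mul0r //; case: (odd _) hs.
rewrite ew type_defect2D formDE (type_defect2_parity p0) // add0r.
have [ O [xs [D [Ox hf]]]] := frame_exists HS x.
have [oO _ _] := hf; have [chi [c1 c0]] := bump_at HS (open_nbhs_nbhs (conj oO Ox)).
(* Division by the degree inverts the Euler operator; in degree 0 the inverse of zero is zero, and
   [w1] has no component there. *)
pose w2 := degscale (fun k => k%:R^-1) w1.
have e : chi *: w1 = chi *: \sum_j cliff (0, differential (xs j)) (contract (D j) w2).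
  apply: form_eqx => y t;
    change (chi y * w1 t y = chi y * (\sum_j cliff (0, differential (xs j)) (contract (D j) w2)) t
    y).
  have [Oy|nOy] := pselect (O y); last by rewrite (nbhs_singleton (c0 _ nOy)) !mul0r.
  congr (_ * _); under eq_bigr => j _ do rewrite cliff_wedge.
  rewrite (sum_wedge_contract HS w2 t (frame_on_pframe hf Oy)) degscaleE CvalM Cval_cst.
  by case: t => [|X t]; [rewrite p1 // mulr0 mulr0|rewrite mulrA mulfV ?mul1r // pnatr_eq0].
have := congr1 (fun v => type_defect2 v [::] x) e;
  rewrite !type_defect2Z !formZE !CvalM (nbhs_singleton c1) !mul1r => ->.
have E10 : type_defect2 0 = 0 by apply: (addrI (type_defect2 0)); rewrite -type_defect2D !addr0.
rewrite (big_morph type_defect2 type_defect2D E10) form_sumE big1 // => j _.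
by rewrite type_defect2_cliff cliff_wedge formNE wedge_nil oppr0.
Qed.

(** Contractions are Clifford actions too, so evaluation on any arguments reduces to the component
    of degree 0 of another value of the operator. *)
Lemma type_defect2_eq0 w : type_defect2 w = 0.
Proof.
apply: formE => s; elim: s w => [|X s IH] w; first exact: type_defect2_nil.
by rewrite -contractE -cliff_contract -[cliff _ _]opprK -type_defect2_cliff formNE IH oppr0.
Qed.
End Integrability.

(** * The differential changes the level by one *)

Section SplitDifferential.
Context {R : realType} {q : nat} {S : smoothSpace R}.
Hypothesis HS : leuclid (2 * q) S.
Local Notation A := (Cinf S).
Local Notation V := (vfield S).
Local Notation form := (form S).
Local Notation gtan := (gtan S).
Local Notation cform := (cform S).
Implicit Types (x : S) (f : A) (X Y : V) (w v : form) (u : gtan) (z : cform).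
Variables (J : gcs S) (N : form -> form).
Hypothesis hN : forall x (xs : 'I_(2 * q) -> A) D w, pframe x xs D -> eqx x (N w) (Nframe J xs D w).
Local Notation Kop := (level (q := q) N).
Local Notation KB := (KopB HS hN).
Local Notation kcomp := (level_comp (q := q) J).

Lemma ext_dCB : {morph (@ext_dC R S) : v w / v - w}.
Proof. by move=> v w; rewrite /ext_dC /= !ext_dB. Qed.

Definition adK (F : cform -> cform) z : cform := Kop (F z) - F (Kop z).
Definition both (F : form -> form) z : cform := (F z.1, F z.2).

Lemma adK_both (F : form -> form) z : (forall w v, F (w + v) = F w + F v) -> adK (both F) z =
  muli (both (adN N F) z).
Proof.
move=> FD; have FN w : F (- w) = - F w := add_opp w FD.
have fB : {morph (both F) : v w / v - w} by move=> v w; rewrite /both /= !FD !FN.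
rewrite /adK /level fB (mBMn fB) subACA subrr sub0r opprB.
have c1 : F (N z.2) - N (F z.2) = - adN N F z.2 by rewrite /adN opprB.
have c2 : F (- N z.1) - - N (F z.1) = adN N F z.1 by rewrite FN opprK addrC.
by congr (_, _); [exact: c1|exact: c2].
Qed.

(** The level operator is q + i N, so ad K is i times ad N and its square is - (ad N)^2; this turns
    the equation for d into one for integer levels. *)
Lemma adK2_both (F : form -> form) z : (forall w v, F (w + v) = F w + F v) ->
  adK (adK (both F)) z = - both (adN N (adN N F)) z.
Proof.
move=> FD; have aD w v : adN N F (w + v) = adN N F w + adN N F v := adND HS hN w v FD.
have e : adK (both F) = fun z => muli (both (adN N F) z) by apply/funext => v; exact: adK_both.
rewrite e /adK (Kop_muli HS hN) -muliB -/(adK (both (adN N F)) z) (adK_both _ aD).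
exact: muli_muli.
Qed.

Lemma adK_ext_d z : ext_dC z - adK (adK (@ext_dC R S)) z -
  (adK (adK (fun z => ext_dC z - adK (adK (@ext_dC R S)) z)) z) = 0.
Proof.
have e : (fun z => ext_dC z - adK (adK (@ext_dC R S)) z) = both (type_defect N).
  apply/funext => v; rewrite -[@ext_dC R S]/(both (@ext_d R S)) (adK2_both _ (ext_dD (S := S)))
    opprK addrC.
  by rewrite /both /type_defect; congr (_, _).
rewrite -[ext_dC z - _]/((fun z => ext_dC z - adK (adK (@ext_dC R S)) z) z) e
  (adK2_both _ (type_defectD HS hN)) opprK addrC.
have h1 := type_defect2_eq0 HS hN z.1; have h2 := type_defect2_eq0 HS hN z.2.
by congr (_, _).
Qed.

Lemma kcomp_Kop k z : (k <= 2 * q)%N -> kcomp k (Kop z) = kcomp k z *+ k.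
Proof.
move=> kq; apply: (kcompE HS hN (c := fun k => kcomp k z *+ k)) => // [l lq|].
  by rewrite (mBMn KB) (kcomp_eigen HS hN z lq).
rewrite {1}(kcomp_sum HS hN z) (big_morph Kop (mBD KB) (mB0 KB)); apply: eq_bigr => l _.
by rewrite (kcomp_eigen HS hN) // -ltnS.
Qed.
Lemma kcompB k : (k <= 2 * q)%N -> {morph kcomp k : z z' / z - z'}.
Proof.
move=> kq z z'; apply: (addIr (kcomp k z')); rewrite -(kcompD HS hN) // !subrK //.
Qed.

Lemma kcomp_adK k l (F : cform -> cform) z : {morph F : v w / v - w} -> Kop z = z *+ k ->
  (l <= 2 * q)%N ->
  kcomp l (adK F z) = kcomp l (F z) *~ (l%:Z - k%:Z).
Proof.
move=> FB Kz lq; rewrite /adK kcompB // kcomp_Kop // Kz (mBMn FB) (mBMn (kcompB lq)).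
by rewrite mulrzBr -!pmulrn.
Qed.

(** On the component from level k to level l, ad K is multiplication by e = l - k, so that component
    is killed by (1 - e^2)^2, a nonzero integer unless e is 1 or -1. *)
Lemma ext_dC_eigen k l z : Kop z = z *+ k -> (l <= 2 * q)%N -> (l != k.+1)%N -> (l.+1 != k)%N ->
  kcomp l (ext_dC z) = 0.
Proof.
move=> Kz lq lk kl.
have adB F : {morph F : v w / v - w} -> {morph (adK F) : v w / v - w}.
  by move=> FB v w; rewrite /adK FB KB KB FB subACA.
have a2 := adB _ (adB _ ext_dCB).
pose F (v : cform) := ext_dC v - adK (adK (@ext_dC R S)) v.
have FB : {morph F : v w / v - w} by move=> v w; rewrite /F ext_dCB a2 subACA.
have := congr1 (kcomp l) (adK_ext_d z); rewrite -/F -[ext_dC z - _]/(F z).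
rewrite kcompB // (kcomp_adK (adB _ FB) Kz lq) (kcomp_adK FB Kz lq) -mulrzA.
rewrite /F kcompB // (kcomp_adK (adB _ ext_dCB) Kz lq) (kcomp_adK ext_dCB Kz lq) -mulrzA.
set e := l%:Z - k%:Z; set y := kcomp l (ext_dC z).
have -> : y - y *~ (e * e) - (y - y *~ (e * e)) *~ (e * e) = y *~ ((1 - e * e) * (1 - e * e)).
  have h (v : cform) : v - v *~ (e * e) = v *~ (1 - e * e) by rewrite mulrzBr mulr1z.
  by rewrite (h (y - y *~ (e * e))) h -mulrzA.
have -> : kcomp l 0 = 0 by exact: mB0 (kcompB lq).
apply: (@Ztfz _ (fun z : cform => z = 0)) => //.
- by move=> v w -> ->; rewrite subr0.
- by move=> w n h; apply: (@cform_eq0 _ S) => x; apply: (@Zxtf _ _ x _ n); rewrite h; exact: Zx0.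
by rewrite mulf_neq0 // /e; lia.
Qed.

Lemma kcomp_out k z : (2 * q < k)%N -> kcomp k z = 0.
Proof. by move=> qk; apply: component_out; lia. Qed.

Lemma kcomp_kcomp k l z : kcomp l (kcomp k z) = if l == k then kcomp k z else 0.
Proof.
have [kq|kq] := leqP k (2 * q); last first.
  rewrite (kcomp_out z kq) if_same; have [lq|lq] := leqP l (2 * q); last exact: kcomp_out.
  exact: mB0 (kcompB lq).
have [lq|lq] := leqP l (2 * q); first exact: (kcomp_id HS hN kq lq (kcomp_eigen HS hN z kq)).
by rewrite kcomp_out // ifN // neq_ltn (leq_ltn_trans kq lq) orbT.
Qed.

Lemma kcompDr k z z' : kcomp k (z + z') = kcomp k z + kcomp k z'.
Proof.
have [kq|kq] := leqP k (2 * q); first exact: (kcompD HS hN).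
by rewrite !kcomp_out // addr0.
Qed.

Lemma kcomp_muli k z : kcomp k (muli z) = muli (kcomp k z).
Proof.
have [kq|kq] := leqP k (2 * q); last by rewrite !kcomp_out // (mB0 muliB).
apply: (kcompE HS hN (c := fun k => muli (kcomp k z))) => // [l lq|].
  by rewrite (Kop_muli HS hN) (kcomp_eigen HS hN) // (mBMn muliB).
by rewrite {1}(kcomp_sum HS hN z) (big_morph _ (mBD muliB) (mB0 muliB)).
Qed.

(** Since j = q - k, the operator [partialbar_op] raises the level and [partial_op] lowers it.
    Lowering from k = 0 would land in j = q + 1, where [component] is 0. *)
Lemma dJ_opE z : dJ_op q J z = muli (\sum_(k < (2 * q).+1) kcomp k.+1 (ext_dC (kcomp k z)) -
  \sum_(k < (2 * q).+1) (if k : nat is k'.+1 then kcomp k' (ext_dC (kcomp k z)) else 0)).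
Proof.
rewrite /dJ_op; congr (muli (_ - _)); apply: eq_bigr => -[k kq] _ /=.
  by rewrite /level_comp; congr component; lia.
case: k kq => [|k] kq; first by apply: component_out; lia.
by rewrite /level_comp; congr component; lia.
Qed.

Lemma ext_dC_split k z : ext_dC (kcomp k z) =
  kcomp k.+1 (ext_dC (kcomp k z)) + (if k is k'.+1 then kcomp k' (ext_dC (kcomp k z)) else 0).
Proof.
have [kq|kq] := leqP k (2 * q); last first.
  have d0 : ext_dC (0 : cform) = 0 := mB0 ext_dCB.
  rewrite (kcomp_out z kq) d0 [kcomp k.+1 0](_ : _ = 0); last first.
    by rewrite kcomp_out // ltnS ltnW.
  case: k kq => [|k kq]; first by rewrite addr0.
  have [kq'|kq'] := leqP k (2 * q); last by rewrite kcomp_out // addr0.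
  by rewrite (mB0 (kcompB kq')) addr0.
set y := ext_dC _.
have hy l : (l <= 2 * q)%N -> (l != k.+1)%N -> (l.+1 != k)%N -> kcomp l y = 0.
  by move=> *; apply: (@ext_dC_eigen k) => //; exact: kcomp_eigen.
rewrite {1}(kcomp_sum HS hN y).
case: k kq @y hy => [|k] kq y hy.
  rewrite addr0; have [q1|q1] := leqP 1 (2 * q).
    have q1' : (1 < (2 * q).+1)%N by [].
    rewrite (bigD1 (Ordinal q1')) //= big1 ?addr0 // => i i1.
    by apply: hy; [rewrite -ltnS; exact: ltn_ord|apply: contra i1 => /eqP e; apply/eqP/val_inj|].
  rewrite kcomp_out // big1 // => i _; have := ltn_ord i => iq.
  by apply: hy => //; lia.
have hk : (k < (2 * q).+1)%N by rewrite ltnS ltnW.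
rewrite (bigD1 (Ordinal hk)) //= addrC; congr (_ + _).
have [q2|q2] := leqP k.+2 (2 * q).
  have q2' : (k.+2 < (2 * q).+1)%N by [].
  rewrite (bigD1 (Ordinal q2')) //=; last by rewrite -val_eqE /=; lia.
  rewrite big1 ?addr0 // => i /andP[i1 i2]; have iq := ltn_ord i; apply: hy; first by rewrite -ltnS.
    by apply: contra i2 => /eqP e; apply/eqP/val_inj.
  by apply: contra i1 => /eqP [e]; apply/eqP/val_inj.
rewrite kcomp_out // big1 // => i i1; have iq := ltn_ord i; apply: hy; first by rewrite -ltnS.
  by lia.
by apply: contra i1 => /eqP [e]; apply/eqP/val_inj.
Qed.

Definition cparity (e : bool) z : Prop := fparity e z.1 /\ fparity e z.2.
Definition cpart (e : bool) z : cform :=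
  (degscale (fun k => (odd k == e)%:R) z.1, degscale (fun k => (odd k == e)%:R) z.2).

Lemma degscale_id e w : degscale (fun k => (odd k == e)%:R) w = w <-> fparity e w.
Proof.
split=> [<- s hs|hw]; first by rewrite degscaleE (negPf hs) Ccst0 mul0r.
apply: formE => s; rewrite degscaleE; case: (boolP (odd (size s) == e)) => hs;
  first by rewrite Ccst1 mul1r.
by rewrite Ccst0 mul0r hw.
Qed.
Lemma degscaleB c w v : degscale c (w - v) = degscale c w - degscale c v.
Proof. by apply: formE => s; exact: mulrBr. Qed.

Lemma N_degscale e w : N (degscale (fun k => (odd k == e)%:R) w) =
  degscale (fun k => (odd k == e)%:R) (N w).
Proof.
set c := fun k => _.
have ew : w = degscale c w + (w - degscale c w) by rewrite addrCA subrr addr0.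
rewrite [in RHS]ew (ND HS hN).
have cD w1 w2 : degscale c (w1 + w2) = degscale c w1 + degscale c w2.
  by apply: formE => s; exact: mulrDr.
rewrite cD (_ : degscale c (N (w - _)) = 0) ?addr0; last first.
  have p : fparity (~~ e) (w - degscale c w).
    move=> s hs; rewrite formDE formNE degscaleE /c.
    by rewrite (_ : odd (size s) = e) ?eqxx ?Ccst1 ?mul1r ?subrr //; move: hs; clear;
      case: (odd _); case: (e).
  apply: formE => s; rewrite degscaleE /c; case: (boolP (odd (size s) == e)) => es.
    by rewrite (fparity_N HS hN p) ?mulr0 // (eqP es); clear; case: (e).
  by rewrite Ccst0 mul0r.
symmetry; apply/degscale_id; apply: (fparity_N HS hN); apply/degscale_id.
apply: formE => s; rewrite !degscaleE mulrA -CcstM /c.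
by case: eqP; rewrite ?mul1r ?mul0r.
Qed.

(** N is quadratic in the Clifford action, so it commutes with the projection to parity e; that
    projection of the components is then again a decomposition into levels. *)
Lemma kcomp_parity k e z : cparity e z -> cparity e (kcomp k z).
Proof.
move=> [h1 h2]; have [kq|kq] := leqP k (2 * q); last by rewrite kcomp_out.
have cB : {morph cpart e : v w / v - w} by move=> v w; rewrite /cpart /= !degscaleB.
have zE : cpart e z = z by case: z h1 h2 => a b /degscale_id h1 /degscale_id h2; congr (_, _).
have : kcomp k z = cpart e (kcomp k z).
  apply: (kcompE HS hN (c := fun k => cpart e (kcomp k z))) => // [l lq|].
    have -> : Kop (cpart e (kcomp l z)) = cpart e (Kop (kcomp l z)).
      rewrite /level cB (mBMn cB); congr (_ - _).
      have c1 := N_degscale e (kcomp l z).1; have c2 := N_degscale e (kcomp l z).2.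
      have dN w : degscale (fun k => (odd k == e)%:R) (- w) =
        - degscale (fun k => (odd k == e)%:R) w.
        by apply: formE => s; exact: mulrN.
      by congr (_, _); [exact: c2|rewrite /= dN; congr (- _); exact: c1].
    by rewrite (kcomp_eigen HS hN) // (mBMn cB).
  by rewrite -{1}zE {1}(kcomp_sum HS hN z) (big_morph _ (mBD cB) (mB0 cB)).
move=> h; split; apply/degscale_id; [exact: (esym (congr1 fst h))|exact: (esym (congr1 snd h))].
Qed.
End SplitDifferential.

(** * Basic forms and invariant forms *)

Section BasicForms.
Context {R : realType} {n q : nat} {M : manifold R n} (F : foliation q M).
Local Notation N := (fol_target F).
Local Notation T := (transverse F).
Local Notation SM := (space_of M).
Implicit Types (i j : fol_idx F) (x : SM) (t : T) (X V : vfield SM) (Y : vfield T).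
Local Notation HM := (manifold_split_leuclid F).
Local Notation HM0 := (manifold_leuclid M).
Local Notation HT := (transverse_leuclid F).
Local Notation mg := (@map_graph R n q M F).

Definition vertical i x V : Prop := forall t, mg i x t -> related (mg i) x t V 0.

Lemma mg_ex i x : fol_dom i x -> exists t, mg i x t.
Proof. by move=> Vx; have [y e] := to_piece Vx; exists (existT _ i y); split => //; exists y. Qed.

Lemma mg_onto t : exists x, mg (projT1 t) x t.
Proof.
case: t => i y; have [x Vx e] := pieceP y; exists x; split => //; exists y => //.
Qed.

Lemma vertical_fol i x V : fol_dom i x ->
  vertical i x V <-> related (fol_graph i) x (fol_map i x) V 0.
Proof.
move=> Vx; split=> [hV h g hg|hV t Gxt h g hg].
  have [h' hh'] := transverse_of_target h; have [t Gxt] := mg_ex Vx.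
  apply: (hV t Gxt h' g); apply: filterS hg => x' e t' /map_graphE[y [-> yx Vx']].
  by rewrite hh' /forget_piece /= yx; apply: e.
have [y [tE yx _]] := map_graphE Gxt; rewrite tE in hg *.
have [h' hh'] := target_near h y; apply: (hV h' g).
have cf : {for x, continuous (fol_map i)} by have [[+ _] _] := fol_map_submersion i; apply.
rewrite yx in hh'; have n1 : \forall x' \near x, forall y' : piece i, set_val y' = fol_map i x' ->
  h' (fol_map i x') = h (existT _ i y').
  exact: (cf _ hh').
apply: filterS2 n1 hg => x' e1 e2 z [Vx' ->]; have [y' y'x'] := to_piece Vx'.
by rewrite (e2 (existT _ i y')) ?(e1 y') //; split => //; exists y'.
Qed.

Lemma leaf_tangent_vertical i x X : leaf_tangent F X -> fol_dom i x -> vertical i x X.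
Proof. by move=> tX Vx; apply/vertical_fol => //; exact: tX. Qed.

Lemma vertical_trans i j x V : fol_dom i x -> fol_dom j x -> vertical i x V -> vertical j x V.
Proof.
move=> Vi Vj /(vertical_fol _ Vi) h; apply/vertical_fol => //.
set W := fol_map i @` (fol_dom i `&` fol_dom j).
have oW : open W by rewrite /W setIC; apply: fol_image_open; exact: fol_dom_open.
have [|sm _] := @fol_trans_diffeo R n q M F i j; first by exists x.
have sg := graph_on_smooth oW sm.
have Wy : W (fol_map i x) by exists x.
have G' : graph_on W (@fol_trans R n q M F i j) (fol_map i x) (fol_map j x) by split=> //;
  exact: fol_transP.
have r0 : @related R (space_of N) (space_of N) (graph_on W (@fol_trans R n q M F i j))
  (fol_map i x) (fol_map j x) 0 0 by [].
have Gi : fol_graph i x (fol_map i x) by split.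
apply: (@related_comp R SM (space_of N) (space_of N) _ _ (fol_graph j) _ _ _ _ _ _
  (fol_graph_smooth i) sg Gi G' _ h r0).
apply: open_near (fol_dom_open j) Vj _ => x' Vj' y' z' [Vi' ->] [_ ->]; split => //.
exact: esym (fol_transP Vi' Vj').
Qed.

(** Basic forms are tested on global fields tangent to the leaves. A vertical vector is first
    extended to a field vertical near x, then cut off by a bump function; [vertical_trans] gives
    tangency with respect to every other submersion. *)
Lemma vertical_extend i x V : fol_dom i x -> vertical i x V -> exists V', vfeq x V V' /\
  leaf_tangent F V'.
Proof.
move=> Vx hV; have [t Gxt] := mg_ex Vx.
have [V1 [e1 n1]] := related0_extend HM HT (@map_graph_smooth _ _ _ _ F i)
  (@map_graph_submersive _ _ _ _ F i) Gxt (hV t Gxt).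
have [B [oB Bx hB]] := near_open (filterI n1 (open_nbhs_nbhs (conj (fol_dom_open i) Vx))).
have [chi [c1 c0]] := bump_at HM0 (open_nbhs_nbhs (conj oB Bx)).
exists (chi *: V1); split.
  by move=> f; rewrite vact_scale CvalM (nbhs_singleton c1) mul1r e1.
move=> j x' Vj.
have [Bx'|nBx'] := pselect (B x'); last first.
  move=> h g hg; rewrite vact_scale CvalM (nbhs_singleton (c0 _ nBx')) mul0r.
  by [].
have [h1 Vi'] := hB _ Bx'.
have vi : vertical i x' V1 by move=> t' Gt'; exact: h1.
have /(vertical_fol _ Vj) := vertical_trans Vi' Vj vi.
have := @relatedZ _ _ _ (fol_graph j) x' (fol_map j x') chi (Ccst _ (chi x')) V1 0 erefl.
by rewrite scaler0.
Qed.

Section FromBasic.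
Variable w : form SM.
Hypothesis wb : forall X, leaf_tangent F X -> contract X w = 0 /\ contract X (ext_d w) = 0.

Lemma basic_horizontal i x V s : fol_dom i x -> vertical i x V -> w (V :: s) x = 0.
Proof.
move=> Vx /(vertical_extend Vx)[V' [e tV]].
have [h _] := wb tV; rewrite (Alin_eq HM0 (form_slot w [::] s) e) /=.
by rewrite -contractE h.
Qed.

(** Two lifts of the same field differ at x by a vertical vector, which v ignores in any slot by
    antisymmetry. *)
Lemma horizontal_lift_indep i x t (v : form SM) (l l' : seq (vfield SM * vfield T)) : mg i x t ->
  (forall V s, vertical i x V -> v (V :: s) x = 0) ->
  (forall p, p \in l -> related (mg i) x t p.1 p.2) ->
    (forall p, p \in l' -> related (mg i) x t p.1 p.2) ->
  unzip2 l = unzip2 l' -> v (unzip1 l) x = v (unzip1 l') x.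
Proof.
move=> Gxt; elim: l l' v => [|[X Y] l IH] [|[X' Y'] l'] v //= hv hl hl' [eY el].
have rX : related (mg i) x t X Y := hl (X, Y) (mem_head _ _).
have rX' : related (mg i) x t X' Y by rewrite eY; exact: (hl' (X', Y') (mem_head _ _)).
have vX : vertical i x (X - X').
  move=> t' Gt'; have [Gf _ _ _] := @map_graph_smooth _ _ _ _ F i.
  by rewrite -(Gf _ _ _ Gxt Gt') -(subrr Y); exact: relatedB.
have e s : v (X :: s) x = v (X' :: s) x.
  have := hv _ s vX; rewrite (AlinD (X) (- X') (form_slot v [::] s)) /=.
  have -> : v (- X' :: s) = - v (X' :: s) by rewrite -scaleN1r (AlinZ _ _ (form_slot v [::] s))
    mulN1r.
  by move=> h; apply/eqP; rewrite -subr_eq0; apply/eqP.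
rewrite e -!contractE; apply: IH => // [V s vV|p pl|p pl].
- by rewrite contractE form_swap CvalN hv ?oppr0.
- by apply: hl; rewrite inE pl orbT.
- by apply: hl'; rewrite inE pl orbT.
Qed.

Lemma basic_lift_indep i x t (l l' : seq (vfield SM * vfield T)) : mg i x t ->
  (forall p, p \in l -> related (mg i) x t p.1 p.2) ->
    (forall p, p \in l' -> related (mg i) x t p.1 p.2) ->
  unzip2 l = unzip2 l' -> w (unzip1 l) x = w (unzip1 l') x.
Proof.
by move=> Gxt; apply: (horizontal_lift_indep Gxt) => V s; apply: basic_horizontal; case: Gxt.
Qed.

(** The value of w on lifts is constant in vertical directions V: the Lie derivative of w along V
    vanishes by Cartan's formula, and the bracket of V with a lift is related to a bracket with 0,
    hence vertical. Then [factor_through] applies. *)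
Lemma basic_value_near i x0 t0 (s : seq (vfield T)) : mg i x0 t0 ->
  exists h : Cinf T, \forall x \near x0, forall t, mg i x t ->
    forall l : seq (vfield SM * vfield T),
    (forall p, p \in l -> related (mg i) x t p.1 p.2) -> unzip2 l = s -> w (unzip1 l) x = h t.
Proof.
move=> G0; have sG := @map_graph_smooth _ _ _ _ F i; have subG := @map_graph_submersive _ _ _ _ F i.
have [l0 [el0 hl0]] : exists l0 : seq (vfield SM * vfield T), unzip2 l0 = s /\
    \forall x \near x0, forall p, p \in l0 -> forall t, mg i x t -> related (mg i) x t p.1 p.2.
  elim: s => [|Y s [l [el hl]]]; first by exists [::]; split => //; apply: filterE.
  have [X hX] := related_lift HM HT sG subG G0 Y.
  exists ((X, Y) :: l); split; first by rewrite /= el.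
  apply: filterS2 hX hl => x e1 e2 p; rewrite inE => /orP[/eqP->|pl]; [exact: e1|exact: e2].
have {}hl0 := nbhs_interior hl0.
have [h hh] : exists h : Cinf T, \forall x \near x0, forall t, mg i x t -> w (unzip1 l0) x = h t.
  apply: (factor_through HM HT sG subG G0).
  apply: filterS hl0 => x hx t Gxt V rV; have [Vx _] := Gxt.
  have vV : vertical i x V.
    by move=> t' Gt'; have [Gf _ _ _] := sG; rewrite -(Gf _ _ _ Gxt Gt').
  have [V' [eV tV]] := vertical_extend Vx vV.
  have [c1 c2] := wb tV.
  have L0 : lieD V' w = 0.
    have := contract_ext_d V' w; rewrite c1 c2 [ext_d 0](_ : _ = 0) ?subr0 => [->//|].
    by apply: formE => u; exact: ext_d_zero.
  have : lieD V' w (unzip1 l0) x = 0 by rewrite L0.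
  rewrite eV -[lieD V' w _]/(V' (w (unzip1 l0)) - \sum_(k < size (unzip1 l0)) (-1) ^+
    k * w (lie V' (nth 0 (unzip1 l0) k) :: remove_nth k (unzip1 l0))).
  rewrite CvalB => /eqP; rewrite subr_eq0 => /eqP ->; rewrite Cval_sum big1 // => k _.
  have kl : (k < size l0)%N by rewrite -(size_map fst l0); exact: ltn_ord.
  rewrite CvalM (basic_horizontal _ Vx) ?mulr0 // => t' Gt'.
  have pl := mem_nth (0, 0) kl.
  have -> : nth 0 (unzip1 l0) k = (nth (0, 0) l0 k).1 by rewrite (nth_map (0, 0)).
  have lie0 : lie 0 (nth (0, 0) l0 k).2 = 0 :> vfield T.
    by apply: vfE => f; change (0 - (nth (0, 0) l0 k).2 0 = 0 :> Cinf T); rewrite vact0 subr0.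
  have n1 : related_near (mg i) x V' 0.
    apply: open_near (fol_dom_open i) Vx _ => x' Vx'; exact: leaf_tangent_vertical.
  have n2 : related_near (mg i) x (nth (0, 0) l0 k).1 (nth (0, 0) l0 k).2.
    by apply: filterS hx => x' e1; exact: e1.
  by have := related_lie Gt' n1 n2; rewrite lie0.
exists h; apply: filterS2 hh hl0 => x e1 /nbhs_singleton e2 t Gxt l hl el.
rewrite -(e1 _ Gxt); apply: (basic_lift_indep Gxt) => //; last by rewrite el el0.
by move=> p pl; exact: e2.
Qed.

Lemma lift_list i x t (s : seq (vfield T)) : mg i x t ->
  exists l : seq (vfield SM * vfield T), (forall p, p \in l -> related (mg i) x t p.1 p.2) /\
    unzip2 l = s.
Proof.
move=> Gxt; elim: s => [|Y s [l [hl el]]]; first by exists [::].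
have [X rX] := @map_graph_submersive _ _ _ _ F i _ _ Gxt Y.
exists ((X, Y) :: l); split; last by rewrite /= el.
by move=> p; rewrite inE => /orP[/eqP->|/hl].
Qed.

(** By [basic_value_near] the value is locally constant along the fibre, and the fibre is
    connected. *)
Lemma basic_value_fibre i x x' t (l l' : seq (vfield SM * vfield T)) : mg i x t -> mg i x' t ->
  (forall p, p \in l -> related (mg i) x t p.1 p.2) ->
    (forall p, p \in l' -> related (mg i) x' t p.1 p.2) ->
  unzip2 l = unzip2 l' -> w (unzip1 l) x = w (unzip1 l') x'.
Proof.
move=> Gxt Gx't; set s := unzip2 l' => hl hl' el.
pose P (z : SM) (v : R) := forall l : seq (vfield SM * vfield T),
  mg i z t -> (forall p, p \in l -> related (mg i) z t p.1 p.2) -> unzip2 l = s ->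
    w (unzip1 l) z = v.
have ex z : exists v, P z v.
  have [Gz|nG] := pselect (mg i z t); last by exists 0.
  have [l1 [hl1 el1]] := lift_list s Gz; exists (w (unzip1 l1) z) => l2 _ hl2 el2.
  by apply: (basic_lift_indep Gz) => //; rewrite el2.
have [val hval] := choice ex.
have loc z : mg i z t -> \forall z' \near z, mg i z' t -> val z' = val z.
  move=> Gz; have [h hh] := basic_value_near s Gz.
  have main z' : (forall t, mg i z' t -> forall l : seq (vfield SM * vfield T),
    (forall p, p \in l -> related (mg i) z' t p.1 p.2) -> unzip2 l = s -> w (unzip1 l) z' = h t)
      -> mg i z' t -> val z' = h t.
    by move=> e Gz'; have [l1 [hl1 el1]] := lift_list s Gz'; rewrite -(hval z' l1) // (e _ Gz').
  by apply: filterS (hh) => z' /main e /e ->; rewrite (main z) //; exact: (nbhs_singleton hh).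
rewrite (hval x l) // (hval x' l') //.
have [y [tE yx _]] := map_graphE Gxt.
pose A := fol_dom i `&` fol_map i @^-1` [set set_val y].
have AG z : A z <-> mg i z t.
  rewrite tE; split=> [[Vz e]|/map_graphE[y' [/eqP e1 e2 Vz]]]; first by split => //; exists y.
  by move: e1; rewrite eq_Tagged => /eqP /= e1; split => //=; rewrite -e2 e1.
pose B := [set z | A z /\ val z = val x].
have opn (Q : SM -> Prop) : open [set z | \forall z' \near z, A z' -> Q z'].
  by rewrite openE => z /nbhs_interior.
have -> // : val x' = val x.
have : B x' ; last by case.
have -> : B = A; last exact/AG.
apply: (fol_map_connected (i := i) (y := set_val y)).
- by exists x; split => //; exact/AG.
- exists [set z | \forall z' \near z, A z' -> val z' = val x]; first exact: opn.
  apply/seteqP; split=> z [Az].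
    move=> vz; split => //=; have := loc z ((AG z).1 Az).
    by apply: filterS => z' e Az'; rewrite e ?vz //; exact/AG.
  by move=> /nbhs_singleton; split => //; auto.
- exists (~` [set z | \forall z' \near z, A z' -> val z' <> val x]); first by apply: open_closedC;
  exact: opn.
  apply/seteqP; split=> z [Az].
    by move=> vz; split => // /nbhs_singleton; apply.
  move=> nz; split => //; apply: contrapT => vz; apply: nz.
  have := loc z ((AG z).1 Az); apply: filterS => z' e Az'; rewrite e //; exact/AG.
Qed.

(** The value at t is taken at any point above t with any lifts of the arguments. Its smoothness
    near t follows from that near one point above, because the submersions are open maps. *)
Lemma basic_descends : exists tau : form T, forall i x t, mg i x t -> pullback_at (mg i) x t w tau.
Proof.
have ex (st : seq (vfield T) * T) : exists v, forall x (l : seq (vfield SM * vfield T)),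
    mg (projT1 st.2) x st.2 -> (forall p, p \in l -> related (mg (projT1 st.2)) x st.2 p.1 p.2) ->
      unzip2 l = st.1 -> w (unzip1 l) x = v.
  case: st => s t /=; have [x Gx] := mg_onto t; have [l [hl el]] := lift_list s Gx.
  exists (w (unzip1 l) x) => x' l' Gx' hl' el'; apply: (basic_value_fibre Gx' Gx) => //;
    by rewrite el' el.
have [g hg] := choice ex.
have mgi i x t : mg i x t -> i = projT1 t by move=> [_ [y -> _]].
have {hg} hg i x t (l : seq (vfield SM * vfield T)) s : mg i x t ->
  (forall p, p \in l -> related (mg i) x t p.1 p.2) ->
    unzip2 l = s -> w (unzip1 l) x = g (s, t).
  by move=> Gxt hl el; have ei := mgi _ _ _ Gxt; subst i; apply: (hg (s, t)).
have [|||tau htau] := @mk_form _ _ _ HT (fun s t => g (s, t)).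
- move=> s t0; have [x0 G0] := mg_onto t0; have [h hh] := basic_value_near s G0; exists h.
  have := graph_open_map HM HT (@map_graph_smooth _ _ _ _ F _) (@map_graph_submersive _ _ _ _ F _)
    G0 hh.
  apply: filterS => t [x e Gxt]; have [l [hl el]] := lift_list s Gxt.
  by rewrite -(hg _ _ _ _ _ Gxt hl el) (e _ Gxt).
- move=> s1 s2 f X Y t; have [x Gxt] := mg_onto t.
  have [l1 [h1 e1]] := lift_list s1 Gxt; have [l2 [h2 e2]] := lift_list s2 Gxt.
  have [X' rX] := @map_graph_submersive _ _ _ _ F _ _ _ Gxt X.
  have [Y' rY] := @map_graph_submersive _ _ _ _ F _ _ _ Gxt Y.
  have hin (Z' : vfield SM) (Z : vfield T) : related (mg (projT1 t)) x t Z' Z ->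
      forall p, p \in l1 ++ (Z', Z) :: l2 -> related (mg (projT1 t)) x t p.1 p.2.
    by move=> rZ p; rewrite mem_cat inE => /or3P[/h1|/eqP->|/h2].
  have hun (Z' : vfield SM) (Z : vfield T) : unzip2 (l1 ++ (Z', Z) :: l2) = s1 ++
    Z :: s2 by rewrite /unzip2 map_cat /= -/(unzip2 _) e1 -/(unzip2 _) e2.
  have rXY : related (mg (projT1 t)) x t (Ccst SM (f t) *: X' + Y') (f *: X + Y).
    by apply: relatedD => //; exact: relatedZ.
  rewrite -(hg _ _ _ _ _ Gxt (hin _ _ rXY) (hun _ _)) -(hg _ _ _ _ _ Gxt (hin _ _ rX) (hun _ _))
    -(hg _ _ _ _ _ Gxt (hin _ _ rY) (hun _ _)).
  by rewrite /unzip1 !map_cat /= (formP w).1.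
- move=> s1 s2 s3 X t; have [x Gxt] := mg_onto t.
  have [l1 [h1 e1]] := lift_list s1 Gxt; have [l2 [h2 e2]] := lift_list s2 Gxt;
    have [l3 [h3 e3]] := lift_list s3 Gxt.
  have [X' rX] := @map_graph_submersive _ _ _ _ F _ _ _ Gxt X.
  rewrite -(hg _ _ _ (l1 ++ (X', X) :: l2 ++ (X', X) :: l3) _ Gxt);
    first by rewrite /unzip1 !map_cat /= map_cat (formP w).2.
    by move=> p; rewrite mem_cat inE mem_cat inE => /or4P[/h1|/eqP->|/h2|/orP[/eqP->|/h3]].
  by rewrite /unzip2 !map_cat /= map_cat /= -/(unzip2 _) e1 -/(unzip2 _) e2 -/(unzip2 _) e3.
by exists tau => i x t Gxt l hl; rewrite htau; exact: (hg _ _ _ _ _ Gxt hl erefl).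
Qed.
End FromBasic.
End BasicForms.

(** * Basic forms on M correspond to invariant forms on T *)

Section Representation.
Context {R : realType} {n q : nat} {M : manifold R n} (F : foliation q M).
Local Notation N := (fol_target F).
Local Notation T := (transverse F).
Local Notation SM := (space_of M).
Implicit Types (i j : fol_idx F) (x : SM) (t : T) (X V : vfield SM) (Y Z : vfield T)
  (tau : form T) (w : form SM).
Local Notation HM := (manifold_split_leuclid F).
Local Notation HM0 := (manifold_leuclid M).
Local Notation HT := (transverse_leuclid F).
Local Notation mg := (@map_graph R n q M F).
Local Notation sG := (@map_graph_smooth _ _ _ _ F _).
Local Notation subG := (@map_graph_submersive _ _ _ _ F _).

Definition rep tau w : Prop := forall i x t, mg i x t -> pullback_at (mg i) x t w tau.
Definition hol_inv tau : Prop := forall G, holonomy G -> forall t t', G t t' ->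
  pullback_at G t t' tau tau.

Lemma mg_trans i j x t t' : mg i x t -> mg j x t' -> trans_graph i j t t'.
Proof.
move=> /map_graphE[y [-> yx Vi]] /map_graphE[y' [-> y'x Vj]]; exists y, y'; split => //.
  by exists x.
by rewrite y'x yx; exact: fol_transP.
Qed.

Lemma mg_trans_near i j x t t' : mg i x t -> mg j x t' ->
  \forall x' \near x, forall y' z', mg i x' y' -> trans_graph i j y' z' -> mg j x' z'.
Proof.
move=> _ /map_graphE[_ [_ _ Vj]]; apply: open_near (fol_dom_open j) Vj _ => x' Vj' y' z'.
move=> /map_graphE[y [-> yx Vi]] [y1 [y2 [/eqP + -> _ y2E]]].
rewrite eq_Tagged => /eqP /= e; split => //; exists y2 => //.
by rewrite y2E -e yx; exact: esym (fol_transP Vi Vj').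
Qed.

Lemma related_id t Y Z : related (fun t t' : T => t' = t) t t Y Z -> vfeq t Y Z.
Proof. by move=> r h; apply: r; apply: filterE => t1 t2 ->. Qed.

(** For a generator, vectors related by the transition map lift to a common vector on M, and both
    values of tau equal that of w. The other constructors of the pseudogroup preserve the
    property. *)
Lemma rep_hol_inv tau w : rep tau w -> hol_inv tau.
Proof.
move=> hw G; elim=> {G}.
- move=> i j t t' tg s hs.
  have [x Gi Gj] : exists2 x, mg i x t & mg j x t'.
    move: tg => [y [y' [-> -> [x [Vi Vj] xy] y'E]]]; exists x; split => //; first by exists y.
    by exists y' => //; rewrite y'E -xy; exact: esym (fol_transP Vi Vj).
  have [l1 [l2 [h1 h2 e0 <- <-]]] : exists l1 l2 : seq (vfield SM * vfield T),
     [/\ forall p, p \in l1 -> related (mg i) x t p.1 p.2, forall p, p \in l2 ->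
       related (mg j) x t' p.1 p.2,
       unzip1 l1 = unzip1 l2, unzip2 l1 = unzip1 s & unzip2 l2 = unzip2 s].
    elim: s hs => [|[Y Z] s IH] hs; first by exists [::], [::].
    have [|l1 [l2 [h1 h2 e0 e1 e2]]] := IH; first by move=> p ps; apply: hs; rewrite inE ps orbT.
    have rYZ : related (trans_graph i j) t t' Y Z := hs (Y, Z) (mem_head _ _).
    have [X rX] := subG Gi Y.
    have rX' : related (mg j) x t' X Z.
      exact: related_comp (sG : smooth_graph (mg i)) (trans_graph_smooth i j) Gi tg
        (mg_trans_near Gi Gj) rX rYZ.
    exists ((X, Y) :: l1), ((X, Z) :: l2); split; rewrite /= ?e0 ?e1 ?e2 // => p.
      by rewrite inE => /orP[/eqP->|/h1].
    by rewrite inE => /orP[/eqP->|/h2].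
  by rewrite -(hw _ _ _ Gi l1 h1) -(hw _ _ _ Gj l2 h2) e0.
- move=> t t' -> s hs; apply: (form_congr HT) => p /hs; exact: related_id.
- move=> G hG IH t t' Gt s hs.
  have [s1 s2] := holonomy_local_diffeo hG.
  have -> : unzip1 s = unzip2 (map (fun p => (p.2, p.1)) s) by rewrite /unzip1 /unzip2 -map_comp;
    apply: eq_map.
  have -> : unzip2 s = unzip1 (map (fun p => (p.2, p.1)) s) by rewrite /unzip1 /unzip2 -map_comp;
    apply: eq_map.
  symmetry; apply: (IH _ _ Gt) => _ /mapP[p /hs r ->] /=.
  have lG : local_diffeo_graph (flip_graph G) by split.
  exact: (related_flip lG Gt r).
- move=> G G' hG IH hG' IH' t t'' [t' Gt Gt'] s hs.
  have [s1 _] := holonomy_local_diffeo hG.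
  have [l1 [l2 [h1 h2 <- e0 <-]]] : exists l1 l2 : seq (vfield T * vfield T),
     [/\ forall p, p \in l1 -> related G t t' p.1 p.2, forall p, p \in l2 ->
       related G' t' t'' p.1 p.2,
       unzip1 l1 = unzip1 s, unzip2 l1 = unzip1 l2 & unzip2 l2 = unzip2 s].
    elim: s hs => [|[Y Z] s IHs] hs; first by exists [::], [::].
    have [|l1 [l2 [h1 h2 e0 e1 e2]]] := IHs; first by move=> p ps; apply: hs; rewrite inE ps orbT.
    have rYZ := hs (Y, Z) (mem_head _ _).
    have GG : \forall x' \near t, forall y' z', G x' y' -> (exists2 t', G x' t' & G' t' z') ->
      G' y' z'.
      by have [Gf _ _ _] := s1; apply: filterE => x' y' z' Gy [y'' Gy''];
        rewrite (Gf _ _ _ Gy Gy'').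
    have [Y' [rY rY']] := related_factor HT HT s1 Gt GG rYZ.
    exists ((Y, Y') :: l1), ((Y', Z) :: l2); split; rewrite /= ?e0 ?e1 ?e2 // => p.
      by rewrite inE => /orP[/eqP->|/h1].
    by rewrite inE => /orP[/eqP->|/h2].
  by rewrite (IH _ _ Gt l1 h1) e0 (IH' _ _ Gt' l2 h2).
- move=> G O oO hG IH t t' [Ot Gt] s hs; apply: (IH _ _ Gt) => p ps h g hg.
  by apply: (hs p ps); apply: filterS hg => x' e y' [_ Gy]; exact: e.
- move=> K G hG IH h1 h2 t t' [k Gt] s hs; apply: (IH k _ _ Gt) => p ps h g hg.
  have [[_ Gd _ _] _] := holonomy_local_diffeo (hG k).
  apply: (hs p ps); apply: filterS2 (Gd _ _ Gt) hg => x' [y1 Gy1] e y' [l Gy'].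
  by rewrite -(h1 _ _ _ _ _ Gy1 Gy'); exact: e.
Qed.

Lemma rep_ext_d tau w : rep tau w -> rep (ext_d tau) (ext_d w).
Proof.
move=> hw i x t Gxt; apply: (pullback_ext_d HM HT sG subG Gxt).
by apply: filterE => x' y' Gy'; exact: hw.
Qed.

Lemma push_list i x t (s : seq (vfield SM)) : mg i x t ->
  exists l : seq (vfield SM * vfield T), (forall p, p \in l -> related (mg i) x t p.1 p.2) /\
    unzip1 l = s.
Proof.
move=> Gxt; elim: s => [|X s [l [hl el]]]; first by exists [::].
have [Y rY] := related_push HM HT sG X Gxt.
exists ((X, Y) :: l); split; last by rewrite /= el.
by move=> p; rewrite inE => /orP[/eqP->|/hl].
Qed.

Lemma mg_dom x : exists i t, mg i x t.
Proof. by have [i Vi] := fol_domP F x; have [t Gt] := mg_ex Vi; exists i, t. Qed.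

Lemma rep_horizontal tau w X : rep tau w -> leaf_tangent F X -> contract X w = 0.
Proof.
move=> hw tX; apply: formE => s; apply: CinfP => x; have [i [t Gxt]] := mg_dom x.
have [l [hl <-]] := push_list s Gxt; have [Vx _] := Gxt.
rewrite contractE (hw _ _ _ Gxt ((X, 0) :: l)) /=; first by rewrite form0.
move=> p; rewrite inE => /orP[/eqP->|/hl //]; exact: (leaf_tangent_vertical tX Vx).
Qed.

Lemma rep_basic tau w X : rep tau w -> leaf_tangent F X -> contract X w = 0 /\
  contract X (ext_d w) = 0.
Proof. by move=> hw tX; split;
  [exact: rep_horizontal hw tX|exact: rep_horizontal (rep_ext_d hw) tX]. Qed.

Lemma rep_uniq tau w w' : rep tau w -> rep tau w' -> w = w'.
Proof.
move=> hw hw'; apply: formE => s; apply: CinfP => x; have [i [t Gxt]] := mg_dom x.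
by have [l [hl <-]] := push_list s Gxt; rewrite (hw _ _ _ Gxt l hl) (hw' _ _ _ Gxt l hl).
Qed.
Lemma rep_uniql tau tau' w : rep tau w -> rep tau' w -> tau = tau'.
Proof.
move=> hw hw'; apply: formE => s; apply: CinfP => t; have [x Gxt] := mg_onto t.
by have [l [hl <-]] := lift_list s Gxt; rewrite -(hw _ _ _ Gxt l hl) -(hw' _ _ _ Gxt l hl).
Qed.

Lemma push_indep i x t tau (l l' : seq (vfield SM * vfield T)) : mg i x t ->
  (forall p, p \in l -> related (mg i) x t p.1 p.2) ->
    (forall p, p \in l' -> related (mg i) x t p.1 p.2) ->
  unzip1 l = unzip1 l' -> tau (unzip2 l) t = tau (unzip2 l') t.
Proof.
move=> Gxt; elim: l l' tau => [|[X Y] l IH] [|[X' Y'] l'] tau //= hl hl' [eX el].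
have rY : related (mg i) x t X Y := hl (X, Y) (mem_head _ _).
have rY' : related (mg i) x t X Y' by rewrite eX; exact: (hl' (X', Y') (mem_head _ _)).
rewrite (Alin_eq HT (form_slot tau [::] (unzip2 l)) (related_uniq sG Gxt rY rY')) /=.
rewrite -!contractE; apply: IH => // p pl; [apply: hl|apply: hl']; by rewrite inE pl orbT.
Qed.

(** The two images on T of a vector on M are related by the transition map, under which tau is
    invariant; so the form induced on M does not depend on the submersion chosen. *)
Lemma push_change i j x t t' tau (l l' : seq (vfield SM * vfield T)) : hol_inv tau -> mg i x t ->
  mg j x t' ->
  (forall p, p \in l -> related (mg i) x t p.1 p.2) ->
    (forall p, p \in l' -> related (mg j) x t' p.1 p.2) ->
  unzip1 l = unzip1 l' -> tau (unzip2 l) t = tau (unzip2 l') t'.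
Proof.
move=> ht Gi Gj hl hl' el; have tg := mg_trans Gi Gj.
have [l1 [l2 [h1 h2 e0 e1 e2]]] : exists (l1 : seq (vfield SM * vfield T))
  (l2 : seq (vfield T * vfield T)),
     [/\ forall p, p \in l1 -> related (mg i) x t p.1 p.2, forall p, p \in l2 ->
       related (trans_graph i j) t t' p.1 p.2,
       unzip1 l1 = unzip1 l', unzip2 l1 = unzip1 l2 & unzip2 l2 = unzip2 l'].
  elim: l' hl' {el} => [|[X Z] s IHs] hs; first by exists [::], [::].
  have [|l1 [l2 [h1 h2 e0 e1 e2]]] := IHs; first by move=> p ps; apply: hs; rewrite inE ps orbT.
  have rXZ : related (mg j) x t' X Z := hs (X, Z) (mem_head _ _).
  have GG : \forall x' \near x, forall y' z', mg i x' y' -> mg j x' z' -> trans_graph i j y' z'.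
    by apply: filterE => x' y' z'; exact: mg_trans.
  have [Y [rY rY']] := related_factor HM HT sG Gi GG rXZ.
  exists ((X, Y) :: l1), ((Y, Z) :: l2); split; rewrite /= ?e0 ?e1 ?e2 // => p.
    by rewrite inE => /orP[/eqP->|/h1].
  by rewrite inE => /orP[/eqP->|/h2].
rewrite -e2 -(ht _ (hol_gen i j) _ _ tg l2 h2) -e1.
by apply: (push_indep _ Gi hl h1); rewrite el e0.
Qed.

(** Fields on M need not be related to fields on T near x0. Their images are expanded pointwise in a
    frame of T, with the smooth coefficients X (g a), and the remaining arguments are treated by
    induction. *)
Lemma push_smooth i x0 t0 (s : seq (vfield SM)) tau : mg i x0 t0 -> exists f : Cinf SM,
  \forall x \near x0, forall t, mg i x t -> forall l : seq (vfield SM * vfield T),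
    (forall p, p \in l -> related (mg i) x t p.1 p.2) -> unzip1 l = s -> tau (unzip2 l) t = f x.
Proof.
move=> G0; have [_ _ Gc Gs] := sG : smooth_graph (mg i).
elim: s tau => [|X s IH] tau.
  have [g hg] := Gs (tau [::]) _ _ G0; exists g; apply: filterS hg => x e t Gxt [|//] _ _.
  by rewrite (e _ Gxt).
have [ O [ys [D [Ot hf]]]] := frame_exists HT t0; have [oO _ _] := hf.
have [g hg] := choice (fun a => Gs (ys a) _ _ G0).
have [f hf'] := choice (fun a => IH (contract (D a) tau)).
exists (\sum_a X (g a) * f a).
have n1 : \forall x \near x0, forall a, \forall x' \near x, forall y', mg i x' y' ->
  g a x' = ys a y'.
  by apply: filter_forall => a; exact: nbhs_interior (hg a).
have n2 : \forall x \near x0, forall a, forall t, mg i x t -> forall l : seq (vfield SM * vfield T),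
    (forall p, p \in l -> related (mg i) x t p.1 p.2) -> unzip1 l = s ->
      contract (D a) tau (unzip2 l) t = f a x.
  by apply: filter_forall; exact: hf'.
have n3 := Gc _ _ _ G0 (open_nbhs_nbhs (conj oO Ot)).
apply: filterS3 n1 n2 n3 => x e1 e2 e3 t Gxt [//|[X' Y] l] hl [eX el]; rewrite /= in eX *; subst X'.
have rY : related (mg i) x t X Y := hl (X, Y) (mem_head _ _).
rewrite (frame_expand HT Y hf (form_slot tau [::] (unzip2 l)) (e3 _ Gxt)) Cval_sum;
  apply: eq_bigr => a _.
rewrite CvalM -(rY (ys a) (g a)) //; congr (_ * _).
by apply: (e2 a _ Gxt) => // p pl; apply: hl; rewrite inE pl orbT.
Qed.

Lemma hol_inv_lifts tau : hol_inv tau -> exists w, rep tau w.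
Proof.
move=> ht.
have ex (sx : seq (vfield SM) * SM) : exists v, forall i t (l : seq (vfield SM * vfield T)),
    mg i sx.2 t -> (forall p, p \in l -> related (mg i) sx.2 t p.1 p.2) -> unzip1 l = sx.1 ->
      tau (unzip2 l) t = v.
  case: sx => s x /=; have [i [t Gxt]] := mg_dom x; have [l [hl el]] := push_list s Gxt.
  exists (tau (unzip2 l) t) => i' t' l' G' hl' el'; apply: (push_change ht G' Gxt) => //;
    by rewrite el' el.
have [g hg0] := choice ex.
have hg s x i t (l : seq (vfield SM * vfield T)) : mg i x t ->
  (forall p, p \in l -> related (mg i) x t p.1 p.2) ->
    unzip1 l = s -> tau (unzip2 l) t = g (s, x) by move=> Gxt hl el;
      exact: (hg0 (s, x) i t l Gxt hl el).
have [|||w hw] := @mk_form _ _ _ HM0 (fun s x => g (s, x)).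
- move=> s x0; have [i [t0 G0]] := mg_dom x0; have [f hf] := push_smooth s tau G0; exists f.
  have [_ Gd _ _] := sG : smooth_graph (mg i).
  apply: filterS2 hf (Gd _ _ G0) => x e [t Gxt]; have [l [hl el]] := push_list s Gxt.
  by rewrite -(hg _ _ _ _ _ Gxt hl el) (e _ Gxt).
- move=> s1 s2 f X Y x; have [i [t Gxt]] := mg_dom x.
  have [l1 [h1 e1]] := push_list s1 Gxt; have [l2 [h2 e2]] := push_list s2 Gxt.
  have [X' rX] := related_push HM HT sG X Gxt; have [Y' rY] := related_push HM HT sG Y Gxt.
  have hin (Z : vfield SM) (Z' : vfield T) : related (mg i) x t Z Z' ->
      forall p, p \in l1 ++ (Z, Z') :: l2 -> related (mg i) x t p.1 p.2.
    by move=> rZ p; rewrite mem_cat inE => /or3P[/h1|/eqP->|/h2].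
  have hun (Z : vfield SM) (Z' : vfield T) : unzip1 (l1 ++ (Z, Z') :: l2) = s1 ++
    Z :: s2 by rewrite /unzip1 map_cat /= -/(unzip1 _) e1 -/(unzip1 _) e2.
  have rXY : related (mg i) x t (f *: X + Y) (Ccst T (f x) *: X' + Y').
    by apply: relatedD => //; exact: relatedZ.
  rewrite -(hg _ _ _ _ _ Gxt (hin _ _ rXY) (hun _ _)) -(hg _ _ _ _ _ Gxt (hin _ _ rX) (hun _ _))
    -(hg _ _ _ _ _ Gxt (hin _ _ rY) (hun _ _)).
  by rewrite /unzip2 !map_cat /= (formP tau).1.
- move=> s1 s2 s3 X x; have [i [t Gxt]] := mg_dom x.
  have [l1 [h1 e1]] := push_list s1 Gxt; have [l2 [h2 e2]] := push_list s2 Gxt;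
    have [l3 [h3 e3]] := push_list s3 Gxt.
  have [X' rX] := related_push HM HT sG X Gxt.
  rewrite -(hg _ _ _ _ (l1 ++ (X, X') :: l2 ++ (X, X') :: l3) Gxt);
    first by rewrite /unzip2 !map_cat /= map_cat (formP tau).2.
    by move=> p; rewrite mem_cat inE mem_cat inE => /or4P[/h1|/eqP->|/h2|/orP[/eqP->|/h3]].
  by rewrite /unzip1 !map_cat /= map_cat /= -/(unzip1 _) e1 -/(unzip1 _) e2 -/(unzip1 _) e3.
by exists w => i x t Gxt l hl; rewrite hw; symmetry; exact: (hg _ _ _ _ _ Gxt hl erefl).
Qed.
End Representation.

(** * Level components of invariant forms are invariant *)

Section InvariantComponents.
Context {R : realType} {q : nat} {S : smoothSpace R}.
Hypothesis HS : leuclid (2 * q) S.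
Local Notation A := (Cinf S).
Local Notation form := (form S).
Local Notation gtan := (gtan S).
Local Notation cform := (cform S).
Implicit Types (x y : S) (w v : form) (z : cform).
Variables (J : gcs S) (N : form -> form).
Hypothesis hN : forall x (xs : 'I_(2 * q) -> A) D w, pframe x xs D -> eqx x (N w) (Nframe J xs D w).
Variable G : S -> S -> Prop.
Hypotheses (lG : local_diffeo_graph G) (JG : invariant_gcs G J).
Variables (x y : S).
Hypothesis Gxy : G x y.
Local Notation Kop := (level (q := q) N).
Local Notation pb := (fun w => pullback_at G x y w w).

Lemma pullback_cliff (u v : gtan) (w w' : form) : related_gtan G x y u v ->
  pullback_at G x y w w' ->
  pullback_at G x y (cliff u w) (cliff v w').
Proof.
move=> [r1 r2] hw s hs; rewrite !cliffE !formDE !CvalD; congr (_ + _).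
  rewrite !contractE; apply: (hw ((u.1, v.1) :: s)) => p; rewrite inE => /orP[/eqP->|/hs] //.
rewrite !wedgeE /wedge_fun !Cval_sum !size_map; apply: eq_bigr => i _.
have si := ltn_ord i.
have pi := hs _ (mem_nth (0, 0) si).
have sg : ((-1) ^+ i : A) x = ((-1) ^+ i : A) y.
  by elim: (i : nat) => [|k IH]; rewrite ?expr0 // exprS !CvalM IH.
rewrite !CvalM (nth_map (0, 0)) // (nth_map (0, 0)) // (r2 _ _ pi) sg; congr (_ * (_ * _)).
rewrite /remove_nth -!map_take -!map_drop -!map_cat; apply: hw => p;
  rewrite mem_cat => /orP[/mem_take|/mem_drop]; exact: hs.
Qed.

Lemma pullback_add (w w' v v' : form) : pullback_at G x y w w' -> pullback_at G x y v v' ->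
  pullback_at G x y (w + v) (w' + v').
Proof. by move=> h1 h2 s hs; rewrite !formDE !CvalD h1 ?h2. Qed.
Lemma pullback_opp (w w' : form) : pullback_at G x y w w' -> pullback_at G x y (- w) (- w').
Proof. by move=> h1 s hs; rewrite !formNE !CvalN h1. Qed.
Lemma pullback_sum (I : finType) (w w' : I -> form) : (forall i, pullback_at G x y (w i) (w' i))
  -> pullback_at G x y (\sum_i w i) (\sum_i w' i).
Proof. by move=> h s hs; rewrite !form_sumE !Cval_sum; apply: eq_bigr => i _; exact: h. Qed.

Lemma related_pframe (ys : 'I_(2 * q) -> A) D' : pframe y ys D' -> exists xs D, pframe x xs D /\
  forall a, related_gtan G x y (gbasis xs D a) (gbasis ys D' a).
Proof.
move=> [h1 h2]; have [sG sG'] := lG; have [_ _ _ Gs] := sG; have [_ _ _ G's] := sG'.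
have [xs hxs] := choice (fun a => Gs (ys a) _ _ Gxy).
have [D hD] := choice (fun a => local_diffeo_submersive HS HS lG Gxy (D' a)).
exists xs, D; split; last first.
  case=> j; split; [exact: hD|by move=> X Y _|by move=> h g _|move=> X Y r].
  exact: (r (ys j) (xs j) (hxs j)).
split=> [X f|i j]; last by rewrite (hD i _ _ (hxs j)).
have [Y rY] := related_push HS HS sG X Gxy.
have [h hh] := G's f _ _ Gxy.
have fh : \forall x' \near x, forall y', G x' y' -> f x' = h y'.
  have [_ _ Gc _] := sG; have := Gc _ _ _ Gxy hh; apply: filterS => x' e y' Gy'.
  by rewrite (e _ Gy' x').
rewrite (rY h f fh) h1; apply: eq_bigr => a _.
by rewrite (rY _ _ (hxs a)) (hD a h f fh).
Qed.

(** N may be evaluated at x and at y in frames related by G; invariance of J then matches the two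
    expressions term by term. *)
Lemma pullback_N w : pb w -> pb (N w).
Proof.
move=> hw s hs; have [ys [D' hf']] := pframe_exists HS y.
have [xs [D [hf r]]] := related_pframe hf'.
rewrite (hN _ hf) (hN _ hf') /Nframe !formZE !CvalM !Cval_cst; congr (_ * _).
apply: pullback_sum hs => a; apply: pullback_cliff; first by apply: JG => //; exact: r.
by apply: pullback_cliff; first exact: r.
Qed.

Definition cpb z : Prop := pb z.1 /\ pb z.2.
Lemma cpbD z z' : cpb z -> cpb z' -> cpb (z + z').
Proof. by move=> [h1 h2] [h3 h4]; split; exact: pullback_add. Qed.
Lemma cpbN z : cpb z -> cpb (- z).
Proof. by move=> [h1 h2]; split; exact: pullback_opp. Qed.
Lemma cpb0 : cpb 0. Proof. by split. Qed.
Lemma cpbMn z k : cpb z -> cpb (z *+ k).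
Proof. by move=> h; elim: k => [|k IH]; [exact: cpb0|rewrite mulrS; exact: cpbD]. Qed.
Lemma cpb_Kop z : cpb z -> cpb (Kop z).
Proof.
move=> h; apply: cpbD; first exact: cpbMn.
apply: cpbN; have [h1 h2] := h; split; first exact: pullback_N.
by apply: pullback_opp; exact: pullback_N.
Qed.
Lemma cpb_fall s z : cpb z -> cpb (fall Kop s z).
Proof.
move=> h; elim: s => [|k s IH] //; change (cpb (shift_op Kop k (fall Kop s z))); rewrite /shift_op.
by apply: cpbD; [exact: cpb_Kop|apply: cpbN; exact: cpbMn].
Qed.
Lemma cpb_tf z (e : int) : e != 0 -> cpb (z *~ e) -> cpb z.
Proof.
have tf k : cpb (z *+ k.+1) -> cpb z.
  move=> [h1 h2]; have inj (a b : R) : a *+ k.+1 = b *+ k.+1 -> a = b by apply: pmulrnI.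
  split=> s hs; apply: inj; [rewrite -!cformMn1; exact: h1|rewrite -!cformMn2; exact: h2].
case: e => [[|k]|k] // _; first exact: tf.
by rewrite NegzE mulrNz => /cpbN; rewrite opprK; exact: tf.
Qed.

(** Up to a nonzero integer, the projection to level k is the product of K - m over all other levels
    m, a polynomial in an operator that is compatible with pullback. *)
Lemma cpb_kcomp k z : cpb z -> cpb (level_comp (q := q) J k z).
Proof.
move=> hz; have [kq|kq] := leqP k (2 * q); last by rewrite kcomp_out //; exact: cpb0.
set s := [seq l <- iota 0 (2 * q).+1 | l != k].
have fE l : (l <= 2 * q)%N -> fall Kop s (level_comp (q := q) J l z) =
  level_comp (q := q) J l z *~ (\prod_(m <- s) (l%:Z - m%:Z)).
  move=> lq; apply/eqP; rewrite -subr_eq0; apply/eqP.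
  apply: (@fall_eigen _ (fun z : cform => z = 0) Kop) => //.
  - by move=> v w -> ->; rewrite subr0.
  - exact: (KopB HS hN).
  - by move=> w ->; rewrite (mB0 (KopB HS hN)).
  by rewrite (kcomp_eigen HS hN) // -pmulrn subrr.
apply: (@cpb_tf _ (\prod_(m <- s) (k%:Z - m%:Z))).
  by rewrite prodf_seq_neq0; apply/allP => m; rewrite mem_filter => /andP[mk _] /=;
    rewrite subr_eq0 eqz_nat eq_sym.
rewrite -fE //.
have -> : fall Kop s (level_comp (q := q) J k z) = fall Kop s z.
  have kq' : (k < (2 * q).+1)%N by rewrite ltnS.
  have fB := fallB (KopB HS hN) s.
  rewrite {2}(kcomp_sum HS hN z) (big_morph _ (mBD fB) (mB0 fB)) (bigD1 (Ordinal kq')) //=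
    big1 ?addr0 // => i ik.
  have iq : (i <= 2 * q)%N by rewrite -ltnS.
  rewrite fE // (_ : \prod_(m <- s) _ = 0) ?mulr0z //; apply/eqP.
  rewrite prodf_seq_eq0; apply/hasP; exists (i : nat); last by rewrite subrr.
  rewrite mem_filter mem_iota /= add0n ltnS iq andbT; apply: contra ik => /eqP e; exact/eqP/val_inj.
exact: cpb_fall.
Qed.
End InvariantComponents.

(** * Homological algebra of the lemma *)

Section CohomologyClasses.
Variables (U : zmodType) (deg : bool -> set U) (D : U -> U).
Hypotheses (deg0 : forall e, deg e 0) (degB : forall e u v, deg e u -> deg e v -> deg e (u - v))
  (DB : {morph D : u v / u - v}).

Lemma class_eqP e u u' : cocycle deg D e u -> cocycle deg D e u' ->
  cohomology_class deg D e u = cohomology_class deg D e u' <-> exists2 b, deg (~~ e) b &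
    u - u' = D b.
Proof.
move=> cu cu'; split=> [E|[b pb ub]].
  have : cohomology_class deg D e u u by split=> //; exists 0 => //; rewrite subrr (mB0 DB).
  by rewrite E => -[_].
apply/seteqP; split=> v [cv [b' pb' vb']]; split=> //.
  exists (b' - - b); last by rewrite DB (mBN DB) opprK -vb' -ub addrA subrK.
  by apply: degB => //; rewrite -sub0r; exact: degB.
by exists (b' - b); [exact: degB|rewrite DB -vb' -ub opprB addrA subrK].
Qed.
End CohomologyClasses.

Section BigradedComplex.
Variables (B Q : zmodType) (n : nat) (d mi : B -> B) (p : nat -> B -> B) (P : bool -> set B).
Variables (proj : B -> Q) (sec : Q -> B) (D : B -> B).
Hypotheses (dB : {morph d : u v / u - v}) (pB : forall k, {morph p k : u v / u - v})
  (miB : {morph mi : u v / u - v}).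
Hypotheses (dd : forall w, d (d w) = 0) (p_sum : forall w, w = \sum_(k < n) p k w)
  (pp : forall k l w, p l (p k w) = if l == k then p k w else 0).
Definition prev_p k w := if k is k'.+1 then p k' w else 0.
Hypotheses (d_p : forall k w, d (p k w) = p k.+1 (d (p k w)) + prev_p k (d (p k w))).
Hypotheses (mi_mi : forall w, mi (mi w) = - w) (d_mi : forall w, d (mi w) = mi (d w))
  (p_mi : forall k w, p k (mi w) = mi (p k w)).
Hypothesis DE : forall w,
  D w = mi (\sum_(k < n) p k.+1 (d (p k w)) - \sum_(k < n) prev_p k (d (p k w))).
Hypotheses (P0 : forall e, P e 0) (PB : forall e u v, P e u -> P e v -> P e (u - v))
  (Pd : forall e w, P e w -> P (~~ e) (d w)) (Pp : forall k e w, P e w -> P e (p k w))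
    (Pmi : forall e w, P e w -> P e (mi w))
  (P_ex : forall w, exists w' : bool -> B, w = w' true + w' false /\ forall e, P e (w' e))
  (P_disj : forall e w, P e w -> P (~~ e) w -> w = 0).
Hypotheses (projB : {morph proj : u v / u - v}) (projP : forall u v, proj u = proj v <-> exists c,
  u - v = d c)
  (secK : forall c, proj (sec c) = c).

Lemma prev_pB k : {morph prev_p k : u v / u - v}.
Proof. by case: k => [|k] u v; rewrite /= ?pB // subr0. Qed.

Lemma comp_ext (f g : B -> B) : {morph f : u v / u - v} -> {morph g : u v / u - v} ->
  (forall k w, f (p k w) = g (p k w)) -> forall w, f w = g w.
Proof.
move=> fB gB e w; rewrite (p_sum w) (big_morph f (mBD fB) (mB0 fB)) (big_morph g (mBD gB) (mB0 gB)).
by apply: eq_bigr => k _; exact: e.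
Qed.

Lemma p_out k w : (n <= k)%N -> p k w = 0.
Proof.
move=> nk; rewrite (p_sum (p k w)) big1 // => i _; rewrite pp ifN // neq_ltn.
by rewrite (leq_trans (ltn_ord i) nk).
Qed.

Lemma sum_p (F : nat -> B -> B) k w : (forall l, F l 0 = 0) -> \sum_(l < n) F l (p l (p k w)) =
  F k (p k w).
Proof.
move=> F0; have [nk|kn] := leqP n k.
  by rewrite (p_out w nk) F0 big1 // => i _; rewrite (mB0 (pB i)) F0.
rewrite (bigD1 (Ordinal kn)) //= pp eqxx big1 ?addr0 // => i ik.
by rewrite pp ifN ?F0 //; apply: contra ik => /eqP e; apply/eqP/val_inj.
Qed.

Lemma D_p k w : D (p k w) = mi (p k.+1 (d (p k w)) - prev_p k (d (p k w))).
Proof.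
rewrite DE (sum_p (F := fun k v => p k.+1 (d v))) ?(sum_p (F := fun k v => prev_p k (d v))) // => l.
  by rewrite (mB0 dB) (mB0 (prev_pB l)).
by rewrite (mB0 dB) (mB0 (pB _)).
Qed.

Lemma DB : {morph D : u v / u - v}.
Proof.
move=> u v; rewrite !DE -miB; congr mi.
have -> : \sum_(k < n) p k.+1 (d (p k (u - v))) = \sum_(k < n) p k.+1 (d (p k u)) - \sum_(k < n) p
  k.+1 (d (p k v)).
  by rewrite -sumrB; apply: eq_bigr => k _; rewrite pB dB pB.
have -> : \sum_(k < n) prev_p k (d (p k (u - v))) = \sum_(k < n) prev_p k (d (p k u)) -
  \sum_(k < n) prev_p k (d (p k v)).
  by rewrite -sumrB; apply: eq_bigr => k _; rewrite pB dB prev_pB.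
exact: subACA.
Qed.

(* [i ^ k] on level [k]: conjugates [d] to [D] and [D] to [- d], and has order 4. *)
Definition rot w : B := \sum_(k < n) iter k mi (p k w).
Lemma iter_mi0 k : iter k mi 0 = 0.
Proof. by elim: k => //= k ->; exact: mB0 miB. Qed.
Lemma iter_miB k : {morph iter k mi : u v / u - v}.
Proof. by elim: k => [|k IH] u v; rewrite ?iterS ?IH ?miB. Qed.
Lemma rotB : {morph rot : u v / u - v}.
Proof. by move=> u v; rewrite /rot -sumrB; apply: eq_bigr => k _; rewrite pB iter_miB. Qed.
Lemma rot_p k w : rot (p k w) = iter k mi (p k w).
Proof. exact: (sum_p (F := fun k v => iter k mi v) k w iter_mi0). Qed.
Lemma iter_commute (f : B -> B) k w : (forall w, f (mi w) = mi (f w)) -> f (iter k mi w) =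
  iter k mi (f w).
Proof. by move=> h; elim: k => //= k <-; exact: h. Qed.
Lemma D_mi w : D (mi w) = mi (D w).
Proof.
apply: (comp_ext (f := D \o mi) (g := mi \o D)) => [u v|u v|k v] /=; rewrite ?miB ?DB ?miB //.
rewrite -p_mi !D_p p_mi d_mi p_mi; case: k => [|k]; first by rewrite !subr0.
by rewrite /prev_p p_mi -miB.
Qed.

(** On level k, where d is the sum of a raising part a and a lowering part b, both sides are i^(k+1)
    (a - b), because i^(k-1) = - i^(k+1). *)
Lemma D_rot w : D (rot w) = rot (d w).
Proof.
apply: (comp_ext (f := D \o rot) (g := rot \o d)) => [u v|u v|k v] /=;
  rewrite ?rotB ?DB ?dB ?rotB //.
rewrite rot_p (iter_commute _ _ D_mi) D_p [in RHS]d_p (mBD rotB) rot_p -iterSr iter_miB /=;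
  congr (_ + _).
case: k => [|k] /=; first by rewrite (mB0 miB) (mB0 rotB) oppr0.
by rewrite rot_p mi_mi opprK.
Qed.

Lemma d_rot w : d (rot w) = - rot (D w).
Proof.
apply: (comp_ext (f := d \o rot) (g := fun w => - rot (D w))) => [u v|u v|k v] /=;
  first by rewrite rotB dB.
  by rewrite DB rotB opprD.
have rot_mi u : rot (mi u) = mi (rot u).
  by rewrite /rot (big_morph mi (mBD miB) (mB0 miB)); apply: eq_bigr => l _;
    rewrite p_mi -iterS iterSr.
have hb : mi (rot (prev_p k (d (p k v)))) = iter k mi (prev_p k (d (p k v))).
  by case: k => [|k] /=; rewrite ?rot_p // (mB0 rotB) (mB0 miB).
rewrite rot_p (iter_commute _ _ d_mi) D_p rot_mi.
set a := p k.+1 _; set b := prev_p k _ in hb *; have -> : d (p k v) = a + b := d_p k v.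
rewrite rotB miB hb [rot a]rot_p iterS mi_mi (mBD (iter_miB k)).
by rewrite opprB opprK addrC.
Qed.

Lemma p_rot k w : p k (rot w) = iter k mi (p k w).
Proof.
rewrite -(iter_commute (f := p k)); last exact: p_mi.
apply: (comp_ext (f := p k \o rot) (g := p k \o iter k mi)) => [u v|u v|l v] /=;
  rewrite ?rotB ?iter_miB ?pB //.
rewrite rot_p !(iter_commute (f := p k)) ?pp; try exact: p_mi.
by case: eqP => [->//|_]; rewrite !iter_mi0.
Qed.

Lemma rot4 w : rot (rot (rot (rot w))) = w.
Proof.
rewrite [RHS]p_sum [LHS]p_sum; apply: eq_bigr => k _; rewrite !p_rot -!iterD.
have mi4 v : iter 4 mi v = v by rewrite /= !mi_mi opprK.
have it4 l v : iter (l * 4) mi v = v by elim: l => // l IH; rewrite mulSn iterD IH mi4.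
by rewrite (_ : _ + _ + _ + _ = k * 4)%N ?it4 //; lia.
Qed.

Lemma DD w : D (D w) = 0.
Proof. by rewrite -(rot4 w) D_rot D_rot dd (mB0 rotB). Qed.

(* [D] is a commutator with [d], hence anticommutes with it. *)
Definition grade w : B := \sum_(k < n) p k w *+ k.
Lemma gradeB : {morph grade : u v / u - v}.
Proof. by move=> u v; rewrite /grade -sumrB; apply: eq_bigr => k _; rewrite pB mulrnBl. Qed.
Lemma grade_p k w : grade (p k w) = p k w *+ k.
Proof. by apply: (sum_p (F := fun k v => v *+ k)) => l; exact: mul0rn. Qed.
Lemma grade_d w : mi (grade (d w) - d (grade w)) = D w.
Proof.
apply: (comp_ext (f := fun w => mi (grade (d w) - d (grade w))) (g := D)) => [u v|u v|k v];
  rewrite ?DB //.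
  by rewrite !(dB, gradeB) -miB subACA.
rewrite D_p grade_p (mBMn dB); congr mi.
have gb : grade (prev_p k (d (p k v))) + prev_p k (d (p k v)) = prev_p k (d (p k v)) *+ k.
  by case: k => [|k]; [rewrite /= (mB0 gradeB) addr0|rewrite /= grade_p mulrSr].
set a := p k.+1 _; set b := prev_p k _ in gb *; have -> : d (p k v) = a + b := d_p k v.
rewrite (mBD gradeB) [grade a]grade_p mulrnDl -gb mulrS.
have zl (x y g h : B) : x + y + g - (y + (g + h)) = x - h.
  by rewrite !opprD !addrA [LHS](ACl (1*6*(2*4)*(3*5)))/= !subrr !addr0.
exact: zl.
Qed.

Lemma dD w : d (D w) = - D (d w).
Proof.
rewrite -!grade_d dd d_mi dB !dd (mB0 gradeB) sub0r subr0 (mBN miB) opprK //.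
Qed.

Lemma PD e w : P e w -> P (~~ e) (D w).
Proof.
move=> Pw; have PD' u v : P (~~ e) u -> P (~~ e) v -> P (~~ e) (u + v).
  by move=> hu hv; rewrite -[v]opprK; apply: PB => //; rewrite -sub0r; exact: PB.
rewrite DE; apply: Pmi; apply: PB; (elim/big_ind: _ => [|//|k _]; first exact: P0).
  by apply: Pp; apply: Pd; exact: Pp.
by case: (k : nat) => [|l]; [exact: P0|apply: Pp; apply: Pd; exact: Pp].
Qed.

(** A homogeneous element in the image of f is the image of a homogeneous one; s records whether f
    reverses parity. Cohomology classes admit only homogeneous primitives. *)
Lemma P_part (f : B -> B) s e w u : {morph f : u v / u - v} ->
  (forall e w, P e w -> P (s (+) e) (f w)) ->
  P (s (+) e) w -> w = f u -> exists2 v, P e v & w = f v.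
Proof.
move=> fB Pf Pw wu; have [u' [uE Pu]] := P_ex u; exists (u' e) => //.
apply/eqP; rewrite -subr_eq0; apply/eqP; apply: (@P_disj (s (+) e)); first by apply: PB => //;
  exact: Pf.
have -> : w - f (u' e) = f (u' (~~ e)).
  by rewrite wu {1}uE (mBD fB); case: (e); rewrite /= ?addrK // addrC addKr.
by rewrite -addbN; exact: Pf.
Qed.

Definition DQ c : Q := proj (D (sec c)).
Lemma DQ_proj w : DQ (proj w) = proj (D w).
Proof.
apply/projP; have [c hc] : exists c, sec (proj w) - w = d c by apply/projP; exact: secK.
by exists (- D c); rewrite -DB hc (mBN dB) dD opprK.
Qed.

Lemma proj0 : proj 0 = 0.
Proof. by have := projB 0 0; rewrite !subrr. Qed.

Lemma proj_eq0 w : proj w = 0 <-> exists c, w = d c.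
Proof. by rewrite -proj0 projP subr0. Qed.

Definition quotP e : set Q := proj @` P e.

Lemma DQB : {morph DQ : u v / u - v}.
Proof.
by move=> u v; rewrite -[u]secK -[v]secK -projB !DQ_proj DB projB.
Qed.

Lemma quotP0 e : quotP e 0. Proof. by exists 0; [exact: P0|exact: proj0]. Qed.
Lemma quotPB e u v : quotP e u -> quotP e v -> quotP e (u - v).
Proof. by move=> [a Pa <-] [b Pb <-]; exists (a - b); [exact: PB|exact: projB]. Qed.

Lemma proj_cocycle e u : cocycle P D e u -> cocycle quotP DQ e (proj u).
Proof. by move=> [Pu Du]; split; [exists u|rewrite DQ_proj Du proj0]. Qed.

Lemma induced_class e u : cocycle P D e u ->
  induced_map quotP DQ proj e (cohomology_class P D e u) = cohomology_class quotP DQ e (proj u).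
Proof.
move=> cu; have Q2 := class_eqP quotP0 quotPB DQB.
apply/seteqP; split=> [x [v [cv [b Pb vb]]]|x hx].
  rewrite ((Q2 e (proj v) (proj u) (proj_cocycle cv) (proj_cocycle cu)).2) //.
  by exists (proj b); [exists b|rewrite -projB vb DQ_proj].
exists u => //; split => //; exists 0; first exact: P0.
by rewrite subrr (mB0 DB).
Qed.

Lemma ddJ_cohomology :
  (range (d \o D) = range d `&` [set w | D w = 0] /\
   range d `&` [set w | D w = 0] = [set w | d w = 0] `&` range D) <->
  cohomology_iso P D quotP DQ proj.
Proof.
have B2 := class_eqP P0 PB DB; have Q2 := class_eqP quotP0 quotPB DQB.
have pc e u := @proj_cocycle e u; have ic e u := @induced_class e u.
have neg e : ~~ e = true (+) e by case: e.
split=> [[E1 E2] e|iso].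
  split.
  - by move=> _ [u cu <-]; rewrite ic //; exists (proj u) => //; exact: pc.
  - move=> x y /set_mem[u cu <-] /set_mem[v cv <-]; rewrite !ic // => /Q2 h.
    have [_ [b Pb <-] hb] := h (pc _ _ cu) (pc _ _ cv).
    apply/B2 => //; rewrite -projB DQ_proj in hb.
    have [c hc] := (projP _ _).1 hb.
    (* Here d c = u - v - D b is closed for D, so the second equality makes it exact for D, and u -
       v with it. *)
    have : (range d `&` [set w | D w = 0]) (d c).
      by split; [exists c|rewrite /= -hc !DB cu.2 cv.2 DD !subr0].
    rewrite E2 => -[_ [a _ ac]].
    apply: (@P_part D true (~~ e) (u - v) (b + a));
      [exact: DB|by move=> e' w; rewrite -neg; exact: PD| |].
      by rewrite -neg negbK; apply: PB; [case: cu|case: cv].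
    by rewrite (mBD DB) ac -hc addrCA subrr addr0.
  move=> _ [_ [[u Pu <-] Du] <-].
  have [c hc] : exists c, D u = d c by apply/proj_eq0; rewrite -DQ_proj.
  have : (range d `&` [set w | D w = 0]) (D u) by split; [exists c|exact: DD].
  rewrite -E1 => -[b0 _ /= hb0].
  have [b Pb hb] : exists2 b, P (~~ e) b & D u = (d \o D) b.
    apply: (@P_part (d \o D) false (~~ e) (D u) b0) => //.
    - by move=> x y /=; rewrite DB dB.
    - by move=> e' w /PD /Pd; rewrite negbK.
    - exact: PD.
  (* D (d b) = - d (D b) = - D u, so adding d b closes u without changing it modulo the image of
     d. *)
  have cub : cocycle P D e (u + d b).
    split; last by rewrite (mBD DB) hb /= dD addNr.
    rewrite -[d b]opprK; apply: PB => //; rewrite -sub0r; apply: PB; first exact: P0.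
    by rewrite -[e]negbK; exact: Pd.
  exists (cohomology_class P D e (u + d b)); first by exists (u + d b).
  rewrite ic //; congr (cohomology_class _ _ _ _).
  by apply/projP; exists b; rewrite addrAC subrr add0r.
(* Injectivity: x = d c is a cocycle for D whose class vanishes modulo the image of d. The
   isomorphism concerns homogeneous classes, hence the splitting of c by parity. *)
have one x : range d x -> D x = 0 -> range D x.
  move=> [c _ hc] Dx; have [c' [cE Pc]] := P_ex c.
  have part e : exists b, d (c' e) = D b.
    have Dx' : D (d (c' e)) = 0.
      apply: (@P_disj e); first by have := PD (Pd (Pc e)); rewrite negbK.
      have : D (d (c' true)) + D (d (c' false)) = 0 by rewrite -(mBD DB) -(mBD dB) -cE hc.
      move/eqP; rewrite addr_eq0 => /eqP h.
      have nP e' w : P e' w -> P e' (- w) by move=> h'; rewrite -sub0r; exact: PB.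
      case: (e) h => h; [rewrite h|rewrite -[D _]opprK -h]; apply: nP; have := PD (Pd (Pc false));
        have := PD (Pd (Pc true)); rewrite ?negbK //.
    have c1 : cocycle P D (~~ e) (d (c' e)) by split => //; exact: Pd.
    have c0 : cocycle P D (~~ e) 0 by split; [exact: P0|exact: mB0 DB].
    have [_ inj _] := iso (~~ e).
    have : cohomology_class P D (~~ e) (d (c' e)) = cohomology_class P D (~~ e) 0.
      apply: inj; [by apply/mem_set; exists (d (c' e))|by apply/mem_set; exists 0|].
      rewrite !ic //; congr (cohomology_class _ _ _ _); rewrite proj0; apply/proj_eq0;
        by exists (c' e).
    move/B2 => h; have [b _ hb] := h c1 c0; exists b; by rewrite -hb subr0.
  have [b1 h1] := part true; have [b2 h2] := part false.
  by exists (b1 + b2) => //; rewrite (mBD DB) -h1 -h2 -(mBD dB) -cE.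
(* Surjectivity: modulo the image of d, each parity part of c is a cocycle, so it has the form u - D
   b - d x with u a genuine cocycle, and applying D leaves only - D (d x). *)
have two c a : D c = d a -> exists b, D c = D (d b).
  move=> ca; have [c' [cE Pc]] := P_ex c.
  have part e : exists b, D (c' e) = D (d b).
    have [a' Pa' ha'] : exists2 a', P e a' & D (c' e) = d a'.
      have [a' [aE Pa]] := P_ex a; exists (a' e) => //; apply/eqP; rewrite -subr_eq0; apply/eqP.
      have h : D (c' true) - d (a' true) + (D (c' false) - d (a' false)) = 0.
        by rewrite addrACA -(mBD DB) -opprD -(mBD dB) -cE -aE ca subrr.
      have nP e' w : P e' w -> P e' (- w) by move=> h'; rewrite -sub0r; exact: PB.
      have q e' : P (~~ e') (D (c' e') - d (a' e')) by apply: PB; [exact: PD|exact: Pd].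
      move/eqP: h; rewrite addr_eq0 => /eqP h.
      apply: (@P_disj (~~ e)) => //; rewrite negbK; case: (e) (q false) (q true) h => /= q0 q1 h;
        first by rewrite h; exact: nP.
      by rewrite -[_ - _]opprK -h; exact: nP.
    have cq : cocycle quotP DQ e (proj (c' e)).
      by split; [exists (c' e)|rewrite DQ_proj; apply/proj_eq0; exists a'].
    have [_ _ surj] := iso e.
    have [_ [u cu <-]] : (induced_map quotP DQ proj e @` cohomology P D e)
      (cohomology_class quotP DQ e (proj (c' e))).
      by apply: surj; exists (proj (c' e)).
    rewrite ic // => /Q2 h; have [_ [b Pb <-]] := h (pc _ _ cu) cq.
    rewrite -projB DQ_proj => /projP[x hx]; exists (- x).
    have -> : c' e = u - D b - d x by rewrite -hx !opprD !opprK !addrA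
      [RHS](ACl (4*(1*3)*(2*5)))/= subrr addNr !addr0.
    by rewrite !DB cu.2 DD subr0 sub0r (mBN dB) (mBN DB).
  have [b1 h1] := part true; have [b2 h2] := part false.
  by exists (b1 + b2); rewrite cE (mBD DB) h1 h2 -(mBD DB) -(mBD dB).
have E1 : range (d \o D) = range d `&` [set w | D w = 0].
  apply/seteqP; split=> x.
    move=> [a _ <-] /=; split; first by exists (D a).
    by rewrite dD (mBN DB) DD oppr0.
  move=> [dx Dx]; have [c _ hc] := one x dx Dx; have [a _ ha] := dx.
  have [|b hb] := two c a; first by rewrite hc ha.
  exists (- b) => //=; by rewrite (mBN DB) (mBN dB) dD opprK -hb.
split => //; rewrite -E1; apply/seteqP; split=> x.
  move=> [a _ <-] /=; split; first exact: dd.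
  by exists (- d a) => //; rewrite (mBN DB) -dD.
move=> [/= dx [c _ hc]].
(* The cube of [rot] is its inverse. It turns x = D c with d x = 0 into y = d c1 with D y = 0, to
   which the equality already proved applies. *)
pose y := rot (rot (rot x)); pose c1 := rot (rot (rot c)).
have rI : injective rot by move=> u v /(congr1 (fun w => rot (rot (rot w)))); rewrite !rot4.
have yc : y = d c1 by apply: rI; rewrite -D_rot /y /c1 !rot4.
have Dy : D y = 0.
  apply: rI; apply: oppr_inj; rewrite -d_rot /y rot4 dx (mB0 rotB) oppr0 //.
have : range (d \o D) y by rewrite E1; split => //; exists c1.
move=> [a _ ha]; exists (rot a) => //=.
rewrite dD d_rot (mBN DB) opprK D_rot -[d (D a)]/((d \o D) a) ha /y rot4 //.
Qed.
End BigradedComplex.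

(** * The complex of basic forms *)

Section BasicComplex.
Context {R : realType} {n q : nat} {M : manifold R n} (F : foliation q M) (J : transverse_gcs F).
Local Notation T := (transverse F).
Local Notation SM := (space_of M).
Local Notation HT := (transverse_leuclid F).
Local Notation basic := (basic_form F).
Implicit Types (tau : form T) (w : form SM) (t : cform T) (b : basic).

Lemma representsP t (z : cform SM) : represents t z <-> rep t.1 z.1 /\ rep t.2 z.2.
Proof.
split=> [h|[h1 h2] i x y Gxy]; last by split; [exact: h1|exact: h2].
by split=> i x y Gxy; have [] := h i x y Gxy.
Qed.

Lemma invariant_formP t : invariant_form t <-> hol_inv t.1 /\ hol_inv t.2.
Proof.
split=> [h|[h1 h2] G hG x y Gxy]; last by split; [exact: h1|exact: h2].
by split=> G hG x y Gxy; have [] := h G hG x y Gxy.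
Qed.

Lemma basic_formP b X : leaf_tangent F X ->
  (contract X (basic_val b).1 = 0 /\ contract X (ext_d (basic_val b).1) = 0) /\
  (contract X (basic_val b).2 = 0 /\ contract X (ext_d (basic_val b).2) = 0).
Proof. by move=> tX; have /asboolP h := valP b; have [] := h X tX. Qed.

Lemma represented b : exists t, represents t b.
Proof.
have [t1 h1] := basic_descends (fun X tX => (basic_formP b tX).1).
have [t2 h2] := basic_descends (fun X tX => (basic_formP b tX).2).
by exists (t1, t2); apply/representsP.
Qed.

Lemma represents_invariant t (z : cform SM) : represents t z -> invariant_form t.
Proof. by move=> /representsP[h1 h2]; apply/invariant_formP; split;
  [exact: rep_hol_inv h1|exact: rep_hol_inv h2]. Qed.

Lemma lifted t : exists b, invariant_form t -> represents t b.
Proof.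
have [it|nt] := pselect (invariant_form t); last by exists 0.
have /invariant_formP[i1 i2] := it.
have [w1 h1] := hol_inv_lifts i1; have [w2 h2] := hol_inv_lifts i2.
have hb : (w1, w2) \in is_basic F.
  apply/asboolP => X tX; have [a1 a2] := rep_basic h1 tX; have [a3 a4] := rep_basic h2 tX.
  by split.
by exists (MkBasic hb) => _; apply/representsP.
Qed.

Lemma represents_uniq t b b' : represents t b -> represents t b' -> b = b'.
Proof.
move=> /representsP[h1 h2] /representsP[h3 h4]; apply: val_inj.
rewrite [LHS]surjective_pairing [RHS]surjective_pairing; congr (_, _);
  [exact: rep_uniq h1 h3|exact: rep_uniq h2 h4].
Qed.
Lemma represents_uniql t t' b : represents t b -> represents t' b -> t = t'.
Proof.
move=> /representsP[h1 h2] /representsP[h3 h4].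
rewrite [LHS]surjective_pairing [RHS]surjective_pairing; congr (_, _);
  [exact: rep_uniql h1 h3|exact: rep_uniql h2 h4].
Qed.

Lemma repB tau tau' w w' : rep tau w -> rep tau' w' -> rep (tau - tau') (w - w').
Proof. by move=> h h' i x y Gxy s hs;
  rewrite !formDE !formNE !CvalD !CvalN (h _ _ _ Gxy s hs) (h' _ _ _ Gxy s hs). Qed.

Lemma hol_inv_degscale c tau : hol_inv tau -> hol_inv (degscale c tau).
Proof.
by move=> h G hG x y Gxy s hs; rewrite !degscaleE !CvalM (h _ hG _ _ Gxy s hs) !Cval_cst !size_map.
Qed.

Lemma rep_parity e tau w : rep tau w -> fparity e tau <-> fparity e w.
Proof.
move=> h; split=> p s hs; apply: CinfP => x.
  have [i [y Gxy]] := mg_dom F x; have [l [hl el]] := push_list s Gxy.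
  by rewrite -el (h _ _ _ Gxy l hl) p // size_map -(size_map fst) -/(unzip1 l) el.
have [y Gxy] := mg_onto x; have [l [hl el]] := lift_list s Gxy.
by rewrite -el -(h _ _ _ Gxy l hl) p // size_map -(size_map snd) -/(unzip2 l) el.
Qed.

Lemma basic_parityP e b : basic_parity e b <-> fparity e (basic_val b).1 /\
  fparity e (basic_val b).2.
Proof.
split=> [h|[h1 h2] s hs]; last by rewrite h1 ?h2.
by split=> s hs; have [] := h s hs.
Qed.

(** Each basic form is replaced by the unique invariant form on T that represents it. This
    correspondence is additive and injective and commutes with d, so the hypotheses on the bigraded
    complex are checked as identities between forms on T. *)
Theorem ddJ_basic : basic_ddJ_lemma J <->
  cohomology_iso (basic_parity (F := F)) (basic_dJ J) (quot_parity (F := F)) (quot_dJ J)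
    (quot_proj (F := F)).
Proof.
have [N hN] := number_operator_exists HT (tgcs J).
pose K := @level_comp R q T (tgcs J).
have [tb htb] := choice represented; have [wb hwb] := choice lifted.
have itb b : invariant_form (tb b) := represents_invariant (htb b).
have tbE t b : represents t b -> tb b = t by move=> h; exact: represents_uniql (htb b) h.
have tbwb t : invariant_form t -> tb (wb t) = t by move=> it; apply: tbE; exact: hwb.
have tb_inj : injective tb by move=> b b' e; apply: (represents_uniq (t := tb b)) => //; rewrite e.
have tbB : {morph tb : u v / u - v}.
  move=> u v; apply: tbE; apply/representsP; have /representsP[h1 h2] := htb u;
    have /representsP[h3 h4] := htb v.
  by split; exact: repB.
have tbd b : tb (basic_ext_d b) = ext_dC (tb b).
  by apply: tbE; apply/representsP; have /representsP[h1 h2] := htb b; split; exact: rep_ext_d.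
have iK k t : invariant_form t -> invariant_form (K k t).
  move=> it G hG x y Gxy.
  exact: (cpb_kcomp HT hN (holonomy_local_diffeo hG) (tgcs_invariant J hG) Gxy k (it G hG x y Gxy)).
have im t : invariant_form t -> invariant_form (muli t).
  move=> it G hG x y Gxy; have [h1 h2] := it G hG x y Gxy; split => //; exact: pullback_opp.
have iB t t' : invariant_form t -> invariant_form t' -> invariant_form (t - t').
  move=> it it' G hG x y Gxy; have [h1 h2] := it G hG x y Gxy; have [h3 h4] := it' G hG x y Gxy.
  by split; apply: pullback_add => //; exact: pullback_opp.
have i0 : invariant_form (0 : cform T) by [].
have iD t t' : invariant_form t -> invariant_form t' -> invariant_form (t + t').
  by move=> it it'; rewrite -[t']opprK; apply: (iB) => //; rewrite -sub0r; exact: iB.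
have id_ t : invariant_form t -> invariant_form (ext_dC t).
  by move=> it; rewrite -(tbwb t it) -tbd.
pose p k b := wb (K k (tb b)); pose mi b := wb (muli (tb b)).
have tbp k b : tb (p k b) = K k (tb b) by apply: tbwb; exact: iK.
have tbm b : tb (mi b) = muli (tb b) by apply: tbwb; exact: im.
have KD k t t' : K k (t + t') = K k t + K k t' := kcompDr HT hN k t t'.
have K0 k : K k 0 = 0 by apply: (addrI (K k 0)); rewrite -KD !addr0.
have KB k : {morph K k : u v / u - v}.
  by move=> u v; apply: (addIr (K k v)); rewrite -KD !subrK.
have dCB := @ext_dCB R T.
have tb0 : tb 0 = 0 by have := tbB 0 0; rewrite !subrr.
have tbN v : tb (- v) = - tb v by have := tbB 0 v; rewrite !sub0r tb0 sub0r.
have tbD : {morph tb : u v / u + v} by move=> u v; rewrite -[v in LHS]opprK tbB tbN opprK.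
have tb_sum m (G : 'I_m -> basic) : tb (\sum_(k < m) G k) = \sum_(k < m) tb (G k) by exact:
  (big_morph tb tbD tb0).
have tbpm k b : tb (prev_p p k b) = if k is k'.+1 then K k' (tb b) else 0 by case: k => [|k'] /=;
  rewrite ?tbp ?tb0.
(* [basic_dJ] is defined by [xget], so a witness is needed: [dJ_op] of an invariant form is
   invariant, being built from d and level components, and hence lifts to a basic form. *)
have tbJ b : tb (basic_dJ J b) = dJ_op q (tgcs J) (tb b).
  have iJ : invariant_form (dJ_op q (tgcs J) (tb b)).
    rewrite (dJ_opE (tgcs J)); apply: (im); apply: (iB); (elim/big_ind: _ => [//|//|k _]).
      by apply: (iK); apply: (id_); exact: iK.
    by case: (k : nat) => [//|k']; apply: (iK); apply: (id_); exact: iK.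
  have [t [it ht hv]] : [set v : basic | exists t,
    [/\ invariant_form t, represents t b & represents (dJ_op q (tgcs J) t) v]] (basic_dJ J b).
    by apply: xgetPex; exists (wb (dJ_op q (tgcs J) (tb b))), (tb b); split => //; exact: hwb.
  by rewrite (represents_uniql (htb b) ht); apply: tbE.
have mB := @muliB R T.
have PtbP e b : basic_parity e b <-> cparity e (tb b).
  have /representsP[h1 h2] := htb b; split=> [/basic_parityP[p1 p2]|[p1 p2]].
    by split; [exact/(rep_parity _ h1)|exact/(rep_parity _ h2)].
  by apply/basic_parityP; split; [exact/(rep_parity _ h1)|exact/(rep_parity _ h2)].
have cpB e u v : cparity e u -> cparity e v -> cparity e (u - v) :> Prop.
  move=> [h1 h2] [h3 h4]; split=> s hs.
    by change (u.1 s - v.1 s = 0); rewrite h1 ?h3 ?subrr.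
  by change (u.2 s - v.2 s = 0); rewrite h2 ?h4 ?subrr.
apply: (@ddJ_cohomology basic (basic_mod_d F) (2 * q).+1 (@basic_ext_d R n q M F) mi p
  (basic_parity (F := F)) (quot_proj (F := F)) repr (basic_dJ J)).
- by move=> u v; apply: tb_inj; rewrite tbB !tbd tbB dCB.
- by move=> k u v; apply: tb_inj; rewrite tbB !tbp tbB KB.
- by move=> u v; apply: tb_inj; rewrite tbB !tbm tbB mB.
- by move=> w; apply: tb_inj; rewrite !tbd tb0 /ext_dC /= !ext_dd.
- move=> w; apply: tb_inj; rewrite tb_sum {1}(kcomp_sum HT hN (tb w)); by apply: eq_bigr => k _;
  rewrite tbp.
- by move=> k l w; apply: tb_inj; rewrite !tbp /K (kcomp_kcomp HT hN) -/K; case: eqP => _;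
  rewrite ?tbp ?tb0.
- move=> k w; apply: tb_inj; rewrite tbD tbpm !(tbd, tbp); exact: (ext_dC_split HT hN).
- by move=> w; apply: tb_inj; rewrite !tbm -sub0r tbB tb0 sub0r.
- move=> w; apply: tb_inj; rewrite !(tbd, tbm); congr (_, _); exact: ext_dN.
- by move=> k w; apply: tb_inj; rewrite !(tbp, tbm); exact: (kcomp_muli HT hN).
- move=> w; apply: tb_inj; rewrite tbJ tbm tbB !tb_sum (dJ_opE (tgcs J)); congr (muli (_ - _));
  apply: eq_bigr => k _.
    by rewrite tbp tbd tbp.
  by rewrite tbpm tbd tbp.
- by move=> e; apply/PtbP; rewrite tb0.
- by move=> e u v /PtbP hu /PtbP hv; apply/PtbP; rewrite tbB; exact: cpB.
- move=> e w /PtbP[h1 h2]; apply/PtbP; rewrite tbd; split; exact: fparity_ext_d.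
- by move=> k e w /PtbP h; apply/PtbP; rewrite tbp; exact: (kcomp_parity HT hN).
- move=> e w /PtbP[h1 h2]; apply/PtbP; rewrite tbm; split => // s hs; by rewrite formNE h2 ?oppr0.
- move=> w; have ic e : invariant_form (cpart e (tb w)).
    have /invariant_formP[i1 i2] := itb w; apply/invariant_formP; split; exact: hol_inv_degscale.
  exists (fun e => wb (cpart e (tb w))); split.
    apply: tb_inj; rewrite tbD !tbwb //.
    have e1 (v : form T) : v = degscale (fun k => (odd k == true)%:R) v +
      degscale (fun k => (odd k == false)%:R) v.
      by apply: formE => s; rewrite formDE !degscaleE; case: (odd _);
        rewrite /= Ccst0 Ccst1 mul0r mul1r ?addr0 ?add0r.
    rewrite [LHS]surjective_pairing; congr (_, _); exact: e1.
  move=> e; apply/PtbP; rewrite tbwb //; split=> s hs; rewrite degscaleE (negPf hs) Ccst0 mul0r //.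
- move=> e w /basic_parityP[h1 h2] /basic_parityP[h3 h4]; apply: val_inj.
  have z (v : form SM) : fparity e v -> fparity (~~ e) v -> v = 0.
    move=> p1 p2; apply: formE => s; have [es|es] := boolP (odd (size s) == e); last exact: p1.
    by rewrite p2 // (eqP es); case: (e).
  by rewrite [LHS]surjective_pairing; congr (_, _); exact: z.
- by move=> u v; rewrite /quot_proj; exact: pi_is_zmod_morphism.
- move=> u v; split.
    move=> /eqP; rewrite -Quotient.idealrBE => /asboolP[c _ <-]; by exists c.
  move=> [c hc]; apply/eqP; rewrite -Quotient.idealrBE; apply/asboolP; by exists c.
- by move=> c; exact: reprK.
Qed.
End BasicComplex.

Theorem theorem4p2 (R : realType) (n q : nat) (M : manifold R n)
    (F : foliation q M) (J : transverse_gcs F) :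
  basic_ddJ_lemma J <->
  cohomology_iso (basic_parity (F := F)) (basic_dJ J)
                 (quot_parity (F := F)) (quot_dJ J) (quot_proj (F := F)).
Proof. exact: ddJ_basic. Qed.
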